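(* Let $N\in\{2,3\}$, let $\alpha\in\mathbb{R}$ if $N=2$ and $\alpha<0$ if $N=3$, and let $1<p<\infty$ if $N=2$ and $1<p<2$ if $N=3$. Then for every $\omega$ with $0\le\omega<\omega_\alpha$ there exists a unique positive, radial, and (radially) decreasing function $\phi_\omega$ such that $$\mathcal{A}_\omega=\{e^{i\theta}\phi_\omega : \theta\in\mathbb{R}\},$$ where $\mathcal{A}_\omega$ is the set of nontrivial solutions of $(\omega-\Delta_\alpha)\phi+|\phi|^{p-1}\phi=0$ on $\mathbb{R}^N$.
   Context: All functions are complex valued and $\langle u,v\rangle=\int_{\mathbb{R}^N}u\overline{v}\,dx$. For $\lambda>0$, $G_\lambda\in L^2(\mathbb{R}^N)$ is the solution of $(\lambda-\Delta)G_\lambda=\delta_0$ in $\mathcal{D}'$. Set $\beta(\lambda)=\frac{1}{2\pi}\bigl(\gamma+\log\frac{\sqrt\lambda}{2}\bigr)$ if $N=2$ ($\gamma$ the Euler–Mascheroni constant) and $\beta(\lambda)=\frac{\sqrt\lambda}{4\pi}$ if $N=3$. $-\Delta_\alpha$ is the self-adjoint Laplacian with point interaction at the origin: its domain consists of $u=f+cG_\lambda$ with $f\in H^2(\mathbb{R}^N)$, $c\in\mathbb{C}$, $(\alpha+\beta(\lambda))c=f(0)$, and $(\lambda-\Delta_\alpha)u=(\lambda-\Delta)f$. Its unique negative eigenvalue is $e_\alpha=-4e^{-4\pi\alpha-2\gamma}$ if $N=2$ and $e_\alpha=-(4\pi\alpha)^2$ if $N=3$; $\omega_\alpha:=|e_\alpha|$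 (the unique solution of $\alpha+\beta(\omega_\alpha)=0$). The form domain is $H^1_\alpha(\mathbb{R}^N)=\{f+cG_\lambda: f\in H^1(\mathbb{R}^N),\,c\in\mathbb{C}\}$. The larger space is $X_0=\{f+cG_\lambda: f\in L^{p+1}(\mathbb{R}^N),\,\nabla f\in L^2(\mathbb{R}^N),\,c\in\mathbb{C}\}$, with norm $\|u\|_{X_0}=\|\nabla f\|_{L^2}+|c|+\|u\|_{L^{p+1}}$. On $X_0$ the form of $-\Delta_\alpha$ is, for $u=f+cG_\lambda$, $v=g+dG_\lambda$, $$\langle-\Delta_\alpha u,v\rangle=\langle\nabla f,\nabla g\rangle+(\alpha+\beta(\lambda)+\lambda\|G_\lambda\|_{L^2}^2)c\overline d-\lambda\overline d\langle u,G_\lambda\rangle-\lambda c\overline{\langle v,G_\lambda\rangle},$$ which is independent of $\lambda>0$ and agrees on $H^1_\alpha(\mathbb{R}^N)\subset X_0$ with the usual form of the operator. The action functional is $S_\omega(u)=\frac12\langle-\Delta_\alpha u,u\rangle+\frac{\omega}{2}\|u\|_{L^2}^2+\frac{1}{p+1}\|u\|_{L^{p+1}}^{p+1}$, for $u\in H^1_\alpha(\mathbb{R}^N)$ if $\omega>0$, and $S_0(u)=\frac12\langle-\Delta_\alpha u,u\rangle+\frac{1}{p+1}\|u\|_{L^{p+1}}^{p+1}$ for $u\in X_0$ if $\omega=0$. Define $\mathcal{A}_\omega=\{\phi\in H^1_\alpha(\mathbb{R}^N):\phi\ne0,\ S_\omega'(\phi)=0\}$ for $\omega>0$ and $\mathcal{A}_0=\{\phi\in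 X_0:\phi\neq0,\ S_0'(\phi)=0\}$. Here $S_\omega'(\phi)=0$ means $\langle-\Delta_\alpha\phi,w\rangle+\omega\langle\phi,w\rangle+\int|\phi|^{p-1}\phi\overline w\,dx=0$ for all $w$ in the respective space (without the $\omega$ term if $\omega=0$). Positivity and monotonicity are understood on $\mathbb{R}^N\setminus\{0\}$ (solutions are continuous there and singular at the origin). *)

(* Defs.v *)
From HB Require Import structures.
From mathcomp Require Import all_boot all_order all_algebra.
From mathcomp Require Import complex.
From mathcomp Require Import all_classical all_reals all_analysis.

Set Implicit Arguments.
Unset Strict Implicit.
Unset Printing Implicit Defensive.

Import Order.TTheory GRing.Theory Num.Theory.
Import numFieldNormedType.Exports.

Local Open Scope classical_set_scope.
Local Open Scope ring_scope.

(* The product (= Borel) sigma-algebra on 'rV[R]_n. *)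
Section measurable_rV.
Context (R : realType) (n : nat).

Let coors : 'I_n -> 'rV[R]_n -> R := fun i x => x ord0 i.

Let rV_set0 : g_sigma_preimage coors set0.
Proof. exact: sigma_algebra0. Qed.

Let rV_setC A : g_sigma_preimage coors A -> g_sigma_preimage coors (~` A).
Proof. exact: sigma_algebraC. Qed.

Let rV_bigcup (F : (set 'rV[R]_n)^nat) :
  (forall i, g_sigma_preimage coors (F i)) ->
  g_sigma_preimage coors (\bigcup_i (F i)).
Proof. exact: sigma_algebra_bigcup. Qed.

HB.instance Definition _ := @isMeasurable.Build default_measure_display
  'rV[R]_n (g_sigma_preimage coors) rV_set0 rV_setC rV_bigcup.

End measurable_rV.

Lemma measurable_coord (R : realType) n (i : 'I_n) :
  measurable_fun [set: 'rV[R]_n] (fun x : 'rV[R]_n => x ord0 i).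
Proof.
move=> _ Y mY; rewrite setTI; apply: sub_sigma_algebra => /=.
rewrite -bigcup_seq/=; exists i => /=; first by rewrite mem_index_enum.
by exists Y => //; rewrite setTI.
Qed.

Lemma measurable_fun_rVP d (T : measurableType d) (R : realType) n
    (f : T -> 'rV[R]_n) :
  (forall i, measurable_fun [set: T] (fun t => f t ord0 i)) ->
  measurable_fun [set: T] f.
Proof.
move=> mf; pose S := [set A : set 'rV[R]_n | measurable (f @^-1` A)].
suff: (@measurable _ 'rV[R]_n) `<=` S by move=> mS _ A /mS; rewrite setTI.
apply: smallest_sub.
  split; rewrite /S /=.
  - by rewrite preimage_set0.
  - by move=> A mA; rewrite setTD -preimage_setC; exact: measurableC.
  - by move=> F mF; rewrite preimage_bigcup; exact: bigcupT_measurable.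
rewrite -bigcup_seq; apply: bigcup_sub => i _ A [B mB <-].
by rewrite /S/= setTI -[X in measurable X]setTI; exact: mf.
Qed.

(* Lebesgue measure on 'rV[R]_n is the n-fold product of the Lebesgue measure
   on R, transported along (t, v) |-> row_mx t v. *)
Section lebesgue_rV_step.
Context (R : realType) (n : nat).

Definition consr (x : R * 'rV[R]_n) : 'rV[R]_n.+1 := row_mx x.1%:M x.2.

Lemma consr0 x : consr x ord0 ord0 = x.1.
Proof.
have -> : ord0 = lshift n (ord0 : 'I_1) by exact/val_inj.
by rewrite /consr (row_mxEl x.1%:M x.2) mxE eqxx.
Qed.

Lemma consrS x (i : 'I_n) : consr x ord0 (lift ord0 i) = x.2 ord0 i.
Proof.
have -> : lift ord0 i = rshift 1 i by exact/val_inj.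
by rewrite /consr (row_mxEr x.1%:M x.2).
Qed.

Lemma measurable_consr : measurable_fun [set: R * 'rV[R]_n] consr.
Proof.
apply: measurable_fun_rVP => i; case: (unliftP ord0 i) => [j|] ->.
  under eq_fun do rewrite consrS.
  exact: (measurableT_comp (measurable_coord j) measurable_snd).
by under eq_fun do rewrite consr0; exact: measurable_fst.
Qed.

Definition unconsr (x : 'rV[R]_n.+1) : R * 'rV[R]_n :=
  (x ord0 ord0, \row_i x ord0 (lift ord0 i)).

Lemma consrK : cancel consr unconsr.
Proof.
move=> x; rewrite /unconsr consr0 [RHS]surjective_pairing; congr pair.
by apply/rowP => i; rewrite mxE consrS.
Qed.

Lemma measurable_unconsr : measurable_fun [set: 'rV[R]_n.+1] unconsr.
Proof.
apply: measurable_fun_pair; first exact: measurable_coord.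
apply: measurable_fun_rVP => i.
by under eq_fun do rewrite mxE; exact: measurable_coord.
Qed.

Variable m : {sigma_finite_measure set 'rV[R]_n -> \bar R}.

Definition lebesgue_step : set 'rV[R]_n.+1 -> \bar R :=
  pushforward (lebesgue_measure \x m)%E consr.

Let step0 : lebesgue_step set0 = 0%E.
Proof. by rewrite /lebesgue_step /pushforward preimage_set0 measure0. Qed.

Let step_ge0 A : (0 <= lebesgue_step A)%E.
Proof. by rewrite /lebesgue_step /pushforward; exact: integral_ge0. Qed.

Let step_sigma_additive : semi_sigma_additive lebesgue_step.
Proof.
move=> F mF tF mUF; rewrite /lebesgue_step /pushforward preimage_bigcup.
apply: measure_semi_sigma_additive.
- by move=> k; rewrite -[X in measurable X]setTI; exact: measurable_consr.
- apply/trivIsetP => /= i j _ _ ij; rewrite -preimage_setI.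
  by move/trivIsetP : tF => /(_ _ _ _ _ ij) ->//; rewrite preimage_set0.
- rewrite -preimage_bigcup -[X in measurable X]setTI.
  exact: measurable_consr.
Qed.

HB.instance Definition _ :=
  isMeasure.Build _ _ _ lebesgue_step step0 step_ge0 step_sigma_additive.

Let step_sigma_finite : sigma_finite setT lebesgue_step.
Proof.
have /sigma_finiteP[F [FT ndF Foo]] := sigma_finiteT (@lebesgue_measure R).
have /sigma_finiteP[G [GT ndG Goo]] := sigma_finiteT m.
exists (fun k => unconsr @^-1` (F k `*` G k)).
  rewrite -preimage_bigcup -[LHS](preimage_setT unconsr); congr (_ @^-1` _).
  rewrite -setXTT FT GT; apply/seteqP; split=> [[x y] [/= [i _ Fx] [j _ Gy]]|].
    exists (maxn i j) => //; split => /=.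
      by move: x Fx; exact/subsetPset/ndF/leq_maxl.
    by move: y Gy; exact/subsetPset/ndG/leq_maxr.
  by move=> [x y] [i _ [/= Fx Gy]]; split; exists i.
move=> k; have [mF Fk] := Foo k; have [mG Gk] := Goo k; split.
  rewrite -[X in measurable X]setTI; apply: measurable_unconsr => //.
  exact: measurableX.
rewrite /lebesgue_step /pushforward -comp_preimage.
rewrite (_ : unconsr \o consr = id); last exact/funext/consrK.
by rewrite preimage_id product_measure1E// lte_mul_pinfty// ge0_fin_numE.
Qed.

HB.instance Definition _ :=
  Measure_isSigmaFinite.Build _ _ _ lebesgue_step step_sigma_finite.

End lebesgue_rV_step.

Fixpoint lebesgue_rV (R : realType) (n : nat) :
    {sigma_finite_measure set 'rV[R]_n -> \bar R} :=
  match n return {sigma_finite_measure set 'rV[R]_n -> \bar R} with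
  | 0 => \d_ (0 : 'rV[R]_0)
  | k.+1 => lebesgue_step (lebesgue_rV R k)
  end.

Lemma lebesgue_rV_box (R : realType) n (A : 'I_n -> set R) :
  (forall i, measurable (A i)) ->
  lebesgue_rV R n [set x | forall i, A i (x ord0 i)] =
  (\prod_(i < n) lebesgue_measure (A i))%E.
Proof.
elim: n => [|n IH] in A *; move=> mA.
  rewrite big_ord0 /= diracE mem_set//= => -[]//.
have mbox : measurable [set x : 'rV[R]_n | forall i, A (lift ord0 i) (x ord0 i)].
  rewrite (_ : [set _ | _] = \big[setI/setT]_(i < n)
      ((fun x : 'rV[R]_n => x ord0 i) @^-1` A (lift ord0 i))).
    apply: bigsetI_measurable => i _; rewrite -[X in measurable X]setTI.
    exact: (measurable_coord i measurableT).
  rewrite -bigcap_seq; apply/seteqP; split => x /= h i; first by move=> _; exact: h.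
  by apply: h; rewrite /= mem_index_enum.
rewrite big_ord_recl -IH// -product_measure1E//=; last exact: mA.
rewrite /lebesgue_step /pushforward; congr product_measure1.
apply/seteqP; split => [x /= h|x /= [h0 h] i].
  by split=> [|i]; [rewrite -consr0|rewrite -consrS]; exact: h.
by case: (unliftP ord0 i) => [j|] ->; rewrite ?consrS ?consr0.
Qed.

Local Open Scope complex_scope.

Local Notation cabs := (@Normc.normc _).

Section function_spaces.
Context (R : realType) (N : nat).
Local Notation E := 'rV[R]_N.
Local Notation mu := (lebesgue_rV R N).

(* The norm `|x| that the library puts on 'rV[R]_N is the sup norm. *)
Definition enorm (x : E) : R := Num.sqrt (\sum_(i < N) x ord0 i ^+ 2).

Definition pderiv (i : 'I_N) (f : E -> R) (x : E) : R :=
  'D_(delta_mx ord0 i) f x.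

Definition laplacian (f : E -> R) (x : E) : R :=
  \sum_(i < N) pderiv i (pderiv i f) x.

Fixpoint Ck (k : nat) (f : E -> R) : Prop :=
  continuous f /\
  if k is k'.+1 then
    forall i, (forall x, derivable f x (delta_mx ord0 i)) /\ Ck k' (pderiv i f)
  else True.

(* Real-valued test functions determine, by linearity, the complex-valued
   ones. *)
Definition test_function (f : E -> R) : Prop :=
  (forall k, Ck k f) /\ compact (closure [set x | f x != 0]).

Definition cmeasurable (f : E -> R[i]) : Prop :=
  measurable_fun setT (fun x => complex.Re (f x)) /\
  measurable_fun setT (fun x => complex.Im (f x)).

Definition cintegral (f : E -> R[i]) : R[i] :=
  (\int[mu]_x complex.Re (f x)) +i* (\int[mu]_x complex.Im (f x)).

Definition inner (u v : E -> R[i]) : R[i] :=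
  cintegral (fun x => u x * (v x)^*).

Definition cLp (q : R) (f : E -> R[i]) : Prop :=
  cmeasurable f /\
  ('N[mu]_(q%:E)[EFin \o (cabs \o f)] < +oo)%E.

Definition weak_gradient_L2 (f : E -> R[i]) : set ('I_N -> E -> R[i]) :=
  [set F | (forall i, cLp 2 (F i)) /\
    forall i psi, test_function psi ->
      cintegral (fun x => f x * (pderiv i psi x)%:C) =
      - cintegral (fun x => F i x * (psi x)%:C)].

(* Meaningful when weak_gradient_L2 f is nonempty; it is then a single
   almost-everywhere class. *)
Definition gradient (f : E -> R[i]) : 'I_N -> E -> R[i] :=
  xget (fun _ _ => 0) (weak_gradient_L2 f).

Definition H1 : set (E -> R[i]) :=
  [set f | cLp 2 f /\ weak_gradient_L2 f !=set0].

Definition D1 (q : R) : set (E -> R[i]) :=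
  [set f | cLp q f /\ weak_gradient_L2 f !=set0].

(* (lambda - Laplacian) G = delta_0 in the sense of distributions. *)
Definition is_green (lambda : R) (G : E -> R[i]) : Prop :=
  cLp 2 G /\
  forall psi, test_function psi ->
    cintegral (fun x => G x * (lambda * psi x - laplacian psi x)%:C) =
    (psi 0)%:C.

Definition green (lambda : R) : E -> R[i] :=
  xget (fun=> 0) [set G | is_green lambda G].

End function_spaces.

Definition euler_gamma (R : realType) : R :=
  limn (fun n => series harmonic n - ln n%:R).

(* The next three are meant for N = 2 and N = 3 only. *)
Definition beta_coef (R : realType) (N : nat) (lambda : R) : R :=
  if N == 2 then (2 * pi)^-1 * (euler_gamma R + ln (Num.sqrt lambda / 2))
  else Num.sqrt lambda / (4 * pi).

Definition eigenvalue_alpha (R : realType) (N : nat) (alpha : R) : R :=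
  if N == 2 then - (4 * expR (- (4 * pi * alpha) - 2 * euler_gamma R))
  else - (4 * pi * alpha) ^+ 2.

Definition omega_alpha (R : realType) (N : nat) (alpha : R) : R :=
  `|eigenvalue_alpha N alpha|.

Section point_interaction.
Context (R : realType) (N : nat) (alpha p lambda : R).
Local Notation E := 'rV[R]_N.
Local Notation mu := (lebesgue_rV R N).
Local Notation G := (green (N := N) lambda).

Definition regular_part (u : E -> R[i]) (c : R[i]) : E -> R[i] :=
  fun x => u x - c * G x.

Definition H1alpha : set (E -> R[i]) :=
  [set u | exists c, H1 (regular_part u c)].

Definition X0 : set (E -> R[i]) :=
  [set u | exists c, D1 (p + 1) (regular_part u c)].

(* The coefficient c of u = f + c G_lambda in X0; it is unique since the
   gradient of G_lambda is not in L^2. *)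
Definition charge_coef (u : E -> R[i]) : R[i] :=
  xget 0 [set c | D1 (p + 1) (regular_part u c)].

(* <-Delta_alpha u, v> on X0, for the decompositions u = f + c G_lambda and
   v = g + d G_lambda; its value does not depend on lambda > 0. *)
Definition form (u v : E -> R[i]) : R[i] :=
  let c := charge_coef u in
  let d := charge_coef v in
  let f := regular_part u c in
  let g := regular_part v d in
  \sum_(i < N) inner (gradient f i) (gradient g i)
  + ((alpha + beta_coef N lambda)%:C + lambda%:C * inner G G) * c * d^*
  - lambda%:C * d^* * inner u G
  - lambda%:C * c * (inner v G)^*.

Definition energy_space (omega : R) : set (E -> R[i]) :=
  if omega == 0 then X0 else H1alpha.

(* Left-hand side of the weak form of S_omega'(phi) = 0 tested against w. *)
Definition action_deriv (omega : R) (phi w : E -> R[i]) : R[i] :=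
  form phi w + omega%:C * inner phi w
  + cintegral (fun x =>
      (cabs (phi x) `^ (p - 1))%:C * phi x * (w x)^*).

Definition critical_points (omega : R) : set (E -> R[i]) :=
  [set phi | [/\ energy_space omega phi,
    ~ (\forall x \ae mu, phi x = 0) &
    forall w, energy_space omega w -> action_deriv omega phi w = 0]].

End point_interaction.

Section positive_solutions.
Context (R : realType) (N : nat).
Local Notation E := 'rV[R]_N.
Local Notation mu := (lebesgue_rV R N).

Definition positive_radial_decreasing (phi : E -> R) : Prop :=
  [/\ forall x, x != 0 -> 0 < phi x,
      forall x y, x != 0 -> enorm x = enorm y -> phi x = phi y &
      forall x y, x != 0 -> enorm x < enorm y -> phi y < phi x].

(* Complex functions are identified when they agree almost everywhere. *)
Definition phase_orbit (phi : E -> R) : set (E -> R[i]) :=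
  [set u | cmeasurable u /\ exists theta : R,
    \forall x \ae mu, u x = (cos theta +i* sin theta) * (phi x)%:C].

End positive_solutions.

(* Main.v *)
(**
In polar coordinates -Delta v + g(v) = |S^(n-1)| delta_0 becomes v' = -(1 - J) / r^(n-1),
J' = r^(n-1) g(v), J(0+) = 0, where v - S -> a0 at 0+ for the fundamental singularity
S = -ln r or 1/r. The local solution is the fixed point of an integral operator. For
g(v) = omega v + M v^p one shoots in M. For large M the solution stays positive, while for M = 0 it
reaches zero: this is where omega < omega_alpha is used, since a nonnegative solution of the linear
equation is comparable with the Green function. At the supremum M of the values for which it
reaches zero, the solution is positive, decreasing and tends to 0 at infinity, and
phi = M^(1/(p-1)) v. The Green function itself is the profile for the linear
nonlinearity lambda v; it is unique among all functions with (lambda - Delta) G = delta_0, because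
the difference of two, tested against translates of a test function, is a smooth solution of
(lambda - Delta) D = 0 vanishing at infinity, hence zero by the maximum principle. Only differences
of beta enter the argument, so the value of the Euler constant is irrelevant.

That phi is critical is the radial integration by parts for its regular part together with a
Wronskian identity between phi and G for the charge. For uniqueness let
L_w(a, b) = <-Delta_alpha a, b> + omega <a, b> + int |w|^(p-1) a b; then w is critical iff
L_w(w, .) = 0. On functions without charge L_w is nonnegative, and adding a multiple of a critical
point with nonzero charge does not change L_w(a, a), so L_w >= 0 for critical w. Adding
L_phi(u, u) >= 0 and L_|u|(phi, phi) >= 0 gives int (|u|^(p-1) - phi^(p-1)) (phi^2 - |u|^2) >= 0,
hence |u| = phi. Then L_phi(u - t phi, u - t phi) = 0 with t chosen to cancel the charge, and
u = t phi.
*)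

From HB Require Import structures.
Require Import Defs.
From mathcomp Require Import all_boot all_order all_algebra.
From mathcomp Require Import complex.
From mathcomp Require Import all_classical all_reals all_analysis.
From mathcomp Require Import measurable_realfun.
From mathcomp Require Import ring lra.

Set Implicit Arguments.
Unset Strict Implicit.
Unset Printing Implicit Defensive.

Import Order.TTheory GRing.Theory Num.Theory.
Import numFieldNormedType.Exports.

Local Open Scope classical_set_scope.
Local Open Scope ring_scope.

Local Notation mfun := (measurable_fun setT).
Local Notation leb := (@lebesgue_measure _).
Local Notation Ipos := (\1_(`]0, +oo[%classic)).
Local Notation e_ i := (delta_mx ord0 i).
Local Notation Re := (@complex.Re _).
Local Notation Im := (@complex.Im _).

(** Elements of the energy spaces are known only through a weak gradient in L^2, and [green],
    [gradient] and [charge_coef] are choices whose values have to be identified. Complex functions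
    are therefore reduced to pairs of real triples (function, charge, gradient of the regular part).
    The real and imaginary parts of a critical point satisfy one linear equation, whose weight
    |u|^(p-1) is their only coupling.

    For omega = 0 a regular part need not be in L^2, so pairings with it use L^(p+1) and
    L^((p+1)/p). For omega > 0 the space is built on H^1, and its inclusion in L^(p+1) is a Sobolev
    inequality, proved by comparing a function with its averages over small cubes.

    No decay rate of a profile at infinity is computed: v and J are bounded, and up to sign they are
    primitives of (1 - J)/r^(n-1) and of r^(n-1) g(v), so that powers of profiles are integrable at
    infinity by comparison with these two. At the origin everything is measured by powers of the
    singularity S. Integrability of r^(n-1) S^(p+1) at 0 is the condition p < 2 in dimension 3. *)

Ltac pos := intros; solve [
  done | assumption
| match goal with
  | |- is_true (0 <= _ * _)%R => apply: mulr_ge0; pos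
  | |- is_true (0 < _ * _)%R => apply: mulr_gt0; pos
  | |- is_true (0 <= _ + _)%R => apply: addr_ge0; pos
  | |- is_true (0 < _ + _)%R => first [apply: addr_gt0; pos | apply: ltr_wpDl; pos | apply: ltr_pwDl; pos]
  | |- is_true (0 <= _ ^-1)%R => rewrite invr_ge0; pos
  | |- is_true (0 < _ ^-1)%R => rewrite invr_gt0; pos
  | |- is_true (0 <= _ ^+ 2)%R => exact: sqr_ge0
  | |- is_true (0 <= _ ^+ _)%R => apply: exprn_ge0; pos
  | |- is_true (0 < _ ^+ _)%R => apply: exprn_gt0; pos
  | |- is_true (0 <= _ `^ _)%R => exact: powR_ge0
  | |- is_true (0 < _ `^ _)%R => apply: powR_gt0; pos
  | |- is_true (0 < expR _)%R => exact: expR_gt0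
  | |- is_true (0 <= Num.sqrt _)%R => exact: sqrtr_ge0
  | |- is_true (_ != 0) => apply: lt0r_neq0; pos
  | |- is_true (0 <= _)%R => solve [apply: ltW; pos]
  end
| match goal with H : _ |- _ => apply: H; pos end ].

(** * Integrals of real functions *)

Section real_integral.
Context d (T : measurableType d) (R : realType) (mu : {measure set T -> \bar R}).
Implicit Types f g h : T -> R.

Definition integ f := mu.-integrable setT (EFin \o f).

Lemma integ_measurable f : integ f -> mfun f.
Proof. by move=> /integrableP[/measurable_EFinP]. Qed.

Lemma integ_le_ae f g : mfun f -> integ g ->
  (\forall x \ae mu, `|f x| <= g x) -> integ f.
Proof.
move=> mf ig fg; apply/integrableP; split; first exact/measurable_EFinP.
have /integrableP[mg gfin] := ig.
apply: le_lt_trans gfin; apply: ae_ge0_le_integral => //=.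
- by apply/measurable_EFinP; exact: measurableT_comp.
- by apply/measurable_EFinP; apply: measurableT_comp => //; exact/measurable_EFinP.
- by apply: filterS fg => x h _; rewrite lee_fin (le_trans h)// ler_norm.
Qed.

Lemma integ_le f g : mfun f -> integ g ->
  (forall x, `|f x| <= g x) -> integ f.
Proof. by move=> mf ig fg; apply: (integ_le_ae mf ig); exact: aeW. Qed.

Lemma integ_ae f g : mfun f -> integ g ->
  (\forall x \ae mu, f x = g x) -> integ f.
Proof.
move=> mf ig fg; apply: (@integ_le_ae _ (fun x => `|g x|)) => //.
  exact: (integrable_norm ig).
by apply: filterS fg => x ->.
Qed.

Lemma integ_eq f g : (forall x, f x = g x) -> integ g -> integ f.
Proof. by move=> /funext ->. Qed.

Lemma integ0 : integ (fun=> 0).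
Proof. exact: integrable0. Qed.

Lemma integD f g : integ f -> integ g -> integ (fun x => f x + g x).
Proof. by move=> if_ ig; exact: (integrableD measurableT if_ ig). Qed.

Lemma integN f : integ f -> integ (fun x => - f x).
Proof. by move=> if_; exact: (integrableN if_). Qed.

Lemma integB f g : integ f -> integ g -> integ (fun x => f x - g x).
Proof. by move=> ? ?; apply: integD => //; exact: integN. Qed.

Lemma integZ k f : integ f -> integ (fun x => k * f x).
Proof. by move=> if_; exact: (integrableZl measurableT k if_). Qed.

Lemma integ_norm f : integ f -> integ (fun x => `|f x|).
Proof. exact: integrable_norm. Qed.

Lemma integ_sum I (s : seq I) (F : I -> T -> R) :
  (forall i, integ (F i)) -> integ (fun x => \sum_(i <- s) F i x).
Proof.
move=> h; elim: s => [|i s IH].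
  by under eq_fun do rewrite big_nil; exact: integ0.
by under eq_fun do rewrite big_cons; exact: integD.
Qed.

Lemma integM_bounded f g M : integ f -> mfun g ->
  (forall x, `|g x| <= M) -> integ (fun x => f x * g x).
Proof.
move=> if_ mg gM; apply: (@integ_le _ (fun x => M * `|f x|)).
- by apply: measurable_funM => //; exact: integ_measurable.
- exact/integZ/integ_norm.
- by move=> x; rewrite normrM mulrC ler_wpM2r.
Qed.

Lemma integ_fin A : measurable A -> (mu A < +oo)%E -> integ (\1_A).
Proof. move=> mA Afin; apply/integrableP; split.
  by apply/measurable_EFinP; exact: measurable_indic.
rewrite (_ : (\int[mu]_x _)%E = (\int[mu]_x (\1_A x)%:E)%E).
  by rewrite integral_indic// setIT.
by apply: eq_integral => x _; rewrite /= ger0_norm. Qed.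

Lemma IntD f g : integ f -> integ g ->
  \int[mu]_x (f x + g x) = \int[mu]_x f x + \int[mu]_x g x.
Proof. by move=> ? ?; exact: RintegralD. Qed.

Lemma IntB f g : integ f -> integ g ->
  \int[mu]_x (f x - g x) = \int[mu]_x f x - \int[mu]_x g x.
Proof. by move=> ? ?; exact: RintegralB. Qed.

Lemma IntZ k f : integ f -> \int[mu]_x (k * f x) = k * \int[mu]_x f x.
Proof. by move=> ?; exact: RintegralZl. Qed.

Lemma IntN f : integ f -> \int[mu]_x (- f x) = - \int[mu]_x f x.
Proof.
by move=> ?; rewrite -mulN1r -IntZ//; apply: eq_Rintegral => x _; rewrite mulN1r.
Qed.

Lemma Int_sum I (s : seq I) (F : I -> T -> R) : (forall i, integ (F i)) ->
  \int[mu]_x (\sum_(i <- s) F i x) = \sum_(i <- s) \int[mu]_x F i x.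
Proof.
move=> h; elim: s => [|i s IH].
  rewrite big_nil -[RHS](mul0r (\int[mu]_x 0)) -IntZ; last exact: integ0.
  by apply: eq_Rintegral => x _; rewrite big_nil mul0r.
by under eq_Rintegral do rewrite big_cons; rewrite IntD ?big_cons ?IH//;
  exact: integ_sum.
Qed.

Lemma Int_ext f g : (forall x, f x = g x) -> \int[mu]_x f x = \int[mu]_x g x.
Proof. by move=> fg; apply: eq_Rintegral => x _. Qed.

Lemma Int0 : \int[mu]_x (0 : R) = 0.
Proof. by rewrite /Rintegral integral0. Qed.

Lemma Int_ae f g : mfun f -> mfun g ->
  (\forall x \ae mu, f x = g x) -> \int[mu]_x f x = \int[mu]_x g x.
Proof.
move=> mf mg fg; congr fine; apply: ae_eq_integral => //.
- exact/measurable_EFinP.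
- exact/measurable_EFinP.
- by apply: filterS fg => x -> _.
Qed.

Lemma Int_ge0 f : (forall x, 0 <= f x) -> 0 <= \int[mu]_x f x.
Proof. by move=> f0; exact: Rintegral_ge0. Qed.

Lemma Int_le f g : integ f -> integ g -> (forall x, f x <= g x) ->
  \int[mu]_x f x <= \int[mu]_x g x.
Proof. by move=> ? ? h; exact: le_Rintegral. Qed.

Lemma Int_abs_le f : integ f -> `|\int[mu]_x f x| <= \int[mu]_x `|f x|.
Proof. by move=> ?; exact: le_normr_Rintegral. Qed.

Lemma Int_abs_leP f g : integ f -> integ g -> (forall x, `|f x| <= g x) ->
  `|\int[mu]_x f x| <= \int[mu]_x g x.
Proof.
move=> if_ ig fg; apply: (le_trans (Int_abs_le if_)).
by apply: Int_le => //; exact: integ_norm.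
Qed.

Lemma EFin_Int f : integ f -> (\int[mu]_x f x)%:E = (\int[mu]_x (f x)%:E)%E.
Proof. by move=> ?; rewrite fineK//; exact: integrable_fin_num. Qed.

Lemma Int_eq0 f : integ f -> (forall x, 0 <= f x) -> \int[mu]_x f x = 0 ->
  \forall x \ae mu, f x = 0.
Proof.
move=> if_ f0 If.
have mf : mfun (EFin \o f).
  exact/measurable_EFinP/integ_measurable.
have : (\int[mu]_x `|(EFin \o f) x| = 0)%E.
  under eq_integral do rewrite /= ger0_norm//.
  by rewrite -EFin_Int// If.
move=> /(ae_eq_integral_abs mu measurableT mf).
by apply: filterS => x /(_ Logic.I)[].
Qed.

Lemma dct (f_ : nat -> T -> R) f g :
  (forall n, mfun (f_ n)) -> mfun f ->
  integ g -> (forall n x, `|f_ n x| <= g x) ->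
  (\forall x \ae mu, f_ ^~ x @ \oo --> f x) ->
  integ f /\ \int[mu]_x f_ n x @[n --> \oo] --> \int[mu]_x f x.
Proof.
move=> mf_ mf ig fg ff.
have [] := @dominated_convergence _ _ _ mu setT measurableT
  (fun n => EFin \o f_ n) (EFin \o f) (EFin \o g).
- by move=> n; exact/measurable_EFinP.
- exact/measurable_EFinP.
- apply: filterS ff => x h _; by apply: cvg_EFin; [exact: nearW | exact: h].
- exact: ig.
- by apply: aeW => x n _; rewrite lee_fin.
move=> if_ _ cv; split => //.
by apply: fine_cvg; rewrite fineK//; exact: integrable_fin_num.
Qed.

Lemma dct_pw (f_ : nat -> T -> R) f g :
  (forall n, mfun (f_ n)) ->
  integ g -> (forall n x, `|f_ n x| <= g x) ->
  (forall x, f_ ^~ x @ \oo --> f x) ->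
  integ f /\ \int[mu]_x f_ n x @[n --> \oo] --> \int[mu]_x f x.
Proof.
move=> mf_ ig fg ff; apply: (dct mf_ _ ig fg); last exact: aeW.
by apply: (measurable_fun_cvg mf_) => x _; exact: ff.
Qed.

Lemma dct_cvg (f_ : nat -> T -> R) f g :
  (forall n, mfun (f_ n)) ->
  integ g -> (forall n x, `|f_ n x| <= g x) ->
  (forall x, f_ ^~ x @ \oo --> f x) ->
  \int[mu]_x f_ n x @[n --> \oo] --> \int[mu]_x f x.
Proof. by move=> h1 h2 h3 h4; have [] := dct_pw h1 h2 h3 h4. Qed.

(** Fatou serves to produce integrability: an exhausting sequence with bounded integrals is often
    all that is known about a limit. *)
Lemma integ_fatou (f_ : nat -> T -> R) f C :
  (forall n, integ (f_ n)) -> (forall n x, 0 <= f_ n x) ->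
  (forall n, \int[mu]_x f_ n x <= C) -> (forall x, f_ ^~ x @ \oo --> f x) ->
  integ f /\ \int[mu]_x f x <= C.
Proof.
move=> if_ f0 fC ff.
have f0' x : 0 <= f x.
  rewrite -(cvg_lim (@Rhausdorff R) (ff x)); apply: limr_ge; first exact: cvgP (ff x).
  by apply: nearW => n; exact: f0.
have mf : mfun f.
  apply: (measurable_fun_cvg (fun n => integ_measurable (if_ n))) => x _; exact: ff.
have hle : (\int[mu]_x (f x)%:E <= C%:E)%E.
  have := @fatou _ _ _ mu setT measurableT (fun n => EFin \o f_ n).
  rewrite (_ : (\int[mu]_x limn_einf _)%E = (\int[mu]_x (f x)%:E)%E); last first.
    apply: eq_integral => x _.
    have cf : (EFin \o f_ n) x @[n --> \oo] --> (f x)%:E.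
      by apply: cvg_EFin; [exact: nearW|exact: ff].
    by rewrite is_cvg_limn_einfE; [exact: cvg_lim|exact: cvgP cf].
  move=> h; apply: (le_trans (h _ _)).
  - by move=> n; exact/measurable_EFinP/integ_measurable.
  - pos.
  - rewrite limn_einf_lim; apply: lime_le; first exact: is_cvg_einfs.
    apply: nearW => n; apply: (@le_trans _ _ (\int[mu]_x (EFin \o f_ n) x)%E).
      by apply: ereal_inf_lbound; exists n => //=.
    by rewrite -EFin_Int// lee_fin.
have if' : integ f.
  apply/integrableP; split; first exact/measurable_EFinP.
  rewrite (_ : (\int[mu]_x _)%E = (\int[mu]_x (f x)%:E)%E).
    by rewrite (le_lt_trans hle)// ltry.
  by apply: eq_integral => x _; rewrite /= ger0_norm.
by split => //; rewrite -lee_fin EFin_Int.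
Qed.

Lemma measurable_gt0 f : mfun f -> measurable [set x | 0 < f x].
Proof.
move=> mf; rewrite (_ : [set x | _] = setT `&` f @^-1` `]0, +oo[%classic).
  (* [pos] ends by applying hypotheses, so it also closes goals that are not about signs; here [mf]
     gives the measurability. *)
  pos.
by apply/seteqP; split => x /=; rewrite in_itv/= andbT// => -[].
Qed.

End real_integral.

Arguments Int_ext {d T R} mu f g.
Arguments Int0 {d T R} mu.

(** * Boxes, uniqueness of measures and Borel sets of row vectors *)

Section rV_measure.
Context (R : realType) (n : nat).
Local Notation E := 'rV[R]_n.
Local Notation mu := (lebesgue_rV R n).

Definition rV_box (A : 'I_n -> set R) : set E := [set x | forall i, A i (x ord0 i)].

Lemma measurable_rV_box A : (forall i, measurable (A i)) -> measurable (rV_box A).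
Proof.
move=> mA.
rewrite (_ : rV_box A = \big[setI/setT]_(i < n)
    ((fun x : E => x ord0 i) @^-1` A i)).
  apply: bigsetI_measurable => i _; rewrite -[X in measurable X]setTI.
  exact: (measurable_coord i measurableT).
rewrite -bigcap_seq; apply/seteqP; split => x /= h i; first by move=> _; exact: h.
by apply: h; rewrite /= mem_index_enum.
Qed.

Lemma rV_boxE A : (forall i, measurable (A i)) ->
  mu (rV_box A) = (\prod_(i < n) lebesgue_measure (A i))%E.
Proof. exact: lebesgue_rV_box. Qed.

Definition rV_boxes : set (set E) :=
  [set B | exists a b : 'I_n -> R, B = rV_box (fun i => `]a i, b i[%classic)].

Lemma rV_boxesI : setI_closed rV_boxes.
Proof.
move=> _ _ [a [b ->]] [c [d ->]].
exists (fun i => Num.max (a i) (c i)), (fun i => Num.min (b i) (d i)).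
apply/seteqP; split => [x [h1 h2] i|x h].
  have := h1 i; have := h2 i; rewrite /= !in_itv/= gt_max lt_min.
  by move=> /andP[-> ->] /andP[-> ->].
split => i; have := h i; rewrite /= !in_itv/= gt_max lt_min;
  by move=> /andP[/andP[h1 h2] /andP[h3 h4]]; apply/andP.
Qed.

Lemma rV_boxes_gen : @measurable _ E = <<s rV_boxes >>.
Proof.
apply/seteqP; split; last first.
  apply: smallest_sub; first exact: sigma_algebra_measurable.
  move=> _ [a [b ->]]; apply: measurable_rV_box => i; exact: measurable_itv.
apply: smallest_sub; first exact: smallest_sigma_algebra.
rewrite -bigcup_seq; apply: bigcup_sub => i _ _ [B mB <-]; rewrite setTI.
pose S := [set B : set R | <<s rV_boxes >> ((fun x : E => x ord0 i) @^-1` B)].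
suff : @measurable _ R `<=` S by apply.
have -> : @measurable _ R = <<s @RGenOpens.G R >> := RGenOpens.measurableE R.
apply: smallest_sub.
  split; rewrite /S /=.
  - by rewrite preimage_set0; exact: sigma_algebra0.
  - by move=> A mA; rewrite setTD -preimage_setC -setTD; exact: sigma_algebraCD.
  - by move=> F mF; rewrite preimage_bigcup; exact: sigma_algebra_bigcup.
move=> _ [a [b ->]].
(* A coordinate slab is the union of the boxes whose other sides are (-k, k). *)
rewrite /S /= (_ : _ @^-1` _ = \bigcup_k rV_box (fun j =>
    `](if j == i then a else - k%:R), (if j == i then b else k%:R)[%classic)).
  apply: sigma_algebra_bigcup => k; apply: sub_sigma_algebra.
  by exists (fun j => if j == i then a else - k%:R), (fun j => if j == i then b else k%:R).
apply/seteqP; split => [x /= xab|x [k _ /(_ i)]]; last by rewrite /= eqxx.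
have [k kx] : exists k : nat, forall i, `|x ord0 i| < k%:R.
  exists (\max_i (Num.trunc `|x ord0 i|).+1)%N => j.
  apply: lt_le_trans (truncnS_gt _) _; rewrite ler_nat.
  by rewrite (bigD1 j)//=; exact: leq_maxl.
exists k => // j /=; case: eqP => [->//|_]; by rewrite in_itv/= -ltr_norml.
Qed.

Definition rV_cube (k : nat) : set E := rV_box (fun=> `]- k%:R, k%:R[%classic).

Lemma rV_cube_boxes k : rV_boxes (rV_cube k).
Proof. by exists (fun=> - k%:R), (fun=> k%:R). Qed.

Lemma measurable_rV_cube k : measurable (rV_cube k).
Proof. by apply: measurable_rV_box => i; exact: measurable_itv. Qed.

Lemma rV_cube_cover : \bigcup_k rV_cube k = setT.
Proof.
apply/seteqP; split => // x _.
have [k kx] : exists k : nat, forall i, `|x ord0 i| < k%:R.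
  exists (\max_i (Num.trunc `|x ord0 i|).+1)%N => i.
  apply: lt_le_trans (truncnS_gt _) _; rewrite ler_nat.
  rewrite (bigD1 i)//=; exact: leq_maxl.
by exists k => // i /=; rewrite in_itv/= -ltr_norml kx.
Qed.

Lemma rV_cube_fin k : (mu (rV_cube k) < +oo)%E.
Proof.
rewrite rV_boxE; last by move=> i; exact: measurable_itv.
rewrite (eq_bigr (fun=> (k%:R + k%:R)%:E)); last first.
  move=> i _; rewrite lebesgue_measure_itv/=; case: ifPn => [_|].
    by rewrite opprK.
  rewrite lte_fin -leNgt => h; congr EFin.
  have : (0 : R) <= k%:R by []. by move: h; lra.
by rewrite prodEFin ltry.
Qed.

Lemma rV_measure_unique (m1 m2 : {measure set E -> \bar R}) :
  (forall B, rV_boxes B -> m1 B = m2 B) ->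
  (forall k, (m1 (rV_cube k) < +oo)%E) ->
  forall X, measurable X -> m1 X = m2 X.
Proof.
move=> m12 m1fin X mX.
apply: (measure_unique rV_boxes rV_cube) => //.
- exact: rV_boxes_gen.
- exact: rV_boxesI.
- exact: rV_cube_boxes.
- exact: rV_cube_cover.
Qed.

(** The sigma-algebra is generated by the coordinates, not by the topology. An open set is a
    countable union of boxes with rational centre and half-side 1/(k+1), because the norm is the sup
    norm. *)
Lemma open_measurable_rV (U : set E) : open U -> measurable U.
Proof.
move=> oU.
pose B (z : 'rV[rat]_n * nat) : set E :=
  rV_box (fun i => `]ratr (z.1 ord0 i) - z.2.+1%:R^-1, ratr (z.1 ord0 i) + z.2.+1%:R^-1[%classic).
have -> : U = \bigcup_z (if `[< B z `<=` U >] then B z else set0).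
  apply/seteqP; split; last first.
    by move=> x [z _]; case: asboolP => // + Bz; apply.
  move=> x Ux.
  have /nbhs_ballP[e /= e0 eU] : nbhs x U by pos.
  (* Half of the radius: both x and the points of the box lie within 1/(k+1) of the rational
     centre. *)
  have [k ke] : exists k : nat, k.+1%:R^-1 < e / 2.
    exists (Num.trunc (e / 2)^-1); rewrite invf_plt ?posrE ?divr_gt0//.
    by rewrite truncnS_gt.
  have hq i : exists q : rat, `|ratr q - x ord0 i| < k.+1%:R^-1.
    have [q] := @rat_in_itvoo _ (x ord0 i - k.+1%:R^-1) (x ord0 i + k.+1%:R^-1)
      (ltac:(rewrite ltrD2l gt0_cp// invr_gt0 ltr0n)).
    rewrite in_itv/= => /andP[q1 q2]; exists q.
    by rewrite ltr_distl q1 q2.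
  pose q : 'rV[rat]_n := \row_i projT1 (cid (hq i)).
  have qx i : `|ratr (q ord0 i) - x ord0 i| < k.+1%:R^-1.
    by rewrite mxE; case: cid.
  exists (q, k) => //=; case: asboolP => [_ i /=|].
    rewrite in_itv/= -ltr_distl distrC; exact: qx.
  apply: contra_notP => _ y By; apply: eU; split => // i0 j; rewrite (ord1 i0).
  have := By j; rewrite /= in_itv/= -ltr_distl => yq.
  rewrite /ball/=.
  rewrite (_ : x ord0 j - y ord0 j = (x ord0 j - ratr (q ord0 j)) + (ratr (q ord0 j) - y ord0 j)); last by ring.
  apply: (le_lt_trans (ler_normD _ _)).
  have := qx j; rewrite distrC => h1; rewrite distrC in yq.
  apply: (lt_le_trans (ltrD h1 yq)); move: (ltW ke).
  by move: (k.+1%:R^-1) => t; lra.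
apply: countable_bigcupT_measurable; first exact: countableP.
move=> z; case: ifP => // _; apply: measurable_rV_box => i.
exact: measurable_itv.
Qed.

Lemma continuous_measurable_rV (f : E -> R) : continuous f -> mfun f.
Proof.
move=> /continuousP cf; apply: (measurability _ (RGenOpens.measurableE R)).
move=> _ [_ [a [b ->] <-]]; rewrite setTI; apply: open_measurable_rV.
exact/cf/interval_open.
Qed.

End rV_measure.

(** * Change of variables: measure-preserving maps, translations, dilations *)

Section measure_preserving.
Context d d' (T : measurableType d) (T' : measurableType d') (R : realType).
Variables (mu : {measure set T -> \bar R}) (mu' : {measure set T' -> \bar R}).
Variable f : T -> T'.

Definition mpres := mfun f /\
  forall X, measurable X -> mu (f @^-1` X) = mu' X.

Hypothesis fP : mpres.

Lemma mpres_ge0_integral (F : T' -> \bar R) : mfun F ->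
  (forall x, 0 <= F x)%E -> (\int[mu]_x F (f x) = \int[mu']_x F x)%E.
Proof.
move=> mF F0; have := @ge0_integral_pushforward _ _ _ _ _ _ (proj1 fP) mu setT F.
rewrite preimage_setT => <- //; apply: eq_measure_integral => [|? A mA _].
  exact: (proj1 fP).
by rewrite /= /pushforward (proj2 fP).
Qed.

Lemma mpres_integ (F : T' -> R) : integ mu' F -> integ mu (fun x => F (f x)).
Proof.
move=> iF; have mF := integ_measurable iF.
have /integrableP[_ hF] := iF.
apply/integrableP; split.
  by apply/measurable_EFinP; apply: measurableT_comp => //; case: fP.
rewrite (mpres_ge0_integral (F := fun x => `|(F x)%:E|%E))//.
by apply: measurableT_comp => //; exact/measurable_EFinP.
Qed.

Lemma mpres_integE (F : T' -> R) : mfun F ->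
  integ mu (fun x => F (f x)) -> integ mu' F.
Proof.
move=> mF iF; have /integrableP[_ hF] := iF.
apply/integrableP; split; first exact/measurable_EFinP.
rewrite -(mpres_ge0_integral (F := fun x => `|(F x)%:E|%E))//.
by apply: measurableT_comp => //; exact/measurable_EFinP.
Qed.

Lemma mpres_Int (F : T' -> R) : integ mu' F ->
  \int[mu]_x F (f x) = \int[mu']_x F x.
Proof.
move=> iF; have mF := integ_measurable iF.
have := @integral_pushforward _ _ _ _ _ _ (proj1 fP) mu setT (EFin \o F).
rewrite preimage_setT => h; congr fine; rewrite -h//.
- apply: eq_measure_integral => [|? A mA _]; first exact: (proj1 fP).
  by rewrite /= /pushforward (proj2 fP).
- exact/measurable_EFinP.
- exact: mpres_integ.
Qed.

End measure_preserving.

Section rV_affine.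
Context (R : realType).

Lemma lebesgue_shift (a : R) (A : set R) : measurable A ->
  lebesgue_measure ((fun x : R => x + a) @^-1` A) = lebesgue_measure A.
Proof.
move=> mA.
have ms : mfun (fun x : measurableTypeR R => x + a : measurableTypeR R).
  by apply: measurable_funD.
pose f := fun x : measurableTypeR R => (x + a : measurableTypeR R).
have := @lebesgue_measure_unique R (pushforward lebesgue_measure f).
move=> /(_ ms _ A mA) ->//= _ [[b c] _ <-].
rewrite /pushforward (_ : _ @^-1` _ = `](b - a), (c - a)]%classic).
  rewrite !lebesgue_measure_itv/= !lte_fin ltrD2r; case: ifP => // _.
  by rewrite -!EFinB; congr EFin; ring.
by apply/seteqP; split => x /=; rewrite !in_itv/= /f ltrBlDr lerBrDr.
Qed.

Lemma lebesgue_scale (a : R) (A : set R) : 0 < a -> measurable A ->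
  (a%:E * lebesgue_measure ((fun x : R => a * x)%R @^-1` A))%E = lebesgue_measure A.
Proof.
move=> a0 mA.
have ms : mfun (fun x : measurableTypeR R => a * x : measurableTypeR R).
  by apply: measurable_funM.
pose f := fun x : measurableTypeR R => (a * x : measurableTypeR R).
have := @lebesgue_measure_unique R (mscale (NngNum (ltW a0)) (pushforward lebesgue_measure f)).
move=> /(_ ms _ A mA) -> //= _ [[b c] _ <-].
rewrite /mscale/= /pushforward (_ : _ @^-1` _ = `](b / a), (c / a)]%classic).
  rewrite !lebesgue_measure_itv/= !lte_fin ltr_pM2r ?invr_gt0//.
  case: ifP => _; last by rewrite mule0.
  by rewrite -!EFinB -EFinM -mulrBl mulrCA divff ?gt_eqF// mulr1.
apply/seteqP; split => x /=; rewrite !in_itv/=.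
  by rewrite ltr_pdivrMr// ler_pdivlMr// !(mulrC x).
by rewrite ltr_pdivrMr// ler_pdivlMr// !(mulrC x).
Qed.

Context (n : nat).
Local Notation E := 'rV[R]_n.
Local Notation mu := (lebesgue_rV R n).

Lemma rV_shift_measurable (v : E) : mfun (fun x : E => x + v).
Proof.
apply: measurable_fun_rVP => i; under eq_fun do rewrite mxE.
by apply: measurable_funD => //; exact: measurable_coord.
Qed.

Lemma rV_shift_mpres (v : E) : mpres mu mu (fun x : E => x + v).
Proof.
split; first exact: rV_shift_measurable.
pose f := (fun x : E => x + v).
move=> X mX; apply/esym.
apply: (@rV_measure_unique _ _ mu (pushforward mu f)) => //.
- exact: rV_shift_measurable.
- move=> mf _ [a [b ->]]; set A := (fun i => _ : set R).
  have mA i : measurable (A i) by exact: measurable_itv.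
  rewrite /= /pushforward.
rewrite (_ : f @^-1` _ = rV_box (fun i => (fun x => x + v ord0 i) @^-1` (A i))).
  rewrite !rV_boxE//.
    by apply: eq_bigr => i _; rewrite lebesgue_shift.
  move=> i; rewrite -[X in measurable X]setTI.
  by apply: measurable_funD => //.
  by apply/seteqP; split => x /= h i; have := h i; rewrite /= mxE.
- exact: rV_cube_fin.
Qed.

Lemma rV_scale_measurable (a : R) : mfun (fun x : E => a *: x).
Proof.
apply: measurable_fun_rVP => i; under eq_fun do rewrite mxE.
by apply: measurable_funM => //; exact: measurable_coord.
Qed.

Lemma rV_scale (a : R) (X : set E) : 0 < a -> measurable X ->
  ((a ^+ n)%:E * mu ((fun x : E => a *: x)%R @^-1` X))%E = mu X.
Proof.
move=> a0 mX.
pose f := (fun x : E => a *: x).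
have an0 : 0 <= a ^+ n by rewrite exprn_ge0// ltW.
apply/esym.
apply: (@rV_measure_unique _ _ mu (mscale (NngNum an0) (pushforward mu f))) => //.
- exact: rV_scale_measurable.
- move=> mf _ [b [c ->]]; set A := (fun i => _ : set R).
  have mA i : measurable (A i) by exact: measurable_itv.
  transitivity ((a ^+ n)%:E * mu (f @^-1` rV_box A))%E; last by [].
rewrite (_ : f @^-1` _ = rV_box (fun i => (fun x => a * x) @^-1` (A i))).
  transitivity (\prod_(i < n) lebesgue_measure (A i))%E; first exact: rV_boxE.
  rewrite rV_boxE//.
    rewrite (_ : a ^+ n = \prod_(i < n) a); last first.
      by rewrite prodr_const card_ord.
    rewrite -prodEFin -big_split/=; apply: eq_bigr => i _.
    by rewrite lebesgue_scale.
  move=> i; rewrite -[X in measurable X]setTI.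
  by apply: measurable_funM => //.
  by apply/seteqP; split => x /= h i; have := h i; rewrite /= mxE.
- exact: rV_cube_fin.
Qed.

End rV_affine.

(** * Smooth functions and test functions *)

Section derivative_1d.
Context (R : realType).
Implicit Types (f g : R -> R) (x : R).

(** A relation instead of a derivative operator: existence and value travel together, and formulas
    are adjusted with [dd_eq]. *)
Definition dd f x (d : R) := is_derive x (1 : R) f d.

Lemma dd_eq f x d d' : dd f x d -> d = d' -> dd f x d'.
Proof. by move=> h <-. Qed.

Lemma dd_cont f x d : dd f x d -> {for x, continuous f}.
Proof. by case=> df _; apply/differentiable_continuous/derivable1_diffP. Qed.

Lemma dd_near f g x d : (\near x, f x = g x) -> dd f x d -> dd g x d.
Proof. by move=> fg h; apply: near_eq_is_derive h => //; rewrite oner_neq0. Qed.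

Lemma dd_cst (c : R) x : dd (fun=> c) x 0.
Proof. exact: is_derive_cst. Qed.

Lemma dd_id x : dd (fun y => y) x 1.
Proof. exact: is_derive_id. Qed.

Lemma ddD f g x df dg : dd f x df -> dd g x dg -> dd (fun y => f y + g y) x (df + dg).
Proof. by move=> h1 h2; exact: is_deriveD. Qed.

Lemma ddB f g x df dg : dd f x df -> dd g x dg -> dd (fun y => f y - g y) x (df - dg).
Proof. by move=> h1 h2; exact: is_deriveB. Qed.

Lemma ddN f x df : dd f x df -> dd (fun y => - f y) x (- df).
Proof. by move=> h; exact: is_deriveN. Qed.

Lemma ddM f g x df dg : dd f x df -> dd g x dg ->
  dd (fun y => f y * g y) x (f x * dg + df * g x).
Proof.
move=> h1 h2; apply: dd_eq (is_deriveM h1 h2) _.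
by rewrite /GRing.scale/= (mulrC df).
Qed.

Lemma ddZ (c : R) f x df : dd f x df -> dd (fun y => c * f y) x (c * df).
Proof.
move=> h; apply: dd_eq (ddM (dd_cst c x) h) _.
by rewrite mul0r addr0.
Qed.

Lemma dd_comp f g x df dg : dd f (g x) df -> dd g x dg ->
  dd (fun y => f (g y)) x (df * dg).
Proof. by move=> h1 h2; exact: is_derive1_comp. Qed.

Lemma ddV f x df : f x != 0 -> dd f x df -> dd (fun y => (f y)^-1) x (- df / (f x) ^+ 2).
Proof.
move=> f0 h; apply: dd_eq (is_deriveV f0 h) _.
by rewrite /GRing.scale/= mulNr mulrC mulNr.
Qed.

Lemma dd_expR f x df : dd f x df -> dd (fun y => expR (f y)) x (expR (f x) * df).
Proof. by move=> h; apply: dd_comp h; exact: is_derive_expR. Qed.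

Lemma dd_affine (a b x : R) : dd (fun y => a * y + b) x a.
Proof.
apply: dd_eq (ddD (ddZ a (dd_id x)) (dd_cst b x)) _; by rewrite mulr1 addr0.
Qed.

Lemma dd_limP f x d : dd f x d <->
  ((fun h => h^-1 * (f (h + x) - f x)) @ 0^' --> d).
Proof.
have E : (fun h : R => h^-1 *: ((f \o shift x) (h *: (1 : R)) - f x)) =
    (fun h => h^-1 * (f (h + x) - f x)).
  by apply/funext => h; rewrite /= /GRing.scale/= mulr1.
split => [[df <-]|h].
  by move: df; rewrite /derivable /derive E => /cvg_ex[l hl]; rewrite (cvg_lim _ hl).
apply: DeriveDef; first by rewrite /derivable E; apply/cvg_ex; exists d.
by rewrite /derive E; exact: cvg_lim.
Qed.

Lemma dd_bound0 f x C : f x = 0 -> (\forall y \near x, `|f y| <= C * (y - x) ^+ 2) ->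
  dd f x 0.
Proof.
move=> f0 h; apply/dd_limP; rewrite f0.
apply/cvgrPdist_le => e e0.
have h' : \forall y \near 0, `|f (y + x)| <= C * y ^+ 2.
  have cx : (fun y : R => y + x) @ (0 : R) --> x.
    by rewrite -[X in _ --> X]add0r; apply: cvgD; [exact: cvg_id|exact: cvg_cst].
  have hx : nbhs (0 : R) [set y | `|f (y + x)| <= C * ((y + x) - x) ^+ 2] := cx _ h.
  by apply: filterS hx => y /=; rewrite addrK.
have C1 : 0 < `|C| + 1 by rewrite ltr_wpDl.
near=> y.
have y0 : y != 0 by near: y; exact: nbhs_dnbhs_neq.
rewrite sub0r normrN subr0 normrM normfV.
rewrite ler_pdivrMl ?normr_gt0//.
have : `|f (y + x)| <= C * y ^+ 2 by near: y; exact: nbhs_dnbhs.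
move=> /le_trans; apply.
apply: (@le_trans _ _ ((`|C| + 1) * (`|y| * `|y|))).
  rewrite -normrM -expr2 ger0_norm ?sqr_ge0// ler_wpM2r ?sqr_ge0//.
  by rewrite (le_trans (ler_norm _))// lerDl.
rewrite mulrCA ler_wpM2l//.
rewrite mulrC -ler_pdivlMr//.
by near: y; apply: dnbhs0_le; rewrite divr_gt0.
Unshelve. all: by end_near. Qed.

End derivative_1d.

Section smooth_1d.
Context (R : realType).
Implicit Types (f g k : R -> R) (x : R).

(* Infinite differentiability, coinductively: [k] lies in a class closed under derivatives. *)
Definition smooth1 k := exists2 C : set (R -> R), C k &
  forall f, C f -> exists2 f', C f' & forall x, dd f x (f' x).

Lemma smooth1_der k : smooth1 k -> exists2 k', smooth1 k' & forall x, dd k x (k' x).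
Proof.
by move=> [C Ck HC]; have [k' Ck' dk] := HC _ Ck; exists k' => //; exists C.
Qed.

Lemma smooth1_antider k k' : smooth1 k' -> (forall x, dd k x (k' x)) -> smooth1 k.
Proof.
move=> [C Ck HC] dk; exists (C `|` [set k]); first by right.
move=> f [/HC[f' ? ?]|->]; first by exists f' => //; left.
by exists k' => //; left.
Qed.

Lemma smooth1_affine k (a b : R) : smooth1 k -> smooth1 (fun x => k (a * x + b)).
Proof.
move=> [C Ck HC].
exists [set f | exists2 g, C g & exists c, f = (fun x => c * g (a * x + b))].
  by exists k => //; exists 1; apply/funext => x; rewrite mul1r.
move=> _ [g /HC[g' Cg' dg] [c ->]]; exists (fun x => c * a * g' (a * x + b)).
  by exists g' => //; exists (c * a).
move=> x; apply: dd_eq (ddZ c (dd_comp (dg _) (dd_affine a b x))) _.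
by rewrite mulrAC mulrA.
Qed.

(** Leibniz' rule keeps sums of products stable under derivation, which makes this class the witness
    for [smooth1M]. *)
Inductive prod_class (C D : set (R -> R)) : set (R -> R) :=
| pc_mul f g : C f -> D g -> prod_class C D (fun x => f x * g x)
| pc_add f g : prod_class C D f -> prod_class C D g ->
    prod_class C D (fun x => f x + g x).

Lemma smooth1M f g : smooth1 f -> smooth1 g -> smooth1 (fun x => f x * g x).
Proof.
move=> [C Cf HC] [D Dg HD]; exists (prod_class C D); first exact: pc_mul.
move=> h; elim => {h}[f1 g1 Cf1 Dg1|f1 g1 _ [f' cf df] _ [g' cg dg]].
  have [f' Cf' df] := HC _ Cf1; have [g' Dg' dg] := HD _ Dg1.
  exists (fun x => f1 x * g' x + f' x * g1 x); last by move=> x; exact: ddM.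
  by apply: pc_add; exact: pc_mul.
exists (fun x => f' x + g' x); first exact: pc_add.
by move=> x; exact: ddD.
Qed.

Lemma monomial_le_expR m : exists2 C : R, 0 <= C &
  forall y : R, 0 <= y -> y ^+ m <= C * expR y.
Proof.
elim: m => [|m [C C0 HC]].
  exists 1 => // y y0; rewrite expr0 mul1r -expR0 ler_expR//.
exists (2 ^+ m.+1 * C); first by rewrite mulr_ge0// exprn_ge0.
move=> y y0; have y2 : 0 <= y / 2 by rewrite divr_ge0.
have -> : y ^+ m.+1 = 2 ^+ m.+1 * ((y / 2) * (y / 2) ^+ m).
  by rewrite -exprS -exprMn mulrCA divff// mulr1.
rewrite -[leRHS]mulrA ler_pM2l ?exprn_gt0//.
have -> : expR y = expR (y / 2) * expR (y / 2).
  by rewrite -expRD; congr expR; field.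
rewrite mulrA (mulrC (C * _)); apply: ler_pM => //.
- exact: exprn_ge0.
- by apply: le_trans (expR_ge1Dx _); rewrite lerDr.
- exact: HC.
Qed.

Lemma poly_le_expR (P : {poly R}) m : exists2 C : R, 0 <= C &
  forall y : R, 0 <= y -> `|P.[y]| * y ^+ m <= C * expR y.
Proof.
elim/poly_ind: P m => [|P c IH] m.
  by exists 0 => // y _; rewrite horner0 normr0 !mul0r.
have [C C0 HC] := IH m.+1; have [D D0 HD] := monomial_le_expR m.
exists (C + `|c| * D); first by rewrite addr_ge0// mulr_ge0.
move=> y y0; rewrite hornerMXaddC.
apply: (@le_trans _ _ (`|P.[y]| * y ^+ m.+1 + `|c| * y ^+ m)).
  rewrite exprS mulrA -mulrDl ler_wpM2r ?exprn_ge0//.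
  by rewrite (le_trans (ler_normD _ _))// normrM (ger0_norm y0).
by rewrite mulrDl lerD ?HC// -mulrA ler_wpM2l// HD.
Qed.

Definition flat (x : R) : R := if 0 < x then expR (- x^-1) else 0.

(** The functions P(1/x) exp(-1/x), extended by 0, form a class stable under derivation, P becoming
    (P - P')X^2. At 0 the derivative is 0 because such a function is O(y^2). *)
Lemma flat_smooth : smooth1 flat.
Proof.
exists [set f | exists P : {poly R},
    f = fun x => if 0 < x then P.[x^-1] * expR (- x^-1) else 0].
  by exists 1; apply/funext => x; rewrite hornerC mul1r.
move=> _ [P ->].
exists (fun x => if 0 < x then ((P - P^`()) * 'X^2).[x^-1] * expR (- x^-1) else 0).
  by eexists; reflexivity.
move=> x; have [x0|x0|<-] := ltgtP 0 x.
- apply: (@dd_near _ (fun x => P.[x^-1] * expR (- x^-1))).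
    by near=> y; rewrite ifT//; near: y; exact: lt_nbhsr.
  have xn0 : x != 0 by rewrite gt_eqF.
  have dv := ddV xn0 (dd_id x).
  have dP : dd (fun y : R => P.[y^-1]) x (P^`().[x^-1] * (- 1 / x ^+ 2)).
    by apply: (@dd_comp _ (horner P) (fun y => y^-1)) => //; exact: is_derive_poly.
  apply: dd_eq (ddM dP (dd_expR (ddN dv))) _.
  rewrite hornerM hornerXn hornerD hornerN.
  by move: (expR _) P.[_] P^`().[_] => a b c; field.
- apply: (@dd_near _ (fun=> 0)); last exact: dd_cst.
  near=> y; rewrite ifF//; apply/negbTE; rewrite -leNgt; apply/ltW.
  by near: y; exact: lt_nbhsl.
- have [C C0 HC] := poly_le_expR P 2.
  rewrite ?ltxx; apply: (@dd_bound0 _ _ _ C); first by rewrite ltxx.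
  near=> y; rewrite subr0; case: ifPn => y0; last first.
    by rewrite normr0 mulr_ge0// sqr_ge0.
  rewrite normrM (ger0_norm (expR_ge0 _)) expRN ler_pdivrMr ?expR_gt0//.
  have := HC y^-1; rewrite invr_ge0 => /(_ (ltW y0)).
  rewrite exprVn ler_pdivrMr ?exprn_gt0// => /le_trans; apply.
  by rewrite le_eqVlt; apply/orP; left; apply/eqP; ring.
Unshelve. all: by end_near. Qed.

Lemma flat_ge0 x : 0 <= flat x.
Proof. by rewrite /flat; case: ifP => // _; exact: expR_ge0. Qed.

Lemma flat_le1 x : flat x <= 1.
Proof.
rewrite /flat; case: ifP => // x0.
by rewrite -expR0 ler_expR oppr_le0 invr_ge0 ltW.
Qed.

Lemma flat_le0 x : x <= 0 -> flat x = 0.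
Proof. by rewrite /flat leNgt; case: ltP. Qed.

(** Dilations of [flat] tend to the indicator of the open half-line; products of two of them
    approximate the indicator of an interval. *)
Lemma flat_cvg1 x : 0 < x -> flat (n%:R * x) @[n --> \oo] --> (1 : R).
Proof.
move=> x0.
have h : expR (- (x^-1 * n%:R^-1)) @[n --> \oo] --> expR (- (x^-1 * 0)).
  apply: continuous_cvg; first exact: continuous_expR.
  apply: cvgN; apply: cvgMr; rewrite -(cvg_shiftS); exact: cvg_harmonic.
rewrite mulr0 oppr0 expR0 in h.
apply: cvg_trans h; apply: near_eq_cvg; near=> n.
have n0 : (0 < n)%N by near: n; exists 1%N.
by rewrite /flat ifT ?mulr_gt0 ?ltr0n// invfM mulrC.
Unshelve. all: by end_near. Qed.

Definition csupp k := exists M : R, forall x, M <= `|x| -> k x = 0.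

Definition bump1 k := smooth1 k /\ csupp k.

Lemma csupp_der k k' : csupp k -> (forall x, dd k x (k' x)) -> csupp k'.
Proof.
move=> [M HM] dk; exists (M + 1) => x Mx.
have [_ <-] := dk x.
have : dd k x 0.
  apply: (@dd_near _ (fun=> 0)); last exact: dd_cst.
  have xM : M < `|x| by rewrite (lt_le_trans _ Mx)// ltrDl.
  have : \forall y \near x, M < `|y|.
    have : (fun y : R => `|y|) @ x --> `|x| by exact: cvg_norm.
    by move=> /(_ _ (lt_nbhsr xM)).
  by apply: filterS => y My; rewrite HM// ltW.
by case.
Qed.

Lemma bump1_der k : bump1 k -> exists2 k', bump1 k' & forall x, dd k x (k' x).
Proof.
move=> [/smooth1_der[k' sk' dk] ck]; exists k' => //; split => //.
exact: csupp_der dk.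
Qed.

Lemma bump1_shift k a : bump1 k -> bump1 (fun x => k (x + a)).
Proof.
move=> [sk [M HM]]; split.
  have := smooth1_affine 1 a sk; congr smooth1; apply/funext => x.
  by rewrite mul1r.
exists (M + `|a|) => x; rewrite -lerBrDr => Mx; apply: HM.
apply: (le_trans Mx); rewrite lerBlDr.
by rewrite -{1}(addrK a x) (le_trans (ler_normB _ _)).
Qed.

Lemma bump1_cont k : bump1 k -> continuous k.
Proof. by move=> [/smooth1_der[k' _ dk] _] x; exact: dd_cont (dk x). Qed.

Lemma bump1_flat (a b c : R) : bump1 (fun x => flat (c * (x - a)) * flat (c * (b - x))) \/ c <= 0.
Proof.
have [c0|c0] := leP c 0; [by right|left; split].
  apply: smooth1M.
    have := smooth1_affine c (- (c * a)) flat_smooth; congr smooth1.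
    by apply/funext => x; rewrite mulrBr.
  have := smooth1_affine (- c) (c * b) flat_smooth; congr smooth1.
  by apply/funext => x; congr flat; ring.
exists (`|a| + `|b|) => x Mx.
have [xa|ax] := leP x a.
  by rewrite flat_le0 ?mul0r// pmulr_rle0// subr_le0.
rewrite [flat (c * (b - x))]flat_le0 ?mulr0// pmulr_rle0// subr_le0.
rewrite leNgt; apply/negP => xb.
have : `|x| < `|a| + `|b| -> False by rewrite ltNge Mx.
apply; rewrite ltr_norml; apply/andP; split.
  have := ler_norm (- a); have := normr_ge0 b; rewrite normrN; lra.
have := ler_norm b; have := normr_ge0 a; lra.
Qed.

Lemma bump1_bounded k : bump1 k -> exists M : R, forall x, `|k x| <= M.
Proof.
move=> bk; have ck := bump1_cont bk; case: bk => _ [M HM].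
have cc : {within `[- `|M|, `|M|], continuous (fun x => `|k x|)}.
  by apply: continuous_subspaceT => x; apply: cvg_norm; exact: ck.
have [c _ Hc] := EVT_max (ge0_cp (normr_ge0 M)).2 cc.
exists `|k c| => x; have [xM|xM] := leP `|x| `|M|.
  by apply: Hc; rewrite in_itv/= -ler_norml.
by rewrite HM ?normr0// (le_trans (ler_norm _))// ltW.
Qed.

End smooth_1d.

Lemma cvg_prodr (R : realType) (T : Type) (F : set_system T) (FF : Filter F) (n : nat)
    (f : 'I_n -> T -> R) (l : 'I_n -> R) :
  (forall i, f i x @[x --> F] --> l i) ->
  \prod_i f i x @[x --> F] --> \prod_i l i.
Proof.
move=> h; elim: (index_enum _) => [|i s IH].
  by rewrite big_nil; under eq_fun do rewrite big_nil; exact: cvg_cst.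
by rewrite big_cons; under eq_fun do rewrite big_cons; exact: cvgM.
Qed.

Lemma flat_cvg1S (R : realType) (x : R) : 0 < x ->
  flat (n.+1%:R * x) @[n --> \oo] --> (1 : R).
Proof.
by move=> /flat_cvg1 h; rewrite -(cvg_shiftS (fun n => flat (n%:R * x))) in h.
Qed.

Lemma indicU_disj (R : realType) (T : Type) (A B : set T) x : A `&` B = set0 ->
  \1_(A `|` B) x = \1_A x + \1_B x :> R.
Proof.
move=> AB; rewrite !indicE in_setU.
have [xA|_] := boolP (x \in A); last by rewrite add0r.
have [xB|_] := boolP (x \in B); last by rewrite addr0.
suff : set0 x by [].
by rewrite -AB; split; exact: set_mem.
Qed.

Lemma indic_mulI (R : realType) (T : Type) (A B : set T) x :
  \1_A x * \1_B x = \1_(A `&` B) x :> R.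
Proof. by rewrite indicI. Qed.

(** * Products of one-dimensional bumps as test functions *)

Section product_test_functions.
Context (R : realType) (n : nat).
Local Notation E := 'rV[R]_n.
Local Notation mu := (lebesgue_rV R n).
Implicit Types (k : 'I_n -> R -> R) (x : E) (i : 'I_n).

(** Products of bumps are enough to detect functions that vanish almost everywhere
    ([fundamental_lemma]), and a partial derivative changes a single factor ([upd]). *)
Definition prodf k x : R := \prod_i k i (x ord0 i).

Definition upd k i (f : R -> R) : 'I_n -> R -> R := fun j => if j == i then f else k j.

Lemma is_derive_coord (F : E -> R) x i (g : R -> R) d :
  (forall h, F (h *: delta_mx ord0 i + x) = g (h + x ord0 i)) ->
  dd g (x ord0 i) d -> is_derive x (delta_mx ord0 i : E) F d.
Proof.
move=> Fg /dd_limP dg.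
have F0 : F x = g (x ord0 i) by have := Fg 0; rewrite scale0r !add0r.
have E1 : (fun h : R => h^-1 *: ((F \o shift x) (h *: (delta_mx ord0 i : E)) - F x)) =
    (fun h => h^-1 * (g (h + x ord0 i) - g (x ord0 i))).
  by apply/funext => h; rewrite /= Fg F0.
apply: DeriveDef; first by rewrite /derivable E1; apply/cvg_ex; exists d.
by rewrite /derive E1; exact: cvg_lim.
Qed.

Lemma coord_line x i j h :
  (h *: (delta_mx ord0 i : E) + x) ord0 j = if j == i then h + x ord0 j else x ord0 j.
Proof.
rewrite !mxE eqxx/=; case: eqVneq => [->|ji]; first by rewrite mulr1.
by rewrite mulr0 add0r.
Qed.

Lemma prodf_line k x i h : prodf k (h *: delta_mx ord0 i + x) =
  k i (h + x ord0 i) * \prod_(j | j != i) k j (x ord0 j).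
Proof.
rewrite /prodf (bigD1 i)//= coord_line eqxx; congr (_ * _).
by apply: eq_bigr => j ji; rewrite coord_line (negbTE ji).
Qed.

Lemma prodf_upd k x i f : prodf (upd k i f) x =
  f (x ord0 i) * \prod_(j | j != i) k j (x ord0 j).
Proof.
rewrite /prodf (bigD1 i)//= /upd eqxx; congr (_ * _).
by apply: eq_bigr => j ji; rewrite (negbTE ji).
Qed.

Lemma prodf_is_derive k x i (k' : R -> R) : dd (k i) (x ord0 i) (k' (x ord0 i)) ->
  is_derive x (delta_mx ord0 i : E) (prodf k) (prodf (upd k i k') x).
Proof.
move=> dk; apply: (is_derive_coord (g := fun t => k i t * \prod_(j | j != i) k j (x ord0 j))).
  exact: prodf_line.
rewrite prodf_upd; apply: dd_eq (ddM dk (dd_cst _ _)) _.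
by rewrite mulr0 add0r.
Qed.

Lemma prodf_continuous k : (forall i, continuous (k i)) -> continuous (prodf k).
Proof.
move=> ck x; apply: (@cvg_prodr _ _ (nbhs x) _ n (fun i x => k i (x ord0 i))) => i.
by apply: continuous_comp; [exact: coord_continuous|exact: ck].
Qed.

Lemma upd_bump1 k i f : (forall i, bump1 (k i)) -> bump1 f -> forall j, bump1 (upd k i f j).
Proof. by move=> bk bf j; rewrite /upd; case: ifP. Qed.

Lemma prodf_Ck m k : (forall i, bump1 (k i)) -> Ck m (prodf k).
Proof.
elim: m k => [|m IH] k bk; (split; first by apply: prodf_continuous => i; exact: bump1_cont).
  by [].
move=> i; have [k' bk' dk] := bump1_der (bk i).
split => [x|]; first by have [] := @prodf_is_derive k x i k' (dk _).
rewrite (_ : pderiv i _ = prodf (upd k i k')); first exact/IH/upd_bump1.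
by apply/funext => x; have [_ <-] := @prodf_is_derive k x i k' (dk _).
Qed.

Lemma prodf_csupp k : (forall i, bump1 (k i)) ->
  exists M : R, forall x, prodf k x != 0 -> forall i, `|x ord0 i| <= M.
Proof.
move=> bk.
have /choice[M HM] : forall i, exists M : R, forall t, M <= `|t| -> k i t = 0.
  by move=> i; have [_] := bk i.
exists (\sum_i `|M i|) => x + i; apply: contra_neqP => /negP; rewrite -ltNge => xi.
rewrite /prodf (bigD1 i)//= HM ?mul0r//.
apply: le_trans (ltW xi); rewrite (bigD1 i)//=.
by rewrite (le_trans (ler_norm _))// lerDl sumr_ge0.
Qed.

Lemma prodf_test k : (forall i, bump1 (k i)) -> test_function (prodf k).
Proof.
move=> bk; split=> [m|]; first exact: prodf_Ck.
have [M HM] := prodf_csupp bk.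
have cB : compact [set x : E | forall i, `[- M, M]%classic (x ord0 i)].
  exact: (@rV_compact R n (fun=> `[- M, M]%classic) (fun=> @segment_compact _ _ _)).
apply: (subclosed_compact _ cB); first exact: closed_closure.
have clB := compact_closed (@norm_hausdorff _ _) cB.
rewrite closureE => x; apply; split => // y /= /HM h i.
by rewrite /= in_itv/= -ler_norml; exact: h.
Qed.

Lemma prodf_measurable k : (forall i, bump1 (k i)) -> mfun (prodf k).
Proof.
move=> bk; apply: continuous_measurable_rV; apply: prodf_continuous => i.
exact: bump1_cont.
Qed.

Lemma prodf_bounded k : (forall i, bump1 (k i)) ->
  exists2 C : R, 0 <= C & forall x, `|prodf k x| <= C.
Proof.
move=> bk; have /choice[M HM] : forall i, exists M : R, forall t, `|k i t| <= M.
  by move=> i; exact: bump1_bounded (bk i).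
have M0 i : 0 <= M i by apply: le_trans (HM i 0).
exists (\prod_i M i); first exact: prodr_ge0.
by move=> x; rewrite /prodf normr_prod; apply: ler_prod => i _; rewrite normr_ge0 HM.
Qed.

Definition locinteg (F : E -> R) := mfun F /\
  forall m, integ mu (fun x => F x * \1_(rV_cube m) x).

Lemma indic_cube_measurable m : mfun (\1_(rV_cube m) : E -> R).
Proof. exact: (measurable_indic (measurable_rV_cube m)). Qed.

Lemma integ_cube m : integ mu (\1_(rV_cube m)).
Proof. by apply: integ_fin; [exact: measurable_rV_cube|exact: rV_cube_fin]. Qed.

Lemma prodf_cube k : (forall i, bump1 (k i)) -> exists m : nat, exists2 C : R, 0 <= C &
  forall x, `|prodf k x| <= C * \1_(rV_cube m) x.
Proof.
move=> bk; have [M HM] := prodf_csupp bk; have [C C0 HC] := prodf_bounded bk.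
exists (Num.trunc M).+1; exists C => // x.
have [->|px] := eqVneq (prodf k x) 0; first by rewrite normr0 mulr_ge0.
rewrite indicE mem_set ?mulr1// => i /=; rewrite in_itv/= -ltr_norml.
by rewrite (le_lt_trans (HM _ px i))// truncnS_gt.
Qed.

Lemma locinteg_test F (K : E -> R) m C : locinteg F -> mfun K ->
  0 <= C -> (forall x, `|K x| <= C * \1_(rV_cube m) x) -> integ mu (fun x => F x * K x).
Proof.
move=> [mF iF] mK C0 HC.
apply: (@integ_le _ _ _ mu _ (fun x => C * `|F x * \1_(rV_cube m) x|)).
- exact: measurable_funM.
- exact/integZ/integ_norm.
- move=> x; rewrite !normrM mulrCA ler_wpM2l//.
  by apply: (le_trans (HC x)); rewrite ler_wpM2l// ler_norm.
Qed.

Lemma locinteg_prodf F k : locinteg F -> (forall i, bump1 (k i)) ->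
  integ mu (fun x => F x * prodf k x).
Proof.
move=> lF bk; have [m [C C0 HC]] := prodf_cube bk.
exact: (locinteg_test lF (prodf_measurable bk) C0 HC).
Qed.

(** Bumps converge boundedly to indicators of open boxes, so F has integral zero over the boxes
    inside a cube. Boxes form a generating pi-system, hence the same holds over all Borel subsets of
    the cube, in particular where F has a given sign. *)
Lemma fundamental_lemma F : locinteg F ->
  (forall k, (forall i, bump1 (k i)) -> \int[mu]_x (F x * prodf k x) = 0) ->
  \forall x \ae mu, F x = 0.
Proof.
move=> [mF iF] HF.
suff : \forall x \ae mu, forall m, F x * \1_(rV_cube m) x = 0.
  apply: filterS => x h.
  have [m _ xm] : (\bigcup_k rV_cube k) x by rewrite rV_cube_cover.
  by have := h m; rewrite indicE mem_set// mulr1.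
apply/ae_foralln => m.
pose f x := F x * \1_(rV_cube m) x.
have mf : mfun f.
  by apply: measurable_funM => //; exact: indic_cube_measurable.
have if_ : integ mu f by exact: iF.
have ifA A : measurable A -> integ mu (fun x => f x * \1_A x).
  move=> mA; apply: (integM_bounded (M := 1)) => //.
  by move=> x; rewrite ger0_norm// indicE; case: (_ \in _).
have box0 B : rV_boxes B -> \int[mu]_x (f x * \1_B x) = 0.
  move=> BB; have [a [b E0]] : rV_boxes (B `&` rV_cube m).
    by apply: rV_boxesI => //; exact: rV_cube_boxes.
  (* As j grows these bumps tend to the indicator of (a i, b i), with values in [0, 1]. *)
  pose k (j : nat) i (t : R) := flat (j.+1%:R * (t - a i)) * flat (j.+1%:R * (b i - t)).
  have bk j i : bump1 (k j i) by have [//|] := bump1_flat (a i) (b i) j.+1%:R; rewrite leNgt ltr0n.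
  have k01 j i t : 0 <= k j i t <= 1.
    rewrite mulr_ge0 ?flat_ge0//=; apply: mulr_ile1; by rewrite ?flat_ge0 ?flat_le1.
  have p01 j x : 0 <= prodf (k j) x <= 1.
    apply/andP; split.
      by apply: prodr_ge0 => i _; have /andP[] := k01 j i (x ord0 i).
    apply: (@le_trans _ _ (\prod_(i < n) 1)); last by rewrite big1.
    by apply: ler_prod => i _; exact: k01.
  have k0 j i t : ~~ (a i < t < b i) -> k j i t = 0.
    rewrite negb_and -!leNgt => /orP[h|h]; rewrite /k.
      by rewrite flat_le0 ?mul0r// pmulr_rle0 ?ltr0n// subr_le0.
    by rewrite [X in _ * X]flat_le0 ?mulr0// pmulr_rle0 ?ltr0n// subr_le0.
  have pout j x : ~ (B `&` rV_cube m) x -> prodf (k j) x = 0.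
    rewrite E0 => h0.
    have [i hi] := iffRL (existsNP _) h0.
    move: hi; rewrite /= in_itv/= => /negP h.
    by rewrite /prodf (bigD1 i)//= k0// mul0r.
  have : \int[mu]_x (F x * prodf (k j) x) @[j --> \oo] --> \int[mu]_x (f x * \1_B x).
    apply: (@dct_cvg _ _ _ _ _ _ (fun x => `|f x|)).
    - by move=> j; apply: measurable_funM => //; exact: prodf_measurable.
    - exact: integ_norm.
    - move=> j x; rewrite /f; have [xB|xB] := pselect ((B `&` rV_cube m) x).
        rewrite indicE mem_set; last by case: xB.
        rewrite mulr1 normrM ler_piMr//; have /andP[h1 h2] := p01 j x.
        by rewrite ger0_norm.
      by rewrite pout// mulr0 normr0.
    - move=> x; have [xB|xB] := pselect ((B `&` rV_cube m) x); last first.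
        under eq_fun do rewrite pout// mulr0.
        rewrite (_ : f x * _ = 0); first exact: cvg_cst.
        by rewrite /f -mulrA indic_mulI indicE memNset ?mulr0// setIC.
      rewrite /f !indicE !mem_set; [|by case: xB|by case: xB].
      rewrite !mulr1 -[X in _ --> X]mulr1; apply: cvgMr.
      rewrite (_ : 1 = \prod_(i < n) (1 : R)); last by rewrite big1.
      apply: cvg_prodr => i.
      rewrite E0 in xB; have := xB i; rewrite /= in_itv/= => /andP[h1 h2].
      rewrite -[X in _ --> X]mulr1; apply: cvgM.
        by apply: flat_cvg1S; rewrite subr_gt0.
      by apply: flat_cvg1S; rewrite subr_gt0.
  under eq_fun do rewrite HF//.
  by move=> /cvg_lim <-//; rewrite lim_cst.
have T0 : \int[mu]_x (f x * \1_setT x) = 0.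
  rewrite -(box0 _ (rV_cube_boxes R n m)); apply: Int_ext => x.
  by rewrite /f indicT mulr1 -mulrA indic_mulI setIid.
have all0 A : measurable A -> \int[mu]_x (f x * \1_A x) = 0.
  move=> mA.
  apply: (@dynkin_induction _ E (@rV_boxes R n)
    (fun A => \int[mu]_x (f x * \1_A x) = 0)); last by rewrite -rV_boxes_gen.
  - exact: rV_boxes_gen.
  - exact: rV_boxesI.
  - exact: T0.
  - by move=> B /box0.
  - move=> S mS S0.
    rewrite -[RHS](subrr 0) -{1}T0 -S0 -IntB; [|exact: ifA|exact: ifA].
    apply: Int_ext => x; rewrite indicT -mulrBr; congr (_ * _).
    by rewrite !indicE in_setC /=; case: (_ \in _); rewrite /= ?subrr ?subr0.
  - move=> G mG tG G0.
    have mU j : measurable (\big[setU/set0]_(i < j) G i) by exact: bigsetU_measurable.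
    have : \int[mu]_x (f x * \1_(\big[setU/set0]_(i < j) G i) x) @[j --> \oo] -->
        \int[mu]_x (f x * \1_(\bigcup_j G j) x).
      apply: (@dct_cvg _ _ _ _ _ _ (fun x => `|f x|)).
      + by move=> j; exact/integ_measurable/ifA.
      + exact: integ_norm.
      + move=> j x; rewrite normrM ler_piMr// ger0_norm indicE//.
        by case: (_ \in _).
      + move=> x; apply: cvgMr.
        have [xG|xG] := pselect ((\bigcup_j G j) x); last first.
          rewrite indicE memNset//; apply: cvg_near_cst; apply: nearW => j.
          rewrite indicE memNset// => h; apply: xG.
          by move: h; rewrite -bigcup_mkord => -[i _ Gi]; exists i.
        rewrite indicE mem_set//; apply: cvg_near_cst.
        case: xG => i _ Gi; exists i.+1 => // j /= ij.
        by rewrite indicE mem_set// -bigcup_mkord; exists i.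
    rewrite (_ : (fun j => _) = fun=> 0); first by move=> /cvg_lim <-//; rewrite lim_cst.
    apply/funext => j; rewrite (Int_ext _ _ (fun x => \sum_(i < j) f x * \1_(G i) x)).
      by rewrite Int_sum ?big1// => i; exact: ifA.
    move=> x; rewrite -mulr_sumr; congr (_ * _).
    elim: j => [|j IH]; first by rewrite !big_ord0 indic0.
    rewrite !big_ord_recr/= -IH indicU_disj//.
    rewrite -bigcup_mkord setI_bigcupl bigcup0// => i /= ij.
    by move/trivIsetP : tG => /(_ i j Logic.I Logic.I); apply; rewrite ltn_eqF.
(* The exponent s treats the sets F > 0 and F < 0 at once. *)
have f0 (s : bool) : \forall x \ae mu, ~ (0 < (-1) ^+ s * f x).
  pose A := [set x | 0 < (-1) ^+ s * f x].
  have mA : measurable A by apply: measurable_gt0; exact: measurable_funM.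
  have : \forall x \ae mu, \1_A x * ((-1) ^+ s * f x) = 0.
    apply: Int_eq0.
    - by apply: integ_eq (integZ ((-1) ^+ s) (ifA _ mA)) => x /=; ring.
    - move=> x; rewrite indicE; have [h|h] := pselect (A x).
        by rewrite mem_set//= mul1r ltW.
      by rewrite memNset// mul0r.
    - rewrite (Int_ext _ _ (fun x => (-1) ^+ s * (f x * \1_A x))).
        by rewrite IntZ ?all0 ?mulr0//; exact: ifA.
      by move=> x; rewrite mulrC -mulrA.
  apply: filterS => x h xA; move: h; rewrite indicE mem_set// mul1r => h.
  by rewrite h ltxx in xA.
have := f0 true; have := f0 false; apply: filterS2 => x.
rewrite expr0 expr1 !mul1r mulN1r oppr_gt0 => h1 h2.
by change (f x = 0); have [x0|x0|//] := ltgtP (f x) 0.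
Qed.

End product_test_functions.

(** * Fubini's theorem and primitives for real functions *)

Section real_fubini.
Context d1 d2 (T1 : measurableType d1) (T2 : measurableType d2) (R : realType).
Variables (m1 : {sigma_finite_measure set T1 -> \bar R})
  (m2 : {sigma_finite_measure set T2 -> \bar R}).
Implicit Type F : T1 -> T2 -> R.

Lemma integ_fine d (T : measurableType d) (mu : {measure set T -> \bar R})
    (g : T -> \bar R) : mu.-integrable setT g -> integ mu (fun x => fine (g x)).
Proof.
move=> ig; have /integrableP[mg gfin] := ig; apply/integrableP; split.
  by apply/measurable_EFinP; exact: (measurableT_comp (fine_measurable measurableT)).
apply: le_lt_trans gfin; apply: ge0_le_integral => //.
- apply: measurableT_comp => //.
  by apply/measurable_EFinP; exact: (measurableT_comp (fine_measurable measurableT)).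
- exact: measurableT_comp.
- by move=> x _ /=; case: (g x) => [r| |] //=; rewrite normr0 leey.
Qed.

Lemma real_fubini F : integ (m1 \x m2)%E (fun z => F z.1 z.2) ->
  [/\ \forall x \ae m1, integ m2 (F x),
      integ m1 (fun x => \int[m2]_y F x y),
      integ m2 (fun y => \int[m1]_x F x y) &
      \int[m1]_x (\int[m2]_y F x y) = \int[m2]_y (\int[m1]_x F x y)].
Proof.
move=> iF.
have ae1 : \forall x \ae m1, integ m2 (F x) by exact: (ae_integrable1 iF).
have ae2 : \forall y \ae m2, integ m1 (F ^~ y) by exact: (ae_integrable2 iF).
have iF1 := integrable_fubini_F iF.
have mF1 := measurable_fubini_F iF; have mF2 := measurable_fubini_G iF.
have iF2 : m2.-integrable setT (fubini_G m1 (fun z => (F z.1 z.2)%:E)).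
  apply/integrableP; split => //.
  have iN : integ (m1 \x m2)%E (fun z => `|F z.1 z.2|) by exact: integ_norm.
  have mN : mfun (fun z : T1 * T2 => (`|F z.1 z.2|)%:E).
    by apply/measurable_EFinP; exact: (integ_measurable iN).
  have /integrableP[_] := iN.
  rewrite (_ : (\int[_]_x `|_|)%E = (\int[m2]_y \int[m1]_x `|F x y|%:E)%E); last first.
    transitivity (\int[(m1 \x m2)%E]_z (`|F z.1 z.2|)%:E)%E.
      by apply: eq_integral => z _; rewrite /= normr_id.
    by rewrite (@fubini_tonelli2 _ _ _ _ _ m1 m2 _ mN).
  apply: le_lt_trans; apply: ge0_le_integral => //.
  - exact: measurableT_comp.
  - exact: (@measurable_fun_fubini_tonelli_G _ _ _ _ _ m1 _ mN).
  - move=> y _; apply: le_abse_integral => //.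
    apply/measurable_EFinP; apply: (measurableT_comp (integ_measurable iF)).
    exact: pair2_measurable.
have i1 := integ_fine iF1; have i2 := integ_fine iF2.
split=> //.
transitivity (fine (\int[(m1 \x m2)%E]_z (F z.1 z.2)%:E)).
  rewrite -(integral12_prod_meas1 iF); congr fine; apply: ae_eq_integral => //.
    by apply/measurable_EFinP; exact: (integ_measurable i1).
  by apply: filterS ae1 => x ix _; rewrite EFin_Int.
rewrite -(integral21_prod_meas1 iF); congr fine; apply: ae_eq_integral => //.
  by apply/measurable_EFinP; exact: (integ_measurable i2).
by apply: filterS ae2 => x ix _; rewrite EFin_Int.
Qed.

Lemma integ_prod_le F (b : T2 -> R) :
  mfun (fun z : T1 * T2 => F z.1 z.2) ->
  (forall y, integ m1 (F ^~ y)) -> integ m2 b ->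
  (forall y, \int[m1]_x `|F x y| <= b y) ->
  integ (m1 \x m2)%E (fun z => F z.1 z.2).
Proof.
move=> mF iF ib Fb.
have mEF : mfun (fun z : T1 * T2 => (F z.1 z.2)%:E) by exact/measurable_EFinP.
apply/(integrable21ltyP _ _ mEF).
have /integrableP[mb] := ib; apply: le_lt_trans.
apply: ge0_le_integral => //.
- by move=> y _; exact: integral_ge0.
- apply: (@measurable_fun_fubini_tonelli_G _ _ _ _ _ m1 (fun z => `|(F z.1 z.2)%:E|%E)) => //.
  exact: measurableT_comp.
- exact: measurableT_comp.
move=> y _; have iN := integ_norm (iF y).
rewrite -(EFin_Int iN) lee_fin.
by apply: (le_trans (Fb y)); exact: ler_norm.
Qed.

End real_fubini.

Section ftc_1d.
Context (R : realType).

Lemma ftc2 (f F : R -> R) (a b : R) : a < b -> (forall x, dd F x (f x)) -> continuous f ->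
  \int[leb]_(x in `[a, b]) f x = F b - F a.
Proof.
move=> ab dF cf.
have cF : continuous F by move=> x; exact: dd_cont (dF x).
rewrite /Rintegral (@continuous_FTC2 _ f F a b)//.
- by apply: continuous_subspaceT.
- split.
  + by move=> x _; have [] := dF x.
  + exact/cvg_at_right_filter/cF.
  + exact/cvg_at_left_filter/cF.
- by move=> x _; have [_] := dF x; rewrite derive1E.
Qed.

Lemma integ_seg (f : R -> R) (a b : R) : continuous f ->
  lebesgue_measure.-integrable `[a, b] (EFin \o f).
Proof.
move=> cf; apply: continuous_compact_integrable; first exact: segment_compact.
exact: continuous_subspaceT.
Qed.

Lemma integ_restrict (A : set R) (f : R -> R) : measurable A ->
  leb.-integrable A (EFin \o f) <-> integ leb (fun x => f x * \1_A x).
Proof.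
move=> mA; rewrite /integ.
have -> : EFin \o (fun x => f x * \1_A x) = (EFin \o f) \_ A.
  apply/funext => x; rewrite /= patchE indicE.
  by case: ifP => _; rewrite ?mulr1 ?mulr0.
exact: (@integrable_mkcond _ (measurableTypeR R) R leb A (EFin \o f) mA).
Qed.

Lemma Int_restrict (A : set R) (f : R -> R) :
  \int[leb]_(x in A) f x = \int[leb]_x (f x * \1_A x).
Proof.
rewrite Rintegral_mkcond; apply: Int_ext => x.
by rewrite patchE indicE; case: ifP => _; rewrite ?mulr1 ?mulr0.
Qed.

Lemma csupp_antider (k : R -> R) : continuous k -> csupp k ->
  exists A, forall x, dd A x (k x).
Proof.
move=> ck [M HM].
have ik : integ leb k.
  apply: integ_eq (iffLR (integ_restrict k (measurable_itv `[- `|M|, `|M|])) (integ_seg _ _ ck)).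
  move=> x; rewrite indicE; have [|xM] := boolP (x \in _); first by rewrite mulr1.
  rewrite mulr0 HM// (le_trans (ler_norm M))//.
  rewrite leNgt; apply: contra xM => xM; rewrite inE /= in_itv/= -ler_norml; exact: ltW.
exists (fun x => \int[leb]_(t in `]-oo, x]) k t) => x.
have x1 : x < x + 1 by rewrite ltrDl.
have [|h1 h2] := @continuous_FTC1 _ k (BInfty R true) x (x + 1) x1 _ (ltNyr x) (ck x).
  by apply: (integrableS measurableT) => //; exact: measurable_itv.
by split; rewrite -?derive1E.
Qed.

End ftc_1d.

(** * Weak derivatives and the Sobolev inequality *)

Section weak_derivative.
Context (R : realType) (n : nat).
Local Notation E := 'rV[R]_n.
Local Notation mu := (lebesgue_rV R n).
Implicit Types (g h : E -> R) (i : 'I_n).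

(** Only products of bumps are test functions here, and local integrability is included. [wder_ibp]
    extends the identity to compactly supported functions with a bounded classical derivative. *)
Definition wder i g h := [/\ locinteg g, locinteg h &
  forall k k', (forall j, bump1 (k j)) -> (forall x, dd (k i) x (k' x)) ->
    \int[mu]_x (g x * prodf (upd k i k') x) = - \int[mu]_x (h x * prodf k x)].

Lemma locintegD g h : locinteg g -> locinteg h -> locinteg (fun x => g x + h x).
Proof.
move=> [mg ig] [mh ih]; split; first exact: measurable_funD.
by move=> m; apply: integ_eq (integD (ig m) (ih m)) => x; rewrite mulrDl.
Qed.

Lemma locintegZ (c : R) g : locinteg g -> locinteg (fun x => c * g x).
Proof.
move=> [mg ig]; split; first exact: measurable_funM.
by move=> m; apply: integ_eq (integZ c (ig m)) => x; rewrite mulrA.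
Qed.

Lemma locintegB g h : locinteg g -> locinteg h -> locinteg (fun x => g x - h x).
Proof.
move=> lg lh; have := locintegD lg (locintegZ (-1) lh).
by congr locinteg; apply/funext => x; rewrite mulN1r.
Qed.

Lemma rV_cube_shift m (v : E) : exists m' : nat, forall x, rV_cube m (x - v) -> rV_cube m' x.
Proof.
exists (m + \sum_i (Num.trunc `|v ord0 i|).+1)%N => x h i.
have := h i; rewrite /= !in_itv/= -!ltr_norml !mxE => h1.
rewrite -(subrK (v ord0 i) (x ord0 i)) (le_lt_trans (ler_normD _ _))//.
rewrite natrD ltrD// (lt_le_trans (truncnS_gt _))// ler_nat.
by rewrite (bigD1 i)//= leq_addr.
Qed.

Lemma locinteg_shift_le g m (v : E) : locinteg g ->
  exists2 m' : nat, forall x, rV_cube m (x - v) -> rV_cube m' x &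
   integ mu (fun x => g (x + v) * \1_(rV_cube m) x).
Proof.
move=> [mg ig]; have [m' hm'] := rV_cube_shift m v; exists m' => //.
apply: (mpres_integE (mu := mu) (mu' := mu) (f := fun x : E => x - v)).
- exact: rV_shift_mpres.
- apply: measurable_funM; last by exact: indic_cube_measurable.
  by apply: measurableT_comp => //; exact: rV_shift_measurable.
apply: (@integ_le _ _ _ mu _ (fun x => `|g x * \1_(rV_cube m') x|)).
- apply: measurable_funM.
    by under eq_fun do rewrite subrK.
  apply: (measurableT_comp (f := \1_(rV_cube m) : E -> R)).
    by exact: indic_cube_measurable.
  exact: rV_shift_measurable.
- exact: integ_norm.
move=> x; rewrite subrK !normrM ler_wpM2l// !indicE.
have [h|h] := pselect (rV_cube m (x - v)).
  by rewrite (mem_set h) (mem_set (hm' _ h)).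
by rewrite memNset// normr0.
Qed.

Lemma locinteg_shift g (v : E) : locinteg g -> locinteg (fun x => g (x + v)).
Proof.
move=> lg; split; last by move=> m; have [] := locinteg_shift_le m v lg.
by apply: measurableT_comp; [case: lg|exact: rV_shift_measurable].
Qed.

Lemma Int_shift g (v : E) : integ mu g -> \int[mu]_x g (x + v) = \int[mu]_x g x.
Proof. exact: (mpres_Int (rV_shift_mpres v)). Qed.

Lemma integ_shift g (v : E) : integ mu g -> integ mu (fun x => g (x + v)).
Proof. exact: (mpres_integ (rV_shift_mpres v)). Qed.

(* The one-dimensional primitive turning a difference quotient of a test
   function into a derivative. *)
Lemma bump1_diff_antider (k : R -> R) (t : R) : bump1 k -> exists2 K, bump1 K &
  (forall x, dd K x (k (x - t) - k x)) /\
  (forall x, K x = - (t * \int[leb]_(s in `[0, 1]) k (x - s * t))).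
Proof.
move=> bk; have ck := bump1_cont bk; have [sk ck'] := bk.
have [A dA] := csupp_antider ck ck'.
(* The primitive A need not have compact support, but the difference of two translates has, by the
   mean formula [KE]. *)
pose K x := A (x - t) - A x.
have dK x : dd K x (k (x - t) - k x).
  apply: ddB; last exact: dA.
  apply: dd_eq (dd_comp (g := fun x => x - t) (dA _) (ddB (dd_id x) (dd_cst t x))) _.
  by rewrite subr0 mulr1.
have KE x : K x = - (t * \int[leb]_(s in `[0, 1]) k (x - s * t)).
  have [t0|t0] := eqVneq t 0; first by rewrite /K t0 mul0r !oppr0 addr0 addrN.
  have d1 s : dd (fun s => - (t^-1 * A (x - s * t))) s (k (x - s * t)).
    apply: dd_eq (ddN (ddZ t^-1 (dd_comp (g := fun s => x - s * t) (dA _) _))) _.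
      apply: ddB; first exact: dd_cst.
      by apply: (@ddM _ _ (fun=> t)); [exact: dd_id|exact: dd_cst].
    by rewrite /=; field.
  rewrite (ftc2 ltr01 d1).
    by rewrite mul0r mul1r subr0 /K; field.
  move=> s; apply: continuous_comp; last exact: ck.
  by apply: cvgB; [exact: cvg_cst|apply: cvgMl; exact: cvg_id].
exists K => //; split.
  apply: (smooth1_antider (k' := fun x => k (x - t) - k x)) => //.
  have [C Ck HC] := sk.
  exists [set f | exists2 f0, C f0 & f = fun x => f0 (x - t) - f0 x].
    by exists k.
  move=> _ [f0 /HC[f0' Cf0' df0] ->]; exists (fun x => f0' (x - t) - f0' x).
    by exists f0'.
  move=> x; apply: ddB; last exact: df0.
  apply: dd_eq (dd_comp (g := fun x => x - t) (df0 _) (ddB (dd_id x) (dd_cst t x))) _.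
  by rewrite subr0 mulr1.
have [M HM] := ck'; exists (M + `|t|) => x Mx.
rewrite KE (_ : \int[leb]_(s in _) _ = 0) ?mulr0 ?oppr0//.
rewrite Int_restrict -[RHS](Int0 leb); apply: Int_ext => s.
rewrite indicE; have [|_] := boolP (s \in _); last by rewrite mulr0.
rewrite inE/= in_itv/= mulr1 => /andP[s0 s1]; apply: HM.
rewrite -lerBrDr in Mx; apply: (le_trans Mx); rewrite lerBlDr.
rewrite -{1}(subrK (s * t) x) (le_trans (ler_normD _ _))// lerD2l normrM ler_piMl//.
by rewrite ger0_norm.
Qed.

End weak_derivative.

Section weak_derivative_translation.
Context (R : realType) (n : nat).
Local Notation E := 'rV[R]_n.
Local Notation mu := (lebesgue_rV R n).
Local Notation I01 := (\1_(`[0, 1]%classic) : R -> R).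
Implicit Types (g h : E -> R) (i : 'I_n).

Lemma I01E (s : R) : I01 s = (0 <= s <= 1)%R%:R.
Proof. by rewrite indicE; congr (_%:R); rewrite mem_setE in_itv. Qed.

Lemma I01_ge0 (s : R) : 0 <= I01 s. Proof. pos. Qed.

Lemma integ_I01 : integ leb I01.
Proof.
apply: integ_fin; first exact: measurable_itv.
by rewrite /= lebesgue_measure_itv/= lte_fin ltr01 -EFinB ltry.
Qed.

Lemma Int_I01 : \int[leb]_s I01 s = 1.
Proof.
rewrite /Rintegral integral_indic//.
by rewrite setIT /= lebesgue_measure_itv/= lte_fin ltr01 oppr0 adde0.
Qed.

Lemma shift_line_measurable (t : R) i (f : E -> R) : mfun f ->
  mfun (fun z : E * R => f (z.1 + (z.2 * t) *: e_ i)).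
Proof.
move=> mf; apply: (measurableT_comp (f := f)) => //.
apply: measurable_fun_rVP => j; under eq_fun do rewrite !mxE.
apply: measurable_funD.
  exact: (measurableT_comp (measurable_coord j) measurable_fst).
by apply: measurable_funM => //; apply: measurable_funM.
Qed.

Lemma prodf_shift (k : 'I_n -> R -> R) x i (t : R) :
  prodf k (x - t *: e_ i) = prodf (upd k i (fun s => k i (s - t))) x.
Proof.
by rewrite addrC -scaleNr prodf_line prodf_upd addrC.
Qed.

Lemma cube_line m i (t : R) : exists m' : nat,
  forall x s, 0 <= s <= 1 -> rV_cube m (x - (s * t) *: e_ i) -> rV_cube m' x.
Proof.
exists (m + (Num.trunc `|t|).+1)%N => x s /andP[s0 s1] h j.
have := h j; rewrite /= !in_itv/= -!ltr_norml !mxE => h1.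
rewrite -(subrK (s * t * (e_ i : E) ord0 j) (x ord0 j)) (le_lt_trans (ler_normD _ _))//.
rewrite natrD ltrD//; first by rewrite mxE.
apply: le_lt_trans (truncnS_gt _); rewrite mxE eqxx/=.
case: (_ == _); rewrite ?mulr0 ?normr0// mulr1 normrM ler_piMl//.
by rewrite ger0_norm.
Qed.

Lemma rV_cube_mono a b (y : E) : (a <= b)%N -> rV_cube a y -> rV_cube b y.
Proof.
move=> ab h1 j; have := h1 j; rewrite /= !in_itv/= -!ltr_norml => /lt_le_trans; apply.
by rewrite ler_nat.
Qed.

(** The bound is uniform in s because all translates of a cube along the segment stay in one larger
    cube. *)
Lemma integ_line_cube g m i (t : R) : locinteg g ->
  integ (mu \x leb)%E
    (fun z => g (z.1 + (z.2 * t) *: e_ i) * \1_(rV_cube m) z.1 * I01 z.2).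
Proof.
move=> lg; have [mg ig] := lg.
have [m' hm'] := cube_line m i t.
pose C := \int[mu]_x `|g x * \1_(rV_cube m') x|.
apply: (@integ_prod_le _ _ _ _ _ mu leb
  (fun (x : E) (s : R) => g (x + (s * t) *: e_ i) * \1_(rV_cube m) x * I01 s) (fun s => C * I01 s)).
- apply: measurable_funM; first apply: measurable_funM.
  + exact: shift_line_measurable.
  + apply: (measurableT_comp (f := \1_(rV_cube m) : E -> R)) => //.
      by exact: indic_cube_measurable.
  + apply: (measurableT_comp (f := I01)) => //.
- move=> s; have [_ _ h] := locinteg_shift_le m ((s * t) *: e_ i) lg.
  by apply: integ_eq (integZ (I01 s) h) => x; rewrite mulrC.
- exact/integZ/integ_I01.
move=> s.
have [_ _ h] := locinteg_shift_le m ((s * t) *: e_ i) lg.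
rewrite (Int_ext _ _ (fun x : E => I01 s * `|g (x + (s * t) *: e_ i) * \1_(rV_cube m) x|)); last first.
  by move=> x; rewrite normrM (ger0_norm (I01_ge0 s)) mulrC.
rewrite (IntZ _ (integ_norm h)) mulrC; have [s01|s01] := boolP (0 <= s <= 1); last first.
  by rewrite I01E (negbTE s01) !mulr0.
rewrite ler_wpM2r//.
have h2 : integ mu (fun x => `|g x * \1_(rV_cube m) (x - (s * t) *: e_ i)|).
  have := integ_shift (- ((s * t) *: e_ i)) (integ_norm h).
  by apply: integ_eq => x; rewrite subrK.
rewrite -(@Int_shift _ _ _ (- ((s * t) *: e_ i)) (integ_norm h)).
under Int_ext do rewrite subrK.
apply: Int_le => //; first exact: integ_norm.
move=> x; rewrite !normrM ler_wpM2l// !indicE.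
have [hx|hx] := pselect (rV_cube m (x - (s * t) *: e_ i)); last by rewrite memNset// normr0.
by rewrite (mem_set hx) (mem_set (hm' _ _ s01 hx)).
Qed.

Lemma integ_line_test g (K : E -> R) m C i (t : R) : locinteg g -> mfun K ->
  0 <= C -> (forall x, `|K x| <= C * \1_(rV_cube m) x) ->
  integ (mu \x leb)%E (fun z => g (z.1 + (z.2 * t) *: e_ i) * K z.1 * I01 z.2).
Proof.
move=> lg mK C0 HC.
apply: (integ_le (g := fun z : E * measurableTypeR R =>
  C * `|g (z.1 + (z.2 * t) *: e_ i) * \1_(rV_cube m) z.1 * I01 z.2|)).
- apply: measurable_funM; first apply: measurable_funM.
  + by apply: shift_line_measurable; case: lg.
  + exact: (measurableT_comp (f := K)).
  + exact: (measurableT_comp (f := I01)).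
- exact/integZ/integ_norm/integ_line_cube.
move=> z; rewrite !normrM mulrA ler_wpM2r// mulrCA ler_wpM2l//.
by apply: le_trans (HC z.1) _; rewrite ler_wpM2l// ler_norm.
Qed.

Lemma integ_line_test2 h (K : E -> R) m C i (t : R) : locinteg h -> mfun K ->
  0 <= C -> (forall x, `|K x| <= C * \1_(rV_cube m) x) ->
  integ (mu \x leb)%E (fun z => h z.1 * K (z.1 - (z.2 * t) *: e_ i) * I01 z.2).
Proof.
move=> lh mK C0 HC; have [mh ih] := lh.
have [m' hm'] := cube_line m i t.
have hb := integZ C (integ_norm (integ_line_cube m' i 0 lh)).
apply: (integ_le _ hb).
  apply: measurable_funM; first apply: measurable_funM.
  + exact: (measurableT_comp (f := h)).
  + under eq_fun do rewrite -scaleNr -mulrN.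
    exact: (@shift_line_measurable (- t)).
  + exact: (measurableT_comp (f := I01)).
move=> z; rewrite mulr0 scale0r addr0 !normrM.
have [z01|z01] := boolP (0 <= z.2 <= 1); last first.
  by rewrite I01E (negbTE z01) normr0 !mulr0.
rewrite (_ : C * _ = `|h z.1| * (C * `|\1_(rV_cube m') z.1|) * `|I01 z.2|); last by ring.
rewrite ler_wpM2r// ler_wpM2l//.
apply: (le_trans (HC _)); rewrite ler_wpM2l// !indicE.
have [hx|hx] := pselect (rV_cube m (z.1 - (z.2 * t) *: e_ i)); last by rewrite memNset// normr_ge0.
by rewrite (mem_set hx) (mem_set (hm' _ _ z01 hx)) normr1.
Qed.

Lemma line_avg_locinteg h i (t : R) : locinteg h ->
  locinteg (fun x => \int[leb]_s (h (x + (s * t) *: e_ i) * I01 s)) /\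
  \forall x \ae mu, integ leb (fun s => h (x + (s * t) *: e_ i) * I01 s).
Proof.
move=> lh; have [mh ih] := lh.
pose Th x := \int[leb]_s (h (x + (s * t) *: e_ i) * I01 s).
have cubeT m := real_fubini (F := fun (x : E) (s : measurableTypeR R) => h (x + (s * t) *: e_ i) * \1_(rV_cube m) x * I01 s)
  (integ_line_cube m i t lh).
split; last first.
  have : \forall x \ae mu, forall m, integ leb (fun s => h (x + (s * t) *: e_ i) * \1_(rV_cube m) x * I01 s).
    by apply/ae_foralln => m; have [] := cubeT m.
  apply: filterS => x hx.
  have [m _ xm] : (\bigcup_k rV_cube k) x by rewrite rV_cube_cover.
  apply: integ_eq (hx m) => s; rewrite (_ : \1_(rV_cube m) x = 1) ?mulr1//.
  by rewrite indicE mem_set.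
have iT m : integ mu (fun x => Th x * \1_(rV_cube m) x).
  have [ae1 i1 _ _] := cubeT m.
  apply: integ_eq i1 => x; rewrite indicE.
  have [_|_] := boolP (_ \in _).
    by rewrite mulr1; apply: Int_ext => s; rewrite mulr1.
  by rewrite mulr0 -[LHS](Int0 leb); apply: Int_ext => s; rewrite mulr0 mul0r.
split=> //.
apply: (@measurable_fun_cvg _ _ _ setT (fun m x => Th x * \1_(rV_cube m) x)).
  by move=> m; exact/integ_measurable/iT.
move=> x _; rewrite -[X in _ --> X]mulr1; apply: cvgMr.
have [m _ xm] : (\bigcup_k rV_cube k) x by rewrite rV_cube_cover.
apply: cvg_near_cst; exists m => // m' /= mm'; rewrite indicE mem_set//.
exact: rV_cube_mono xm.
Qed.

Lemma integ_line_slice (K : E -> R) C i (t : R) x : mfun K ->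
  (forall x, `|K x| <= C) ->
  integ leb (fun s => K (x - (s * t) *: e_ i) * I01 s).
Proof.
move=> mK HC; apply: (integ_le _ (integZ C integ_I01)).
  apply: measurable_funM => //.
  under eq_fun do rewrite -scaleNr -mulrN.
  exact: (measurableT_comp (shift_line_measurable (- t) i mK) (@pair1_measurable _ _ _ (measurableTypeR R) x)).
by move=> s; rewrite normrM (ger0_norm (I01_ge0 s)) ler_wpM2r.
Qed.

Lemma test_bounded (K : E -> R) m C : 0 <= C -> (forall x, `|K x| <= C * \1_(rV_cube m) x) ->
  forall x, `|K x| <= C.
Proof.
move=> C0 HC x; apply: (le_trans (HC x)); rewrite ler_piMr//.
Qed.

(** Averaging h over a segment is adjoint to averaging the test function over the reversed
    segment. *)
Lemma line_fubini h (K : E -> R) m C i (t : R) : locinteg h -> mfun K ->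
  0 <= C -> (forall x, `|K x| <= C * \1_(rV_cube m) x) ->
  [/\ \int[mu]_x (\int[leb]_s (h (x + (s * t) *: e_ i) * I01 s) * K x) =
      \int[mu]_x (h x * \int[leb]_s (K (x - (s * t) *: e_ i) * I01 s)),
      integ mu (fun x => \int[leb]_s (h (x + (s * t) *: e_ i) * I01 s) * K x) &
      integ mu (fun x => h x * \int[leb]_s (K (x - (s * t) *: e_ i) * I01 s))].
Proof.
move=> lh mK C0 HC.
have KC := test_bounded C0 HC.
have [lTh aeTh] := line_avg_locinteg i t lh.
have [_ i1 _ FE] := real_fubini (F := fun (x : E) (s : measurableTypeR R) =>
  h (x + (s * t) *: e_ i) * K x * I01 s) (integ_line_test i t lh mK C0 HC).
have [_ i2 _ FE2] := real_fubini (F := fun (x : E) (s : measurableTypeR R) =>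
  h x * K (x - (s * t) *: e_ i) * I01 s) (integ_line_test2 i t lh mK C0 HC).
have iT : integ mu (fun x => \int[leb]_s (h (x + (s * t) *: e_ i) * I01 s) * K x).
  exact: locinteg_test HC.
have E2 x : h x * \int[leb]_s (K (x - (s * t) *: e_ i) * I01 s) =
    \int[leb]_s (h x * K (x - (s * t) *: e_ i) * I01 s).
  rewrite -IntZ; last exact: integ_line_slice KC.
  by apply: Int_ext => s; rewrite mulrA.
split=> //; last by apply: integ_eq i2 => x; exact: E2.
transitivity (\int[mu]_x \int[leb]_s (h (x + (s * t) *: e_ i) * K x * I01 s)).
  apply: Int_ae; [exact: integ_measurable iT|exact: integ_measurable i1|].
  apply: filterS aeTh => x hx; rewrite mulrC -IntZ//.
  by apply: Int_ext => s; rewrite mulrC -!mulrA (mulrC (I01 s)).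
rewrite (Int_ext _ _ _ E2) FE2 FE; apply: Int_ext => s.
have ils : integ mu (fun x => h (x + (s * t) *: e_ i) * K x * I01 s).
  have := integZ (I01 s) (locinteg_test (locinteg_shift ((s * t) *: e_ i) lh) mK C0 HC).
  by apply: integ_eq => x; rewrite mulrC.
rewrite -(@Int_shift _ _ _ (- ((s * t) *: e_ i)) ils).
by apply: Int_ext => x; rewrite subrK.
Qed.

Lemma Int_diff_test g (K : E -> R) m C (v : E) : locinteg g -> mfun K ->
  0 <= C -> (forall x, `|K x| <= C * \1_(rV_cube m) x) ->
  \int[mu]_x ((g (x + v) - g x) * K x) = \int[mu]_x (g x * (K (x - v) - K x)).
Proof.
move=> lg mK C0 HC.
have i1 := locinteg_test (locinteg_shift v lg) mK C0 HC.
have i0 := locinteg_test lg mK C0 HC.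
have i2 : integ mu (fun x => g x * K (x - v)).
  have := integ_shift (- v) i1.
  by apply: integ_eq => x; rewrite subrK.
under Int_ext do rewrite mulrBl.
under [RHS]Int_ext do rewrite mulrBr.
rewrite !IntB//; congr (_ - _).
rewrite -(Int_shift (- v) i1).
by apply: Int_ext => x; rewrite subrK.
Qed.

(** Tested against a bump k, the difference of g becomes g tested against a difference of k. The
    latter is the derivative of a bump by [bump1_diff_antider], so the definition of the weak
    derivative applies without regularizing g. *)
Lemma wder_translation i g h (t : R) : wder i g h ->
  \forall x \ae mu, g (x + t *: e_ i) - g x =
    t * \int[leb]_s (h (x + (s * t) *: e_ i) * I01 s).
Proof.
move=> [lg lh gh].
pose Th x := \int[leb]_s (h (x + (s * t) *: e_ i) * I01 s).
have lTh : locinteg Th by case: (line_avg_locinteg i t lh).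
have lF : locinteg (fun x => g (x + t *: e_ i) - g x - t * Th x).
  by apply: locintegB; [apply: locintegB => //; exact: locinteg_shift|exact: locintegZ].
suff : \forall x \ae mu, g (x + t *: e_ i) - g x - t * Th x = 0.
  by apply: filterS => x /eqP; rewrite subr_eq0 => /eqP.
apply: fundamental_lemma => // k bk.
have [m [C C0 HC]] := prodf_cube bk.
have mk := prodf_measurable bk.
have [K bK [dK KE]] := bump1_diff_antider t (bk i).
have ig1 : integ mu (fun x => (g (x + t *: e_ i) - g x) * prodf k x).
  by apply: locinteg_prodf => //; apply: locintegB => //; exact: locinteg_shift.
have iT : integ mu (fun x => Th x * prodf k x) by exact: locinteg_prodf.
rewrite (Int_ext _ _ (fun x : E => (g (x + t *: e_ i) - g x) * prodf k x
   - t * (Th x * prodf k x))); last by move=> x; ring.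
rewrite IntB//; last exact: integZ.
rewrite IntZ// (Int_diff_test _ lg mk C0 HC).
have dK' x : dd (upd k i K i) x (k i (x - t) - k i x) by rewrite /upd eqxx.
have := gh (upd k i K) (fun x => k i (x - t) - k i x) (upd_bump1 i bk bK) dK'.
have -> : upd (upd k i K) i (fun x => k i (x - t) - k i x) = upd k i (fun x => k i (x - t) - k i x).
  by apply/funext => j; rewrite /upd; case: (j == i).
rewrite (Int_ext _ (fun x : E => g x * (prodf k (x - t *: e_ i) - prodf k x))
  (fun x : E => g x * prodf (upd k i (fun s => k i (s - t) - k i s)) x)); last first.
  move=> x; rewrite prodf_shift !prodf_upd mulrBl; congr (_ * (_ - _)).
  by rewrite /prodf (bigD1 i).
move=> ->.
have [-> _ i2] := line_fubini i t lh mk C0 HC.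
rewrite -IntZ// -IntN; last by apply: locinteg_prodf => //; exact: upd_bump1.
rewrite [X in X - _](_ : _ = \int[mu]_x (t * (h x * \int[leb]_s (prodf k (x - (s * t) *: e_ i) * I01 s)))); first exact: subrr.
apply: Int_ext => x; rewrite prodf_upd KE mulNr mulrN opprK.
rewrite Int_restrict mulrCA -!mulrA; congr (_ * _).
have ck := bump1_cont (bk i).
have ik : integ leb (fun s => k i (x ord0 i - s * t) * I01 s).
  apply/(integ_restrict _ (measurable_itv _)).
  apply: integ_seg => s; apply: continuous_comp; last exact: ck.
  by apply: cvgB; [exact: cvg_cst|apply: cvgMl; exact: cvg_id].
rewrite mulrCA; congr (_ * _).
rewrite mulrC -IntZ//; apply: Int_ext => s.
by rewrite prodf_shift prodf_upd; ring.
Qed.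

Lemma line_dd i (K K' : E -> R) : (forall x, is_derive x (e_ i) K (K' x)) ->
  forall x r, dd (fun r => K (r *: e_ i + x)) r (K' (r *: e_ i + x)).
Proof.
move=> dK x r; apply/dd_limP.
have [dv De] := dK (r *: e_ i + x).
under eq_fun do rewrite scalerDl -addrA.
by move: dv; rewrite -De /derive /derivable.
Qed.

Lemma cvg_tau : (fun k => - k.+1%:R^-1 : R) @ \oo --> (0 : R)^'.
Proof.
move=> A [e /= e0 HA].
have : (fun k => - k.+1%:R^-1 : R) @ \oo --> (0 : R).
  by rewrite -oppr0; apply: cvgN; exact: cvg_harmonic.
move=> /cvgrPdist_lt/(_ e e0); apply: filterS => k hk; exact: HA.
Qed.

(* Test functions being smooth, a C^1 function is reached through difference quotients of [g]. *)
Lemma wder_ibp i g h (K K' : E -> R) m C : wder i g h ->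
  continuous K -> mfun K' ->
  (forall x, is_derive x (e_ i) K (K' x)) ->
  (forall x, ~ rV_cube m x -> K x = 0) ->
  (forall x, `|K x| <= C) -> (forall x, `|K' x| <= C) ->
  \int[mu]_x (g x * K' x) = - \int[mu]_x (h x * K x).
Proof.
move=> wg cK mK' dK K0 KC K'C.
have [lg lh _] := wg.
have C0 : 0 <= C by apply: le_trans (KC 0).
have mK := continuous_measurable_rV cK.
have HC x : `|K x| <= C * \1_(rV_cube m) x.
  rewrite indicE; have [h0|h0] := pselect (rV_cube m x); first by rewrite mem_set// mulr1.
  by rewrite memNset// K0// normr0 mulr0.
(* With negative increments of K, the function g is translated forwards by -tau. *)
pose tau k : R := - k.+1%:R^-1.
have t0 k : tau k < 0 by rewrite oppr_lt0 invr_gt0 ltr0n.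
have [m' hm'] := cube_line m i 1.
have taun k : 0 <= - tau k <= 1.
  by rewrite opprK invr_ge0 ler0n invf_le1// ler1n.
(* The mean value theorem bounds the difference quotients of K, and they live in one cube since the
   increments are at most 1. *)
have dq x k : `|(tau k)^-1 * (K (x + tau k *: e_ i) - K x)| <= C * \1_(rV_cube (maxn m m')) x.
  have [hx|hx] := pselect (rV_cube (maxn m m') x); last first.
    rewrite (K0 x); last by move=> h1; apply: hx; exact: (rV_cube_mono (leq_maxl _ _) h1).
    rewrite K0; last first.
      move=> h1; apply: hx; apply: (rV_cube_mono (leq_maxr _ _)).
      by apply: (hm' _ (- tau k)) => //; rewrite mulr1 scaleNr opprK.
    by rewrite subrr mulr0 normr0 indicE memNset// mulr0.
  rewrite indicE mem_set// mulr1.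
  have [|||c _] := @MVT_segment _ (fun r => K (r *: e_ i + x)) (fun r => K' (r *: e_ i + x)) (tau k) 0.
  - exact: ltW.
  - by move=> y _; exact: line_dd.
  - by apply: continuous_subspaceT => y; exact: dd_cont (line_dd dK x y).
  rewrite scale0r add0r sub0r (addrC _ x) => e1.
  have -> : K (x + tau k *: e_ i) - K x = K' (c *: e_ i + x) * tau k.
    by rewrite -(opprB (K x)) e1 mulrN opprK.
  rewrite mulrC -mulrA mulfV ?lt_eqF// mulr1.
  exact: K'C.
have L1 : \int[mu]_x (g x * ((tau k)^-1 * (K (x + tau k *: e_ i) - K x))) @[k --> \oo] -->
    \int[mu]_x (g x * K' x).
  apply: (@dct_cvg _ _ _ _ _ _ (fun x => C * `|g x * \1_(rV_cube (maxn m m')) x|)).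
  - move=> k; apply: measurable_funM; first by case: lg.
    apply: measurable_funM => //; apply: measurable_funB => //.
    by apply: measurableT_comp => //; exact: rV_shift_measurable.
  - by apply/integZ/integ_norm; case: lg.
  - move=> k x; rewrite normrM (normrM (g x) (\1_ _ x)) [leRHS]mulrCA ler_wpM2l//.
    by rewrite (le_trans (dq _ _))// ler_wpM2l// ler_norm.
  - move=> x; apply: cvgMr.
    have /dd_limP h1 := line_dd dK x 0.
    rewrite scale0r add0r in h1.
    have := cvg_comp _ _ cvg_tau h1.
    apply: cvg_trans; apply: near_eq_cvg; apply: nearW => k /=.
    by rewrite addr0 (addrC _ x).
(* For a fixed increment, [wder_translation] replaces the difference of g by an average of h over a
   short segment. *)
have E1 k : \int[mu]_x (g x * ((tau k)^-1 * (K (x + tau k *: e_ i) - K x))) =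
   - \int[mu]_x (h x * \int[leb]_s (K (x - (s * - tau k) *: e_ i) * I01 s)).
  have -> : \int[mu]_x (g x * ((tau k)^-1 * (K (x + tau k *: e_ i) - K x))) =
      (tau k)^-1 * \int[mu]_x (g x * (K (x - (- tau k *: e_ i)) - K x)).
    rewrite -IntZ.
      by apply: Int_ext => x; rewrite scaleNr opprK mulrCA.
    apply: (locinteg_test (C := `|tau k| * C) (m := maxn m m')) => //.
    - apply: measurable_funB => //.
      by apply: measurableT_comp => //; exact: rV_shift_measurable.
    - pos.
    - move=> x; have := dq x k; rewrite normrM normfV ler_pdivrMl ?normr_gt0 ?lt_eqF//.
      by rewrite mulrA scaleNr opprK.
  rewrite -(Int_diff_test _ lg mK C0 HC).
  have [FE i1 i2] := line_fubini i (- tau k) lh mK C0 HC.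
  rewrite -FE.
  transitivity ((tau k)^-1 * (- tau k * \int[mu]_x (\int[leb]_s (h (x + (s * - tau k) *: e_ i) * I01 s) * K x))); last first.
    by rewrite mulrA mulrN mulVf ?lt_eqF// mulN1r.
  congr (_ * _); rewrite -IntZ//; apply: Int_ae.
  - apply: measurable_funM => //; apply: measurable_funB; last by case: lg.
    by apply: measurableT_comp; [case: lg|exact: rV_shift_measurable].
  - by apply: measurable_funM => //; exact: (integ_measurable i1).
  - by apply: filterS (wder_translation (- tau k) wg) => x ->; rewrite mulrA.
have L2 : \int[mu]_x (h x * \int[leb]_s (K (x - (s * - tau k) *: e_ i) * I01 s)) @[k --> \oo] -->
    \int[mu]_x (h x * K x).
  apply: (@dct_cvg _ _ _ _ _ _ (fun x => C * `|h x * \1_(rV_cube (maxn m m')) x|)).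
  - by move=> k; have [_ _ /integ_measurable] := line_fubini i (- tau k) lh mK C0 HC.
  - by apply/integZ/integ_norm; case: lh.
  - move=> k x; rewrite !normrM mulrCA ler_wpM2l//.
    apply: (@le_trans _ _ (\int[leb]_s (C * \1_(rV_cube (maxn m m')) x * I01 s))); last first.
      by rewrite IntZ ?Int_I01 ?mulr1; [rewrite ler_wpM2l// ler_norm|exact: integ_I01].
    apply: Int_abs_leP; [exact: integ_line_slice KC|exact/integZ/integ_I01|].
    move=> s; rewrite normrM (ger0_norm (I01_ge0 s)).
    have [s01|s01] := boolP (0 <= s <= 1); last by rewrite I01E (negbTE s01) !mulr0.
    rewrite ler_wpM2r// (le_trans (HC _))// ler_wpM2l//.
    rewrite !indicE; have [hx|hx] := pselect (rV_cube m (x - (s * - tau k) *: e_ i)); last first.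
      by rewrite memNset.
    rewrite (mem_set hx) mem_set//.
    have hx' : rV_cube m' x.
      apply: (hm' _ (s * - tau k)); last by rewrite mulr1.
      have /andP[u0 u1] := taun k; have /andP[v0 v1] := s01.
      by rewrite mulr_ge0//= mulr_ile1.
    exact: (rV_cube_mono (leq_maxr _ _) hx').
  - move=> x; apply: cvgMr.
    rewrite (_ : K x = \int[leb]_s (K x * I01 s)); last by rewrite IntZ ?Int_I01 ?mulr1//; exact: integ_I01.
    apply: (@dct_cvg _ _ _ _ _ _ (fun s : measurableTypeR R => C * I01 s)).
    + by move=> k; apply/integ_measurable; exact: integ_line_slice KC.
    + exact/integZ/integ_I01.
    + by move=> k s; rewrite normrM (ger0_norm (I01_ge0 s)) ler_wpM2r.
    + move=> s; apply: cvgMl.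
      have h1 : K (r *: e_ i + x) @[r --> (0 : R)] --> K (0 *: e_ i + x) := dd_cont (line_dd dK x 0).
      rewrite scale0r add0r in h1.
      have ht : s * tau k @[k --> \oo] --> (0 : R).
        rewrite -[X in _ --> X](mulr0 s); apply: cvgMr; rewrite -oppr0; apply: cvgN.
        exact: cvg_harmonic.
      have := cvg_comp _ _ ht h1; apply: cvg_trans; apply: near_eq_cvg; apply: nearW => k /=.
      by rewrite mulrN scaleNr opprK addrC.
rewrite (funext E1) in L1.
exact: (cvg_unique _ L1 (cvgN L2)).
Qed.

End weak_derivative_translation.

Section jensen.
Context d (T : measurableType d) (R : realType) (mu : {measure set T -> \bar R}).
Implicit Types f rho : T -> R.

(** The variance of f under the probability density [rho] is nonnegative. *)
Lemma jensen_sq f rho : mfun f -> integ mu rho -> (forall x, 0 <= rho x) ->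
  \int[mu]_x rho x = 1 -> integ mu (fun x => f x ^+ 2 * rho x) ->
  integ mu (fun x => f x * rho x) /\
  (\int[mu]_x (f x * rho x)) ^+ 2 <= \int[mu]_x (f x ^+ 2 * rho x).
Proof.
move=> mf ir r0 r1 i2.
have i1 : integ mu (fun x => f x * rho x).
  apply: (integ_le _ (integD ir i2)).
    by apply: measurable_funM => //; exact: integ_measurable ir.
  move=> x; rewrite normrM (ger0_norm (r0 x)) -{2}(mul1r (rho x)) -mulrDl ler_wpM2r//.
  have : 0 <= (`|f x| - 2^-1) ^+ 2 by pos.
  rewrite -[f x ^+ 2]real_normK ?num_real//; move: (`|f x|) => u; nra.
split=> //; set m := \int[mu]_x _.
have : 0 <= \int[mu]_x ((f x - m) ^+ 2 * rho x).
  by apply: Int_ge0 => x; rewrite mulr_ge0// sqr_ge0.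
rewrite (Int_ext _ _ (fun x => f x ^+ 2 * rho x - (2 * m) * (f x * rho x) + m ^+ 2 * rho x));
  last by move=> x; ring.
rewrite IntD; [|exact/integB/integZ|exact: integZ].
rewrite IntB//; last exact: integZ.
rewrite !IntZ// r1 -/m; nra.
Qed.

End jensen.

(** * A Sobolev inequality by averaging over small cubes *)

Section sobolev.
Context (R : realType) (n : nat).
Local Notation E := 'rV[R]_n.
Local Notation mu := (lebesgue_rV R n).
Local Notation I01 := (\1_(`[0, 1]%classic) : R -> R).

Lemma wder_diff_L2 i (g h : E -> R) (t : R) : wder i g h -> integ mu (fun x => h x ^+ 2) ->
  integ mu (fun x => (g (x + t *: e_ i) - g x) ^+ 2) /\
  \int[mu]_x (g (x + t *: e_ i) - g x) ^+ 2 <= t ^+ 2 * \int[mu]_x h x ^+ 2.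
Proof.
move=> wg ih; have [[mg _] [mh _] _] := wg.
have mh2 : mfun (fun x => h x ^+ 2) by exact: measurable_funX.
have iF : integ (mu \x leb)%E (fun z => (h (z.1 + (z.2 * t) *: e_ i)) ^+ 2 * I01 z.2).
  apply: (@integ_prod_le _ _ _ _ _ mu leb (fun (x : E) (s : measurableTypeR R) =>
     h (x + (s * t) *: e_ i) ^+ 2 * I01 s) (fun s => (\int[mu]_x h x ^+ 2) * I01 s)).
  - apply: measurable_funM; last exact: (measurableT_comp (f := I01)).
    exact: (@shift_line_measurable _ _ t i (fun x => h x ^+ 2)).
  - move=> s; have := integZ (I01 s) (integ_shift ((s * t) *: e_ i) ih).
    by apply: integ_eq => x; rewrite mulrC.
  - exact/integZ/integ_I01.
  - move=> s; rewrite (Int_ext _ _ (fun x : E => I01 s * h (x + (s * t) *: e_ i) ^+ 2)).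
      rewrite IntZ ?(integ_shift _ ih)// (Int_shift _ ih) mulrC//.
    by move=> x; rewrite [RHS]mulrC ger0_norm// mulr_ge0// sqr_ge0.
have [ae1 i1 _ FE] := real_fubini (F := fun (x : E) (s : measurableTypeR R) =>
     h (x + (s * t) *: e_ i) ^+ 2 * I01 s) iF.
pose B x := t ^+ 2 * \int[leb]_s (h (x + (s * t) *: e_ i) ^+ 2 * I01 s).
have iB : integ mu B by exact: integZ.
have md : mfun (fun x : E => (g (x + t *: e_ i) - g x) ^+ 2).
  apply: measurable_funX; apply: measurable_funB => //.
  by apply: measurableT_comp => //; exact: rV_shift_measurable.
have aeB : \forall x \ae mu, (g (x + t *: e_ i) - g x) ^+ 2 <= B x.
  have := wder_translation t wg; apply: filterS2 ae1 => x h1 ->.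
  rewrite exprMn ler_wpM2l ?sqr_ge0//.
  have [] := @jensen_sq _ _ _ leb (fun s => h (x + (s * t) *: e_ i)) I01 => //.
  - exact: (measurableT_comp (shift_line_measurable t i mh) (@pair1_measurable _ _ _ (measurableTypeR R) x)).
  - exact: integ_I01.
  - exact: Int_I01.
have id : integ mu (fun x => (g (x + t *: e_ i) - g x) ^+ 2).
  apply: (integ_le_ae md iB); apply: filterS aeB => x.
  by rewrite ger0_norm ?sqr_ge0.
split=> //.
have -> : t ^+ 2 * \int[mu]_x h x ^+ 2 = \int[mu]_x B x.
  rewrite IntZ// FE; congr (_ * _).
  transitivity (\int[leb]_s ((\int[mu]_x h x ^+ 2) * I01 s)).
    by rewrite IntZ ?Int_I01 ?mulr1//; exact: integ_I01.
  apply: Int_ext => s; rewrite mulrC -(Int_shift ((s * t) *: e_ i) ih) -IntZ ?(integ_shift _ ih)//.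
  by apply: Int_ext => x; rewrite mulrC.
rewrite -lee_fin !EFin_Int//; apply: ae_ge0_le_integral => //.
- by move=> x _; rewrite lee_fin sqr_ge0.
- exact/measurable_EFinP.
- move=> x _; rewrite lee_fin mulr_ge0 ?sqr_ge0//; apply: Int_ge0 => s.
  pos.
- by apply/measurable_EFinP; exact: integ_measurable iB.
- by apply: filterS aeB => x; rewrite lee_fin.
Qed.

Definition gradL2 (g : E -> R) (h : 'I_n -> E -> R) :=
  forall i, wder i g (h i) /\ integ mu (fun x => h i x ^+ 2).

(** A displacement is decomposed along the axes, with one use of (a + b)^2 <= 2 a^2 + 2 b^2 per
    axis; hence the recursion C -> 2 C + 2. *)
Lemma gradL2_diff_bound g h : gradL2 g h -> exists2 C : R, 0 <= C &
  forall (v : E) (e : R), (forall i, `|v ord0 i| <= e) ->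
  integ mu (fun x => (g (x + v) - g x) ^+ 2) /\
  \int[mu]_x (g (x + v) - g x) ^+ 2 <= C * (\sum_i \int[mu]_x h i x ^+ 2) * e ^+ 2.
Proof.
move=> gh; set H := \sum_i _.
have H0 : 0 <= H by apply: sumr_ge0 => i _; apply: Int_ge0 => x; exact: sqr_ge0.
suff : forall l : seq 'I_n, exists2 C : R, 0 <= C & forall (v : E) (e : R), (forall i, `|v ord0 i| <= e) ->
  integ mu (fun x => (g (x + \sum_(i <- l) v ord0 i *: e_ i) - g x) ^+ 2) /\
  \int[mu]_x (g (x + \sum_(i <- l) v ord0 i *: e_ i) - g x) ^+ 2 <= C * H * e ^+ 2.
  move=> /(_ (index_enum 'I_n))[C C0 HC]; exists C => // v e ve.
  have := HC v e ve.
  by rewrite -(_ : v = \sum_i v ord0 i *: e_ i)// [LHS]row_sum_delta.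
elim=> [|i l [C C0 IH]].
  exists 0 => // v e ve; split.
    apply: integ_eq (integ0 mu) => x; by rewrite big_nil addr0 subrr expr0n.
  rewrite (Int_ext _ _ (fun=> 0)) ?Int0 ?mul0r//.
  by move=> x; rewrite big_nil addr0 subrr expr0n.
exists (2 * C + 2); first by rewrite addr_ge0// mulr_ge0.
move=> v e ve; have [I1 I2] := IH v e ve; have [wi hi] := gh i.
have [J1 J2] := wder_diff_L2 (v ord0 i) wi hi.
set w := \sum_(j <- l) _ in I1 I2 *.
have J3 := integ_shift w J1.
have J4 := Int_shift w J1.
have md : mfun (fun x : E => g (x + \sum_(j <- (i :: l)) v ord0 j *: e_ j) - g x).
  have [[mg _] _ _] := wi; apply: measurable_funB => //.
  by apply: measurableT_comp => //; exact: rV_shift_measurable.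
have bd x : (g (x + \sum_(j <- (i :: l)) v ord0 j *: e_ j) - g x) ^+ 2 <=
   2 * (g (x + w) - g x) ^+ 2 + 2 * (g (x + w + v ord0 i *: e_ i) - g (x + w)) ^+ 2.
  rewrite big_cons -/w (addrC (v ord0 i *: _)) addrA.
  move: (g _) (g x) (g (x + w)) => a b c; have := sqr_ge0 (a - c - (c - b)); nra.
have iS : integ mu (fun x => 2 * (g (x + w) - g x) ^+ 2 + 2 * (g (x + w + v ord0 i *: e_ i) - g (x + w)) ^+ 2).
  by apply: integD; exact: integZ.
have iD : integ mu (fun x => (g (x + \sum_(j <- (i :: l)) v ord0 j *: e_ j) - g x) ^+ 2).
  apply: (integ_le _ iS); first exact: measurable_funX.
  by move=> x; rewrite ger0_norm ?sqr_ge0.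
split=> //; apply: (le_trans (Int_le iD iS bd)).
rewrite IntD; [|exact: integZ|exact: integZ].
rewrite !IntZ// J4.
have hH : \int[mu]_x h i x ^+ 2 <= H.
  rewrite /H (bigD1 i)//= lerDl; apply: sumr_ge0 => j _; apply: Int_ge0 => x; exact: sqr_ge0.
have ve2 : v ord0 i ^+ 2 <= e ^+ 2.
  by rewrite -[X in X <= _]real_normK ?num_real// lerXn2r ?nnegrE// (le_trans _ (ve i)).
have := ler_pM (sqr_ge0 _) (Int_ge0 mu (fun x => sqr_ge0 (h i x))) ve2 hH.
move: J2 I2; nra.
Qed.

Definition rho (e : R) (y : E) : R := (e ^+ n)^-1 * \1_(rV_box (fun=> `]0, e[%classic)) y.

Lemma measurable_rho_box e : measurable (rV_box (fun=> `]0, e[%classic) : set E).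
Proof. by apply: measurable_rV_box => i; exact: measurable_itv. Qed.

Lemma rho_box_measure e : 0 < e -> mu (rV_box (fun=> `]0, e[%classic)) = (e ^+ n)%:E.
Proof.
move=> e0; rewrite rV_boxE; last by move=> i; exact: measurable_itv.
rewrite (eq_bigr (fun=> e%:E)); last first.
  by move=> i _; rewrite lebesgue_measure_itv/= lte_fin e0 oppr0 adde0.
by rewrite prodEFin prodr_const card_ord.
Qed.

Lemma integ_rho e : 0 < e -> integ mu (rho e).
Proof.
move=> e0; apply: integZ; apply: integ_fin; first exact: measurable_rho_box.
by apply: (@le_lt_trans _ _ (e ^+ n)%:E); [rewrite -(rho_box_measure e0)|rewrite ltry].
Qed.

Lemma rho_ge0 e y : 0 < e -> 0 <= rho e y.
Proof. by move=> e0; rewrite mulr_ge0// invr_ge0 exprn_ge0// ltW. Qed.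

Lemma Int_rho e : 0 < e -> \int[mu]_y rho e y = 1.
Proof.
move=> e0; rewrite IntZ; last first.
  apply: integ_fin; first exact: measurable_rho_box.
  by apply: (@le_lt_trans _ _ (e ^+ n)%:E); [rewrite -(rho_box_measure e0)|rewrite ltry].
rewrite /Rintegral integral_indic//; last exact: measurable_rho_box.
rewrite setIT [X in fine X](_ : _ = (e ^+ n)%:E); last exact: rho_box_measure.
by rewrite /= mulVf// expf_neq0// gt_eqF.
Qed.

Definition avg (e : R) (g : E -> R) (x : E) : R := \int[mu]_y (g (x + y) * rho e y).

Lemma add_rV_measurable (f : E -> R) : mfun f ->
  mfun (fun z : E * E => f (z.1 + z.2)).
Proof.
move=> mf; apply: (measurableT_comp (f := f)) => //.
apply: measurable_fun_rVP => j; under eq_fun do rewrite !mxE.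
apply: measurable_funD.
  exact: (measurableT_comp (measurable_coord j) measurable_fst).
exact: (measurableT_comp (measurable_coord j) measurable_snd).
Qed.

(** The L^2 distance of g to its average at scale e is O(e). It is expressed by an integrable
    majorant of the square, so that measurability of the average itself never enters. *)
Lemma avg_L2 g h : gradL2 g h -> (0 < n)%N -> exists2 C : R, 0 <= C &
  forall e, 0 < e -> exists2 B : E -> R, integ mu B & [/\
    \forall x \ae mu, (g x - avg e g x) ^+ 2 <= B x, (forall x, 0 <= B x) &
    \int[mu]_x B x <= C * (\sum_i \int[mu]_x h i x ^+ 2) * e ^+ 2].
Proof.
move=> gh n0; have [C C0 HC] := gradL2_diff_bound gh; exists C => // e e0.
set CH := C * _ in HC *.
have [[[mg lg] _ _] _] := gh (Ordinal n0).
have md : mfun (fun z : E * E => g (z.1 + z.2) - g z.1).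
  apply: measurable_funB; first exact: add_rV_measurable.
  exact: (measurableT_comp (f := g)).
have [_ mrho] : True /\ mfun (rho e).
  by split => //; exact: integ_measurable (integ_rho e0).
have iF : integ (mu \x mu)%E (fun z => (g (z.1 + z.2) - g z.1) ^+ 2 * rho e z.2).
  have small y : rho e y != 0 -> forall i, `|y ord0 i| <= e.
    rewrite /rho indicE => hy i; have [yb|yb] := boolP (y \in rV_box (fun=> `]0, e[%classic)); last first.
      by rewrite (negbTE yb) mulr0 eqxx in hy.
    have := set_mem yb i; rewrite /= in_itv/= => /andP[y0 ye].
    by rewrite ger0_norm ltW.
  apply: (@integ_prod_le _ _ _ _ _ mu mu (fun (x y : E) => (g (x + y) - g x) ^+ 2 * rho e y)
    (fun y => CH * e ^+ 2 * rho e y)).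
  - apply: measurable_funM; first exact: measurable_funX.
    exact: (measurableT_comp (f := rho e)).
  - move=> y; have [y0|y0] := eqVneq (rho e y) 0.
      by apply: integ_eq (integ0 mu) => x; rewrite y0 mulr0.
    have [h1 _] := HC y e (small y y0).
    by apply: integ_eq (integZ (rho e y) h1) => x; rewrite mulrC.
  - exact/integZ/integ_rho.
  - move=> y; have [y0|y0] := eqVneq (rho e y) 0.
      rewrite y0 mulr0 (Int_ext _ _ (fun=> 0)) ?Int0// => x.
      by rewrite mulr0 normr0.
    have [h1 h2] := HC y e (small y y0).
    rewrite (Int_ext _ _ (fun x : E => rho e y * (g (x + y) - g x) ^+ 2)).
      by rewrite IntZ// mulrC ler_wpM2r// rho_ge0.
    by move=> x; rewrite [RHS]mulrC ger0_norm// mulr_ge0 ?rho_ge0// sqr_ge0.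
have [ae1 i1 i2] := real_fubini (F := fun (x y : E) => (g (x + y) - g x) ^+ 2 * rho e y) iF.
have mslice (x : E) : mfun (fun y : E => g (x + y) - g x).
  exact: (measurableT_comp md (@pair1_measurable _ _ _ _ x)).
have ae2 : \forall x \ae mu, integ mu (fun y => g (x + y) * rho e y) /\
    (g x - avg e g x) ^+ 2 <= \int[mu]_y ((g (x + y) - g x) ^+ 2 * rho e y).
  apply: filterS ae1 => x h1.
  have [j1 j2] := jensen_sq (mslice x) (integ_rho e0) (fun y => rho_ge0 y e0) (Int_rho e0) h1.
  have j3 : integ mu (fun y => g (x + y) * rho e y).
    by apply: integ_eq (integD j1 (integZ (g x) (integ_rho e0))) => y; ring.
  split=> //; apply: le_trans j2.
  rewrite (Int_ext _ (fun y => (g (x + y) - g x) * rho e y)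
     (fun y => g (x + y) * rho e y - g x * rho e y)); last by move=> y; ring.
  rewrite IntB; [|exact: j3|exact/integZ/integ_rho].
  rewrite IntZ ?Int_rho ?mulr1 -/(avg e g x); [|by []|exact: integ_rho].
  lra.
move=> FE; exists (fun x => \int[mu]_y ((g (x + y) - g x) ^+ 2 * rho e y)); first exact: i1.
split.
- by apply: filterS ae2 => x [].
- by move=> x; apply: Int_ge0 => y; rewrite mulr_ge0 ?sqr_ge0 ?rho_ge0.
rewrite FE; clear FE ae1 ae2 iF.
have -> : CH * e ^+ 2 = \int[mu]_y (CH * e ^+ 2 * rho e y).
  by rewrite IntZ ?Int_rho ?mulr1//; exact: integ_rho.
apply: Int_le; [exact: i2|exact/integZ/integ_rho|move=> y]; have [y0|y0] := eqVneq (rho e y) 0.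
  rewrite y0 mulr0 (Int_ext _ _ (fun=> 0)) ?Int0// => x.
  by rewrite mulr0.
have small i : `|y ord0 i| <= e.
  move: y0; rewrite /rho indicE; have [yb|yb] := boolP (y \in rV_box (fun=> `]0, e[%classic)); last first.
    by rewrite mulr0 eqxx.
  have := set_mem yb i; rewrite /= in_itv/= => /andP[y1 y2] _.
  by rewrite ger0_norm ltW.
have [h1 h2] := HC y e small.
rewrite (Int_ext _ _ (fun x : E => rho e y * (g (x + y) - g x) ^+ 2)).
  by rewrite IntZ// mulrC ler_wpM2r// rho_ge0.
by move=> x; rewrite mulrC.
Qed.

(** Values are split at the level T; the large ones are paid for by the integral of w, the density
    being at most e^(-n). *)
Lemma avg_bound (g : E -> R) (w : R -> R) T B e : 0 < e -> mfun g ->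
  (forall u, 0 <= u -> u <= T + B * w u) -> 0 <= B -> (forall u, 0 <= w u) ->
  integ mu (fun x => w `|g x|) ->
  forall x, `|avg e g x| <= T + B * (e ^+ n)^-1 * \int[mu]_x w `|g x|.
Proof.
move=> e0 mg TB B0 w0 iw x.
have iws : integ mu (fun y => w `|g (x + y)|).
  have := integ_shift x iw; by apply: integ_eq => y; rewrite addrC.
have mgs : mfun (fun y => g (x + y)).
  have := @rV_shift_measurable R n x => ms; have := measurableT_comp mg ms.
  by congr measurable_fun; apply/funext => y /=; rewrite addrC.
have en0 : 0 <= (e ^+ n)^-1 by pos.
have bd y : `|g (x + y) * rho e y| <= T * rho e y + (B * (e ^+ n)^-1) * w `|g (x + y)|.
  rewrite normrM (ger0_norm (rho_ge0 y e0)).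
  apply: (@le_trans _ _ ((T + B * w `|g (x + y)|) * rho e y)).
    by rewrite ler_wpM2r ?rho_ge0// TB.
  rewrite mulrDl lerD2l -!mulrA ler_wpM2l// mulrC ler_wpM2r//.
  by rewrite /rho ler_piMr// indicE; case: (_ \in _).
have ib : integ mu (fun y => T * rho e y + (B * (e ^+ n)^-1) * w `|g (x + y)|).
  by apply: integD; [exact/integZ/integ_rho|exact: integZ].
have ig : integ mu (fun y => g (x + y) * rho e y).
  apply: (integ_le _ ib) => //; apply: measurable_funM => //.
  exact: integ_measurable (integ_rho e0).
apply: (le_trans (Int_abs_leP ig ib bd)).
rewrite IntD; [|exact/integZ/integ_rho|exact: integZ].
rewrite IntZ; last exact: integ_rho.
rewrite IntZ// Int_rho// mulr1 lerD2l ler_wpM2l//; first exact: mulr_ge0.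
rewrite -(Int_shift x iw) le_eqVlt; apply/orP; left; apply/eqP; apply: Int_ext => y.
by rewrite addrC.
Qed.

(** Truncate |g| at the levels 2 a_m, a_m = 2^(n m), and average at a scale e_m for which the
    average stays below a_m. Where |g| >= 2 a_m one has |g| <= 2 |g - avg|, hence |g|^(r+1) <= 4
    |g|^(r-1) (g - avg)^2, and [avg_L2] bounds the new slice by a multiple of 2^(m (n (r-1) - 2 r)).
    The hypothesis on n and r makes this at most 2^(-m), so the slices are summable. *)
Lemma sobolev_step g h (r : nat) : gradL2 g h -> (0 < n)%N -> (1 < r)%N ->
  (n * r.-1 < 2 * r)%N -> integ mu (fun x => `|g x| ^+ r) ->
  integ mu (fun x => `|g x| ^+ r.+1).
Proof.
move=> gh n0 r1 nr ir.
have [C C0 HC] := avg_L2 gh n0.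
have [[[mg _] _ _] _] := gh (Ordinal n0).
set H := \sum_i _ in HC.
have H0 : 0 <= H by apply: sumr_ge0 => i _; apply: Int_ge0 => x; exact: sqr_ge0.
set M := \int[mu]_x `|g x| ^+ r.
have M0 : 0 <= M by apply: Int_ge0 => x; rewrite exprn_ge0.
pose a k : R := 2 ^+ (n * k).
have a0 k : 0 < a k by rewrite exprn_gt0.
(* Chosen so that M <= (a_k / 2)^r e_k^n: the right-hand side equals e0^n / 2^r, and e0^n >= e0
   because e0 >= 1. *)
pose e0 := M * 2 ^+ r + 1.
have e01 : 1 <= e0 by rewrite lerDr mulr_ge0// exprn_ge0.
pose e k := e0 / 2 ^+ (r * k).
have ek k : 0 < e k by rewrite divr_gt0// (lt_le_trans _ e01).
have avga k x : `|avg (e k) g x| <= a k.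
  have T0 : 0 < a k / 2 by pos.
  apply: (le_trans (avg_bound (w := fun u => `|u| ^+ r) (T := a k / 2) (B := (a k / 2) ^- r.-1) (ek k) mg _ _ _ _ x)).
  - move=> u u0; rewrite (ger0_norm u0); have [ua|au] := leP u (a k / 2).
      by rewrite ler_wpDr// mulr_ge0 ?exprn_ge0// invr_ge0 exprn_ge0// ltW.
    apply: ler_wpDl; first exact: ltW.
    rewrite ler_pdivlMl ?exprn_gt0// -[in X in _ <= _ ^+ X](ltn_predK r1) exprS mulrC.
    by rewrite ler_wpM2l// lerXn2r ?nnegrE// ltW.
  - pos.
  - pos.
  - by under eq_fun do rewrite normr_id.
  rewrite (Int_ext _ _ (fun x => `|g x| ^+ r)); last by move=> y; rewrite normr_id.
  rewrite -/M.
  suff : (a k / 2) ^- r.-1 * (e k ^+ n)^-1 * M <= a k / 2 by lra.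
  rewrite -invfM mulrC ler_pdivrMr ?mulr_gt0 ?exprn_gt0//.
  rewrite mulrA -exprS (ltn_predK r1) /e /a.
  rewrite !expr_div_n -!exprM -mulrA mulrC [(n * k * r)%N](_ : _ = (r * k * n)%N); last by ring.
  rewrite -mulrA divfK ?expf_neq0 ?pnatr_eq0// mulrC ler_pdivlMr ?exprn_gt0//.
  apply: (@le_trans _ _ e0); first by rewrite lerDl.
  by rewrite -[X in X <= _]expr1 ler_weXn2l.
pose D : R := 4 * (2 ^+ n.+1) ^+ r.-1 * (C * H * e0 ^+ 2).
pose f m x := `|g x| ^+ r.+1 * \1_[set x | 0 < 2 * a m - `|g x|] x.
have mset m : measurable [set x | 0 < 2 * a m - `|g x|].
  by apply: measurable_gt0; apply: measurable_funB => //; exact: measurableT_comp.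
have mf m : mfun (f m).
  apply: measurable_funM; last exact: measurable_indic.
  by apply: measurable_funX; exact: measurableT_comp.
have f0 m x : 0 <= f m x by rewrite mulr_ge0// exprn_ge0.
have indB m x : f m x = if `|g x| < 2 * a m then `|g x| ^+ r.+1 else 0.
  rewrite /f indicE; case: ifPn => hx.
    by rewrite mem_set ?mulr1//= subr_gt0.
  by rewrite memNset ?mulr0//= subr_gt0; exact/negP.
have step m : integ mu (f m) /\ \int[mu]_x f m x <= 2 * M + D * \sum_(k < m) 2^-1 ^+ k.
  elim: m => [|m [IH1 IH2]].
    have f0r x : f 0 x <= 2 * `|g x| ^+ r.
      rewrite indB; case: ifPn => hx; last by rewrite mulr_ge0// exprn_ge0.
      by rewrite exprS ler_wpM2r// ltW// (lt_le_trans hx)// /a muln0 expr0 mulr1.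
    have i0 : integ mu (f 0).
      apply: (integ_le _ (integZ 2 ir)) => // x; by rewrite ger0_norm.
    split=> //; rewrite big_ord0 mulr0 addr0 -IntZ//; apply: Int_le => //; exact: integZ.
  have [B iB [aeB B0 HB]] := HC (e m) (ek m).
  have aef : \forall x \ae mu, f m.+1 x <= f m x + (4 * (2 * a m.+1) ^+ r.-1) * B x.
    apply: filterS aeB => x hB.
    rewrite !indB; case: ifPn => hx; last first.
      rewrite addr_ge0//; last by rewrite !mulr_ge0// ?exprn_ge0// mulr_ge0// ltW.
      by case: ifP => // _; rewrite exprn_ge0.
    case: ifPn => hx'; first by rewrite lerDl !mulr_ge0// ?exprn_ge0// mulr_ge0// ltW.
    rewrite add0r.
    have -> : `|g x| ^+ r.+1 = `|g x| ^+ r.-1 * `|g x| ^+ 2.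
      by rewrite -exprD addn2 -[in LHS](ltn_predK r1).
    rewrite [X in _ <= X * _]mulrC -mulrA.
    apply: ler_pM; rewrite ?exprn_ge0//.
      by rewrite lerXn2r ?nnegrE// ?mulr_ge0// ltW.
    apply: (@le_trans _ _ (4 * (g x - avg (e m) g x) ^+ 2)); last by rewrite ler_wpM2l.
    rewrite -[(g x - _) ^+ 2]real_normK ?num_real//.
    have : `|g x| / 2 <= `|g x - avg (e m) g x|.
      have := lerB_dist (g x) (avg (e m) g x); have := avga m x.
      move: hx'; rewrite -leNgt; lra.
    have := normr_ge0 (g x); move: (`|g x|) (`|g x - _|) => u v; nra.
  have iR : integ mu (fun x => f m x + (4 * (2 * a m.+1) ^+ r.-1) * B x).
    by apply: integD => //; exact: integZ.
  have im : integ mu (f m.+1).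
    by apply: (integ_le_ae _ iR) => //; apply: filterS aef => x; rewrite ger0_norm.
  split=> //.
  apply: (@le_trans _ _ (\int[mu]_x (f m x + (4 * (2 * a m.+1) ^+ r.-1) * B x))).
    rewrite -lee_fin !EFin_Int//; apply: ae_ge0_le_integral => //.
    - pos.
    - exact/measurable_EFinP.
    - by move=> x _; rewrite lee_fin addr_ge0// !mulr_ge0// ?exprn_ge0// mulr_ge0// ltW.
    - by apply/measurable_EFinP; exact: integ_measurable iR.
    - by apply: filterS aef => x; rewrite lee_fin.
  rewrite IntD//; last exact: integZ.
  rewrite IntZ// big_ord_recr/= mulrDr addrA lerD//.
  apply: (@le_trans _ _ (4 * (2 * a m.+1) ^+ r.-1 * (C * H * e m ^+ 2))).
    by rewrite ler_wpM2l// mulr_ge0// exprn_ge0// mulr_ge0// ltW.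
  rewrite /D -!mulrA ler_pM2l// /e expr_div_n.
  rewrite [leLHS](_ : _ = (C * H * e0 ^+ 2) * ((2 * a m.+1) ^+ r.-1 / (2 ^+ (r * m)) ^+ 2)); last by ring.
  rewrite [leRHS](_ : _ = (C * H * e0 ^+ 2) * ((2 ^+ n.+1) ^+ r.-1 * 2^-1 ^+ m)); last by ring.
  rewrite ler_wpM2l ?mulr_ge0 ?exprn_ge0//; try by rewrite (le_trans _ e01).
  rewrite ler_pdivrMr ?exprn_gt0// exprVn mulrAC ler_pdivlMr ?exprn_gt0//.
  rewrite /a -exprS -!exprM -!exprD ler_eXn2l ?ltr1n//.
  have : (n * r.-1 * m + m <= 2 * r * m)%N by rewrite -mulSnr leq_mul2r nr orbT.
  move: r.-1 => r' hr.
  have -> : ((n * m.+1).+1 * r' + m = (n * r' + r') + (n * r' * m + m))%N by ring.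
  have -> : (n.+1 * r' + r * m * 2 = (n * r' + r') + 2 * r * m)%N by ring.
  by rewrite leq_add2l.
have [] := @integ_fatou _ _ _ mu f (fun x => `|g x| ^+ r.+1) (2 * M + D * 2).
- by move=> m; have [] := step m.
- exact: f0.
- move=> m; have [_ h2] := step m; apply: (le_trans h2); rewrite lerD2l ler_wpM2l//.
    by rewrite !mulr_ge0//// (le_trans _ e01).
  elim: m {h2} => [|m IH]; first by rewrite big_ord0.
  rewrite big_ord_recl expr0 (eq_bigr (fun i : 'I_m => 2^-1 * 2^-1 ^+ i)).
    by rewrite -mulr_sumr; move: IH; lra.
  by move=> i _; rewrite -exprS; congr (_ ^+ _).
- move=> x; apply: cvg_near_cst.
  exists (Num.trunc `|g x|).+1 => // m /= hm; rewrite indB ifT//.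
  apply: (lt_le_trans (truncnS_gt _)).
  apply: (@le_trans _ _ m%:R); first by rewrite ler_nat.
  apply: (@le_trans _ _ (2 ^+ m)); first by rewrite -natrX ler_nat ltnW// ltn_expl.
  apply: (@le_trans _ _ (a m)); last by rewrite ler_peMl ?(ltW (a0 _))// ler1n.
  by rewrite ler_eXn2l ?ltr1n// leq_pmull.
by [].
Qed.

End sobolev.

(** * Radial integration *)

Section half_line.
Context (R : realType).
Implicit Types f F g : R -> R.

Definition cpos f := forall r : R, 0 < r -> {for r, continuous f}.
Definition ddpos F f := forall r : R, 0 < r -> dd F r (f r).
Definition halfint f := integ leb (fun r => f r * Ipos r).

Lemma IposE (r : R) : Ipos r = (0 < r)%R%:R :> R.
Proof.
by rewrite indicE; congr (_%:R); congr nat_of_bool;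
  apply/idP/idP => [/set_mem|h]; [rewrite /= in_itv/= andbT|rewrite inE /= in_itv/= andbT].
Qed.

Lemma indic_segE (a b r : R) : \1_(`[a, b]%classic : set R) r = (a <= r <= b)%R%:R :> R.
Proof.
by rewrite indicE; congr (_%:R); congr nat_of_bool;
  apply/idP/idP => [/set_mem|h]; [rewrite /= in_itv|rewrite inE /= in_itv].
Qed.

Lemma ddpos_cpos F f : ddpos F f -> cpos F.
Proof. by move=> h r r0; exact: dd_cont (h r r0). Qed.

Lemma cpos_measurable f : cpos f -> mfun (fun r => f r * Ipos r).
Proof.
move=> cf.
have mD : measurable (`]0%R, +oo[%classic : set R) by pos.
have := iffLR (measurable_restrictT f mD).
rewrite (_ : f \_ _ = fun r => f r * Ipos r); first apply.
  apply: open_continuous_measurable_fun; first exact: interval_open.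
  by move=> r; rewrite inE /= in_itv/= andbT; exact: cf.
by apply/funext => r; rewrite patchE indicE; case: ifP => _; rewrite ?mulr1 ?mulr0.
Qed.

Lemma ftc_seg f F (a b : R) : 0 < a -> a < b -> cpos f -> ddpos F f ->
  integ leb (fun r => f r * \1_(`[a, b]%classic) r) /\
  \int[leb]_r (f r * \1_(`[a, b]%classic) r) = F b - F a.
Proof.
move=> a0 ab cf dF.
have cfab : {within `[a, b], continuous f}.
  apply: continuous_in_subspaceT => r; rewrite inE /= in_itv/= => /andP[ar _].
  by apply: cf; exact: lt_le_trans ar.
have b0 := lt_trans a0 ab.
split.
  apply: (iffLR (integ_restrict _ (measurable_itv `[a, b]))).
  by apply: continuous_compact_integrable => //; exact: segment_compact.
rewrite -Int_restrict /Rintegral (@continuous_FTC2 _ f F a b)//.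
- split.
  + by move=> x; rewrite in_itv/= => /andP[ax _]; have [] := dF x (lt_trans a0 ax).
  + by apply/cvg_at_right_filter; exact: (ddpos_cpos dF).
  + by apply/cvg_at_left_filter; exact: (ddpos_cpos dF).
- move=> x; rewrite in_itv/= => /andP[ax _].
  by have [_] := dF x (lt_trans a0 ax); rewrite derive1E.
Qed.

(** The shift by 2 keeps 1 strictly inside [lo n, hi n]; the bounds near 0 and near infinity are
    glued at 1. *)
Let lo n : R := n.+2%:R^-1.
Let hi n : R := n.+2%:R.

Let lo0 n : 0 < lo n. Proof. by rewrite invr_gt0. Qed.
Let hi1 n : 1 < hi n. Proof. by rewrite ltr1n. Qed.
Let lo1 n : lo n < 1. Proof. by rewrite invf_lt1// ltr1n. Qed.
Let lohi n : lo n < hi n. Proof. exact: lt_trans (lo1 n) (hi1 n). Qed.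

Let hi_cvg : hi n @[n --> \oo] --> +oo.
Proof. by have := @cvgr_idn R; rewrite -(cvg_shiftn 2); under eq_fun do rewrite addn2. Qed.

Let lo_cvg : lo n @[n --> \oo] --> (0 : R).
Proof.
by have := @cvg_harmonic R; rewrite -cvg_shiftS.
Qed.

Let exhaust f (r : R) : f r * \1_(`[lo n, hi n]%classic) r @[n --> \oo] --> f r * Ipos r.
Proof.
rewrite IposE; have [r0|r0] := ltP 0 r; last first.
  apply: cvg_near_cst; apply: nearW => n.
  by rewrite indic_segE leNgt (le_lt_trans r0 (lo0 n)).
apply: cvg_near_cst; near=> n.
rewrite indic_segE; suff -> : lo n <= r <= hi n by [].
apply/andP; split.
- by near: n; apply: (cvgr_le _ lo_cvg).
- by near: n; exact: (cvgryPge _).1 hi_cvg r.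
Unshelve. all: by end_near. Qed.

(** A certificate of integrability near 0: a continuous majorant with a bounded primitive. [domoo]
    is its counterpart at infinity. No integral has to be computed. *)
Definition dom0 f := exists f0 F0, exists2 C : R, [/\ cpos f0, ddpos F0 f0 &
  forall r, 0 < r <= 1 -> `|f r| <= f0 r] & forall r, 0 < r <= 1 -> F0 1 - F0 r <= C.

Definition domoo f := exists f1 F1, exists2 C : R, [/\ cpos f1, ddpos F1 f1 &
  forall r, 1 <= r -> `|f r| <= f1 r] & forall r, 1 <= r -> F1 r - F1 1 <= C.

Lemma half_dom f : cpos f -> dom0 f -> domoo f -> halfint f.
Proof.
move=> cf [f0 [F0 [C0 [cf0 dF0 b0] B0]]] [f1 [F1 [C1 [cf1 dF1 b1] B1]]].
have cnf : cpos (fun r => `|f r|).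
  by move=> r r0; apply: continuous_comp; [exact: cf|exact: norm_continuous].
have iseg n : integ leb (fun r => `|f r| * \1_(`[lo n, hi n]%classic) r).
  apply: (iffLR (integ_restrict _ (measurable_itv `[lo n, hi n]))).
  apply: continuous_compact_integrable; first exact: segment_compact.
  apply: continuous_in_subspaceT => r; rewrite inE /= in_itv/= => /andP[ar _].
  by apply: cnf; exact: lt_le_trans ar.
have bseg n : \int[leb]_r (`|f r| * \1_(`[lo n, hi n]%classic) r) <= C0 + C1.
  have [i0 e0] := ftc_seg (lo0 n) (lo1 n) cf0 dF0.
  have [i1 e1] := ftc_seg ltr01 (hi1 n) cf1 dF1.
  apply: (@le_trans _ _ ((F0 1 - F0 (lo n)) + (F1 (hi n) - F1 1))); last first.
    by rewrite lerD ?B0 ?B1 ?lo0 ?ltW.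
  rewrite -e0 -e1 -IntD//; apply: Int_le => //; first exact: integD.
  move=> r; rewrite !indic_segE.
  have f1p : 1 <= r -> 0 <= f1 r by move=> /b1; exact: le_trans.
  have [lr|lr] := leP (lo n) r; last first.
    by rewrite (leNgt 1 r) (lt_trans lr (lo1 n)) !mulr0 addr0.
  have rp := lt_le_trans (lo0 n) lr.
  have [r1|r1] := leP r 1.
    rewrite (le_trans r1 (ltW (hi1 n))) andbT !mulr1.
    have := b0 r; rewrite rp r1 => /(_ isT) h; apply: (le_trans h); rewrite lerDl.
    by case: (leP 1 r) => h1; rewrite ?mulr0// mulr1 f1p.
  by rewrite (ltW r1) mulr0 add0r/=; case: (leP r (hi n)) => h1; rewrite ?mulr0// !mulr1 b1// ltW.
have [] := integ_fatou iseg _ bseg (@exhaust (fun r => `|f r|)).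
  pos.
move=> h _; apply: (integ_le _ h); first exact: cpos_measurable.
by move=> r; rewrite normrM (ger0_norm (_ : 0 <= Ipos r)).
Qed.

Lemma half_ftc f F A B : cpos f -> ddpos F f -> halfint f ->
  F r @[r --> 0^'+] --> A -> F r @[r --> +oo] --> B ->
  \int[leb]_r (f r * Ipos r) = B - A.
Proof.
move=> cf dF hf FA FB.
have h1 := @dct_cvg _ _ _ leb (fun n r => f r * \1_(`[lo n, hi n]%classic) r) (fun r => f r * Ipos r)
  (fun r => `|f r * Ipos r|).
have h2 : \int[leb]_r (f r * \1_(`[lo n, hi n]%classic) r) @[n --> \oo] --> B - A.
  under eq_fun do rewrite (ftc_seg (lo0 _) (lohi _) cf dF).2.
  apply: cvgB; first exact: (cvg_comp _ _ hi_cvg FB).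
  by move/(@cvg_at_rightP R) : FA; apply; split => [n|]; [exact: lo0|exact: lo_cvg].
apply: (cvg_unique (@Rhausdorff R) (h1 _ _ _ _) h2).
- by move=> n; exact: integ_measurable (ftc_seg (lo0 n) (lohi n) cf dF).1.
- exact: integ_norm.
- move=> n r; rewrite !normrM ler_wpM2l// IposE indic_segE.
  have [r0|r0] := ltP 0 r; last by rewrite (leNgt (lo n)) (le_lt_trans r0 (lo0 n)).
  by rewrite normr1; case: (_ <= _ <= _); rewrite ?normr1 ?normr0.
- exact: exhaust.
Qed.

Lemma dom0_le f g C : 0 <= C -> dom0 g -> (forall r, 0 < r <= 1 -> `|f r| <= C * `|g r|) ->
  dom0 f.
Proof.
move=> C0 [f0 [F0 [C1 [cf0 dF0 b0] B0]]] fg.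
exists (fun r => C * f0 r), (fun r => C * F0 r), (C * C1); [split|].
- by move=> r r0; apply: cvgM; [exact: cvg_cst|exact: cf0].
- by move=> r r0; apply: ddZ; exact: dF0.
- by move=> r rr; rewrite (le_trans (fg _ rr))// ler_wpM2l// b0.
- by move=> r rr; rewrite -mulrBr ler_wpM2l// B0.
Qed.

Lemma domoo_le f g C : 0 <= C -> domoo g -> (forall r, 1 <= r -> `|f r| <= C * `|g r|) ->
  domoo f.
Proof.
move=> C0 [f0 [F0 [C1 [cf0 dF0 b0] B0]]] fg.
exists (fun r => C * f0 r), (fun r => C * F0 r), (C * C1); [split|].
- by move=> r r0; apply: cvgM; [exact: cvg_cst|exact: cf0].
- by move=> r r0; apply: ddZ; exact: dF0.
- by move=> r rr; rewrite (le_trans (fg _ rr))// ler_wpM2l// b0.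
- by move=> r rr; rewrite -mulrBr ler_wpM2l// B0.
Qed.

Lemma ddpos_powR (a : R) : ddpos (fun r => r `^ a) (fun r => a * r `^ (a - 1)).
Proof. by move=> r r0; exact: is_derive1_powR. Qed.

Lemma cpos_powR (a : R) : cpos (fun r => r `^ a).
Proof. exact: ddpos_cpos (ddpos_powR a). Qed.

Lemma dom0_powR (a : R) : -1 < a -> dom0 (fun r => r `^ a).
Proof.
move=> a1; have a10 : 0 < a + 1 by move: a1; lra.
exists (fun r => r `^ a), (fun r => (a + 1)^-1 * r `^ (a + 1)), (a + 1)^-1; [split|].
- exact: cpos_powR.
- move=> r r0; apply: dd_eq (ddZ _ (ddpos_powR (a + 1) r0)) _.
  by rewrite mulrA mulVf ?gt_eqF// mul1r addrK.
- by move=> r _; rewrite ger0_norm// powR_ge0.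
- by move=> r _; rewrite powR1 mulr1 lerBlDr lerDl mulr_ge0 ?powR_ge0// invr_ge0 ltW.
Qed.

Lemma domoo_powR (a : R) : a < -1 -> domoo (fun r => r `^ a).
Proof.
move=> a1; have a10 : a + 1 < 0 by move: a1; lra.
exists (fun r => r `^ a), (fun r => (a + 1)^-1 * r `^ (a + 1)), (- (a + 1)^-1); [split|].
- exact: cpos_powR.
- move=> r r0; apply: dd_eq (ddZ _ (ddpos_powR (a + 1) r0)) _.
  by rewrite mulrA mulVf ?lt_eqF// mul1r addrK.
- by move=> r _; rewrite ger0_norm// powR_ge0.
- move=> r _; rewrite powR1 mulr1 lerBlDr addNr.
  by rewrite mulr_le0_ge0 ?powR_ge0// invr_le0 ltW.
Qed.

End half_line.

Lemma cvg_sumr (R : realType) (T : Type) (F : set_system T) (FF : Filter F) (n : nat)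
    (f : 'I_n -> T -> R) (l : 'I_n -> R) :
  (forall i, f i x @[x --> F] --> l i) ->
  \sum_i f i x @[x --> F] --> \sum_i l i.
Proof.
move=> h; elim: (index_enum _) => [|i s IH].
  by rewrite big_nil; under eq_fun do rewrite big_nil; exact: cvg_cst.
by rewrite big_cons; under eq_fun do rewrite big_cons; exact: cvgD.
Qed.

(** * Cutoffs near the origin and infinity *)

Section cutoff.
Context (R : realType).

Lemma ddX m (r : R) : dd (fun r => r ^+ m) r (m%:R * r ^+ m.-1).
Proof.
elim: m => [|m IH]; first by rewrite mul0r; exact: dd_cst.
apply: (@dd_near _ (fun r => r * r ^+ m)); first by near=> y; rewrite exprS.
apply: dd_eq (ddM (dd_id r) IH) _.
by case: m {IH} => [|m] /=; rewrite -?natr1 ?exprS; ring.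
Unshelve. all: by end_near. Qed.

Lemma dd_unique (f : R -> R) x d d' : dd f x d -> dd f x d' -> d = d'.
Proof. by move=> [_ <-] [_ <-]. Qed.

Lemma dd_cst_lt (f f' : R -> R) a c : (forall r, dd f r (f' r)) ->
  (forall r, r <= a -> f r = c) -> forall r, r < a -> f' r = 0.
Proof.
move=> df fa r ra; apply: dd_unique (df r) _; apply: (@dd_near _ (fun=> c)); last exact: dd_cst.
by near=> y; rewrite fa// ltW//; near: y; exact: lt_nbhsl.
Unshelve. all: by end_near. Qed.

Lemma dd_cst_gt (f f' : R -> R) a c : (forall r, dd f r (f' r)) ->
  (forall r, a <= r -> f r = c) -> forall r, a < r -> f' r = 0.
Proof.
move=> df fa r ra; apply: dd_unique (df r) _; apply: (@dd_near _ (fun=> c)); last exact: dd_cst.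
by near=> y; rewrite fa// ltW//; near: y; exact: lt_nbhsr.
Unshelve. all: by end_near. Qed.

Lemma cont_bounded_seg (f : R -> R) a b : continuous f -> exists2 C : R, 0 <= C &
  forall x, a <= x <= b -> `|f x| <= C.
Proof.
move=> cf; have [ab|ba] := leP a b; last first.
  by exists 0 => // x /andP[ax xb]; have := le_trans ax xb; rewrite leNgt ba.
have cc : {within `[a, b], continuous (fun x => `|f x|)}.
  by apply: continuous_subspaceT => x; apply: cvg_norm; exact: cf.
have [c _ Hc] := EVT_max ab cc; exists `|f c| => // x xab; exact: Hc.
Qed.

Lemma flat_gt0 (x : R) : 0 < x -> 0 < flat x.
Proof. by move=> x0; rewrite /flat x0 expR_gt0. Qed.

(** The quotient u / (u + v) of flat functions: u vanishes up to 1, v vanishes from 2 on, and they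
    never vanish together. *)
Lemma step_fun : exists th th' : R -> R, exists2 C : R, 0 <= C &
  [/\ forall x, dd th x (th' x), continuous th', forall x, x <= 1 -> th x = 0,
      forall x, 2 <= x -> th x = 1 & forall x, 0 <= th x <= 1] /\
  [/\ forall x, x < 1 -> th' x = 0, forall x, 2 < x -> th' x = 0 &
      forall x, `|x * th' x| <= C].
Proof.
have [k' sk' dk] := smooth1_der (flat_smooth R).
have [k'' _ dk'] := smooth1_der sk'.
have ck' : continuous k' by move=> x; exact: dd_cont (dk' x).
pose u (x : R) := flat (1 * x + -1); pose v (x : R) := flat (-1 * x + 2).
have du x : dd u x (k' (1 * x + -1) * 1) by apply: dd_comp (dd_affine _ _ _); exact: dk.
have dv x : dd v x (k' (-1 * x + 2) * -1) by apply: dd_comp (dd_affine _ _ _); exact: dk.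
have uv0 x : 0 < u x + v x.
  have [x1|x1] := leP x 1.
    by rewrite ltr_wpDl ?flat_ge0// flat_gt0//; move: x1; lra.
  by rewrite ltr_wpDr ?flat_ge0// flat_gt0//; move: x1; lra.
pose th x := u x * (u x + v x)^-1.
pose th' x := u x * (- (k' (1 * x + -1) * 1 + k' (-1 * x + 2) * -1) / (u x + v x) ^+ 2) +
   k' (1 * x + -1) * 1 * (u x + v x)^-1.
have dth x : dd th x (th' x).
  by apply: ddM => //; apply: ddV; [rewrite gt_eqF|exact: ddD].
have cu : continuous u by move=> x; exact: dd_cont (du x).
have cv : continuous v by move=> x; exact: dd_cont (dv x).
have cuv : continuous (fun x => u x + v x) by move=> x; apply: cvgD; [exact: cu|exact: cv].
have caff (a b : R) : continuous (fun x => k' (a * x + b)).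
  move=> x; apply: continuous_comp; last exact: ck'.
  exact: dd_cont (dd_affine a b x).
have cth' : continuous th'.
  move=> x; apply: cvgD; apply: cvgM.
  - exact: cu.
  - apply: cvgM.
      by apply: cvgN; apply: cvgD; apply: cvgM; [exact: caff|exact: cvg_cst|exact: caff|exact: cvg_cst].
    apply: cvgV; first by rewrite expf_neq0 ?gt_eqF.
    by apply: cvgM; exact: cuv.
  - by apply: cvgM; [exact: caff|exact: cvg_cst].
  - by apply: cvgV; [rewrite gt_eqF|exact: cuv].
have th1 x : x <= 1 -> th x = 0 by move=> x1; rewrite /th /u flat_le0//; move: x1; lra.
have th2 x : 2 <= x -> th x = 1.
  move=> x2; have v0 : v x = 0 by rewrite /v flat_le0//; move: x2; lra.
  by have := uv0 x; rewrite /th v0 !addr0 => u0; rewrite mulfV// gt_eqF.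
have th'1 := dd_cst_lt dth th1; have th'2 := dd_cst_gt dth th2.
have cxth : continuous (fun x : R => x * th' x) by move=> x; apply: cvgM; [exact: cvg_id|exact: cth'].
have [C C0 HC] := cont_bounded_seg 1 2 cxth.
exists th, th', C => //; split; split => //.
  move=> x; have u0 : 0 <= u x by exact: flat_ge0.
  rewrite mulr_ge0 ?invr_ge0 ?(ltW (uv0 _))//=.
  by rewrite ler_pdivrMr// mul1r lerDl flat_ge0.
move=> x; have [x1|x1] := ltP x 1; first by rewrite th'1// mulr0 normr0.
have [x2|x2] := ltP 2 x; first by rewrite th'2// mulr0 normr0.
by apply: HC; rewrite x1.
Unshelve. all: by end_near. Qed.

(** Both factors are dilations of one step function, so r c_m'(r) is bounded uniformly in m. This
    scale-invariant bound dominates the error terms when the cutoffs are removed. *)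
Lemma cutoffs : exists c c' : nat -> R -> R, exists2 C : R, 0 <= C &
  [/\ forall m r, dd (c m) r (c' m r), forall m, continuous (c' m), forall m r, 0 <= c m r <= 1,
      forall m r, r <= m.+1%:R^-1 -> c m r = 0 & forall m r, 2 * m.+1%:R <= r -> c m r = 0] /\
  [/\ forall m r, `|r * c' m r| <= C,
      forall r, 0 < r -> \forall m \near \oo, c m r = 1 &
      forall r, 0 < r -> \forall m \near \oo, c' m r = 0].
Proof.
have [th [th' [C C0 [[dth cth' th1 th2 th01] [th'1 th'2 thC]]]]] := step_fun.
pose k m : R := m.+1%:R.
exists (fun m r => th (k m * r + 0) * (1 - th ((k m)^-1 * r + 0))).
exists (fun m r => th (k m * r + 0) * (0 - th' ((k m)^-1 * r + 0) * (k m)^-1) +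
   th' (k m * r + 0) * k m * (1 - th ((k m)^-1 * r + 0))).
have thn x : `|th x| <= 1 by have /andP[h0 h1] := th01 x; rewrite ger0_norm.
have thn' x : `|1 - th x| <= 1.
  by have /andP[h0 h1] := th01 x; rewrite ger0_norm; [move: h0; lra|move: h1; lra].
exists (C + C); first exact: addr_ge0.
split; split.
- move=> m r; apply: ddM; first exact: (dd_comp (dth _) (dd_affine _ _ _)).
  apply: ddB; first exact: dd_cst.
  exact: (dd_comp (dth _) (dd_affine _ _ _)).
- move=> m r.
  have ca (a : R) : {for r, continuous (fun r => a * r + 0)} by exact: dd_cont (dd_affine a 0 r).
  have cth : continuous th by move=> x; exact: dd_cont (dth x).
  have c1 (a : R) : {for r, continuous (fun r => th (a * r + 0))}.
    by apply: continuous_comp; [exact: ca|exact: cth].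
  have c2 (a : R) : {for r, continuous (fun r => th' (a * r + 0))}.
    by apply: continuous_comp; [exact: ca|exact: cth'].
  apply: cvgD; apply: cvgM.
  + exact: c1.
  + by apply: cvgB; [exact: cvg_cst|apply: cvgM; [exact: c2|exact: cvg_cst]].
  + by apply: cvgM; [exact: c2|exact: cvg_cst].
  + by apply: cvgB; [exact: cvg_cst|exact: c1].
- move=> m r; have /andP[h0 h1] := th01 (k m * r + 0); have /andP[g0 g1] := th01 ((k m)^-1 * r + 0).
  by rewrite mulr_ge0 ?subr_ge0//= mulr_ile1// ?subr_ge0// lerBlDr lerDl.
- by move=> m r rm; rewrite th1 ?mul0r// addr0 mulrC -ler_pdivlMr// div1r.
- by move=> m r rm; rewrite (th2 (_^-1 * r + 0)) ?subrr ?mulr0// addr0 mulrC ler_pdivlMr.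
- move=> m r; rewrite mulrDr (le_trans (ler_normD _ _))// lerD//.
    rewrite sub0r mulrCA normrM -[leRHS]mul1r ler_pM//.
    have := thC ((k m)^-1 * r + 0); congr (_ <= _); rewrite mulrN normrN addr0; congr `|_|; ring.
  rewrite mulrA normrM -[leRHS]mulr1 ler_pM//.
  have := thC (k m * r + 0); congr (_ <= _); rewrite addr0; congr `|_|; ring.
- move=> r r0; near=> m.
  have h1 : r < k m by apply: (lt_le_trans (truncnS_gt _)); rewrite ler_nat ltnS;
    near: m; exact: nbhs_infty_ge.
  have h2 : 2 / r < k m by apply: (lt_le_trans (truncnS_gt _)); rewrite ler_nat ltnS;
    near: m; exact: nbhs_infty_ge.
  rewrite th2; last by rewrite addr0 -ler_pdivrMr// ltW.
  by rewrite th1 ?subr0 ?mulr1// addr0 mulrC ler_pdivrMr// mul1r ltW.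
- move=> r r0; near=> m.
  have h1 : r < k m by apply: (lt_le_trans (truncnS_gt _)); rewrite ler_nat ltnS;
    near: m; exact: nbhs_infty_ge.
  have h2 : 2 / r < k m by apply: (lt_le_trans (truncnS_gt _)); rewrite ler_nat ltnS;
    near: m; exact: nbhs_infty_ge.
  rewrite th'1; last by rewrite addr0 mulrC ltr_pdivrMr// mul1r.
  rewrite th'2 ?mul0r ?subr0 ?mulr0 ?addr0//.
  by rewrite -ltr_pdivrMr.
Unshelve. all: by end_near. Qed.

Definition C1pos (H H' : R -> R) := ddpos H H' /\ cpos H'.

Lemma C1pos_cut (H H' c c' : R -> R) (a : R) : C1pos H H' -> 0 < a ->
  (forall r, dd c r (c' r)) -> continuous c' -> (forall r, r <= a -> c r = 0) ->
  (forall r, dd (fun r => H r * c r) r (H r * c' r + H' r * c r)) /\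
  continuous (fun r => H r * c' r + H' r * c r).
Proof.
move=> [dH cH'] a0 dc cc' c0.
have c'0 := dd_cst_lt dc c0.
split=> r; have [r0|r0] := ltP 0 r.
- exact: ddM (dH _ r0) (dc r).
- rewrite c'0 ?(le_lt_trans r0)// c0 ?(le_trans r0) ?(ltW a0)// !mulr0 addr0.
  apply: (@dd_near _ (fun=> 0)); last exact: dd_cst.
  near=> y; rewrite c0 ?mulr0// ltW//; near: y; apply: lt_nbhsl.
  exact: le_lt_trans a0.
- apply: cvgD; apply: cvgM.
  + exact: dd_cont (dH _ r0).
  + exact: cc'.
  + exact: cH'.
  + exact: dd_cont (dc r).
- have ra := le_lt_trans r0 a0.
  have E : \forall y \near r, 0 = H y * c' y + H' y * c y.
    near=> y; have ya : y < a by near: y; exact: lt_nbhsl.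
    by rewrite c'0// c0 ?(ltW ya)// !mulr0 addr0.
  rewrite /prop_for /continuous_at c'0// c0 ?(ltW ra)// !mulr0 addr0.
  apply/cvgrPdist_le => e e0; near=> y.
  have <- : 0 = H y * c' y + H' y * c y by near: y; exact: E.
  by rewrite subrr normr0 ltW.
Unshelve. all: by end_near. Qed.

End cutoff.

(** * Integration in polar coordinates *)

Section radial.
Context (R : realType) (n : nat).
Local Notation E := 'rV[R]_n.
Local Notation mu := (lebesgue_rV R n).

Lemma enorm_ge0 (x : E) : 0 <= enorm x. Proof. exact: sqrtr_ge0. Qed.

Lemma sumsq_ge0 (x : E) : 0 <= \sum_i x ord0 i ^+ 2.
Proof. by apply: sumr_ge0 => i _; exact: sqr_ge0. Qed.

Lemma enorm_sq (x : E) : enorm x ^+ 2 = \sum_i x ord0 i ^+ 2.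
Proof. by rewrite sqr_sqrtr// sumsq_ge0. Qed.

Lemma enorm_coord (x : E) i : `|x ord0 i| <= enorm x.
Proof.
rewrite -(@ler_pXn2r _ 2)// ?nnegrE ?enorm_ge0// enorm_sq real_normK ?num_real//.
by rewrite (bigD1 i)//= lerDl; apply: sumr_ge0 => j _; exact: sqr_ge0.
Qed.

Lemma enorm_gt0 (x : E) : (0 < enorm x) = (x != 0).
Proof.
rewrite lt0r enorm_ge0 andbT; congr (~~ _); apply/eqP/eqP => [x0|->].
  apply/rowP => i; rewrite mxE; apply/eqP; rewrite -normr_le0 -x0; exact: enorm_coord.
by rewrite /enorm big1 ?sqrtr0// => i _; rewrite mxE expr0n.
Qed.

Lemma enorm_pos (x : E) : x != 0 -> 0 < enorm x.
Proof. by rewrite enorm_gt0. Qed.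

Lemma enorm_cont : continuous (@enorm R n).
Proof.
move=> x; apply: continuous_comp; last exact: sqrt_continuous.
apply: (@cvg_sumr _ _ (nbhs x) _ n (fun i x => x ord0 i ^+ 2)) => i.
have h := @continuous_comp _ _ _ (fun y : E => y ord0 i) (fun r : R => r ^+ 2) x.
by apply: h; [exact: coord_continuous|exact: exprn_continuous].
Qed.

Lemma enorm_measurable : mfun (@enorm R n).
Proof. by apply: continuous_measurable_rV; exact: enorm_cont. Qed.

Lemma enormZ (a : R) (x : E) : 0 <= a -> enorm (a *: x) = a * enorm x.
Proof.
move=> a0; rewrite /enorm.
under eq_bigr do rewrite mxE exprMn.
by rewrite -mulr_sumr sqrtrM ?sqr_ge0// sqrtr_sqr ger0_norm.
Qed.

Lemma enorm_cube (x : E) m : enorm x < m%:R -> rV_cube m x.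
Proof.
by move=> xm i; rewrite /= in_itv/= -ltr_norml (le_lt_trans (enorm_coord x i)).
Qed.

Definition eball (r : R) : set E := [set x | enorm x <= r].

Lemma measurable_eball r : measurable (eball r).
Proof.
rewrite (_ : eball r = ~` [set x | 0 < enorm x - r]).
  apply: measurableC; apply: measurable_gt0; apply: measurable_funB => //.
  exact: enorm_measurable.
by apply/seteqP; split => x; rewrite /eball /= subr_gt0 leNgt => /negP.
Qed.

Definition evol : R := fine (mu (eball 1)).

Lemma eball_fin r : (mu (eball r) < +oo)%E.
Proof.
apply: le_lt_trans (rV_cube_fin R n (Num.trunc r).+1).
apply: le_measure; rewrite ?inE; [exact: measurable_eball|exact: measurable_rV_cube|].
by move=> x xr; apply: enorm_cube; rewrite (le_lt_trans xr)// truncnS_gt.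
Qed.

Lemma Int_eball r : 0 < r -> \int[mu]_x \1_(eball r) x = r ^+ n * evol.
Proof.
move=> r0; rewrite /Rintegral integral_indic//; last exact: measurable_eball.
rewrite setIT.
have h := rV_scale r0 (measurable_eball r).
rewrite (_ : (fun x : E => r *: x) @^-1` eball r = eball 1) in h; last first.
  apply/seteqP; split => x; rewrite /eball /= enormZ ?(ltW r0)//.
    by rewrite -[leRHS]mulr1 ler_pM2l.
  by move=> h1; rewrite -[leRHS]mulr1 ler_pM2l.
have : fine (mu (eball r)) = fine ((r ^+ n)%:E * mu (eball 1))%E by rewrite -h.
move=> ->; rewrite fineM//.
by rewrite ge0_fin_numE//; exact: eball_fin.
Qed.

Lemma evol_ge0 : 0 <= evol. Proof. by rewrite /evol fine_ge0. Qed.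

Lemma cont_csupp_integ (k : R -> R) (a b : R) : continuous k ->
  (forall r, r < a -> k r = 0) -> (forall r, b < r -> k r = 0) ->
  integ leb k /\ forall a' b', a' <= a -> b <= b' -> \int[leb]_r k r = \int[leb]_(r in `[a', b']) k r.
Proof.
move=> ck ka kb.
have ext a' b' : a' <= a -> b <= b' -> k = fun r => k r * \1_(`[a', b']%classic) r.
  move=> ha hb; apply/funext => r; rewrite indic_segE.
  have [r1|r1] := ltP r a; first by rewrite ka ?mul0r.
  have [r2|r2] := ltP b r; first by rewrite kb ?mul0r.
  by rewrite (le_trans ha r1) (le_trans r2 hb) mulr1.
split.
  rewrite (ext a b)//; apply: (iffLR (integ_restrict _ (measurable_itv `[a, b]))).
  exact: integ_seg.
by move=> a' b' ha hb; rewrite [RHS]Int_restrict -(ext a' b').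
Qed.

(** Layer cake: H(|x|) is minus the integral of H' over r >= |x|. Fubini gives the integral of
    -H'(r) r^n times the volume of the unit ball, and a one-dimensional integration by parts turns
    it into n H(r) r^(n-1). *)
Lemma radial_test (H H' : R -> R) (a b : R) : (0 < n)%N -> (forall r, dd H r (H' r)) ->
  continuous H' -> 0 < a -> (forall r, r <= a -> H r = 0) -> (forall r, b <= r -> H r = 0) ->
  integ mu (fun x => H (enorm x)) /\
  \int[mu]_x H (enorm x) = (n%:R * evol) * \int[leb]_r (H r * r ^+ n.-1 * Ipos r).
Proof.
move=> n0 dH cH' a0 Ha Hb.
have H'a := dd_cst_lt dH Ha; have H'b := dd_cst_gt dH Hb.
have cH : continuous H by move=> r; exact: dd_cont (dH r).
have crn : continuous (fun r : R => r ^+ n) by exact: exprn_continuous.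
have crn1 : continuous (fun r : R => r ^+ n.-1) by exact: exprn_continuous.
pose F (x : E) (r : measurableTypeR R) : R := H' r * \1_(eball r) x.
have mS : measurable [set z : E * measurableTypeR R | enorm z.1 <= z.2].
  rewrite (_ : [set _ | _] = ~` [set z : E * measurableTypeR R | 0 < enorm z.1 - z.2]).
    apply: measurableC; apply: measurable_gt0; apply: measurable_funB => //.
    exact: (measurableT_comp enorm_measurable measurable_fst).
  by apply/seteqP; split => x /=; rewrite subr_gt0 leNgt => /negP.
have iF : integ (mu \x leb)%E (fun z => F z.1 z.2).
  apply: (@integ_prod_le _ _ _ _ _ mu leb F (fun r => `|H' r| * (`|r| ^+ n * evol))).
  - apply: measurable_funM.
      apply: (measurableT_comp (f := H')) => //; exact: continuous_measurable_fun.
    exact: (measurable_indic mS).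
  - move=> r; apply: integZ; apply: integ_fin; [exact: measurable_eball|exact: eball_fin].
  - apply: (cont_csupp_integ (a := a) (b := b) _ _ _).1.
    + move=> r; apply: cvgM; first by apply: cvg_norm; exact: cH'.
      apply: cvgM; last exact: cvg_cst.
      apply: (@continuous_comp _ _ _ (fun r : R => `|r|) (fun r => r ^+ n)); first exact: norm_continuous.
      exact: exprn_continuous.
    + by move=> r ra; rewrite H'a// normr0 mul0r.
    + by move=> r ra; rewrite H'b// normr0 mul0r.
  - move=> r; have [ra|ra] := ltP r a.
      rewrite H'a// normr0 mul0r (Int_ext _ _ (fun=> 0)) ?Int0//.
      by move=> x; rewrite /F H'a// mul0r normr0.
    have r0 := lt_le_trans a0 ra.
    rewrite (Int_ext _ _ (fun x => `|H' r| * \1_(eball r) x)); last first.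
      by move=> x; rewrite normrM [X in _ * X]ger0_norm.
    rewrite IntZ ?Int_eball ?(gtr0_norm r0)//.
    apply: integ_fin; [exact: measurable_eball|exact: eball_fin].
have [_ i1 _ FE] := real_fubini (F := F) iF.
have E1 x : \int[leb]_r F x r = - H (enorm x).
  pose B := Num.max b (enorm x) + 1.
  have bB : b <= B by rewrite /B ler_wpDr// le_max lexx.
  have xB : enorm x < B by rewrite /B ltr_pwDr// le_max lexx orbT.
  transitivity (\int[leb]_(r in `[enorm x, B]) H' r); last first.
    by rewrite (ftc2 xB dH cH') (Hb B bB) sub0r.
  rewrite [RHS]Int_restrict; apply: eq_Rintegral => r _; rewrite /F indic_segE.
  have [rB|rB] := leP r B; last by rewrite H'b ?mul0r// (le_lt_trans bB).
  rewrite andbT; congr (_ * _); rewrite indicE; congr (_%:R); congr nat_of_bool.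
  by apply/idP/idP => [/set_mem|h]; rewrite ?inE.
have E2 (r : R) : \int[mu]_x F x r = evol * (H' r * r ^+ n).
  have [ra|ra] := ltP r a.
    rewrite H'a// mul0r mulr0 (Int_ext _ _ (fun=> 0)) ?Int0//.
    by move=> x; rewrite /F H'a// mul0r.
  have r0 := lt_le_trans a0 ra.
  rewrite IntZ ?Int_eball//; first by ring.
  apply: integ_fin; [exact: measurable_eball|exact: eball_fin].
have iH : integ mu (fun x => H (enorm x)).
  by apply: integ_eq (integN i1) => x; rewrite E1 opprK.
split=> //.
have -> : \int[mu]_x H (enorm x) = - \int[leb]_r \int[mu]_x F x r.
  by rewrite -FE -IntN//; apply: Int_ext => x; rewrite E1 opprK.
have iA : integ leb (fun r => H' r * r ^+ n).
  apply: (cont_csupp_integ (a := a) (b := b) _ _ _).1 => r.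
  - by apply: cvgM; [exact: cH'|exact: crn].
  - by move=> ra; rewrite H'a// mul0r.
  - by move=> ra; rewrite H'b// mul0r.
have iB : integ leb (fun r => H r * r ^+ n.-1).
  apply: (cont_csupp_integ (a := a) (b := b) _ _ _).1 => r.
  - by apply: cvgM; [exact: cH|exact: crn1].
  - by move=> ra; rewrite Ha ?(ltW ra)// mul0r.
  - by move=> ra; rewrite Hb ?(ltW ra)// mul0r.
rewrite (Int_ext leb _ _ E2) IntZ//.
rewrite (Int_ext leb (fun r => H r * r ^+ n.-1 * Ipos r) (fun r => H r * r ^+ n.-1)); last first.
  move=> r; rewrite IposE; have [r0|r0] := ltP 0 r; first by rewrite mulr1.
  by rewrite Ha ?mul0r// (le_trans r0)// ltW.
suff : \int[leb]_r (H r * (n%:R * r ^+ n.-1) + H' r * r ^+ n) = 0.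
  rewrite IntD//; last by apply: integ_eq (integZ n%:R iB) => r; ring.
  rewrite (Int_ext leb _ (fun r => n%:R * (H r * r ^+ n.-1))); last by move=> r; ring.
  rewrite IntZ//; move: (\int[leb]_r _) => u; move: (\int[leb]_r _) => v h.
  have -> : v = - (n%:R * u) by move: h; lra.
  ring.
have dHn r : dd (fun r => H r * r ^+ n) r (H r * (n%:R * r ^+ n.-1) + H' r * r ^+ n).
  by apply: ddM => //; exact: ddX.
have cc : continuous (fun r => H r * (n%:R * r ^+ n.-1) + H' r * r ^+ n).
  move=> r; apply: cvgD; apply: cvgM; [exact: cH| |exact: cH'|exact: crn].
  by apply: cvgM; [exact: cvg_cst|exact: crn1].
have [|r ra|r ra|_ e0] := @cont_csupp_integ (fun r => H r * (n%:R * r ^+ n.-1) + H' r * r ^+ n) a b.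
- exact: cc.
- by rewrite Ha ?(ltW ra)// H'a// !mul0r addr0.
- by rewrite Hb ?(ltW ra)// H'b// !mul0r addr0.
have bB : b <= Num.max a b + 1 by rewrite ler_wpDr// le_max lexx orbT.
have aB : a < Num.max a b + 1 by rewrite ltr_pwDr// le_max lexx.
by rewrite (e0 a _ (lexx _) bB) (ftc2 aB dHn cc) (Hb _ bB) (Ha _ (lexx _)) !mul0r subrr.
Unshelve. all: by end_near. Qed.

(** The value at the origin is 0 whatever H is there, so statements about r > 0 suffice. *)
Definition rad (H : R -> R) (x : E) : R := H (enorm x) * Ipos (enorm x).

Lemma rad_measurable H : cpos H -> mfun (rad H).
Proof.
move=> /cpos_measurable mH.
exact: (measurableT_comp mH enorm_measurable).
Qed.

(** The converse implication assumes that the unit ball has positive volume. That fact comes later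
    from the Gaussian integral, which is computed with the direct implication. *)
Lemma radial_ge0 (H H' : R -> R) : (0 < n)%N -> C1pos H H' -> (forall r, 0 < r -> 0 <= H r) ->
  (halfint (fun r => H r * r ^+ n.-1) -> integ mu (rad H) /\
   \int[mu]_x rad H x = n%:R * evol * \int[leb]_r (H r * r ^+ n.-1 * Ipos r)) /\
  (0 < evol -> integ mu (rad H) -> halfint (fun r => H r * r ^+ n.-1)).
Proof.
move=> n0 CH H0; have [dH cH'] := CH.
have [c [c' [C C0 [[dc cc' c01 clo chi] [_ c1 _]]]]] := cutoffs R.
have test m : integ mu (fun x => rad H x * c m (enorm x)) /\
    \int[mu]_x (rad H x * c m (enorm x)) =
    n%:R * evol * \int[leb]_r (H r * r ^+ n.-1 * Ipos r * c m r).
  have m0 : 0 < m.+1%:R^-1 :> R by pos.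
  have [dHc cHc] := C1pos_cut CH m0 (dc m) (cc' m) (clo m).
  have := radial_test (b := 2 * m.+1%:R) n0 dHc cHc m0.
  have E1 r : H r * Ipos r * c m r = H r * c m r.
    rewrite IposE; have [r0|r0] := ltP 0 r; first by rewrite mulr1.
    by rewrite clo ?mulr0// (le_trans r0)// ltW.
  rewrite (_ : (fun x => rad H x * c m (enorm x)) = fun x : E => H (enorm x) * c m (enorm x)); last first.
    by apply/funext => x; rewrite /rad E1.
  rewrite (Int_ext leb (fun r => H r * c m r * r ^+ n.-1 * Ipos r)
    (fun r => H r * r ^+ n.-1 * Ipos r * c m r)); last first.
    by move=> r; ring.
  apply.
  - by move=> r ra; rewrite clo ?mulr0.
  - by move=> r ra; rewrite chi ?mulr0.
have rad0 x : 0 <= rad H x.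
  rewrite /rad IposE; case: (ltP 0 (enorm x)) => x0; last by rewrite mulr0.
  by rewrite mulr1 H0.
have hr0 r : 0 <= H r * r ^+ n.-1 * Ipos r.
  rewrite IposE; case: (ltP 0 r) => r0; last by rewrite mulr0.
  by rewrite mulr1 mulr_ge0 ?H0// exprn_ge0// ltW.
have c_0 m r : 0 <= c m r by have /andP[] := c01 m r.
have c_1 m r : c m r <= 1 by have /andP[] := c01 m r.
have cvg1 x : rad H x * c m (enorm x) @[m --> \oo] --> rad H x.
  apply: cvg_near_cst; rewrite /rad IposE; have [x0|x0] := ltP 0 (enorm x).
    by apply: filterS (c1 _ x0) => m ->; rewrite !mulr1.
  by apply: nearW => m; rewrite !mulr0 mul0r.
have cvg2 r : H r * r ^+ n.-1 * Ipos r * c m r @[m --> \oo] --> H r * r ^+ n.-1 * Ipos r.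
  apply: cvg_near_cst; rewrite IposE; have [x0|x0] := ltP 0 r.
    by apply: filterS (c1 _ x0) => m ->; rewrite !mulr1.
  by apply: nearW => m; rewrite !mulr0 mul0r.
have cHn : cpos (fun r => H r * r ^+ n.-1).
  move=> r r0; apply: cvgM; [exact: dd_cont (dH _ r0)|exact: exprn_continuous].
have mc m : mfun (c m).
  by apply: continuous_measurable_fun => r; exact: dd_cont (dc m r).
have mHr := cpos_measurable cHn.
have cst0 : 0 <= n%:R * evol by rewrite mulr_ge0// evol_ge0.
have half_rad : halfint (fun r => H r * r ^+ n.-1) -> integ mu (rad H).
  move=> ih; apply: (integ_fatou (C := n%:R * evol * \int[leb]_r (H r * r ^+ n.-1 * Ipos r))
    (fun m => (test m).1) _ _ cvg1).1.
    pos.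
  move=> m; rewrite (test m).2 ler_wpM2l//; apply: Int_le => //.
    apply: (integ_le _ ih) => [|r]; first exact: (measurable_funM mHr (mc m)).
    by rewrite ger0_norm ?(mulr_ge0 (hr0 r))// ler_piMr.
  by move=> r; rewrite ler_piMr.
have ihm m : integ leb (fun r => H r * r ^+ n.-1 * Ipos r * c m r).
  have m0 : 0 < m.+1%:R^-1 :> R by pos.
  have [dHc cHc] := C1pos_cut CH m0 (dc m) (cc' m) (clo m).
  have E1 r : H r * r ^+ n.-1 * Ipos r * c m r = H r * c m r * r ^+ n.-1.
    rewrite IposE; have [r0|r0] := ltP 0 r; first by rewrite mulr1; ring.
    by rewrite clo ?mulr0 ?mul0r// (le_trans r0)// ltW.
  rewrite (funext E1).
  apply: (cont_csupp_integ (a := 0) (b := 2 * m.+1%:R) _ _ _).1 => r.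
  - by apply: cvgM; [exact: dd_cont (dHc r)|exact: exprn_continuous].
  - by move=> ra; rewrite clo ?mulr0 ?mul0r// (le_trans (ltW ra))// ltW.
  - by move=> ra; rewrite chi ?mulr0 ?mul0r// ltW.
have eq_int : integ mu (rad H) -> halfint (fun r => H r * r ^+ n.-1) ->
    \int[mu]_x rad H x = n%:R * evol * \int[leb]_r (H r * r ^+ n.-1 * Ipos r).
  move=> ir ih.
  have h1 : \int[mu]_x (rad H x * c m (enorm x)) @[m --> \oo] --> \int[mu]_x rad H x.
    apply: (dct_cvg _ ir _ cvg1) => [m|m x]; first exact: integ_measurable (test m).1.
    by rewrite ger0_norm ?(mulr_ge0 (rad0 x))// ler_piMr.
  have h2 : n%:R * evol * \int[leb]_r (H r * r ^+ n.-1 * Ipos r * c m r) @[m --> \oo] -->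
      n%:R * evol * \int[leb]_r (H r * r ^+ n.-1 * Ipos r).
    apply: cvgMr; apply: (dct_cvg _ ih _ cvg2) => [m|m r]; first exact: (measurable_funM mHr (mc m)).
    by rewrite ger0_norm ?(mulr_ge0 (hr0 r))// ler_piMr.
  rewrite (_ : (fun m => n%:R * evol * _) = fun m => \int[mu]_x (rad H x * c m (enorm x))) in h2.
    exact: (cvg_unique (@Rhausdorff R) h1 h2).
  by apply/funext => m; rewrite (test m).2.
split.
  by move=> ih; split; [exact: half_rad|apply: eq_int => //; exact: half_rad].
move=> ev ir; apply: (integ_fatou (C := (n%:R * evol)^-1 * \int[mu]_x rad H x)
    ihm _ _ cvg2).1.
  pos.
move=> m; rewrite ler_pdivlMl; last by rewrite mulr_gt0// ltr0n.
rewrite -(test m).2; apply: Int_le => //; first exact: (test m).1.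
by move=> x; rewrite ler_piMr.
Qed.

Lemma ae_neq0 : (0 < n)%N -> \forall x \ae mu, x != 0.
Proof.
move=> n0; have mB : measurable (rV_box (fun=> `[0, 0]%classic) : set E).
  by apply: measurable_rV_box => i; exact: measurable_itv.
exists (rV_box (fun=> `[0, 0]%classic)); split => //.
  rewrite rV_boxE; last by move=> i; exact: measurable_itv.
  by rewrite (bigD1 (Ordinal n0))//= lebesgue_measure_itv/= lte_fin ltxx mul0e.
by move=> x /= /negP; rewrite negbK => /eqP -> i; rewrite /= mxE in_itv/= lexx.
Qed.

End radial.

(** * Volume of the unit ball from the Gaussian integral *)

Section gauss.
Context (R : realType).
Local Notation leb := (@lebesgue_measure R).

Lemma integ_prod_mul d1 d2 (T1 : measurableType d1) (T2 : measurableType d2)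
    (m1 : {sigma_finite_measure set T1 -> \bar R}) (m2 : {sigma_finite_measure set T2 -> \bar R})
    (f : T1 -> R) (g : T2 -> R) : integ m1 f -> integ m2 g ->
  integ (m1 \x m2)%E (fun z => f z.1 * g z.2) /\
  \int[(m1 \x m2)%E]_z (f z.1 * g z.2) = (\int[m1]_x f x) * \int[m2]_y g y.
Proof.
move=> i1 i2; have mf := integ_measurable i1; have mg := integ_measurable i2.
have iF : integ (m1 \x m2)%E (fun z => f z.1 * g z.2).
  apply: (@integ_prod_le _ _ _ _ _ m1 m2 (fun x y => f x * g y) (fun y => (\int[m1]_x `|f x|) * `|g y|)).
  - apply: measurable_funM; first exact: (measurableT_comp mf measurable_fst).
    exact: (measurableT_comp mg measurable_snd).
  - by move=> y; apply: integ_eq (integZ (g y) i1) => x; rewrite mulrC.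
  - exact/integZ/integ_norm.
  - move=> y; rewrite (Int_ext _ _ (fun x => `|g y| * `|f x|)).
      by rewrite IntZ; [rewrite [leRHS]mulrC|exact: integ_norm].
    by move=> x; rewrite normrM mulrC.
split=> //; apply: EFin_inj; rewrite EFin_Int// EFinM !EFin_Int//.
rewrite -(integral12_prod_meas1 iF)/= -EFin_Int//.
transitivity (\int[m1]_x ((\int[m2]_y g y)%:E * (f x)%:E))%E.
  apply: eq_integral => x _; rewrite /fubini_F/= -EFinM mulrC -IntZ// EFin_Int//; exact: integZ.
by rewrite integralZl// [in RHS]muleC -!EFin_Int.
Qed.

Lemma consr_mpres n : mpres (lebesgue_measure \x lebesgue_rV R n)%E (lebesgue_rV R n.+1) (@consr R n).
Proof. by split; first exact: measurable_consr. Qed.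

Lemma Int_prodf n (k : 'I_n -> R -> R) : (forall i, integ leb (k i)) ->
  integ (lebesgue_rV R n) (prodf k) /\
  \int[lebesgue_rV R n]_x prodf k x = \prod_i \int[leb]_t k i t.
Proof.
elim: n k => [|n IH] k ik.
  have E : prodf k = fun=> 1 by apply/funext => x; rewrite /prodf big_ord0.
  rewrite E big_ord0.
  have i1 : integ (lebesgue_rV R 0) (fun=> 1).
    apply: integ_eq (integ_fin measurableT _); first by move=> x; rewrite indicT.
    by rewrite /= diracT ltry.
  have e1 : lebesgue_rV R 0 setT = 1%E by exact: diracT.
  split=> //; rewrite /Rintegral [X in fine X](_ : _ = 1%E)//.
  transitivity (1%:E * lebesgue_rV R 0 setT)%E; last by rewrite mul1e.
  by rewrite -integral_cst.
have [i2 e2] := IH (fun j => k (lift ord0 j)) (fun j => ik _).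
have [i3 e3] := integ_prod_mul (ik ord0) i2.
have E z : prodf k (consr z) = k ord0 z.1 * prodf (fun j => k (lift ord0 j)) z.2.
  by rewrite /prodf big_ord_recl consr0; congr (_ * _); apply: eq_bigr => j _; rewrite consrS.
have mk : mfun (prodf k).
  apply: measurable_prod => i _; apply: (measurableT_comp (f := k i)); last exact: measurable_coord.
  exact: integ_measurable (ik i).
have i4 : integ (lebesgue_rV R n.+1) (prodf k).
  by apply: (mpres_integE (consr_mpres n) mk); apply: integ_eq i3 => z; rewrite E.
split=> //; rewrite -(mpres_Int (consr_mpres n) i4) big_ord_recl -e2 -e3.
by apply: Int_ext => z; rewrite E.
Qed.

Lemma gauss_integ : integ leb (@gauss_fun R) /\ \int[leb]_x gauss_fun x = Num.sqrt pi.
Proof.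
split; first exact: integrableT_gauss.
by rewrite /Rintegral integralT_gauss.
Qed.

Lemma gauss_half : \int[leb]_r (gauss_fun r * Ipos r) = Num.sqrt pi / 2.
Proof.
have ig : leb.-integrable `]0, +oo[ (EFin \o @gauss_fun R).
  by apply: integrableS integrableT_gauss => //; exact: measurable_itv.
by rewrite -Int_restrict Rintegral_itv_obnd_cbnd// /Rintegral integral0y_gauss.
Qed.

Lemma gauss_enorm n (x : 'rV[R]_n) : expR (- enorm x ^+ 2) = prodf (fun=> @gauss_fun R) x.
Proof.
rewrite enorm_sq /prodf /gauss_fun; elim: (index_enum _) => [|i l IH].
  by rewrite !big_nil oppr0 expR0.
by rewrite !big_cons opprD expRD IH.
Qed.

Lemma gauss_C1 : C1pos (@gauss_fun R) (fun r => gauss_fun r * - (2 * r)).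
Proof.
have dg (r : R) : dd (@gauss_fun R) r (gauss_fun r * - (2 * r)).
  by apply: dd_expR; apply: ddN; apply: dd_eq (ddX 2 r) _; rewrite expr1.
split=> r r0; first exact: dg.
apply: cvgM; first exact: dd_cont (dg r).
by apply: cvgN; apply: cvgM; [exact: cvg_cst|exact: cvg_id].
Qed.

Lemma gauss_decay k : exists2 C : R, 0 <= C & forall r, 1 <= r -> gauss_fun r * r ^+ k <= C * r `^ (- 2).
Proof.
have [C C0 HC] := @monomial_le_expR R k.+2; exists C => // r r1.
have r0 : 0 < r by lra.
rewrite powRN powR_mulrn ?(ltW r0)//.
rewrite ler_pdivlMr ?exprn_gt0// -mulrA -exprD addn2.
rewrite /gauss_fun expRN mulrC ler_pdivrMr ?expR_gt0//.
apply: (@le_trans _ _ ((r ^+ 2) ^+ k.+2)); last by apply: HC; exact: sqr_ge0.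
by rewrite -exprM ler_weXn2l// leq_pmull.
Qed.

Lemma gauss_halfint k : halfint (fun r : R => gauss_fun r * r ^+ k).
Proof.
apply: half_dom.
- by move=> r r0; apply: cvgM; [exact: dd_cont (gauss_C1.1 r r0)|exact: exprn_continuous].
- apply: (dom0_le (C := 1) ler01 (@dom0_powR R 0 _)); first by lra.
  move=> r /andP[r0 r1]; rewrite powRr0 normr1 mulr1 ger0_norm.
    by rewrite mulr_ile1 ?gauss_fun_ge0 ?exprn_ge0 ?exprn_ile1 ?(ltW r0)// gauss_fun_le1.
  by rewrite mulr_ge0 ?gauss_fun_ge0// exprn_ge0// ltW.
- have [C C0 HC] := gauss_decay k.
  apply: (domoo_le C0 (@domoo_powR R (- 2) _)); first by lra.
  move=> r r1; rewrite ger0_norm; first by rewrite (ger0_norm (powR_ge0 _ _)) HC.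
  by rewrite mulr_ge0 ?gauss_fun_ge0// exprn_ge0// (le_trans _ r1).
Qed.

(** The Gaussian is both a product and a radial function; equating the two evaluations of its
    integral determines the volume of the ball. *)
Lemma gauss_moment n : (0 < n)%N ->
  n%:R * evol R n * \int[leb]_r (gauss_fun r * r ^+ n.-1 * Ipos r) = Num.sqrt pi ^+ n.
Proof.
move=> n0.
have [h _] := @radial_ge0 R n _ _ n0 gauss_C1 (fun r _ => gauss_fun_ge0 r).
have [ir <-] := h (gauss_halfint n.-1).
have [ig eg] := gauss_integ.
have [ip ep] := @Int_prodf n (fun=> @gauss_fun R) (fun=> ig).
transitivity (\int[lebesgue_rV R n]_x prodf (fun=> @gauss_fun R) x); last first.
  by rewrite ep eg prodr_const card_ord.
apply: Int_ae.
- exact: integ_measurable ir.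
- exact: integ_measurable ip.
apply: filterS (@ae_neq0 R n n0) => x x0.
by rewrite /rad IposE enorm_gt0 x0 mulr1 -gauss_enorm.
Qed.

Lemma gauss_cvg0 k : (gauss_fun r * r ^+ k : R) @[r --> +oo] --> (0 : R).
Proof.
have [C C0 HC] := gauss_decay k.
apply: (@squeeze_cvgr _ _ _ _ (fun=> 0) (fun r => C * r^-1)).
- near=> r; have r1 : 1 <= r by near: r; exact: nbhs_pinfty_ge.
  have r0 := lt_le_trans ltr01 r1.
  rewrite mulr_ge0 ?gauss_fun_ge0 ?exprn_ge0//=.
  rewrite (le_trans (HC _ r1))// ler_wpM2l// -powR_inv1//.
  by rewrite ler_powR//; lra.
- exact: cvg_cst.
- by rewrite -[X in _ --> X](mulr0 C); apply: cvgMr; apply/gtr0_cvgV0;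
    [exact: nbhs_pinfty_gt|exact: cvg_id].
Unshelve. all: by end_near. Qed.

Lemma evol2 : 2 * evol R 2 = 2 * pi.
Proof.
have h := @gauss_moment 2 isT; move: h; rewrite sqr_sqrtr ?pi_ge0//= => <-.
suff -> : \int[leb]_r (gauss_fun r * r ^+ 1 * Ipos r) = 2^-1 by field.
pose F (r : R) := - 2^-1 * gauss_fun r.
have -> : 2^-1 = 0 - - 2^-1 :> R by ring.
apply: (@half_ftc R _ F).
- by move=> r r0; apply: cvgM; [exact: dd_cont (gauss_C1.1 r r0)|exact: exprn_continuous].
- move=> r r0; apply: dd_eq (ddZ _ (gauss_C1.1 r r0)) _.
  by rewrite expr1; field.
- exact: gauss_halfint.
- apply: cvg_at_right_filter.
  have g0 : gauss_fun (0 : R) = 1 by rewrite /gauss_fun expr0n oppr0 expR0.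
  have <- : F 0 = - 2^-1 by rewrite /F g0 mulr1.
  apply: cvgMr; exact: continuous_gauss_fun.
- rewrite -(mulr0 (- 2^-1)); apply: cvgMr.
  by have := gauss_cvg0 0; under eq_fun do rewrite expr0 mulr1.
Qed.

Lemma evol3 : 3 * evol R 3 = 4 * pi.
Proof.
have h := @gauss_moment 3 isT; move: h; rewrite /= => h.
suff E : \int[leb]_r (gauss_fun r * r ^+ 2 * Ipos r) = Num.sqrt pi / 4.
  have s0 : Num.sqrt (pi : R) != 0 by rewrite gt_eqF// sqrtr_gt0 pi_gt0.
  have sp : Num.sqrt (pi : R) ^+ 2 = pi by rewrite sqr_sqrtr ?pi_ge0.
  rewrite E exprS sp in h; apply: (mulfI s0); move: h; lra.
have i0 := gauss_halfint 0; have i2 := gauss_halfint 2.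
have e0 : \int[leb]_r (gauss_fun r * r ^+ 0 * Ipos r) = Num.sqrt pi / 2.
  by rewrite -gauss_half; apply: (Int_ext leb) => r; rewrite expr0 mulr1.
have c0 k : cpos (fun r : R => gauss_fun r * r ^+ k).
  by move=> r r0; apply: cvgM; [exact: dd_cont (gauss_C1.1 r r0)|exact: exprn_continuous].
(* The integrand is the derivative of r exp(-r^2), whose limits at both ends are 0. *)
have : \int[leb]_r ((gauss_fun r * r ^+ 0 - 2 * (gauss_fun r * r ^+ 2)) * Ipos r) = 0 - 0.
  apply: (@half_ftc R _ (fun r => gauss_fun r * r)).
  - by move=> r r0; apply: cvgB; [exact: c0|apply: cvgM; [exact: cvg_cst|exact: c0]].
  - move=> r r0; apply: dd_eq (ddM (gauss_C1.1 r r0) (dd_id r)) _.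
    by rewrite expr0; ring.
  - apply: integ_eq (integB i0 (integZ 2 i2)) => r; ring.
  - apply: cvg_at_right_filter.
    rewrite -[X in _ --> X](mulr0 (gauss_fun 0)).
    by apply: cvgM; [exact: continuous_gauss_fun|exact: cvg_id].
  - by have := gauss_cvg0 1; under eq_fun do rewrite expr1.
rewrite (Int_ext leb _ (fun r => gauss_fun r * r ^+ 0 * Ipos r - 2 * (gauss_fun r * r ^+ 2 * Ipos r))).
  by rewrite IntB// ?IntZ//; [lra|exact: integZ].
by move=> r; ring.
Qed.

End gauss.

(** * Shooting for the radial equation *)

Section half_line_calculus.
Context (R : realType).
Implicit Types f g F d k : R -> R.

Lemma mvt_dd f f' (a b : R) : 0 < a -> a < b -> ddpos f f' ->
  exists2 c, a < c < b & f b - f a = f' c * (b - a).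
Proof.
move=> a0 ab df; have h x : x \in `]a, b[ -> is_derive x 1 f (f' x).
  by rewrite in_itv/= => /andP[ax _]; apply: df; exact: lt_trans ax.
have [|c cab e] := MVT ab h; last by exists c.
apply: continuous_in_subspaceT => x; rewrite inE /= in_itv/= => /andP[ax _].
by apply: (ddpos_cpos df); exact: lt_le_trans ax.
Qed.

Lemma pos_nincr f f' (a b : R) : 0 < a -> a <= b -> ddpos f f' ->
  (forall x, a < x < b -> f' x <= 0) -> f b <= f a.
Proof.
move=> a0; rewrite le_eqVlt => /predU1P[->//|ab] df f'0.
have [c cab e] := mvt_dd a0 ab df.
by rewrite -subr_le0 e mulr_le0_ge0 ?f'0// subr_ge0 ltW.
Qed.

Lemma pos_ndecr f f' (a b : R) : 0 < a -> a <= b -> ddpos f f' ->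
  (forall x, a < x < b -> 0 <= f' x) -> f a <= f b.
Proof.
move=> a0; rewrite le_eqVlt => /predU1P[->//|ab] df f'0.
have [c cab e] := mvt_dd a0 ab df.
by rewrite -subr_ge0 e mulr_ge0 ?f'0// subr_ge0 ltW.
Qed.

Lemma pos_decr f f' (a b : R) : 0 < a -> a < b -> ddpos f f' ->
  (forall x, a < x < b -> f' x < 0) -> f b < f a.
Proof.
move=> a0 ab df f'0.
have [c cab e] := mvt_dd a0 ab df.
by rewrite -subr_lt0 e nmulr_rlt0 ?f'0// subr_gt0.
Qed.

Lemma pos_incr f f' (a b : R) : 0 < a -> a < b -> ddpos f f' ->
  (forall x, a < x < b -> 0 < f' x) -> f a < f b.
Proof.
move=> a0 ab df f'0.
have [c cab e] := mvt_dd a0 ab df.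
by rewrite -subr_gt0 e mulr_gt0 ?f'0// subr_gt0.
Qed.

Lemma cvg0_le f A B (a : R) : 0 < a -> f r @[r --> 0^'+] --> A ->
  (forall r, 0 < r < a -> f r <= B) -> A <= B.
Proof.
move=> a0 fA fB; rewrite -(cvg_lim (@Rhausdorff R) fA); apply: limr_le; first exact: cvgP fA.
near=> r; apply: fB; apply/andP; split; near: r; [exact: nbhs_right_gt|exact: nbhs_right_lt].
Unshelve. all: by end_near. Qed.

Lemma cvg0_ge f A B (a : R) : 0 < a -> f r @[r --> 0^'+] --> A ->
  (forall r, 0 < r < a -> B <= f r) -> B <= A.
Proof.
move=> a0 fA fB; rewrite -(cvg_lim (@Rhausdorff R) fA); apply: limr_ge; first exact: cvgP fA.
near=> r; apply: fB; apply/andP; split; near: r; [exact: nbhs_right_gt|exact: nbhs_right_lt].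
Unshelve. all: by end_near. Qed.

Lemma first_zero f (a b : R) : cpos f -> 0 < a -> (forall r, 0 < r <= a -> 0 < f r) ->
  0 < b -> f b <= 0 -> exists r0, [/\ a < r0 <= b, f r0 = 0 & forall r, 0 < r < r0 -> 0 < f r].
Proof.
move=> cf a0 fa b0 fb.
pose A := [set r | 0 < r /\ f r <= 0].
have Ab : A b by split.
have Alb : lbound A a.
  move=> r [r0 fr]; rewrite leNgt; apply/negP => ra.
  by have := fa r; rewrite r0 (ltW ra) => /(_ isT); rewrite ltNge fr.
have hi : has_inf A by split; [exists b|exists a].
have aA : a <= inf A by apply: lb_le_inf => //; exists b.
have A0 : 0 < inf A := lt_le_trans a0 aA.
have pos r : 0 < r < inf A -> 0 < f r.
  move=> /andP[r0 rA]; rewrite ltNge; apply/negP => fr.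
  by move: rA; rewrite ltNge => /negP; apply; apply: ge_inf => //; exists a.
have f_le : f (inf A) <= 0.
  rewrite leNgt; apply/negP => f0.
  have : \forall r \near inf A, 0 < f r by exact: (cvgr_gt _ (cf _ A0) _ f0).
  move=> [e /= e0 he].
  have [r [r0 fr] re] := inf_adherent e0 hi.
  have rA : inf A <= r by apply: ge_inf; [exists a|].
  have := he r; rewrite /ball_/= ler0_norm ?subr_le0// opprB ltrBlDl => /(_ re).
  by rewrite ltNge fr.
have fA0 : f (inf A) = 0.
  apply/eqP; rewrite eq_le f_le/= leNgt; apply/negP => fn.
  have : \forall r \near inf A, f r < 0 by exact: (cvgr_lt _ (cf _ A0) _ fn).
  move=> [e /= e0 he].
  have m0 : 0 < Num.min e (inf A) / 2 by rewrite divr_gt0// lt_min e0 A0.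
  have me : Num.min e (inf A) / 2 < e.
    by rewrite ltr_pdivrMr// (le_lt_trans (_ : _ <= e))// ?ge_min ?lexx// mulr_natr mulr2n ltrDl.
  have mA : Num.min e (inf A) / 2 < inf A.
    by rewrite ltr_pdivrMr// (le_lt_trans (_ : _ <= inf A))// ?ge_min ?lexx ?orbT// mulr_natr mulr2n ltrDl.
  have := he (inf A - Num.min e (inf A) / 2).
  rewrite /ball_/= opprB addrC subrK gtr0_norm// => /(_ me).
  have := pos (inf A - Num.min e (inf A) / 2).
  rewrite subr_gt0 mA gtrBl m0 => /(_ isT) h1 h2.
  by have := lt_trans h1 h2; rewrite ltxx.
exists (inf A); split=> //.
rewrite lt_neqAle aA andbT (ge_inf _ Ab) ?andbT; last by exists a.
by apply/negP => /eqP aE; have := fa a; rewrite a0 lexx => /(_ isT); rewrite aE fA0 ltxx.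
Qed.

Definition lint f := forall b : R, integ leb (fun r => f r * \1_(`]0, b]%classic) r).
(** The primitive from the origin, as a Lebesgue integral because the integrand may be singular at
    0. *)
Definition I0 f (r : R) : R := \int[leb]_t (f t * \1_(`]0, r]%classic) t).

Lemma indic_ocE (b r : R) : \1_(`]0, b]%classic : set R) r = (0 < r <= b)%R%:R :> R.
Proof.
by rewrite indicE; congr (_%:R); congr nat_of_bool;
  apply/idP/idP => [/set_mem|h]; [rewrite /= in_itv|rewrite inE /= in_itv/= h].
Qed.

Lemma cpos_lint_measurable f (b : R) : cpos f ->
  mfun (fun r => f r * \1_(`]0, b]%classic) r).
Proof.
move=> /cpos_measurable mf.
rewrite (_ : (fun r => _) = fun r => f r * Ipos r * \1_(`]0, b]%classic) r).
  by apply: measurable_funM => //; exact: measurable_indic.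
apply/funext => r; rewrite -mulrA; congr (_ * _); rewrite IposE indic_ocE.
by case: (0 < r); rewrite ?mul1r ?mul0r.
Qed.

Lemma lintD f g : lint f -> lint g -> lint (fun r => f r + g r).
Proof. by move=> h1 h2 b; apply: integ_eq (integD (h1 b) (h2 b)) => r; rewrite mulrDl. Qed.

Lemma lintZ (c : R) f : lint f -> lint (fun r => c * f r).
Proof. by move=> h1 b; apply: integ_eq (integZ c (h1 b)) => r; rewrite mulrA. Qed.

Lemma lint_eq f g : (forall r, 0 < r -> f r = g r) -> lint g -> lint f.
Proof.
move=> fg h b; apply: integ_eq (h b) => r; rewrite indic_ocE.
by case: ltP => r0; rewrite ?mulr0//= fg.
Qed.

Lemma lint_le f g : (forall b, mfun (fun r => f r * \1_(`]0, b]%classic) r)) ->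
  lint g -> (forall r, 0 < r -> `|f r| <= g r) -> lint f.
Proof.
move=> mf ig fg b; apply: (@integ_le _ _ _ leb _ _ (mf b) (ig b)) => r.
rewrite indic_ocE; case: ltP => r0 /=; last by rewrite !mulr0 normr0.
by case: (r <= b); rewrite ?mulr1 ?fg// !mulr0 normr0.
Qed.

Lemma I0D f g r : lint f -> lint g -> I0 (fun t => f t + g t) r = I0 f r + I0 g r.
Proof.
by move=> h1 h2; rewrite /I0 -IntD; [|exact: h1|exact: h2];
  apply: (Int_ext leb) => t; rewrite mulrDl.
Qed.

Lemma I0Z (c : R) f r : lint f -> I0 (fun t => c * f t) r = c * I0 f r.
Proof.
by move=> h1; rewrite /I0 -IntZ; [|exact: h1];
  apply: (Int_ext leb) => t; rewrite mulrA.
Qed.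

Lemma I0_ext f g r : (forall t, 0 < t -> t <= r -> f t = g t) -> I0 f r = I0 g r.
Proof.
move=> fg; apply: (Int_ext leb) => t; rewrite indic_ocE.
by case: ltP => t0 /=; rewrite//; case: (leP t r) => tr; rewrite ?mulr0// fg.
Qed.

Lemma I0_le f g r : lint f -> lint g -> (forall t, 0 < t -> t <= r -> f t <= g t) ->
  I0 f r <= I0 g r.
Proof.
move=> h1 h2 fg; apply: Int_le; [exact: h1|exact: h2|move=> t; rewrite indic_ocE].
by case: ltP => t0 /=; rewrite//; case: (leP t r) => tr; rewrite ?mulr0// !mulr1 fg.
Qed.

Lemma I0_ge0 f r : (forall t, 0 < t -> t <= r -> 0 <= f t) -> 0 <= I0 f r.
Proof.
move=> f0; apply: Int_ge0 => t; rewrite indic_ocE.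
by case: ltP => t0 /=; rewrite//; case: (leP t r) => tr; rewrite ?mulr0// mulr1 f0.
Qed.

Lemma I0_abs f g r : lint f -> lint g -> (forall t, 0 < t -> t <= r -> `|f t| <= g t) ->
  `|I0 f r| <= I0 g r.
Proof.
move=> h1 h2 fg; apply: Int_abs_leP; [exact: h1|exact: h2|move=> t; rewrite indic_ocE].
case: ltP => t0 /=; rewrite ?mulr0 ?normr0//.
by case: (leP t r) => tr; rewrite ?mulr0 ?normr0// !mulr1 fg.
Qed.

Lemma I0_mono f (r r' : R) : lint f -> (forall t, 0 < t -> 0 <= f t) -> r <= r' ->
  I0 f r <= I0 f r'.
Proof.
move=> h1 f0 rr; apply: Int_le; [exact: h1|exact: h1|move=> t; rewrite !indic_ocE].
case: ltP => t0 /=; rewrite//; case: (leP t r) => tr.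
  by rewrite (le_trans tr rr).
by rewrite mulr0 mulr_ge0// f0.
Qed.

Lemma I0_cpos f : lint f -> cpos (I0 f).
Proof.
move=> lf r r0.
have r2 : r < r + 1 by lra.
pose h t := f t * \1_(`]0, r + 1]%classic) t.
have ih : leb.-integrable `[0, r + 1] (EFin \o h).
  by apply: integrableS (lf (r + 1)) => //; exact: measurable_itv.
have b0 : 0 <= r + 1 by pos.
have /(_ b0 ih) := @parameterized_integral_continuous R 0 (r + 1) h.
have b0' : 0 < r + 1 by pos.
move=> /(continuous_within_itvP _ b0')[+ _ _] => /(_ r); rewrite in_itv/= r0 r2 => /(_ isT) ch.
have E : \forall x \near r, parameterized_integral leb 0 x h = I0 f x.
  near=> x; rewrite /parameterized_integral Int_restrict; apply: (Int_ext leb) => t.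
  have x1 : x < r + 1 by near: x; exact: lt_nbhsl.
  rewrite /h indic_ocE indic_segE indic_ocE -mulrA; congr (_ * _).
  have [t0|t0] := ltP 0 t; last by rewrite mul0r.
  rewrite (ltW t0)/=; have [tx|xt] := leP t x; last by rewrite mulr0.
  by rewrite (le_trans tx (ltW x1)) mulr1.
rewrite /prop_for /continuous_at -(nbhs_singleton E).
apply: cvg_trans ch; apply: near_eq_cvg; by apply: filterS E => x ->.
Unshelve. all: by end_near. Qed.

Lemma I0_dd f : lint f -> cpos f -> ddpos (I0 f) f.
Proof.
move=> lf cf r r0; have r2 : r < r + 1 by rewrite ltrDl.
have [] := @continuous_FTC1 R f (BRight 0) r (r + 1) r2.
- apply: (iffRL (integ_restrict f (measurable_itv `]0, r + 1]))); exact: lf.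
- pos.
- exact: cf.
move=> h1 h2.
have E : (fun y => \int[leb]_(t in `]0, y]) f t) = I0 f.
  by apply/funext => y; rewrite Int_restrict.
by rewrite E in h1 h2; split; rewrite -?derive1E.
Qed.

Lemma I0_cvg0 f : lint f -> I0 f r @[r --> 0^'+] --> (0 : R).
Proof.
move=> lf; apply/cvg_at_rightP => u [u0 cu].
have [M HM] : exists M, forall m, u m <= M.
  have /cvgP/cvg_seq_bounded[M [_ HM]] := cu.
  by exists (M + 1) => m; apply: (le_trans (ler_norm _)); apply: HM; rewrite ?ltrDl.
rewrite -(Int0 leb).
apply: (@dct_cvg _ _ _ leb (fun m t => f t * \1_(`]0, u m]%classic) t) _
  (fun t => `|f t * \1_(`]0, M]%classic) t|)).
- by move=> m; exact: integ_measurable (lf (u m)).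
- exact/integ_norm/lf.
- move=> m t; rewrite !normrM ler_wpM2l// !indic_ocE.
  case: (ltP 0 t) => t0 //=; case: (leP t (u m)) => tu; last by rewrite normr0.
  by rewrite (le_trans tu (HM m)).
- move=> t; apply: cvg_near_cst; have [t0|t0] := ltP 0 t; last first.
    by apply: nearW => m; rewrite indic_ocE ltNge t0 mulr0.
  near=> m; have um : u m < t by near: m; exact: (cvgr_lt _ cu).
  by rewrite indic_ocE leNgt um andbF mulr0.
Unshelve. all: by end_near. Qed.

(** The kernel k may be unbounded at 0. The usual nonincreasing product is therefore compared with
    its limit A at 0+ in place of an initial value. *)
Lemma gronwall d k (A b : R) : cpos d -> cpos k -> lint k -> lint (fun t => k t * d t) ->
  (forall r, 0 < r -> 0 <= k r) ->
  (forall r, 0 < r -> r <= b -> d r <= A + I0 (fun t => k t * d t) r) ->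
  forall r, 0 < r -> r <= b -> d r <= A * expR (I0 k r).
Proof.
move=> cd ck lk lkd k0 dA r r0 rb.
have ckd : cpos (fun t => k t * d t) by move=> t t0; apply: cvgM; [exact: ck|exact: cd].
pose Y t := (A + I0 (fun t => k t * d t) t) * expR (- I0 k t).
have dY : ddpos Y (fun t => (A + I0 (fun t => k t * d t) t) * (expR (- I0 k t) * - k t) +
   (0 + k t * d t) * expR (- I0 k t)).
  move=> t t0; apply: ddM; first by apply: ddD; [exact: dd_cst|exact: (I0_dd lkd ckd)].
  by apply: dd_expR; apply: ddN; exact: (I0_dd lk ck).
have YA : Y t @[t --> 0^'+] --> A.
  have -> : A = (A + 0) * expR (- 0) by rewrite addr0 oppr0 expR0 mulr1.
  apply: cvgM; first by apply: cvgD; [exact: cvg_cst|exact: I0_cvg0].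
  apply: continuous_cvg; first exact: continuous_expR.
  by apply: cvgN; exact: I0_cvg0.
have YrA : Y r <= A.
  apply: (cvg0_ge r0 YA) => t /andP[t0 tr]; apply: (pos_nincr t0 (ltW tr) dY) => x /andP[tx xr].
  have x0 := lt_trans t0 tx.
  have -> : forall a e kk dd : R, a * (e * - kk) + (0 + kk * dd) * e = (kk * e) * (dd - a).
    by move=> a e kk dd; ring.
  rewrite mulr_ge0_le0 ?mulr_ge0 ?k0// subr_le0.
  by apply: dA => //; rewrite (le_trans (ltW xr)).
apply: (le_trans (dA r r0 rb)).
by rewrite -ler_pdivrMr ?expR_gt0// -expRN.
Qed.

End half_line_calculus.

Section power_lipschitz.
Context (R : realType).

Lemma powR_add (x a b : R) : 0 < x -> x `^ (a + b) = x `^ a * x `^ b.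
Proof. by move=> x0; rewrite powRD// (gt_eqF x0) implybT. Qed.

(** Young's inequality with the exponents p and p/(p-1), applied to y and x^(p-1). *)
Lemma powR_tangent (p x y : R) : 1 <= p -> 0 <= y -> 0 <= x ->
  x `^ p - y `^ p <= p * x `^ (p - 1) * (x - y).
Proof.
move=> p1 y0 x0; have [->|pn1] := eqVneq p 1.
  by rewrite subrr powRr0 !mulr1 !powRr1// mul1r.
have p1' : 1 < p by lra.
have p0 : 0 < p := lt_trans ltr01 p1'.
have pn0 : p != 0 by pos.
have pm0 : p - 1 != 0 by rewrite subr_eq0.
have [->|xn0] := eqVneq x 0.
  rewrite [0 `^ p]powR0// [0 `^ (p - 1)]powR0 ?subr_eq0// mulr0 mul0r.
  by rewrite sub0r oppr_le0 powR_ge0.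
have q0 : 0 < p / (p - 1) by rewrite divr_gt0// subr_gt0.
have pq : p^-1 + (p / (p - 1))^-1 = 1.
  by field; rewrite ?pm0.
have := conjugate_powR y0 (powR_ge0 x (p - 1)) p0 q0 pq.
rewrite -powRrM (_ : (p - 1) * (p / (p - 1)) = p); last by field; rewrite subr_eq0 pn1.
rewrite (_ : x `^ p / (p / (p - 1)) = (p - 1) / p * x `^ p); last first.
  by field; rewrite gt_eqF//= subr_eq0 pn1.
move=> h; have : p * (y * x `^ (p - 1)) <= p * (y `^ p / p + (p - 1) / p * x `^ p).
  nra.
rewrite (_ : p * (y `^ p / p + (p - 1) / p * x `^ p) = y `^ p + (p - 1) * x `^ p); last first.
  by field; rewrite gt_eqF.
have -> : x `^ p = x * x `^ (p - 1).
  rewrite [LHS](_ : _ = x `^ (p - 1 + 1)); last by rewrite subrK.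
  by rewrite powRD; [rewrite powRr1// mulrC|rewrite xn0 implybT].
nra.
Qed.

Lemma powR_lip (p b x y : R) : 1 <= p -> 0 <= y -> 0 <= x -> y <= b -> x <= b ->
  `|x `^ p - y `^ p| <= p * b `^ (p - 1) * `|x - y|.
Proof.
move=> p1; wlog yx : x y / y <= x => [H|] y0 x0 yb xb.
  have [yx|xy] := leP y x; first exact: H.
  by rewrite distrC (distrC x); apply: H => //; exact: ltW.
have p0 : 0 <= p := le_trans ler01 p1.
rewrite !ger0_norm ?subr_ge0//; last by apply: ge0_ler_powR; rewrite ?nnegrE.
apply: (le_trans (powR_tangent p1 y0 x0)).
rewrite ler_wpM2r ?subr_ge0// ler_wpM2l//.
by apply: ge0_ler_powR; rewrite ?nnegrE ?subr_ge0// (le_trans x0).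
Qed.

End power_lipschitz.

(** * The radial equation with prescribed singularity *)

Section singular_ode.
Context (R : realType) (n : nat) (S : R -> R) (a0 om p : R).
Implicit Types G v : R -> R.

Definition wt (r : R) : R := r ^+ n.-1.
(** The integral kernel contributes one factor S and the nonlinearity p of them. Integrability of
    this weight at 0 is what restricts p. *)
Definition Phi (r : R) : R := wt r * (1 + `|S r|) `^ (p + 1).

Context (om0 : 0 <= om) (p1 : 1 <= p) (dS : ddpos S (fun r => - (wt r)^-1))
  (Soo : S r @[r --> 0^'+] --> +oo) (lPhi : lint Phi).

Lemma wt_gt0 r : 0 < r -> 0 < wt r. Proof. exact: exprn_gt0. Qed.

Lemma wt_cpos : cpos wt. Proof. by move=> r _; exact: exprn_continuous. Qed.

Lemma S_cpos : cpos S. Proof. exact: ddpos_cpos dS. Qed.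

Lemma S_decr r r' : 0 < r -> r <= r' -> S r' <= S r.
Proof.
move=> r0 rr; apply: (pos_nincr r0 rr dS) => x /andP[rx _].
by rewrite oppr_le0 invr_ge0 ltW// wt_gt0// (lt_trans r0).
Qed.

Lemma aS1 r : 1 <= 1 + `|S r|. Proof. by rewrite lerDl. Qed.

Lemma Phi_cpos : cpos Phi.
Proof.
move=> r r0; apply: cvgM; first exact: wt_cpos.
apply: (@continuous_comp _ _ _ (fun r => 1 + `|S r|) (fun x => x `^ (p + 1))).
  by apply: cvgD; [exact: cvg_cst|apply: cvg_norm; exact: S_cpos].
by apply: cpos_powR; exact: lt_le_trans (aS1 r).
Qed.

Lemma Phi_ge0 r : 0 < r -> 0 <= Phi r.
Proof. by move=> r0; rewrite mulr_ge0// ltW// wt_gt0. Qed.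

(** Admissible sources grow at most like S^p at the origin. Only measurability is required, since
    the limit of the iteration is known to be continuous only afterwards. *)
Definition adm (C : R) G := mfun G /\
  forall r, 0 < r -> `|G r| <= C * (1 + `|S r|) `^ p.

Lemma aS_pow r : (1 + `|S r|) `^ (p + 1) = (1 + `|S r|) `^ p * (1 + `|S r|).
Proof.
have hn : 1 + `|S r| != 0 by pos.
by rewrite powRD ?hn ?implybT// powRr1// ltW.
Qed.

Lemma adm_C0 C G : adm C G -> 0 <= C.
Proof.
move=> [_ /(_ 1 ltr01)] /(le_trans (normr_ge0 _)); rewrite pmulr_lge0// powR_gt0.
Qed.

Lemma cpos_seg_measurable (f : R -> R) (b : R) : mfun f ->
  mfun (fun r => f r * \1_(`]0, b]%classic) r).
Proof. by move=> mf; apply: measurable_funM => //; exact: measurable_indic. Qed.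

Lemma adm_kernel C G f c t : adm C G -> 0 < t -> `|f| <= c * (1 + `|S t|) ->
  `|wt t * f * G t| <= c * C * Phi t.
Proof.
move=> [_ GC] t0 fc; have w0 := ltW (wt_gt0 t0); rewrite !normrM (ger0_norm w0) /Phi aS_pow.
rewrite [leRHS](_ : _ = wt t * (c * (1 + `|S t|)) * (C * (1 + `|S t|) `^ p)); last by ring.
by rewrite ler_pM ?GC ?mulr_ge0// ler_wpM2l.
Qed.

Lemma adm_lint C G f c : adm C G -> cpos f ->
  (forall r, 0 < r -> `|f r| <= c * (1 + `|S r|)) -> lint (fun r => wt r * f r * G r).
Proof.
move=> aG cf fc; have [mG _] := aG.
apply: (lint_le _ (lintZ (c * C) lPhi)) => [b|r r0].
  have -> : (fun r => wt r * f r * G r * \1_(`]0, b]%classic) r) =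
     fun r => wt r * f r * Ipos r * (G r * \1_(`]0, b]%classic) r).
    apply/funext => r; rewrite indic_ocE IposE; case: ltP => r0; rewrite ?mulr0//= mulr1.
    by rewrite -!mulrA.
  apply: measurable_funM; last exact: cpos_seg_measurable.
  by apply: cpos_measurable => r r0; apply: cvgM; [exact: wt_cpos|exact: cf].
exact: adm_kernel (fc _ r0).
Qed.

Definition Jof G := I0 (fun t => wt t * 1 * G t).
Definition Pof G := I0 (fun t => wt t * S t * G t).
(** Variation of constants: by [TofE] this is S + a0 plus the integral of wt(t) (S(t) - S(r)) G(t)
    over ]0, r]. The split into [Pof] and S times [Jof] is made for differentiation; the factor 1 in
    [Jof] makes both of them instances of [adm_lint]. *)
Definition Tof G r := (S r + a0 + Pof G r - S r * Jof G r) * Ipos r.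

Lemma adm_J C G : adm C G -> lint (fun t => wt t * 1 * G t).
Proof.
move=> aG; apply: (adm_lint (f := fun=> 1) (c := 1) aG) => [r r0|r r0].
  exact: cvg_cst.
by rewrite normr1 mul1r aS1.
Qed.

Lemma adm_P C G : adm C G -> lint (fun t => wt t * S t * G t).
Proof.
move=> aG; apply: (adm_lint (c := 1) aG S_cpos) => r r0.
lra.
Qed.

Lemma TofE C G r : adm C G -> 0 < r ->
  Tof G r = S r + a0 + I0 (fun t => wt t * (S t - S r) * G t) r.
Proof.
move=> aG r0; rewrite /Tof IposE r0 mulr1 -addrA; congr (_ + _).
rewrite /Jof -mulNr -I0Z; last exact: adm_J aG.
rewrite /Pof -I0D; [|exact: adm_P aG|exact/lintZ/(adm_J aG)].
by apply: I0_ext => t _ _; ring.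
Qed.

Lemma adm_K C G r : adm C G -> lint (fun t => wt t * (S t - S r) * G t).
Proof.
move=> aG; apply: (lint_eq _ (lintD (adm_P aG) (lintZ (- S r) (adm_J aG)))) => t t0.
by ring.
Qed.

(** The kernel is nonnegative because S is nonincreasing; this is what permits a monotone
    iteration. *)
Lemma Tof_mono C1 C2 G1 G2 r : adm C1 G1 -> adm C2 G2 -> (forall t, 0 < t -> G1 t <= G2 t) ->
  0 < r -> Tof G1 r <= Tof G2 r.
Proof.
move=> a1 a2 G12 r0; rewrite (TofE a1 r0) (TofE a2 r0) lerD2l.
apply: I0_le => [||t t0 tr]; [exact: adm_K a1|exact: adm_K a2|].
rewrite ler_wpM2l ?G12// mulr_ge0 ?(ltW (wt_gt0 t0))// subr_ge0.
exact: S_decr.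
Qed.

Lemma Tof_cpos0 C G : adm C G -> cpos (fun r => S r + a0 + Pof G r - S r * Jof G r).
Proof.
move=> aG r r0; apply: cvgB.
  apply: cvgD; last by apply: (I0_cpos (adm_P aG)).
  by apply: cvgD; [exact: S_cpos|exact: cvg_cst].
by apply: cvgM; [exact: S_cpos|exact: (I0_cpos (adm_J aG))].
Qed.

Lemma Tof_near G (r : R) : 0 < r -> \forall t \near r, S t + a0 + Pof G t - S t * Jof G t = Tof G t.
Proof.
move=> r0; near=> t; have t0 : 0 < t by near: t; exact: lt_nbhsr.
by rewrite /Tof IposE t0 mulr1.
Unshelve. all: by end_near. Qed.

Lemma Tof_cpos C G : adm C G -> cpos (Tof G).
Proof.
move=> aG r r0; have E := @Tof_near G r r0.
rewrite /prop_for /continuous_at -(nbhs_singleton E).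
apply: cvg_trans (Tof_cpos0 aG r0); apply: near_eq_cvg; by apply: filterS E => t ->.
Qed.

Lemma Tof_measurable C G : adm C G -> mfun (Tof G).
Proof. by move=> aG; apply: cpos_measurable; exact: Tof_cpos0 aG. Qed.

Lemma Jof_dd C G : adm C G -> cpos G -> ddpos (Jof G) (fun r => wt r * G r).
Proof.
move=> aG cG r r0; have := I0_dd (adm_J aG) _ r0.
rewrite mulr1; apply => t t0; apply: cvgM; last exact: cG.
by apply: cvgM; [exact: wt_cpos|exact: cvg_cst].
Qed.

Lemma Tof_dd C G : adm C G -> cpos G -> ddpos (Tof G) (fun r => - (1 - Jof G r) / wt r).
Proof.
move=> aG cG r r0; apply: (dd_near (@Tof_near G r r0)).
have dP : dd (Pof G) r (wt r * S r * G r).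
  apply: (I0_dd (adm_P aG) _ r0) => t t0; apply: cvgM; last exact: cG.
  by apply: cvgM; [exact: wt_cpos|exact: S_cpos].
apply: dd_eq (ddB (ddD (ddD (dS r0) (dd_cst a0 r)) dP) (ddM (dS r0) (Jof_dd aG cG r0))) _.
by ring.
Qed.

Lemma Jof_cvg0 C G : adm C G -> Jof G r @[r --> 0^'+] --> (0 : R).
Proof. by move=> aG; exact: I0_cvg0 (adm_J aG). Qed.

Lemma S_near0 (A : R) : exists2 r0 : R, 0 < r0 & forall r, 0 < r <= r0 -> A <= S r.
Proof.
have /cvgryPge/(_ A) := Soo; move=> [e /= e0 he].
exists (e / 2); first by rewrite divr_gt0.
move=> r /andP[r0 re]; apply: he => //=.
by rewrite sub0r normrN gtr0_norm// (le_lt_trans re)// ltr_pdivrMr// mulr_natr mulr2n ltrDl.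
Qed.

Lemma Tof_cvg C G : adm C G -> (Tof G r - S r) @[r --> 0^'+] --> a0.
Proof.
move=> aG; have C0 := adm_C0 aG; have [r1 r10 Sr1] := S_near0 0.
have h : (I0 (fun t => C * Phi t) r) @[r --> 0^'+] --> (0 : R) := I0_cvg0 (lintZ C lPhi).
apply: (@squeeze_cvgr _ _ _ _ (fun r => a0 - I0 (fun t => C * Phi t) r)
   (fun r => a0 + I0 (fun t => C * Phi t) r)).
- near=> r; have r0 : 0 < r by near: r; exact: nbhs_right_gt.
  have rr1 : r <= r1 by apply: ltW; near: r; exact: nbhs_right_lt.
  rewrite (TofE aG r0).
  have -> : S r + a0 + I0 (fun t => wt t * (S t - S r) * G t) r - S r =
     a0 + I0 (fun t => wt t * (S t - S r) * G t) r by ring.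

  have : `|I0 (fun t => wt t * (S t - S r) * G t) r| <= I0 (fun t => C * Phi t) r.
    apply: I0_abs => [||t t0 tr]; [exact: adm_K aG|exact: lintZ|].
    rewrite -[C]mul1r; apply: (adm_kernel aG t0); rewrite mul1r.
    have St := S_decr t0 tr; have Sr : 0 <= S r by rewrite Sr1// r0.
    rewrite ger0_norm ?subr_ge0// ger0_norm//; move: Sr; lra.
  by rewrite ler_norml => /andP[h1 h2]; apply/andP; split; [move: h1; lra|move: h2; lra].
- by rewrite -[X in _ --> X]subr0; apply: cvgB => //; exact: cvg_cst.
- by rewrite -[X in _ --> X]addr0; apply: cvgD => //; exact: cvg_cst.
Unshelve. all: by end_near. Qed.

(** The expected upper bound S + a0 + 1 near 0, frozen beyond r2. Cutting the unknown at this level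
    makes every source admissible; for the shooting parameter finally selected the cut turns out to
    be inactive. *)
Definition Bt (r2 r : R) : R := (S (Num.min r r2) + a0 + 1) * Ipos r.
Definition CB (r2 : R) : R := 1 + `|a0| + `|S r2|.
(** An extension of om u + M u^p from u >= 0 to all real u: nondecreasing, Lipschitz on half-lines u
    <= b, bounded below by -om. Solutions that become negative are thus still defined for all r, as
    shooting requires. *)
Definition hM (M u : R) : R := om * Num.max u (-1) + M * (Num.max u 0) `^ p.
Definition gt (r2 M : R) v (r : R) : R := hM M (Num.min (v r) (Bt r2 r)).

Lemma lip_cont (f : R -> R) : (forall b : R, exists2 C : R, 0 <= C &
  forall x y, x <= b -> y <= b -> `|f x - f y| <= C * `|x - y|) -> continuous f.
Proof.
move=> h x; have [C C0 HC] := h (x + 1).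
apply/cvgrPdist_le => e e0.
have C1 : 0 < C + 1 by pos.
near=> y.
have yx : y <= x + 1 by apply: ltW; near: y; apply: lt_nbhsl; rewrite ltrDl.
have h1 : `|x - y| <= e / (C + 1).
  by near: y; apply: (@cvgr_dist_le _ R _ (nbhs x) _ id x cvg_id); rewrite divr_gt0.
rewrite (le_trans (HC x y _ yx))//; first by rewrite lerDl.
apply: (@le_trans _ _ ((C + 1) * (e / (C + 1)))); last by rewrite mulrC divfK// gt_eqF.
by rewrite ler_pM// lerDl.
Unshelve. all: by end_near. Qed.

Lemma max_lip (x y c : R) : `|Num.max x c - Num.max y c| <= `|x - y|.
Proof.
have := ler_norm (x - y); have := ler_norm (y - x); rewrite distrC ler_norml.
by case: (leP x c); case: (leP y c) => *; apply/andP; split; lra.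
Qed.

Lemma min_lip (x y c : R) : `|Num.min x c - Num.min y c| <= `|x - y|.
Proof.
have := ler_norm (x - y); have := ler_norm (y - x); rewrite distrC ler_norml.
by case: (leP x c); case: (leP y c) => *; apply/andP; split; lra.
Qed.

Lemma hM_lip M b u u' : 0 <= M -> 1 <= b -> u <= b -> u' <= b ->
  `|hM M u - hM M u'| <= (om + M * (p * b `^ (p - 1))) * `|u - u'|.
Proof.
move=> M0 b1 ub ub'; rewrite /hM.
have -> : om * Num.max u (-1) + M * (Num.max u 0) `^ p - (om * Num.max u' (-1) + M * (Num.max u' 0) `^ p) =
  om * (Num.max u (-1) - Num.max u' (-1)) + M * ((Num.max u 0) `^ p - (Num.max u' 0) `^ p) by ring.
have b0 : 0 <= b := le_trans ler01 b1.
rewrite (le_trans (ler_normD _ _))// mulrDl lerD//.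
  by rewrite normrM (ger0_norm om0) ler_wpM2l// max_lip.
rewrite normrM (ger0_norm M0) -mulrA ler_wpM2l//.
apply: (@le_trans _ _ (p * b `^ (p - 1) * `|Num.max u 0 - Num.max u' 0|)).
  by apply: powR_lip; rewrite ?le_max ?lexx ?orbT// ge_max ?ub ?ub' b0.
by rewrite ler_wpM2l ?max_lip// mulr_ge0 ?powR_ge0// (le_trans ler01).
Qed.

Lemma hM_cont M : 0 <= M -> continuous (hM M).
Proof.
move=> M0; apply: lip_cont => b.
have b1 : 1 <= Num.max b 1 by rewrite le_max lexx orbT.
exists (om + M * (p * (Num.max b 1) `^ (p - 1))).
  by rewrite addr_ge0// !mulr_ge0 ?powR_ge0// (le_trans ler01).
by move=> x y xb yb; apply: hM_lip => //; rewrite le_max ?xb ?yb.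
Qed.

Lemma hM_mono M u u' : 0 <= M -> u <= u' -> hM M u <= hM M u'.
Proof.
move=> M0 uu; have mm c : Num.max u c <= Num.max u' c by rewrite ge_max !le_max uu lexx orbT.
rewrite /hM lerD// ler_wpM2l//.
by apply: ge0_ler_powR; rewrite ?nnegrE ?(le_trans ler01 p1)// le_max lexx orbT.
Qed.

Lemma hM_ge M u : 0 <= M -> - om <= hM M u.
Proof.
move=> M0; rewrite /hM -[leLHS]addr0 lerD//; last by rewrite mulr_ge0// powR_ge0.
by rewrite -(mulrN1 om) ler_wpM2l// le_max lexx orbT.
Qed.

Lemma hM_abs M b u : 0 <= M -> 1 <= b -> u <= b -> `|hM M u| <= om * b + M * b `^ p.
Proof.
move=> M0 b1 ub; have b0 : 0 <= b := le_trans ler01 b1.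
rewrite /hM (le_trans (ler_normD _ _))// !normrM (ger0_norm om0) (ger0_norm M0).
rewrite lerD// ler_wpM2l//.
  rewrite ler_norml le_max; apply/andP; split; first by rewrite lerN2 b1 orbT.
  by rewrite ge_max ub/= (le_trans _ b0)// oppr_le0.
rewrite ger0_norm ?powR_ge0//; apply: ge0_ler_powR; rewrite ?nnegrE ?(le_trans ler01 p1)//.
  by rewrite le_max lexx orbT.
by rewrite ge_max ub.
Qed.

Section truncated.
Context (r2 : R) (r20 : 0 < r2) (Br2 : 0 <= S r2 + a0).
Local Notation Bt := (Bt r2).
Local Notation CB := (CB r2).
Local Notation gt := (gt r2).

Lemma min_gt0 r : 0 < r -> 0 < Num.min r r2.
Proof. by move=> r0; rewrite lt_min r0. Qed.

Lemma BtE r : 0 < r -> Bt r = S (Num.min r r2) + a0 + 1.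
Proof. by move=> r0; rewrite /Bt IposE r0 mulr1. Qed.

Lemma Bt_ge1 r : 0 < r -> 1 <= Bt r.
Proof.
move=> r0; rewrite BtE// lerDr.
have := S_decr (min_gt0 r0) (_ : Num.min r r2 <= r2).
by rewrite ge_min lexx orbT => /(_ isT); move: Br2; lra.
Qed.

Lemma CB_ge1 : 1 <= CB. Proof. by rewrite /CB -addrA lerDl addr_ge0. Qed.

Lemma Bt_le r : 0 < r -> Bt r <= CB * (1 + `|S r|).
Proof.
move=> r0; rewrite BtE// /CB.
have h1 := ler_norm a0; have h2 := normr_ge0 a0; have h3 := normr_ge0 (S r2).
have h4 := ler_norm (S r); have h5 := normr_ge0 (S r); have h6 := ler_norm (S r2).
by rewrite minEle; case: (leP r r2) => _; nra.
Qed.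

Lemma Bt_cpos : cpos Bt.
Proof.
have c0 : cpos (fun r => S (Num.min r r2) + a0 + 1).
  move=> r r0; apply: cvgD; last exact: cvg_cst.
  apply: cvgD; last exact: cvg_cst.
  apply: (@continuous_comp _ _ _ (fun r => Num.min r r2) S).
    by apply: continuous_min; [exact: cvg_id|exact: cvg_cst].
  by apply: S_cpos; exact: min_gt0.
move=> r r0; have E : \forall t \near r, S (Num.min t r2) + a0 + 1 = Bt t.
  by near=> t; rewrite BtE//; near: t; exact: lt_nbhsr.
rewrite /prop_for /continuous_at -(nbhs_singleton E).
apply: cvg_trans (c0 r r0); apply: near_eq_cvg; by apply: filterS E => t ->.
Unshelve. all: by end_near. Qed.

Lemma Bt_measurable : mfun Bt.
Proof.
have := cpos_measurable Bt_cpos; congr measurable_fun; apply/funext => r.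
by rewrite /Bt; rewrite IposE; case: (0 < r); rewrite ?mulr1// !mulr0.
Qed.

Lemma Bt_decr r r' : 0 < r -> r <= r' -> Bt r' <= Bt r.
Proof.
move=> r0 rr; rewrite !BtE ?(lt_le_trans r0)// !lerD2r.
apply: S_decr; first exact: min_gt0.
by rewrite le_min !ge_min rr lexx orbT.
Qed.

Lemma gt_measurable M v : 0 <= M -> mfun v -> mfun (gt M v).
Proof.
move=> M0 mv; apply: (measurableT_comp (f := hM M)).
  by apply: continuous_measurable_fun; exact: hM_cont.
by apply: measurable_minr => //; exact: Bt_measurable.
Qed.

Definition C1 (M : R) : R := om * CB + M * CB `^ p.

Lemma aS_le_pow r : 1 + `|S r| <= (1 + `|S r|) `^ p.
Proof. by rewrite -{1}(powRr1 (le_trans ler01 (aS1 r))) ler_powR// aS1. Qed.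

Lemma adm_g M v : 0 <= M -> mfun v -> adm (C1 M) (gt M v).
Proof.
move=> M0 mv; split; first exact: gt_measurable.
move=> r r0; rewrite /gt.
have ub : Num.min (v r) (Bt r) <= Bt r by rewrite ge_min lexx orbT.
apply: (le_trans (hM_abs M0 (Bt_ge1 r0) ub)).
have B0 : 0 <= Bt r by rewrite (le_trans ler01)// Bt_ge1.
have C0 : 0 <= CB := le_trans ler01 CB_ge1.
rewrite /C1 mulrDl lerD//.
  by rewrite -mulrA ler_wpM2l// (le_trans (Bt_le r0))// ler_wpM2l// aS_le_pow.
rewrite -mulrA ler_wpM2l// -powRM//.
have nB : Bt r \in Num.nneg by pos.
have nC : CB * (1 + `|S r|) \in Num.nneg by rewrite nnegrE mulr_ge0.
exact: (ge0_ler_powR (le_trans ler01 p1) nB nC (Bt_le r0)).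
Qed.

Lemma gt_cpos M v : 0 <= M -> cpos v -> cpos (gt M v).
Proof.
move=> M0 cv r r0; apply: (@continuous_comp _ _ _ (fun r => Num.min (v r) (Bt r)) (hM M)).
  by apply: continuous_min; [exact: cv|exact: Bt_cpos].
exact: hM_cont.
Qed.

Lemma gt_mono M v v' r : 0 <= M -> v r <= v' r -> gt M v r <= gt M v' r.
Proof.
move=> M0 vv; apply: hM_mono => //.
by rewrite le_min !ge_min vv lexx orbT.
Qed.

(** Starting from -om, a lower bound of all sources, the monotone operator produces an increasing
    sequence. *)
Fixpoint itv_sol (M : R) (k : nat) : R -> R :=
  if k is k'.+1 then Tof (gt M (itv_sol M k')) else Tof (fun=> - om).

Lemma adm_low : adm om (fun=> - om).
Proof.
split; first exact: measurable_cst.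
by move=> r r0; rewrite normrN ger0_norm// ler_peMr// (le_trans (aS1 r))// aS_le_pow.
Qed.

Lemma itv_measurable M k : 0 <= M -> mfun (itv_sol M k).
Proof.
move=> M0; elim: k => [|k IH]; first exact: Tof_measurable adm_low.
by apply: Tof_measurable; exact: adm_g.
Qed.

Lemma itv_incr M k r : 0 <= M -> 0 < r -> itv_sol M k r <= itv_sol M k.+1 r.
Proof.
move=> M0; elim: k r => [|k IH] r r0.
  apply: (Tof_mono adm_low (adm_g M0 (itv_measurable 0 M0)) _ r0) => t t0.
  exact: hM_ge.
apply: (Tof_mono (adm_g M0 (itv_measurable k M0)) (adm_g M0 (itv_measurable k.+1 M0)) _ r0) => t t0.
by apply: gt_mono => //; exact: IH.
Qed.

Definition bmaj (M : R) (r : R) : R := (C1 M * (1 + `|S r|) `^ p) * Ipos r.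

Lemma adm_bmaj M : 0 <= M -> adm (C1 M) (bmaj M).
Proof.
move=> M0; have C10 : 0 <= C1 M := adm_C0 (adm_g M0 (itv_measurable 0 M0)).
split.
  apply: cpos_measurable => r r0; apply: cvgM; first exact: cvg_cst.
  apply: (@continuous_comp _ _ _ (fun r => 1 + `|S r|) (fun x => x `^ p)).
    by apply: cvgD; [exact: cvg_cst|apply: cvg_norm; exact: S_cpos].
  by apply: cpos_powR; exact: lt_le_trans (aS1 r).
by move=> r r0; rewrite /bmaj IposE r0 mulr1 ger0_norm// mulr_ge0// powR_ge0.
Qed.

Lemma itv_bound M k r : 0 <= M -> 0 < r -> itv_sol M k.+1 r <= Tof (bmaj M) r.
Proof.
move=> M0 r0; apply: (Tof_mono (adm_g M0 (itv_measurable k M0)) (adm_bmaj M0) _ r0) => t t0.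
rewrite /bmaj IposE t0 mulr1 (le_trans (ler_norm _))//.
by case: (adm_g M0 (itv_measurable k M0)) => _; exact.
Qed.

Definition sol (M : R) (r : R) : R := limn (fun k => itv_sol M k r).

Lemma itv_cvg M r : 0 <= M -> itv_sol M k r @[k --> \oo] --> sol M r.
Proof.
move=> M0; have [r0|r0] := ltP 0 r; last first.
  rewrite /sol (_ : (fun k => itv_sol M k r) = fun=> 0); last first.
    by apply/funext => k; case: k => [|k] /=; rewrite /Tof IposE ltNge r0 mulr0.
  by apply: is_cvg_cst.
apply: nondecreasing_is_cvgn.
  by apply/nondecreasing_seqP => k; exact: itv_incr.
exists (Tof (bmaj M) r) => _ [k _ <-].
exact: le_trans (itv_incr k M0 r0) (itv_bound k M0 r0).
Qed.

Lemma sol_measurable M : 0 <= M -> mfun (sol M).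
Proof.
move=> M0; apply: (measurable_fun_cvg (fun k => itv_measurable k M0)) => r _.
exact: itv_cvg.
Qed.

Lemma I0_cvg_seq (F : nat -> R -> R) f g r : (forall k, lint (F k)) -> lint g ->
  (forall k t, 0 < t -> `|F k t| <= g t) -> (forall t, 0 < t -> F k t @[k --> \oo] --> f t) ->
  I0 (F k) r @[k --> \oo] --> I0 f r.
Proof.
move=> lF lg Fg Ff.
apply: (@dct_cvg _ _ _ leb (fun k t => F k t * \1_(`]0, r]%classic) t) _
  (fun t => g t * \1_(`]0, r]%classic) t)).
- by move=> k; exact: integ_measurable (lF k r).
- exact: lg.
- move=> k t; rewrite indic_ocE; case: ltP => t0 /=; last by rewrite !mulr0 normr0.
  by case: (leP t r) => tr; rewrite ?mulr1 ?Fg// !mulr0 normr0.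
- move=> t; rewrite indic_ocE; case: (ltP 0 t) => t0 /=.
    by apply: cvgM; [exact: Ff|exact: cvg_cst].
  by rewrite !mulr0; under eq_fun do rewrite mulr0; exact: cvg_cst.
Qed.

(** The fixed point lives on the whole half-line at once: monotonicity gives the limit, and
    dominated convergence with a multiple of [Phi] passes to the limit under the integral. *)
Lemma sol_fix M r : 0 <= M -> sol M r = Tof (gt M (sol M)) r.
Proof.
move=> M0; have [r0|r0] := ltP 0 r; last first.
  rewrite [RHS]/Tof IposE ltNge r0 mulr0 /sol (_ : (fun k => itv_sol M k r) = fun=> 0).
    by rewrite lim_cst//; exact: Rhausdorff.
  by apply/funext => k; case: k => [|k] /=; rewrite /Tof IposE ltNge r0 mulr0.
have a1 k := adm_g M0 (itv_measurable k M0).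
have a2 := adm_g M0 (sol_measurable M0).
apply: (cvg_unique (@Rhausdorff R) (@itv_cvg M r M0)).
rewrite /= -cvg_shiftS /= (TofE a2 r0).
under eq_fun do rewrite (TofE (a1 _) r0).
apply: cvgD; first exact: cvg_cst.
apply: (I0_cvg_seq (g := fun t => (1 + `|S r|) * C1 M * Phi t)).
- by move=> k; exact: adm_K (a1 k).
- exact: lintZ.
- move=> k t t0; apply: (adm_kernel (a1 k) t0).
  rewrite (le_trans (ler_normB _ _))//; have := normr_ge0 (S t); have := normr_ge0 (S r); nra.
- move=> t t0; apply: cvgM; first exact: cvg_cst.
  apply: continuous_cvg; first exact: hM_cont.
  apply: (cvg_comp _ (fun x : R => Num.min x (Bt t)) (@itv_cvg M t M0)).
  have h : {for sol M t, continuous (fun x : R => Num.min x (Bt t))}.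
    by apply: continuous_min; [exact: cvg_id|exact: cvg_cst].
  exact: h.
Qed.

End truncated.

Section truncated_solutions.
Context (r2 : R) (r20 : 0 < r2) (Br2 : 0 <= S r2 + a0).
Local Notation Bt := (Bt r2).
Local Notation CB := (CB r2).
Local Notation gt := (gt r2).
Local Notation sol := (sol r2).
Local Notation C1 := (C1 r2).

Definition sJ (M : R) : R -> R := Jof (gt M (sol M)).

Lemma adm_sol M : 0 <= M -> adm (C1 M) (gt M (sol M)).
Proof. by move=> M0; apply: (adm_g r20 Br2 M0); exact: sol_measurable. Qed.

Lemma sol_Tof M : 0 <= M -> Tof (gt M (sol M)) = sol M.
Proof. by move=> M0; apply/funext => t; rewrite -(sol_fix r20 Br2). Qed.

Lemma sol_cpos M : 0 <= M -> cpos (sol M).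
Proof. by move=> M0 r r0; have := Tof_cpos (adm_sol M0) r0; rewrite sol_Tof. Qed.

Lemma gsol_cpos M : 0 <= M -> cpos (gt M (sol M)).
Proof. by move=> M0; apply: (gt_cpos r20 M0); exact: sol_cpos. Qed.

Lemma sol_dd M : 0 <= M -> ddpos (sol M) (fun r => - (1 - sJ M r) / wt r).
Proof. by move=> M0 r r0; have := Tof_dd (adm_sol M0) (gsol_cpos M0) r0; rewrite sol_Tof. Qed.

Lemma sJ_dd M : 0 <= M -> ddpos (sJ M) (fun r => wt r * gt M (sol M) r).
Proof. by move=> M0; exact: Jof_dd (adm_sol M0) (gsol_cpos M0). Qed.

Lemma sJ_cvg0 M : 0 <= M -> sJ M r @[r --> 0^'+] --> (0 : R).
Proof. by move=> M0; exact: Jof_cvg0 (adm_sol M0). Qed.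

Lemma sol_cvg0 M : 0 <= M -> (sol M r - S r) @[r --> 0^'+] --> a0.
Proof. by move=> M0; have := Tof_cvg (adm_sol M0); rewrite sol_Tof. Qed.

Lemma sJ_cpos M : 0 <= M -> cpos (sJ M).
Proof. by move=> M0; exact: ddpos_cpos (sJ_dd M0). Qed.

Lemma sol_pos_near M : 0 <= M -> exists2 a : R, 0 < a & forall r, 0 < r <= a -> 0 < sol M r.
Proof.
move=> M0; have [r1 r10 h1] := S_near0 (1 - a0).
have : \forall r \near 0^'+, a0 - 1 < sol M r - S r.
  by apply: (cvgr_gt _ (sol_cvg0 M0)); rewrite ltrBlDr ltrDl.
move=> [e /= e0 he].
exists (Num.min r1 (e / 2)); first by rewrite lt_min r10 divr_gt0.
move=> r /andP[r0]; rewrite le_min => /andP[rr1 re].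
have := he r; rewrite /= sub0r normrN (gtr0_norm r0) => /(_ _ r0) h2.
have : r < e by lra.
by move=> /h2; have := h1 r; rewrite r0 rr1 => /(_ isT); lra.
Qed.

Lemma gsol_ge0 M r : 0 <= M -> 0 < r -> 0 <= sol M r -> 0 <= gt M (sol M) r.
Proof.
move=> M0 r0 v0; rewrite /gt /hM addr_ge0//; last by rewrite mulr_ge0// powR_ge0.
rewrite mulr_ge0// le_max; apply/orP; left.
by rewrite le_min v0 (le_trans ler01)// (Bt_ge1 r20 Br2).
Qed.

Lemma gsol_le0 M r : 0 <= M -> sol M r <= 0 -> gt M (sol M) r <= 0.
Proof.
move=> M0 v0; have m0 : Num.min (sol M r) (Bt r) <= 0 by rewrite ge_min v0.
rewrite /gt /hM (_ : Num.max _ 0 = 0); last by apply/max_idPr.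
rewrite powR0 ?gt_eqF ?(lt_le_trans ltr01 p1)// mulr0 addr0 mulr_ge0_le0//.
by rewrite ge_max m0 lerN10.
Qed.

Lemma gsol_lip M r : 0 <= M -> 0 < r -> 0 <= sol M r ->
  gt M (sol M) r <= (om + M * (Bt r) `^ (p - 1)) * sol M r.
Proof.
move=> M0 r0 v0; have B1 := Bt_ge1 r20 Br2 r0; have B0 := le_trans ler01 B1.
rewrite /gt /hM; set m := Num.min _ _.
have m0 : 0 <= m by rewrite le_min v0.
have mv : m <= sol M r by rewrite ge_min lexx.
have mB : m <= Bt r by rewrite ge_min lexx orbT.
rewrite (_ : Num.max m (-1) = m); last by apply/max_idPl; rewrite (le_trans _ m0)// lerN10.
rewrite (_ : Num.max m 0 = m); last exact/max_idPl.
rewrite mulrDl lerD// ?ler_wpM2l// -mulrA ler_wpM2l//.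
have [->|mn0] := eqVneq m 0.
  by rewrite powR0 ?gt_eqF ?(lt_le_trans ltr01 p1)// mulr_ge0// powR_ge0.
rewrite [leLHS](_ : _ = m `^ (p - 1) * m).
  by apply: ler_pM => //; rewrite ?powR_ge0// ge0_ler_powR//// subr_ge0.
rewrite [LHS](_ : _ = m `^ (p - 1 + 1)); last by rewrite subrK.
by rewrite powRD; [rewrite powRr1|rewrite mn0 implybT].
Qed.

Lemma sol_ge_l M r : 0 <= M -> 0 < r -> (forall t, 0 < t -> t <= r -> 0 <= gt M (sol M) t) ->
  S r + a0 <= sol M r.
Proof.
move=> M0 r0 g0; rewrite (sol_fix r20 Br2 _ M0) (TofE (adm_sol M0) r0) lerDl.
apply: I0_ge0 => t t0 tr; rewrite mulr_ge0 ?g0// mulr_ge0 ?(ltW (wt_gt0 t0))// subr_ge0.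
exact: S_decr.
Qed.

(** J(r0) = 1 means v'(r0) = 0. Two mean value estimates give v <= C (r0 - r)^2 v just before r0,
    which is impossible for v > 0 once C (r0 - r)^2 < 1. *)
Lemma double_zero M r0 : 0 <= M -> 0 < r0 -> sol M r0 = 0 ->
  (forall r, 0 < r < r0 -> 0 < sol M r) -> (forall r, 0 < r < r0 -> sJ M r <= 1) ->
  sJ M r0 = 1 -> False.
Proof.
move=> M0 r00 v0 vp J1 Jr0.
have h0 : 0 < r0 / 2 by pos.
(* On (r0/2, r0), K (r0 - r) v(r) will bound 1 - J(r), and L will bound 1/wt. *)
pose K := r0 ^+ n.-1 * (om + M * (Bt (r0 / 2)) `^ (p - 1)).
have B0 := le_trans ler01 (Bt_ge1 r20 Br2 h0).
have K0 : 0 <= K by rewrite mulr_ge0 ?exprn_ge0 ?(ltW r00)// addr_ge0// mulr_ge0// powR_ge0.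
pose L := (wt (r0 / 2))^-1.
have L0 : 0 < L by rewrite invr_gt0 wt_gt0.
have main r : r0 / 2 < r < r0 -> sol M r <= L * K * (r0 - r) ^+ 2 * sol M r.
  move=> /andP[hr rr].
  have rp := lt_trans h0 hr.
  have vr : 0 < sol M r by rewrite vp// rp.
  have vdec x : r <= x -> x <= r0 -> sol M x <= sol M r.
    move=> rx xr0; apply: (pos_nincr rp rx (sol_dd M0)) => y /andP[ry yx].
    have y0 := lt_trans rp ry.
    rewrite mulNr oppr_le0 divr_ge0 ?(ltW (wt_gt0 y0))// subr_ge0 J1// y0.
    exact: lt_le_trans xr0.
  have [c /andP[rc cr0] e1] := mvt_dd rp rr (sJ_dd M0).
  have cp := lt_trans rp rc.
  have hc : r0 / 2 <= c by lra.
  have JK : 1 - sJ M r <= K * (r0 - r) * sol M r.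
    rewrite -Jr0 e1 [leRHS]mulrAC ler_wpM2r ?subr_ge0 ?(ltW rr)//.
    have vc : 0 <= sol M c by rewrite ltW// vp// cp.
    apply: (@le_trans _ _ (wt c * ((om + M * (Bt c) `^ (p - 1)) * sol M c))).
      by rewrite ler_wpM2l ?(ltW (wt_gt0 cp))// gsol_lip.
    rewrite /K -mulrA; apply: ler_pM; rewrite ?(ltW (wt_gt0 cp))//.
    - pos.
    - by rewrite /wt lerXn2r ?nnegrE ?(ltW cp) ?(ltW r00) ?(ltW cr0).
    - apply: ler_pM => //; first by rewrite addr_ge0// mulr_ge0// powR_ge0.
        rewrite lerD2l ler_wpM2l// ge0_ler_powR ?subr_ge0// ?nnegrE//.
          by rewrite (le_trans ler01)// (Bt_ge1 r20 Br2).
        exact: (Bt_decr r20 h0).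
      by apply: vdec; exact: ltW.
  have Jmono x : r < x < r0 -> sJ M r <= sJ M x.
    move=> /andP[rx xr0]; apply: (pos_ndecr rp (ltW rx) (sJ_dd M0)) => y /andP[ry yx].
    have y0 := lt_trans rp ry.
    rewrite mulr_ge0 ?(ltW (wt_gt0 y0))//; apply: gsol_ge0 => //.
    by rewrite ltW// vp// y0 (lt_trans yx).
  have [d /andP[rd dr0] e2] := mvt_dd rp rr (sol_dd M0).
  have dp := lt_trans rp rd.
  have hd : r0 / 2 <= d by apply: ltW; exact: lt_trans rd.
  have -> : sol M r = (1 - sJ M d) / wt d * (r0 - r).
    by move: e2; rewrite v0 sub0r mulNr mulNr => /oppr_inj.
  rewrite expr2 [leRHS](_ : _ = (L * (K * (r0 - r) * sol M r)) * (r0 - r)); last first.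
    by move: e2; rewrite v0 sub0r mulNr mulNr => /oppr_inj <-; ring.
  rewrite ler_wpM2r ?subr_ge0 ?(ltW rr)// mulrC.
  apply: ler_pM.
  - by rewrite invr_ge0 ltW// wt_gt0.
  - by rewrite subr_ge0 J1// dp.
  - rewrite /L lef_pV2 ?posrE ?wt_gt0// /wt lerXn2r ?nnegrE ?(ltW h0) ?(ltW dp)//.
  - by apply: le_trans JK; rewrite lerD2l lerN2 Jmono// rd.
(* Small enough for L K (e/2)^2 < 1, and at most r0/2 so that r0 - e/2 lies in (r0/2, r0). *)
pose e := Num.min (r0 / 2) (2 * (L * K + 1))^-1.
have LK0 : 0 <= L * K by rewrite mulr_ge0// ltW.
have LK1 : 0 < 2 * (L * K + 1) by rewrite mulr_gt0// ltr_wpDl.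
have e0 : 0 < e by rewrite lt_min h0 invr_gt0.
have e1 : e / 2 < r0 / 2.
  rewrite ltr_pM2r// (le_lt_trans (_ : e <= r0 / 2)) ?ge_min ?lexx//.
  by rewrite ltr_pdivrMr// mulr_natr mulr2n ltrDl.
have e2 : e <= (2 * (L * K + 1))^-1 by rewrite ge_min lexx orbT.
have e3 : e / 2 <= e by rewrite ler_pdivrMr// mulr_natr mulr2n lerDl ltW.
have hr : r0 / 2 < r0 - e / 2 < r0 by apply/andP; split; [move: e1; lra|rewrite gtrBl divr_gt0].
have := main _ hr.
have vr : 0 < sol M (r0 - e / 2) by apply: vp; case/andP: hr => h1 ->; rewrite (lt_trans h0 h1).
rewrite -[leLHS]mul1r ler_pM2r// leNgt => /negP; apply.
rewrite opprB addrC subrK.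
have x1 : e / 2 * (2 * (L * K + 1)) <= 1.
  by rewrite -ler_pdivlMr// div1r (le_trans e3).
have h2 : 0 < e / 2 by rewrite divr_gt0.
have e12 : e / 2 <= 2^-1.
  apply: (le_trans e3); apply: (le_trans e2); rewrite lef_pV2 ?posrE//.
  by rewrite ler_peMr// lerDr.
move: x1 h2 e12 LK0; move: (e / 2) (L * K) => x y; nra.
Qed.

End truncated_solutions.

Section shooting.
Context (r2 : R) (r20 : 0 < r2) (Br2 : 0 <= S r2 + a0).
Local Notation Bt := (Bt r2).
Local Notation CB := (CB r2).
Local Notation gt := (gt r2).
Local Notation sol := (sol r2).
Local Notation C1 := (C1 r2).
Local Notation sJ := (sJ r2).

Lemma sJ_ge0_ind M r1 r : 0 <= M -> 0 < r1 -> r1 <= r ->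
  (forall t, r1 < t < r -> 0 <= sol M t) -> sJ M r1 <= sJ M r.
Proof.
move=> M0 r10 rr h; apply: (pos_ndecr r10 rr (sJ_dd r20 Br2 M0)) => x /andP[x1 x2].
have x0 := lt_trans r10 x1.
by rewrite mulr_ge0 ?(ltW (wt_gt0 x0))//; apply: gsol_ge0 => //; apply: h; rewrite x1.
Qed.

Lemma sJ_right M r0 : 0 <= M -> 0 < r0 -> sJ M r0 < 1 ->
  exists2 d : R, 0 < d & forall r, r0 <= r <= r0 + d -> sJ M r < 1.
Proof.
move=> M0 r00 J1.
have : \forall r \near r0, sJ M r < 1 by exact: (cvgr_lt _ (sJ_cpos r20 Br2 M0 r00) _ J1).
move=> [e /= e0 he]; exists (e / 2); first by rewrite divr_gt0.
move=> r /andP[h1 h2]; apply: he; rewrite /ball_/= distrC ger0_norm ?subr_ge0//.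
rewrite ltrBlDl (le_lt_trans h2)// ltrD2l ltr_pdivrMr// mulr_natr mulr2n ltrDl//.
Qed.

Lemma sol_decr_right M a b : 0 <= M -> 0 < a -> a < b ->
  (forall r, a < r < b -> sJ M r < 1) -> sol M b < sol M a.
Proof.
move=> M0 a00 ab h; apply: (pos_decr a00 ab (sol_dd r20 Br2 M0)) => x xab.
have x0 : 0 < x by case/andP: xab => ax _; exact: lt_trans ax.
by rewrite mulNr oppr_lt0 divr_gt0 ?wt_gt0// subr_gt0 h.
Qed.

(** J is nondecreasing while v is positive, so J > 1 somewhere would make v increase from there up
    to its zero. J = 1 at the zero is excluded by [double_zero]. *)
Lemma zero_sJ_lt1 M r0 : 0 <= M -> 0 < r0 -> sol M r0 = 0 ->
  (forall r, 0 < r < r0 -> 0 < sol M r) ->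
  (forall r, 0 < r < r0 -> sJ M r <= 1) /\ sJ M r0 < 1.
Proof.
move=> M0 r00 v0 vp.
have J1 r : 0 < r < r0 -> sJ M r <= 1.
  move=> /andP[rp rr]; rewrite leNgt; apply/negP => Jr.
  have : sol M r < sol M r0.
    apply: (pos_incr rp rr (sol_dd r20 Br2 M0)) => x /andP[rx xr].
    have x0 := lt_trans rp rx.
    rewrite mulNr oppr_gt0 pmulr_llt0 ?invr_gt0 ?wt_gt0// subr_lt0.
    apply: (lt_le_trans Jr); apply: (sJ_ge0_ind M0 rp (ltW rx)) => t /andP[t1 t2].
    by rewrite ltW// vp// (lt_trans rp t1) (lt_trans t2).
  by rewrite v0 ltNge ltW// vp// rp.
split=> //; rewrite lt_neqAle; apply/andP; split.
  by apply/eqP => e; exact: (double_zero r20 Br2 M0 r00 v0 vp J1 e).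
rewrite leNgt; apply/negP => Jr.
have : \forall r \near r0, 1 < sJ M r by exact: (cvgr_gt _ (sJ_cpos r20 Br2 M0 r00) _ Jr).
move=> [e /= e0 he].
pose d := Num.min e r0 / 2.
have m0 : 0 < Num.min e r0 by rewrite lt_min e0.
have d0 : 0 < d by rewrite divr_gt0.
have dm : d < Num.min e r0 by rewrite ltr_pdivrMr// mulr_natr mulr2n ltrDl.
have [de dr] : d < e /\ d < r0 by move: dm; rewrite lt_min => /andP[].
have := he (r0 - d); rewrite /ball_/= opprB addrC subrK gtr0_norm// => /(_ de).
by rewrite ltNge J1// subr_gt0 dr gtrBl.
Qed.

(** The first zero is transversal. After it v is negative, the source is nonpositive and J is
    nonincreasing; so J stays below 1 and v cannot return to 0. *)
Lemma crossing_J M : 0 <= M -> (exists2 r, 0 < r & sol M r <= 0) ->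
  forall r, 0 < r -> sJ M r <= 1.
Proof.
move=> M0 [b b0 vb].
have [a a00 ha] := sol_pos_near r20 Br2 M0.
have cv := sol_cpos r20 Br2 M0.
have [r0 [/andP[ar0 _] v0 vp]] := first_zero cv a00 ha b0 vb.
have r00 := lt_trans a00 ar0.
have [J1 Jr0] := zero_sJ_lt1 M0 r00 v0 vp.
have [d d0 Jd] := sJ_right M0 r00 Jr0.
have neg r : r0 < r -> r <= r0 + d -> sol M r < 0.
  move=> h1 h2; rewrite -v0; apply: sol_decr_right => // x /andP[h3 h4].
  by rewrite Jd// (ltW h3)/= (le_trans (ltW h4)).
have negall r : r0 < r -> sol M r < 0.
  move=> rr; rewrite ltNge; apply/negP => vr.
  have cf : cpos (fun t => - sol M (t + r0)).
    move=> t t0; apply: cvgN; apply: (@continuous_comp _ _ _ (fun t => t + r0) (sol M)).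
      by apply: cvgD; [exact: cvg_id|exact: cvg_cst].
    by apply: cv; rewrite addr_gt0.
  (* The first return to 0, found by applying [first_zero] to -v shifted by r0. *)
  have [|||s [/andP[ds _] vs vps]] := @first_zero _ (fun t => - sol M (t + r0)) d (r - r0) cf d0.
  - by move=> t /andP[t0 td]; rewrite oppr_gt0 neg// ?ltrDr// addrC lerD2l.
  - by rewrite subr_gt0.
  - by rewrite subrK oppr_le0.
  have s0 := lt_trans d0 ds.
  have Js x : r0 < x < s + r0 -> sJ M x < 1.
    move=> /andP[h1 h2]; apply: le_lt_trans Jr0.
    apply: (pos_nincr r00 (ltW h1) (sJ_dd r20 Br2 M0)) => y /andP[h3 h4].
    have y0 := lt_trans r00 h3.
    rewrite mulr_ge0_le0 ?(ltW (wt_gt0 y0))//; apply: gsol_le0 => //.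
    have := vps (y - r0); rewrite subrK subr_gt0 h3 ltrBlDr (lt_trans h4 h2) => /(_ isT).
    by rewrite oppr_gt0 => /ltW.
  have : sol M (s + r0) < sol M r0.
    by apply: sol_decr_right => //; rewrite ltrDr.
  by move: vs => /eqP; rewrite oppr_eq0 => /eqP ->; rewrite v0 ltxx.
move=> r rp; have [rr|rr|->] := ltgtP r r0; last exact: ltW.
  by rewrite J1// rp.
apply: le_trans (ltW Jr0); apply: (pos_nincr r00 (ltW rr) (sJ_dd r20 Br2 M0)) => y /andP[h3 h4].
have y0 := lt_trans r00 h3.
by rewrite mulr_ge0_le0 ?(ltW (wt_gt0 y0))//; apply: gsol_le0 => //; rewrite ltW// negall.
Qed.

Lemma J_le1_nincr M : 0 <= M -> (forall r, 0 < r -> sJ M r <= 1) ->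
  forall r r', 0 < r -> r <= r' -> sol M r' <= sol M r.
Proof.
move=> M0 h r r' r0 rr; apply: (pos_nincr r0 rr (sol_dd r20 Br2 M0)) => x /andP[rx _].
have x0 := lt_trans r0 rx.
by rewrite mulNr oppr_le0 divr_ge0 ?(ltW (wt_gt0 x0))// subr_ge0 h.
Qed.

(** Bootstrap: the lower bound holds as long as v is nonnegative, and at a first zero of v it would
    contradict S + a0 > 0. *)
Lemma sol_ge_l_pos M r1 : 0 <= M -> 0 < r1 -> (forall t, 0 < t <= r1 -> 0 < S t + a0) ->
  forall r, 0 < r -> r <= r1 -> S r + a0 <= sol M r.
Proof.
move=> M0 r10 l0; suff vp : forall r, 0 < r -> r <= r1 -> 0 < sol M r.
  move=> r r0 rr; apply: (sol_ge_l r20 Br2 M0 r0) => t t0 tr.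
  by apply: gsol_ge0 => //; rewrite ltW// vp// (le_trans tr).
move=> r rp rr; rewrite ltNge; apply/negP => vr.
have [a a00 ha] := sol_pos_near r20 Br2 M0.
have [r0 [/andP[ar0 r0r] v0 vp]] := first_zero (sol_cpos r20 Br2 M0) a00 ha rp vr.
have r00 := lt_trans a00 ar0.
have : S r0 + a0 <= sol M r0.
  apply: (sol_ge_l r20 Br2 M0 r00) => t t0; rewrite le_eqVlt => /predU1P[->|tr].
    by apply: gsol_ge0 => //; rewrite v0.
  by apply: gsol_ge0 => //; rewrite ltW// vp// t0.
by rewrite v0 leNgt l0// r00 (le_trans r0r).
Qed.

(** On ]0, r1] the solution is at least 1, so J' >= M wt and J(r1) >= M r1^n / n. By [crossing_J]
    this bounds all M whose solution reaches zero. *)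
Lemma J_le1_bound M r1 : (0 < n)%N -> 0 <= M -> 0 < r1 -> (forall t, 0 < t <= r1 -> 1 <= S t + a0) ->
  sJ M r1 <= 1 -> M * (r1 ^+ n / n%:R) <= 1.
Proof.
move=> n0 M0 r10 l1 J1; apply: le_trans J1.
have vl := sol_ge_l_pos M0 r10 (fun t h => lt_le_trans ltr01 (l1 t h)).
pose F r := sJ M r - M * (r ^+ n / n%:R).
have dF : ddpos F (fun r => wt r * gt M (sol M) r - M * (n%:R * r ^+ n.-1 * n%:R^-1)).
  move=> r rp; apply: ddB; first exact: sJ_dd.
  apply: ddZ; apply: dd_eq (ddM (ddX n r) (dd_cst _ r)) _.
  by rewrite mulr0 add0r.
have F0 : F r @[r --> 0^'+] --> (0 : R).
  have {2}-> : (0 : R) = 0 - M * (0 ^+ n / n%:R) by rewrite expr0n gtn_eqF// mul0r mulr0 subrr.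
  apply: cvgB; first exact: sJ_cvg0.
  apply: cvgMr; apply: cvgM; last exact: cvg_cst.
  by apply: cvg_at_right_filter; exact: exprn_continuous.
suff : 0 <= F r1 by rewrite /F subr_ge0.
apply: (cvg0_le r10 F0) => r /andP[rp rr].
apply: (pos_ndecr rp (ltW rr) dF) => x /andP[rx xr].
have x0 := lt_trans rp rx.
have -> : M * (n%:R * x ^+ n.-1 * n%:R^-1) = wt x * M.
  by rewrite mulrAC mulfV ?mul1r ?pnatr_eq0 -?lt0n// mulrC.
rewrite -mulrBr mulr_ge0 ?(ltW (wt_gt0 x0))// subr_ge0.
have vx : 1 <= sol M x by apply: le_trans (vl x x0 (ltW xr)); apply: l1; rewrite x0 ltW.
have m1 : 1 <= Num.min (sol M x) (Bt x) by rewrite le_min vx (Bt_ge1 r20 Br2).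
have m0 := le_trans ler01 m1.
rewrite /gt /hM (_ : Num.max _ (-1) = Num.min (sol M x) (Bt x)); last first.
  by apply/max_idPl; rewrite (le_trans _ m0)// lerN10.
rewrite (_ : Num.max _ 0 = Num.min (sol M x) (Bt x)); last exact/max_idPl.
rewrite -[leLHS]add0r lerD ?mulr_ge0// ler_peMr//.
have n1 : 1 \in @Num.nneg R by rewrite nnegrE.
have nm : Num.min (sol M x) (Bt x) \in Num.nneg by rewrite nnegrE.
by have := ge0_ler_powR (le_trans ler01 p1) n1 nm m1; rewrite powR1.
Qed.

Lemma sol_lip M1 b : 0 <= M1 -> 0 < b -> exists2 C : R, 0 <= C &
  forall M M' r, 0 <= M <= M1 -> 0 <= M' <= M1 -> 0 < r -> r <= b ->
  `|sol M r - sol M' r| <= C * `|M - M'|.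
Proof.
move=> M10 b0.
have C0 : 0 <= CB := le_trans ler01 (CB_ge1 r2).
have Sb1 : 0 <= 1 + `|S b| := le_trans ler01 (aS1 b).
pose c2 := (1 + `|S b|) * (om + M1 * (p * CB `^ (p - 1))).
pose c1 := (1 + `|S b|) * CB `^ p.
have p0 : 0 <= p := le_trans ler01 p1.
have c20 : 0 <= c2 by rewrite mulr_ge0// addr_ge0// mulr_ge0// mulr_ge0// powR_ge0.
have c10 : 0 <= c1 by rewrite mulr_ge0// powR_ge0.
have I0b : 0 <= I0 Phi b by apply: I0_ge0 => t t0 _; exact: Phi_ge0.
exists (c1 * I0 Phi b * expR (I0 (fun t => c2 * Phi t) b)).
  by rewrite mulr_ge0 ?expR_ge0// mulr_ge0.
move=> M M' r /andP[M0 MM] /andP[M0' MM'] r0 rb.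
pose d t := `|sol M t - sol M' t|.
have cd : cpos d.
  move=> t t0; apply: cvg_norm; apply: cvgB; exact: sol_cpos.
pose G t := gt M (sol M) t - gt M' (sol M') t.
have aG : adm (C1 M + C1 M') G.
  have [m1 h1] := adm_sol r20 Br2 M0; have [m2 h2] := adm_sol r20 Br2 M0'.
  split; first exact: (measurable_funB m1 m2).
  move=> t t0; rewrite mulrDl; apply: (le_trans (ler_normB _ _)).
  by apply: lerD; [exact: h1|exact: h2].
have dE t : 0 < t -> sol M t - sol M' t = I0 (fun x => wt x * (S x - S t) * G x) t.
  move=> t0; rewrite (sol_fix r20 Br2 t M0) (sol_fix r20 Br2 t M0').
  rewrite (TofE (adm_sol r20 Br2 M0) t0) (TofE (adm_sol r20 Br2 M0') t0) opprD addrACA subrr add0r.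
  rewrite -[X in _ + X]mulN1r -I0Z; last exact: adm_K (adm_sol r20 Br2 M0').
  rewrite -I0D; [|exact: adm_K (adm_sol r20 Br2 M0)|exact/lintZ/(adm_K _ (adm_sol r20 Br2 M0'))].
  by apply: I0_ext => x _ _; rewrite /G; ring.
have kS x t b' : 0 < x -> x <= t -> t <= b' -> 0 <= S x - S t <= (1 + `|S x|) * (1 + `|S b'|).
  move=> x0 xt tb; have h1 := S_decr x0 xt; have h2 := S_decr (lt_le_trans x0 xt) tb.
  rewrite subr_ge0 h1/=.
  have h3 := ler_norm (S x); have h4 := ler_norm (- S b'); rewrite normrN in h4.
  have := normr_ge0 (S x); have := normr_ge0 (S b'); nra.
(* A crude bound on d comes first: it makes c2 Phi d integrable at 0, which [gronwall] requires. *)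
have dbd t b' : 0 < t -> t <= b' -> d t <= I0 (fun x => (1 + `|S b'|) * (C1 M + C1 M') * Phi x) b'.
  move=> t0 tb; rewrite /d dE//.
  have C120 := adm_C0 aG.
  have Sb1' : 0 <= 1 + `|S b'| := le_trans ler01 (aS1 b').
  apply: (@le_trans _ _ (I0 (fun x => (1 + `|S b'|) * (C1 M + C1 M') * Phi x) t)); last first.
    apply: I0_mono => //; first exact: lintZ.
    by move=> x x0; rewrite mulr_ge0 ?Phi_ge0// mulr_ge0.
  apply: I0_abs => [||x x0 xt]; [exact: adm_K aG|exact: lintZ|].
  have /andP[k0 k1] := kS _ _ _ x0 xt tb.
  by apply: (adm_kernel aG x0); rewrite (ger0_norm k0) mulrC.
have lk : lint (fun t => c2 * Phi t) by exact: lintZ.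
have ck : cpos (fun t => c2 * Phi t).
  by move=> t t0; apply: cvgM; [exact: cvg_cst|exact: Phi_cpos].
have lkd : lint (fun t => c2 * Phi t * d t).
  move=> b'; pose D := I0 (fun x => (1 + `|S b'|) * (C1 M + C1 M') * Phi x) b'.
  apply: (@integ_le _ _ _ leb _ _ _ (integZ D (lk b'))).
    apply: cpos_lint_measurable => t t0; apply: cvgM; [exact: ck|exact: cd].
  move=> t; rewrite indic_ocE; case: (ltP 0 t) => t0 /=; last by rewrite !mulr0 normr0.
  case: (leP t b') => tb; last by rewrite !mulr0 normr0.
  have P0 := Phi_ge0 t0.
  have dn : `|d t| = d t by rewrite ger0_norm// normr_ge0.
  rewrite !mulr1 normrM (ger0_norm (mulr_ge0 c20 P0)) dn mulrC.
  by apply: ler_wpM2r; [exact: mulr_ge0 c20 P0|exact: dbd].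
have main t : 0 < t -> t <= b ->
    d t <= c1 * `|M - M'| * I0 Phi b + I0 (fun x => c2 * Phi x * d x) t.
  move=> t0 tb; rewrite {1}/d dE//.
  have lA : lint (fun x => c1 * `|M - M'| * Phi x) by exact: lintZ.
  apply: (@le_trans _ _ (I0 (fun x => c1 * `|M - M'| * Phi x + c2 * Phi x * d x) t)); last first.
    rewrite I0D// lerD2r I0Z// ler_wpM2l ?(mulr_ge0 c10)//.
    by apply: I0_mono => // x; exact: Phi_ge0.
  apply: I0_abs => [||x x0 xt]; [exact: adm_K aG|exact: lintD|].
  have /andP[k0 k1] := kS _ _ _ x0 xt tb.
  rewrite !normrM (gtr0_norm (wt_gt0 x0)) (ger0_norm k0).
  have a1 := aS1 x; have a0' := le_trans ler01 a1.
  have Q0 : 0 <= (1 + `|S x|) `^ p by exact: powR_ge0.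
  have Q1 := le_trans a1 (aS_le_pow x).
  have B1 := Bt_ge1 r20 Br2 x0; have B0 := le_trans ler01 B1.
  have BC := Bt_le r2 x0.
  have CS0 : 0 <= CB * (1 + `|S x|) by rewrite mulr_ge0.
  (* Change of the parameter at a fixed value, plus change of the value at a fixed parameter. *)
  have G1 : `|G x| <= `|M - M'| * (CB `^ p * (1 + `|S x|) `^ p) +
      (om + M1 * (p * CB `^ (p - 1))) * (1 + `|S x|) `^ p * d x.
    pose u := Num.min (sol M x) (Bt x); pose u' := Num.min (sol M' x) (Bt x).
    have uB : u <= Bt x by rewrite ge_min lexx orbT.
    have uB' : u' <= Bt x by rewrite ge_min lexx orbT.
    have -> : G x = (hM M u' - hM M' u') + (hM M u - hM M u') by rewrite /G /gt -/u -/u'; ring.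
    apply: (le_trans (ler_normD _ _)); apply: lerD.
      have -> : hM M u' - hM M' u' = (M - M') * (Num.max u' 0) `^ p by rewrite /hM; ring.
      rewrite normrM ler_wpM2l// ger0_norm ?powR_ge0// -powRM//.
      apply: ge0_ler_powR; rewrite ?nnegrE// ?le_max ?lexx ?orbT//.
      by rewrite ge_max CS0 (le_trans uB').
    apply: (le_trans (hM_lip M0 B1 uB uB')).
    apply: ler_pM => //; last exact: min_lip.
      by rewrite addr_ge0// mulr_ge0// mulr_ge0// powR_ge0.
    rewrite mulrDl lerD//.
      by rewrite ler_peMr.
    rewrite -mulrA ler_pM ?mulr_ge0 ?powR_ge0// -mulrA ler_wpM2l//.
    apply: (@le_trans _ _ ((CB * (1 + `|S x|)) `^ (p - 1))).
      by apply: ge0_ler_powR; rewrite ?nnegrE// subr_ge0.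
    rewrite powRM// ler_wpM2l ?powR_ge0// ler_powR// gerBl//.
  have wk : wt x * (S x - S t) <= wt x * ((1 + `|S x|) * (1 + `|S b|)).
    by rewrite ler_wpM2l// ltW// wt_gt0.
  apply: (@le_trans _ _ (wt x * ((1 + `|S x|) * (1 + `|S b|)) *
      (`|M - M'| * (CB `^ p * (1 + `|S x|) `^ p) + (om + M1 * (p * CB `^ (p - 1))) * (1 + `|S x|) `^ p * d x))).
    by rewrite ler_pM// mulr_ge0// ltW// wt_gt0.
  by rewrite /c1 /c2 /Phi aS_pow le_eqVlt; apply/orP; left; apply/eqP; ring.
have := gronwall cd ck lk lkd _ main r0 rb.
move=> /(_ (fun t t0 => mulr_ge0 c20 (Phi_ge0 t0))) h.
apply: (le_trans h).
rewrite [leRHS](_ : _ = c1 * `|M - M'| * I0 Phi b * expR (I0 (fun t => c2 * Phi t) b)); last by ring.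
rewrite ler_wpM2l ?(mulr_ge0 (mulr_ge0 c10 _) I0b)// ler_expR; apply: I0_mono => // t t0.
by rewrite mulr_ge0// Phi_ge0.
Qed.

End shooting.

Lemma cvg0_near_le (f : R -> R) (e a : R) : f r @[r --> 0^'+] --> (0 : R) -> 0 < e -> 0 < a ->
  exists2 r : R, 0 < r < a & f r <= e.
Proof.
move=> f0 e0 a00.
have : \forall r \near 0^'+, f r <= e by exact: (cvgr_le _ f0).
move=> [d /= d0 hd].
have m0 : 0 < Num.min d a by rewrite lt_min d0.
have m1 : Num.min d a / 2 < Num.min d a by rewrite ltr_pdivrMr// mulr_natr mulr2n ltrDl.
have [md ma] : Num.min d a / 2 < d /\ Num.min d a / 2 < a by move: m1; rewrite lt_min => /andP[].
have m2 : 0 < Num.min d a / 2 by rewrite divr_gt0.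
exists (Num.min d a / 2); first by rewrite m2.
by apply: hd => //=; rewrite sub0r normrN gtr0_norm.
Qed.

(** The truncations have disappeared and g is arbitrary: the same notion covers the ground state
    and, with linear g, the Green function. Here 1 - J is the flux -r^(n-1) v', equal to 1 at the
    origin. *)
Definition profile (g : R -> R) (v J : R -> R) :=
  [/\ forall r, 0 < r -> 0 < v r, ddpos v (fun r => - (1 - J r) / wt r),
      ddpos J (fun r => wt r * g (v r)), forall r, 0 < r -> 0 <= J r < 1 &
      [/\ J r @[r --> 0^'+] --> (0 : R), (v r - S r) @[r --> 0^'+] --> a0 &
          v r @[r --> +oo] --> (0 : R)]].

Lemma profile_decr g v J r r' : profile g v J -> 0 < r -> r < r' -> v r' < v r.
Proof.
move=> [_ dv _ J1 _] r0 rr; apply: (pos_decr r0 rr dv) => x /andP[rx _].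
have x0 := lt_trans r0 rx; have /andP[_ Jx] := J1 x x0.
by rewrite mulNr oppr_lt0 divr_gt0 ?wt_gt0// subr_gt0.
Qed.

(** If r2 is so small that the integral of the largest possible source is at most 1, then v stays
    below [Bt] on ]0, r2], uniformly for M <= Mb. *)
Lemma sol_bound_near r1 r2 Mb M : 0 < r1 -> (forall r, 0 < r <= r1 -> 0 <= S r /\ 0 <= S r + a0) ->
  0 < r2 < r1 -> 0 <= M <= Mb ->
  I0 (fun t => (om * (2 + `|a0|) + Mb * (2 + `|a0|) `^ p) * Phi t) r2 <= 1 ->
  forall r, 0 < r <= r2 -> sol r2 M r <= S r + a0 + 1.
Proof.
move=> r10 l1 /andP[r20 r21] /andP[M0 MM] I1 r /andP[r0 rr].
have r2l : 0 < r2 <= r1 by rewrite r20 ltW.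
have Br2 := (l1 r2 r2l).2.
rewrite (sol_fix r20 Br2 r M0) (TofE (adm_sol r20 Br2 M0) r0) lerD2l.
set c := om * _ + _ in I1.
have Mb0 := le_trans M0 MM.
have c0 : 0 <= c by rewrite addr_ge0// mulr_ge0 ?powR_ge0// addr_ge0.
have lc : lint (fun t => c * Phi t) by exact: lintZ.
have cP t : 0 < t -> 0 <= c * Phi t by move=> t0; rewrite mulr_ge0// Phi_ge0.
apply: le_trans I1; apply: (@le_trans _ _ (I0 (fun t => c * Phi t) r)); last exact: I0_mono.
apply: I0_le => [|//|t t0 tr]; first exact: adm_K (adm_sol r20 Br2 M0).
have tr2 := le_trans tr rr.
have St := S_decr t0 tr.
have [S0 l0] : 0 <= S r /\ 0 <= S r + a0 by apply: l1; rewrite r0 (le_trans rr)// ltW.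
have BtE' : Bt r2 t = S t + a0 + 1 by rewrite BtE// (_ : Num.min t r2 = t)//; apply/min_idPl.
have B1 := Bt_ge1 r20 Br2 t0; have B0 := le_trans ler01 B1.
have uB : Num.min (sol r2 M t) (Bt r2 t) <= Bt r2 t by rewrite ge_min lexx orbT.
have aS0 : 0 <= 1 + `|S t| := le_trans ler01 (aS1 t).
have BS : Bt r2 t <= (2 + `|a0|) * (1 + `|S t|).
  rewrite BtE'; have := ler_norm (S t); have := ler_norm a0.
  have := normr_ge0 (S t); have := normr_ge0 a0; nra.
have p0 := le_trans ler01 p1.
have G1 : gt r2 M (sol r2 M) t <= c * (1 + `|S t|) `^ p.
  apply: (le_trans (ler_norm _)); apply: (le_trans (hM_abs M0 B1 uB)).
  rewrite /c mulrDl lerD//.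
    rewrite -mulrA ler_wpM2l// (le_trans BS)// ler_wpM2l ?addr_ge0//.
    exact: aS_le_pow.
  rewrite -mulrA -powRM ?addr_ge0//; apply: ler_pM => //; first exact: powR_ge0.
  by apply: ge0_ler_powR; rewrite ?nnegrE// mulr_ge0// addr_ge0.
rewrite /Phi aS_pow [leRHS](_ : _ = wt t * (1 + `|S t|) * (c * (1 + `|S t|) `^ p)); last by ring.
apply: (@le_trans _ _ (wt t * (S t - S r) * (c * (1 + `|S t|) `^ p))).
  by rewrite ler_wpM2l// mulr_ge0 ?(ltW (wt_gt0 t0))// subr_ge0.
rewrite ler_wpM2r// ?mulr_ge0 ?powR_ge0// ler_wpM2l ?(ltW (wt_gt0 t0))//.
by have := ler_norm (S t); move: S0; lra.
Qed.

(** The second hypothesis excludes nonnegative solutions for M = 0. It allows a source with u0 <= v0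
    because the solution for M = 0 is only known to satisfy the truncated equation. *)
Theorem shooting : (0 < n)%N ->
  (forall v0 J0 u0 : R -> R, (forall r, 0 < r -> 0 <= v0 r) ->
    ddpos v0 (fun r => - (1 - J0 r) / wt r) -> ddpos J0 (fun r => wt r * (om * u0 r)) ->
    (forall r, 0 < r -> u0 r <= v0 r) -> J0 r @[r --> 0^'+] --> (0 : R) ->
    (v0 r - S r) @[r --> 0^'+] --> a0 -> False) ->
  exists M v J, 0 < M /\ profile (fun x => om * x + M * x `^ p) v J.
Proof.
move=> n0 Hneg.
have [r1 r10 h1] := S_near0 (Num.max 0 (1 - a0)).
have l1 r : 0 < r <= r1 -> 0 <= S r /\ 1 <= S r + a0.
  by move=> /h1; rewrite ge_max => /andP[? ?]; split => //; rewrite -lerBlDr.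
have l0 r : 0 < r <= r1 -> 0 <= S r /\ 0 <= S r + a0.
  by move=> /l1[? ?]; split => //; exact: le_trans ler01 _.
(* The bound of [J_le1_bound] on the parameters whose solution reaches zero. *)
pose Mb := n%:R / r1 ^+ n.
have Mb0 : 0 <= Mb by rewrite divr_ge0// exprn_ge0// ltW.
have [r2 r2r I1] := @cvg0_near_le _ 1 r1 (I0_cvg0 (lintZ (om * (2 + `|a0|) + Mb * (2 + `|a0|) `^ p) lPhi)) ltr01 r10.
have /andP[r20 r21] := r2r.
have r2l : 0 < r2 <= r1 by rewrite r20 ltW.
have Br2 := (l0 r2 r2l).2.
pose Z := [set M | 0 <= M /\ exists2 r, 0 < r & sol r2 M r <= 0].
have Zb M : Z M -> M <= Mb.
  move=> [M0 hM]; have J1 := crossing_J r20 Br2 M0 hM r10.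
  have := J_le1_bound r20 Br2 n0 M0 r10 (fun t ht => (l1 t ht).2) J1.
  rewrite mulrA ler_pdivrMr ?ltr0n// mul1r => h.
  by rewrite /Mb ler_pdivlMr// exprn_gt0.
have Z0 : Z 0.
  split=> //; apply: contrapT => hn.
  have v0 r : 0 < r -> 0 <= sol r2 0 r.
    by move=> r0; rewrite leNgt; apply/negP => vn; apply: hn; exists r => //; exact: ltW.
  apply: (Hneg (sol r2 0) (sJ r2 0) (fun r => Num.min (sol r2 0 r) (Bt r2 r)) v0).
  - exact: sol_dd.
  - move=> r r0; apply: dd_eq (sJ_dd r20 Br2 (lexx 0) r0) _.
    rewrite /gt /hM mul0r addr0; congr (_ * (_ * _)); apply/max_idPl.
    rewrite (@le_trans _ _ 0) ?lerN10// le_min v0//.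
    by rewrite (le_trans ler01)// (Bt_ge1 r20 Br2).
  - by move=> r r0; rewrite ge_min lexx.
  - exact: sJ_cvg0.
  - exact: sol_cvg0.
have supZ : has_sup Z by split; [exists 0|exists Mb => M; exact: Zb].
pose Ms := sup Z.
have Ms0 : 0 <= Ms by apply: ub_le_sup => //; case: supZ.
have MsMb : Ms <= Mb by apply: ge_sup => //; exists 0.
have M10 : 0 <= Mb + 1 by rewrite addr_ge0.
have Ms1 : 0 <= Ms <= Mb + 1 by rewrite Ms0 (le_trans MsMb)// lerDl.
(* For M in Z the solution is nonincreasing by [crossing_J]; monotonicity passes to the supremum by
   continuity in M, and J <= 1 is deduced from it afterwards. *)
have nonincr r r' : 0 < r -> r <= r' -> sol r2 Ms r' <= sol r2 Ms r.
  move=> rp rr; have rp' := lt_le_trans rp rr.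
  have [C C0 HC] := sol_lip r20 Br2 M10 rp'.
  apply/ler_addgt0Pr => e e0.
  have e1 : 0 < e / (2 * C + 1) by rewrite divr_gt0// ltr_wpDl// mulr_ge0.
  have [M [M0 ZM] Mlt] := sup_adherent e1 supZ.
  have MM : M <= Ms by apply: ub_le_sup; [case: supZ|split].
  have M1 : 0 <= M <= Mb + 1 by rewrite M0 (le_trans MM)//; case/andP: Ms1.
  have J1 := J_le1_nincr r20 Br2 M0 (crossing_J r20 Br2 M0 ZM) rp rr.
  have d1 : `|Ms - M| <= e / (2 * C + 1).
    by rewrite ger0_norm ?subr_ge0// lerBlDr addrC -lerBlDr ltW.
  have := HC _ _ _ Ms1 M1 rp rr; have := HC _ _ _ Ms1 M1 rp' (lexx r').
  rewrite !ler_norml => /andP[_ h2] /andP[h3 _].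
  have h4 : C * `|Ms - M| * 2 <= e.
    apply: (@le_trans _ _ ((2 * C + 1) * (e / (2 * C + 1)))); last first.
      by rewrite mulrC divfK// gt_eqF// ltr_wpDl// mulr_ge0.
    apply: (@le_trans _ _ (2 * C * (e / (2 * C + 1)))).
      by rewrite mulrC mulrA ler_wpM2l// mulr_ge0.
    by rewrite ler_wpM2r ?(ltW e1)// lerDl.
  move: h2 h3 h4 J1; lra.
(* Parameters above the supremum give positive solutions; let them tend to Ms. *)
have nonneg r : 0 < r -> 0 <= sol r2 Ms r.
  move=> rp; have [C C0 HC] := sol_lip r20 Br2 M10 rp.
  apply/ler_addgt0Pr => e e0.
  have C1' : 0 < C + 1 by rewrite ltr_wpDl.
  pose d := Num.min 1 (e / (C + 1)).
  have d0 : 0 < d by rewrite lt_min ltr01 divr_gt0.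
  have d1 : d <= 1 by rewrite ge_min lexx.
  have d2 : d <= e / (C + 1) by rewrite ge_min lexx orbT.
  have Md0 : 0 <= Ms + d by rewrite addr_ge0// ltW.
  have vp : 0 < sol r2 (Ms + d) r.
    rewrite ltNge; apply/negP => vn.
    have : Ms + d <= Ms by apply: ub_le_sup; [case: supZ|split => //; exists r].
    by rewrite leNgt ltrDl d0.
  have Md1 : 0 <= Ms + d <= Mb + 1 by rewrite Md0 lerD.
  have := HC _ _ _ Md1 Ms1 rp (lexx r); rewrite addrAC subrr add0r (gtr0_norm d0) ler_norml.
  move=> /andP[_ h2].
  have h4 : C * d <= e.
    apply: (@le_trans _ _ ((C + 1) * (e / (C + 1)))); last by rewrite mulrC divfK// gt_eqF.
    by rewrite ler_pM// ?(ltW d0)// lerDl.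
  move: h2 h4 vp; lra.
have J1 r : 0 < r -> sJ r2 Ms r <= 1.
  move=> rp; rewrite leNgt; apply/negP => Jr.
  have : \forall t \near r, 1 < sJ r2 Ms t by exact: (cvgr_gt _ (sJ_cpos r20 Br2 Ms0 rp) _ Jr).
  move=> [e /= e0 he].
  have re : r < r + e / 2 by rewrite ltrDl divr_gt0.
  have : sol r2 Ms r < sol r2 Ms (r + e / 2).
    apply: (pos_incr rp re (sol_dd r20 Br2 Ms0)) => x /andP[rx xr].
    have x0 := lt_trans rp rx.
    rewrite mulNr oppr_gt0 pmulr_llt0 ?invr_gt0 ?wt_gt0// subr_lt0; apply: he.
    rewrite /ball_/= distrC gtr0_norm ?subr_gt0// ltrBlDl (lt_trans xr)// ltrD2l.
    by rewrite ltr_pdivrMr// mulr_natr mulr2n ltrDl.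
  by rewrite ltNge nonincr// ltW.
(* A zero would be transversal, hence followed by negative values. *)
have pos r : 0 < r -> 0 < sol r2 Ms r.
  move=> rp; rewrite ltNge; apply/negP => vn.
  have [a a00 ha] := sol_pos_near r20 Br2 Ms0.
  have [r0 [/andP[ar0 _] v0 vp]] := first_zero (sol_cpos r20 Br2 Ms0) a00 ha rp vn.
  have r00 := lt_trans a00 ar0.
  have [_ Jr0] := zero_sJ_lt1 r20 Br2 Ms0 r00 v0 vp.
  have [d d0 Jd] := sJ_right r20 Br2 Ms0 r00 Jr0.
  have : sol r2 Ms (r0 + d) < sol r2 Ms r0.
    apply: (sol_decr_right r20 Br2 Ms0 r00); first by rewrite ltrDl.
    by move=> x /andP[h3 h4]; rewrite Jd// !ltW.
  by rewrite v0 ltNge nonneg// addr_gt0.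
have Mspos : 0 < Ms.
  rewrite lt_neqAle Ms0 andbT; apply/eqP => e.
  have [_ [r rp vn]] := Z0.
  by have := pos r rp; rewrite -e ltNge vn.
(* Up to r2 by the choice of r2, and beyond it because v is nonincreasing while [Bt] is constant. *)
have vB r : 0 < r -> sol r2 Ms r <= Bt r2 r.
  move=> rp.
  have near t : 0 < t <= r2 -> sol r2 Ms t <= S t + a0 + 1.
    by apply: (sol_bound_near r10 l0 r2r _ I1); rewrite Ms0.
  rewrite BtE// minEle; case: (leP r r2) => rr; first by rewrite near// rp.
  by rewrite (le_trans (nonincr _ _ r20 (ltW rr)))// near// r20 lexx.
have gE r : 0 < r -> gt r2 Ms (sol r2 Ms) r = om * sol r2 Ms r + Ms * (sol r2 Ms r) `^ p.
  move=> rp; rewrite /gt /hM (_ : Num.min _ _ = sol r2 Ms r); last by apply/min_idPl; exact: vB.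
  have v0 := ltW (pos r rp).
  rewrite (_ : Num.max _ (-1) = sol r2 Ms r).
    by rewrite (_ : Num.max _ 0 = sol r2 Ms r)//; apply/max_idPl.
  by apply/max_idPl; rewrite (le_trans _ v0)// lerN10.
have gpos r : 0 < r -> 0 < gt r2 Ms (sol r2 Ms) r.
  move=> rp; rewrite gE//; apply: ltr_wpDl.
    by rewrite mulr_ge0// ltW// pos.
  by rewrite mulr_gt0// powR_gt0// pos.
have Jincr r r' : 0 < r -> r < r' -> sJ r2 Ms r < sJ r2 Ms r'.
  move=> rp rr; apply: (pos_incr rp rr (sJ_dd r20 Br2 Ms0)) => x /andP[rx _].
  have x0 := lt_trans rp rx.
  by rewrite mulr_gt0 ?wt_gt0// gpos.
have J0 r : 0 < r -> 0 <= sJ r2 Ms r.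
  move=> rp; apply: (cvg0_le rp (sJ_cvg0 r20 Br2 Ms0)) => x /andP[x0 xr].
  exact: ltW (Jincr _ _ x0 xr).
(* J is strictly increasing, so its bound 1 is not attained. *)
have Jlt r : 0 < r -> sJ r2 Ms r < 1.
  move=> rp; apply: lt_le_trans (J1 (r + 1) _); last by rewrite addr_gt0.
  by apply: Jincr => //; rewrite ltrDl.
exists Ms, (sol r2 Ms), (sJ r2 Ms); split=> //; split.
- exact: pos.
- exact: sol_dd.
- by move=> r rp; apply: dd_eq (sJ_dd r20 Br2 Ms0 rp) _; rewrite gE.
- by move=> r rp; rewrite J0// Jlt.
split; [exact: sJ_cvg0|exact: sol_cvg0|].
apply/cvgrPdist_le => e e0.
suff [r rp ve] : exists2 r, 0 < r & sol r2 Ms r <= e.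
  near=> t; have rt : r <= t by near: t; apply: nbhs_pinfty_ge; exact: num_real.
  have tp := lt_le_trans rp rt.
  by rewrite sub0r normrN gtr0_norm ?pos// (le_trans (nonincr r t rp rt)).
apply: contrapT => hn.
have ve r : 0 < r -> e <= sol r2 Ms r.
  by move=> rp; rewrite leNgt; apply/negP => vn; apply: hn; exists r => //; exact: ltW.
have ep : 0 < Ms * e `^ p by rewrite mulr_gt0// powR_gt0.
(* If v stayed above e, then J would increase by at least 1 between 1 and b, since wt >= 1 there. *)
pose b := 1 + (Ms * e `^ p)^-1.
have b1 : 1 < b by rewrite ltrDl invr_gt0.
have [c /andP[c1 _] E] := mvt_dd ltr01 b1 (sJ_dd r20 Br2 Ms0).
have cp := lt_trans ltr01 c1.
have : 1 <= sJ r2 Ms b - sJ r2 Ms 1.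
  rewrite E /b [1 + _]addrC addrK ler_pdivlMr// mul1r.
  have w1 : 1 <= wt c by rewrite /wt exprn_ege1// ltW.
  apply: (@le_trans _ _ (1 * gt r2 Ms (sol r2 Ms) c)).
    rewrite mul1r gE// -[leLHS]add0r lerD ?mulr_ge0// ?(ltW (pos _ cp))//.
    rewrite ler_wpM2l//; apply: ge0_ler_powR; rewrite ?nnegrE ?(le_trans ler01 p1)//.
    - exact: ltW.
    - exact: ltW (pos _ cp).
    - exact: ve.
  by rewrite ler_wpM2r// ltW// gpos.
have := J0 1 ltr01; have := Jlt b (lt_trans ltr01 b1); lra.
Unshelve. all: by end_near. Qed.

End singular_ode.

Section C1_class.
Context (R : realType).
Implicit Types H K : R -> R.

Definition isC1 H := exists H', C1pos H H'.

Lemma isC1_cpos H : isC1 H -> cpos H.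
Proof. by move=> [H' [dH _]]; exact: ddpos_cpos dH. Qed.

Lemma isC1_eq H K : (forall r, 0 < r -> H r = K r) -> isC1 H -> isC1 K.
Proof.
move=> HK [H' [dH cH]]; exists H'; split=> // r r0.
apply: dd_near (dH r r0); near=> t; apply: HK; near: t; exact: lt_nbhsr.
Unshelve. all: by end_near. Qed.

Lemma isC1_cst (c : R) : isC1 (fun=> c).
Proof. by exists (fun=> 0); split=> r r0; [exact: dd_cst|exact: cvg_cst]. Qed.

Lemma isC1D H K : isC1 H -> isC1 K -> isC1 (fun r => H r + K r).
Proof.
move=> [H' [dH cH]] [K' [dK cK]]; exists (fun r => H' r + K' r); split=> r r0.
  by apply: ddD; [exact: dH|exact: dK].
by apply: cvgD; [exact: cH|exact: cK].
Qed.

Lemma isC1M H K : isC1 H -> isC1 K -> isC1 (fun r => H r * K r).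
Proof.
move=> [H' [dH cH]] [K' [dK cK]]; exists (fun r => H r * K' r + H' r * K r); split=> r r0.
  by apply: ddM; [exact: dH|exact: dK].
apply: cvgD; apply: cvgM; [exact: (ddpos_cpos dH)|exact: cK|exact: cH|exact: (ddpos_cpos dK)].
Qed.

Lemma isC1N H : isC1 H -> isC1 (fun r => - H r).
Proof.
move=> h; apply: isC1_eq (isC1M (isC1_cst (-1)) h) => r _; exact: mulN1r.
Qed.

Lemma isC1B H K : isC1 H -> isC1 K -> isC1 (fun r => H r - K r).
Proof. by move=> h k; apply: isC1D => //; exact: isC1N. Qed.

Lemma isC1_comp_powR H (a : R) : isC1 H -> (forall r, 0 < r -> 0 < H r) ->
  isC1 (fun r => H r `^ a).
Proof.
move=> [H' [dH cH]] H0; exists (fun r => a * H r `^ (a - 1) * H' r); split=> r r0.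
  apply: (dd_comp (f := fun x => x `^ a)); last exact: dH.
  by apply: ddpos_powR; exact: H0.
apply: cvgM; last exact: cH.
apply: cvgM; first exact: cvg_cst.
apply: (@continuous_comp _ _ _ H (fun x => x `^ (a - 1))); first exact: (ddpos_cpos dH).
by apply: cpos_powR; exact: H0.
Qed.

Lemma isC1_id : isC1 id.
Proof. by exists (fun=> 1); split=> r r0; [exact: dd_id|exact: cvg_cst]. Qed.

Lemma isC1_powR (a : R) : isC1 (fun r => r `^ a).
Proof. exact: (isC1_comp_powR a isC1_id). Qed.

Lemma isC1_exp m : isC1 (fun r => r ^+ m).
Proof. by apply: isC1_eq (isC1_powR m%:R) => r r0; rewrite powR_mulrn// ltW. Qed.

Lemma isC1V H : isC1 H -> (forall r, 0 < r -> 0 < H r) -> isC1 (fun r => (H r)^-1).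
Proof.
move=> h H0; apply: isC1_eq (isC1_comp_powR (-1) h H0) => r r0.
by rewrite powR_inv1// ltW// H0.
Qed.

Lemma lint_dom0 H : cpos H -> dom0 H -> lint H.
Proof.
move=> cH [f0 [F0 [C [cf0 dF0 b0] B0]]].
(* T equals H on ]0, 1] and H(1)/r^2 beyond, so the criterion [half_dom] for the whole half-line
   applies. *)
pose T r := H (Num.min r 1) * (Num.max r 1) ^- 2.
have m1 (r : R) : 0 < Num.max r 1 by rewrite lt_max ltr01 orbT.
have hT : halfint T.
  apply: half_dom.
  - move=> r r0.
    have h1 : {for r, continuous (fun r : R => Num.min r 1)}.
      by apply: continuous_min; [exact: cvg_id|exact: cvg_cst].
    have h2 : {for r, continuous (fun r : R => Num.max r 1)}.
      by apply: continuous_max; [exact: cvg_id|exact: cvg_cst].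
    have h3 : {for r, continuous (fun r : R => H (Num.min r 1))}.
      apply: (continuous_comp h1); apply: cH.
      by rewrite lt_min r0 ltr01.
    have h4 : {for r, continuous (fun r : R => Num.max r 1 ^+ 2)}.
      exact: (@continuous_comp _ _ _ (fun r : R => Num.max r 1) (fun r : R => r ^+ 2) r h2 (@exprn_continuous R 2 _)).
    apply: (cvgM h3); apply: (cvgV _ h4).
    pos.
  - exists f0, F0, C => //; split=> // r /andP[r0 r1].
    rewrite /T (_ : Num.min r 1 = r); last exact/min_idPl.
    rewrite (_ : Num.max r 1 = 1); last exact/max_idPr.
    by rewrite expr1n invr1 mulr1 b0// r0.
  - apply: (domoo_le (normr_ge0 (H 1)) (@domoo_powR R (- 2) _)); first by lra.
    move=> r r1; have r0 := lt_le_trans ltr01 r1.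
    rewrite /T (_ : Num.min r 1 = 1); last exact/min_idPr.
    rewrite (_ : Num.max r 1 = r); last exact/max_idPl.
    by rewrite normrM powRN powR_mulrn// ltW.
move=> b; have [iT _] : integ leb (fun r => T r * Ipos r * \1_(`]0, 1]%classic) r) /\ True.
  split=> //; apply: (integM_bounded (M := 1) hT); first exact: measurable_indic.
  by move=> r; rewrite indicE; case: (_ \in _); rewrite ?normr1 ?normr0.
have iS : integ leb (fun r => H r * \1_(`[1, Num.max b 1]%classic) r).
  apply: (iffLR (integ_restrict _ (measurable_itv `[1, Num.max b 1]))).
  apply: continuous_compact_integrable; first exact: segment_compact.
  apply: continuous_in_subspaceT => r; rewrite inE /= in_itv/= => /andP[ar _].
  by apply: cH; exact: lt_le_trans ar.
apply: (@integ_le _ _ _ leb _ _ _ (integD (integ_norm iT) (integ_norm iS))).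
  exact: cpos_lint_measurable.
move=> r; rewrite !indic_ocE IposE indic_segE; case: (ltP 0 r) => r0 /=; last first.
  by rewrite !mulr0 normr0 addr_ge0.
case: (leP r b) => rb; last by rewrite mulr0 normr0 addr_ge0.
rewrite !mulr1; case: (leP r 1) => r1.
  rewrite /T (_ : Num.min r 1 = r); last exact/min_idPl.
  rewrite (_ : Num.max r 1 = 1); last exact/max_idPr.
  by rewrite expr1n invr1 !mulr1 lerDl.
by rewrite (ltW r1) le_max rb/= mulr1 lerDr.
Qed.

End C1_class.

Section singularity.
Context (R : realType).

(* The fundamental solution of the Laplacian up to the factor |S^(n-1)|, for n = 2 and n = 3. *)
Definition sing (n : nat) (r : R) : R := if n == 2%N then - ln r else r^-1.

Lemma sing_dd n : (n == 2%N) || (n == 3%N) -> ddpos (sing n) (fun r => - (wt n r)^-1).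
Proof.
move=> n23 r r0; rewrite /sing /wt; case: eqP n23 => [-> _|_ /= /eqP->].
  by apply: ddN; rewrite expr1; exact: is_derive1_ln.
have rn : r != 0 by pos.
by apply: dd_eq (ddV rn (dd_id r)) _; rewrite mulN1r.
Qed.

Lemma sing_cvgy n : (n == 2%N) || (n == 3%N) -> sing n r @[r --> 0^'+] --> +oo.
Proof.
move=> n23; apply/cvgryPge => A; rewrite /sing; case: eqP n23 => [_ _|_ _].
  near=> r; have r0 : 0 < r by near: r; exact: nbhs_right_gt.
  rewrite lerNr -(expRK (- A)) ler_ln ?posrE ?expR_gt0//.
  by near: r; apply: nbhs_right_le; exact: expR_gt0.
near=> r; have r0 : 0 < r by near: r; exact: nbhs_right_gt.
apply: (le_trans (ler_norm A)); apply: (@le_trans _ _ (`|A| + 1)); first by rewrite lerDl.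
have A1 : 0 < `|A| + 1 by pos.
rewrite -[leLHS]invrK lef_pV2 ?posrE ?invr_gt0//.
by near: r; apply: nbhs_right_le; rewrite invr_gt0.
Unshelve. all: by end_near. Qed.

Lemma sing2_bound (th : R) : 0 < th ->
  forall r, 0 < r <= 1 -> 1 + `|sing 2 r| <= (1 + th^-1) * r `^ (- th).
Proof.
move=> th0 r /andP[r0 r1]; rewrite /sing eqxx normrN ler0_norm ?ln_le0//.
have rp : 0 < r `^ (- th) by pos.
have r1' : 1 <= r `^ (- th).
  rewrite /powR (gt_eqF r0) -expR0 ler_expR mulr_le0 ?oppr_le0 ?(ltW th0)//.
  by rewrite ln_le0.
rewrite mulrDl mul1r lerD//.
have := ln_sublinear rp; rewrite ln_powR mulNr => /ltW h.
by rewrite mulrC ler_pdivlMr// mulNr mulrC.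
Qed.

Lemma sing3_bound r : 0 < r <= 1 -> 1 + `|sing 3 r| <= 2 * r `^ (- 1).
Proof.
move=> /andP[r0 r1]; rewrite /sing/= powR_inv1 ?(ltW r0)// gtr0_norm ?invr_gt0//.
have : 1 <= r^-1 by rewrite invr_ge1 ?unitfE ?gt_eqF.
by lra.
Qed.

End singularity.

Section exponents.
Context (R : realType).

(* th is an exponent with sing n r = O(r^(-th)) at 0. *)
Definition good_exp (n : nat) (p th C : R) :=
  [/\ 0 < th <= 1, th * (p + 1) < n%:R, th * p < n%:R - 1, 2 * th < n%:R &
      0 <= C /\ forall r, 0 < r <= 1 -> 1 + `|sing n r| <= C * r `^ (- th)].

(** A logarithm is dominated by any negative power, so a small th serves in dimension 2. In
    dimension 3 the singularity 1/r forces th = 1, and the conditions become p < 2. *)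
Lemma good_exp_ex (n : nat) (p : R) : (n = 2%N /\ 1 <= p) \/ (n = 3%N /\ 1 <= p < 2) ->
  exists th C, good_exp n p th C.
Proof.
move=> [[-> p1]|[-> /andP[p1 p2]]].
  have p0 : 0 < 2 * (p + 1) by lra.
  exists (2 * (p + 1))^-1, (1 + (2 * (p + 1))^-1^-1); split.
  - by rewrite invr_gt0 p0 invf_le1//; move: p1; lra.
  - by rewrite -ltr_pdivlMl ?invr_gt0// invrK; move: p1; nra.
  - by rewrite -ltr_pdivlMl ?invr_gt0// invrK; move: p1; lra.
  - rewrite ltr_pdivrMr//; move: p1; lra.
  - split; first by rewrite addr_ge0// invrK ltW.
    by move=> r; apply: sing2_bound; rewrite invr_gt0.
exists 1, 2; split => //.
- by rewrite ltr01 lexx.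
- lra.
- lra.
- lra.
- by split => // r; exact: sing3_bound.
Qed.

Lemma wt_powR n (r : R) : (0 < n)%N -> 0 < r -> wt n r = r `^ (n%:R - 1).
Proof.
move=> n0 r0; rewrite /wt -powR_mulrn ?(ltW r0)//; congr (_ `^ _).
by rewrite -subn1 natrB.
Qed.

Lemma good_lint n p th C : (n == 2%N) || (n == 3%N) -> 1 <= p -> good_exp n p th C ->
  lint (Phi n (sing n) p).
Proof.
move=> n23 p1 [/andP[th0 _] h1 _ _ [C0 hC]].
have n0 : (0 < n)%N by case/orP: n23 => /eqP ->.
have dS := @sing_dd R n n23.
apply: lint_dom0; first by apply: Phi_cpos.
have a1 : -1 < n%:R - 1 - th * (p + 1) by lra.
have p0 : 0 <= p + 1 by lra.
apply: (dom0_le (powR_ge0 C (p + 1)) (dom0_powR a1)) => r /andP[r0 r1].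
have aS0 : 0 <= 1 + `|sing n r| by pos.
rewrite (ger0_norm (powR_ge0 _ _)) ger0_norm; last exact: Phi_ge0.
rewrite /Phi (wt_powR n0 r0).
apply: (@le_trans _ _ (r `^ (n%:R - 1) * (C * r `^ (- th)) `^ (p + 1))).
  rewrite ler_wpM2l ?powR_ge0//; apply: ge0_ler_powR; rewrite ?nnegrE ?mulr_ge0 ?powR_ge0//.
  by apply: hC; rewrite r0.
rewrite powRM ?powR_ge0// -powRrM mulrCA ler_wpM2l ?powR_ge0//.
by rewrite -powR_add// mulNr.
Qed.

End exponents.

(** * A priori bounds for profiles, Wronskians and comparison *)

Section profile_bounds.
Context (R : realType) (n : nat) (p th C0 : R).
Context (n23 : (n == 2%N) || (n == 3%N)) (p1 : 1 <= p) (gexp : good_exp n p th C0).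

Lemma n23_gt0 : (0 < n)%N. Proof. by case/orP: n23 => /eqP ->. Qed.

Lemma powN_ge1 (s r : R) : 0 <= s -> 0 < r <= 1 -> 1 <= r `^ (- s).
Proof.
move=> s0 /andP[r0 r1]; rewrite /powR (gt_eqF r0) -expR0 ler_expR mulr_le0 ?oppr_le0//.
by rewrite ln_le0.
Qed.

Lemma powN_mono (s t r : R) : s <= t -> 0 < r <= 1 -> r `^ (- s) <= r `^ (- t).
Proof.
move=> st /andP[r0 r1]; rewrite /powR (gt_eqF r0) ler_expR ler_wnM2r ?ln_le0//.
lra.
Qed.

Lemma powR_cvg0 (a : R) : 0 < a -> r `^ a @[r --> 0^'+] --> (0 : R).
Proof.
move=> a0; apply/cvgrPdist_lt => e e0.
have e' : 0 < e `^ a^-1 by pos.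
near=> r; have r0 : 0 < r by near: r; exact: nbhs_right_gt.
rewrite sub0r normrN ger0_norm ?powR_ge0//.
have -> : e = (e `^ a^-1) `^ a by rewrite -powRrM mulVf ?gt_eqF// powRr1// ltW.
have re : r < e `^ a^-1 by near: r; exact: nbhs_right_lt.
by apply: gt0_ltr_powR; rewrite ?nnegrE ?(ltW e').
Unshelve. all: by end_near. Qed.

Lemma rate0 (J j : R -> R) (a C d : R) : ddpos J j -> J r @[r --> 0^'+] --> (0 : R) -> 0 < a ->
  0 <= C -> (forall r, 0 < r <= d -> j r <= C * r `^ (a - 1)) ->
  forall r, 0 < r <= d -> J r <= C / a * r `^ a.
Proof.
move=> dJ J0 a0 C00 hj r /andP[r0 rd].
have dK : ddpos (fun r => J r - C / a * r `^ a) (fun r => j r - C / a * (a * r `^ (a - 1))).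
  by move=> x x0; apply: ddB; [exact: dJ|apply: ddZ; exact: ddpos_powR].
rewrite -subr_le0; apply: (cvg0_ge r0 J0) => e /andP[e0 er].
apply: (@le_trans _ _ (J e - C / a * e `^ a)).
  apply: (pos_nincr e0 (ltW er) dK) => x /andP[ex xr].
  rewrite subr_le0 mulrA mulfVK ?gt_eqF//; apply: hj.
  by rewrite (lt_trans e0 ex)/= (le_trans (ltW xr)).
by rewrite gerBl mulr_ge0 ?powR_ge0// divr_ge0// ltW.
Qed.

Lemma sing_near (v : R -> R) (a : R) : (v r - sing n r) @[r --> 0^'+] --> a ->
  exists2 d, 0 < d <= 1 & forall r, 0 < r < d -> v r <= (`|a| + 1) * C0 * r `^ (- th).
Proof.
move=> h; have [_ _ _ _ [C00 hC]] := gexp.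
have : \forall r \near 0^'+, v r - sing n r < `|a| + 1.
  by apply: (cvgr_lt _ h); rewrite (le_lt_trans (ler_norm _))// ltrDl.
move=> [e /= e0 he]; exists (Num.min e 1); first by rewrite lt_min e0 ltr01 ge_min lexx orbT.
move=> r /andP[r0]; rewrite lt_min => /andP[re r1].
have := he r; rewrite /ball_/= sub0r normrN gtr0_norm// => /(_ re r0) h1.
have r01 : 0 < r <= 1 by rewrite r0 ltW.
have h2 := hC r r01.
have h3 := ler_norm (sing n r).
have h4 : 0 <= `|sing n r| by [].
have h5 : 0 <= `|a| by [].
apply: (@le_trans _ _ ((`|a| + 1) * (1 + `|sing n r|))); first by nra.
nra.
Qed.

(** A growth class containing both l x and om x + M x^p, so that the bounds are proved once for the
    Green function and the ground state. *)
Definition gok (g : R -> R) := cpos g /\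
  exists2 B, 0 <= B & forall x, 0 < x -> 0 <= g x <= B * (x + x `^ p).

Lemma gok_lin (l : R) : 0 <= l -> gok (fun x => l * x).
Proof.
move=> l0; split.
  by move=> x x0; apply: cvgM; [exact: cvg_cst|exact: cvg_id].
exists l => // x x0; rewrite mulr_ge0 ?(ltW x0)//= ler_wpM2l// lerDl powR_ge0//.
Qed.

Lemma gok_pow (l M : R) : 0 <= l -> 0 <= M -> gok (fun x => l * x + M * x `^ p).
Proof.
move=> l0 M0; split.
  move=> x x0; apply: cvgD; apply: cvgM; [exact: cvg_cst|exact: cvg_id|exact: cvg_cst|].
  exact: cpos_powR.
exists (l + M); first exact: addr_ge0.
move=> x x0; have h := powR_ge0 x p; rewrite addr_ge0 ?mulr_ge0 ?(ltW x0)//=.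
by nra.
Qed.

Section one_profile.
Context (a : R) (g v J : R -> R) (gg : gok g) (pv : profile n (sing n) a g v J).

Lemma prof_v0 r : 0 < r -> 0 < v r. Proof. by have [h _ _ _ _] := pv; exact: h. Qed.
Lemma prof_dv : ddpos v (fun r => - (1 - J r) / wt n r). Proof. by have [_ h _ _ _] := pv. Qed.
Lemma prof_dJ : ddpos J (fun r => wt n r * g (v r)). Proof. by have [_ _ h _ _] := pv. Qed.
Lemma prof_J01 r : 0 < r -> 0 <= J r < 1. Proof. by have [_ _ _ h _] := pv; exact: h. Qed.
Lemma prof_J0 : J r @[r --> 0^'+] --> (0 : R). Proof. by have [_ _ _ _ []] := pv. Qed.
Lemma prof_S : (v r - sing n r) @[r --> 0^'+] --> a. Proof. by have [_ _ _ _ []] := pv. Qed.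
Lemma prof_oo : v r @[r --> +oo] --> (0 : R). Proof. by have [_ _ _ _ []] := pv. Qed.

Lemma prof_cv : cpos v. Proof. exact: ddpos_cpos prof_dv. Qed.
Lemma prof_cJ : cpos J. Proof. exact: ddpos_cpos prof_dJ. Qed.

Lemma wt_cpos' : cpos (wt n : R -> R). Proof. by move=> r _; exact: exprn_continuous. Qed.
Lemma wtV_cpos : cpos (fun r : R => (wt n r)^-1).
Proof.
by move=> r r0; apply: cvgV; [rewrite gt_eqF// exprn_gt0|exact: wt_cpos'].
Qed.

Lemma prof_cgv : cpos (fun r => g (v r)).
Proof.
move=> r r0; apply: (@continuous_comp _ _ _ v g); first exact: prof_cv.
by apply: gg.1; exact: prof_v0.
Qed.

Lemma prof_cJ' : cpos (fun r => wt n r * g (v r)).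
Proof. by move=> r r0; apply: cvgM; [exact: wt_cpos'|exact: prof_cgv]. Qed.

Lemma prof_cv' : cpos (fun r => - (1 - J r) / wt n r).
Proof.
move=> r r0; apply: cvgM; last exact: wtV_cpos.
by apply: cvgN; apply: cvgB; [exact: cvg_cst|exact: prof_cJ].
Qed.

Lemma prof_C1v : isC1 v. Proof. by exists (fun r => - (1 - J r) / wt n r); split; [exact: prof_dv|exact: prof_cv']. Qed.
Lemma prof_C1J : isC1 J. Proof. by exists (fun r => wt n r * g (v r)); split; [exact: prof_dJ|exact: prof_cJ']. Qed.

Lemma prof_le r r' : 0 < r -> r <= r' -> v r' <= v r.
Proof.
move=> r0; rewrite le_eqVlt => /predU1P[->//|rr].
by apply: ltW; exact: (profile_decr pv).
Qed.

Lemma prof_v : exists2 C, 0 <= C & forall r, 0 < r <= 1 -> v r <= C * r `^ (- th).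
Proof.
have [/andP[th0 _] _ _ _ [C00 hC]] := gexp.
have [d /andP[d0 d1] hd] := sing_near prof_S.
have d2 : 0 < d / 2 by pos.
have v2 := prof_v0 d2.
have c0 : 0 <= (`|a| + 1) * C0 by pos.
exists ((`|a| + 1) * C0 + v (d / 2)); first by rewrite addr_ge0// ltW.
move=> r /andP[r0 r1]; have [rd|rd] := ltP r d.
  apply: (le_trans (hd r _)); first by rewrite r0.
  by rewrite ler_wpM2r ?powR_ge0// lerDl ltW.
have h1 : 1 <= r `^ (- th) by apply: powN_ge1; [exact: ltW|rewrite r0].
have h2 : v r <= v (d / 2).
  by apply: prof_le => //; apply: le_trans rd; rewrite ler_pdivrMr// ler_pMr// ler1n.
by nra.
Qed.

Lemma prof_J : exists2 C, 0 <= C & forall r, 0 < r <= 1 -> J r <= C * r `^ (n%:R - th * p).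
Proof.
have [/andP[th0 th1] hp1 hp2 _ _] := gexp.
have [Cv Cv0 hv] := prof_v; have [B B0 hB] := gg.2.
pose C := B * (Cv + Cv `^ p).
have C_0 : 0 <= C by rewrite mulr_ge0// addr_ge0// powR_ge0.
have np : 0 < n%:R - th * p by lra.
exists (C / (n%:R - th * p)); first by rewrite divr_ge0// ltW.
move=> r rr; apply: (rate0 prof_dJ prof_J0 np C_0 _ rr) => x /andP[x0 x1].
have xx : 0 < x <= 1 by rewrite x0.
have -> : x `^ (n%:R - th * p - 1) = wt n x * x `^ (- (th * p)).
  rewrite (wt_powR n23_gt0 x0) -powR_add//.
  by congr (_ `^ _); ring.
rewrite mulrCA; apply: ler_wpM2l; first by rewrite ltW// exprn_gt0.
have vx := prof_v0 x0.
apply: (le_trans (andP (hB _ vx)).2); rewrite /C -mulrA ler_wpM2l// mulrDl lerD//.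
  apply: (le_trans (hv x xx)); rewrite ler_wpM2l//; apply: powN_mono => //.
  by move: th0 p1; nra.
apply: (@le_trans _ _ ((Cv * x `^ (- th)) `^ p)).
  by apply: ge0_ler_powR; rewrite ?nnegrE ?mulr_ge0 ?powR_ge0 ?(ltW vx) ?hv// (le_trans ler01 p1).
by rewrite powRM ?powR_ge0// -powRrM mulNr.
Qed.

(** The source is its own majorant and its primitive J is bounded by 1: integrability at infinity
    without any decay rate for v. *)
Lemma prof_domooJ : domoo (fun r => wt n r * g (v r)).
Proof.
exists (fun r => wt n r * g (v r)), J, 1; last first.
  move=> r r1; have r0 := lt_le_trans ltr01 r1.
  have /andP[_ h1] := prof_J01 r0; have /andP[h2 _] := prof_J01 (@ltr01 R).
  lra.
split; [exact: prof_cJ'|exact: prof_dJ|] => r r1.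
have r0 := lt_le_trans ltr01 r1; have [B B0 hB] := gg.2.
by rewrite ger0_norm// mulr_ge0 ?(andP (hB _ (prof_v0 r0))).1// ltW// exprn_gt0.
Qed.

Lemma prof_domoov : domoo (fun r => (1 - J r) / wt n r).
Proof.
exists (fun r => (1 - J r) / wt n r), (fun r => - v r), (v 1); last first.
  move=> r r1; have r0 := lt_le_trans ltr01 r1.
  by rewrite opprK gerDr oppr_le0 ltW// prof_v0.
split.
- move=> r r0; apply: cvgM; last exact: wtV_cpos.
  by apply: cvgB; [exact: cvg_cst|exact: prof_cJ].
- move=> r r0; apply: dd_eq (ddN (prof_dv r0)) _.
  by rewrite mulNr opprK.
- move=> r r1; have r0 := lt_le_trans ltr01 r1; have /andP[_ J1] := prof_J01 r0.
  by rewrite ger0_norm// divr_ge0// ?subr_ge0 ?exprn_ge0// ltW.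
Qed.

Lemma prof_half (f : R -> R) (s C D : R) : cpos f -> s < n%:R -> 0 <= C -> 0 <= D ->
  (forall r, 0 < r <= 1 -> `|f r| <= C * r `^ (- s)) ->
  (forall r, 1 <= r -> `|f r| <= D * g (v r)) -> halfint (fun r => f r * r ^+ n.-1).
Proof.
move=> cf sn C_0 D0 h0 hoo.
have a1 : -1 < n%:R - 1 - s by lra.
apply: half_dom.
- by move=> r r0; apply: cvgM; [exact: cf|exact: wt_cpos'].
- apply: (dom0_le C_0 (dom0_powR a1)) => r /andP[r0 r1].
  rewrite (ger0_norm (powR_ge0 _ _)) normrM [X in _ * X]ger0_norm ?exprn_ge0 ?(ltW r0)//.
  have -> : r `^ (n%:R - 1 - s) = r `^ (- s) * r ^+ n.-1.
    rewrite -[r ^+ n.-1]/(wt n r) (wt_powR n23_gt0 r0) -powR_add//.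
    by congr (_ `^ _); ring.
  by rewrite mulrA ler_wpM2r ?exprn_ge0 ?(ltW r0)// h0// r0.
- apply: (domoo_le D0 prof_domooJ) => r r1.
  have r0 := lt_le_trans ltr01 r1; have [B B0 hB] := gg.2.
  rewrite !normrM (ger0_norm (andP (hB _ (prof_v0 r0))).1) mulrC mulrCA.
  by rewrite ler_wpM2l// hoo.
Qed.

End one_profile.

(** A boundary term of the Wronskian: V J = O(r^(n - th (p+1))), a positive power of r. *)
Lemma prof_mix0 a b g k v V J I : gok g -> gok k -> profile n (sing n) a g v J ->
  profile n (sing n) b k V I -> (V r * J r) @[r --> 0^'+] --> (0 : R).
Proof.
move=> gg kk pv pV; have [/andP[th0 th1] hp1 hp2 _ _] := gexp.
have [C1 C10 h1] := prof_v pV; have [C2 C20 h2] := prof_J gg pv.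
have np : 0 < n%:R - th * (p + 1) by lra.
apply: (@squeeze_cvgr _ _ _ _ (fun=> 0) (fun r => C1 * C2 * r `^ (n%:R - th * (p + 1)))).
- near=> r; have r0 : 0 < r by near: r; exact: nbhs_right_gt.
  have r1 : r <= 1 by near: r; exact: nbhs_right_le.
  have rr : 0 < r <= 1 by rewrite r0.
  have /andP[J0 _] := prof_J01 pv r0.
  rewrite mulr_ge0 ?(ltW (prof_v0 pV r0))//=.
  apply: (le_trans (ler_pM (ltW (prof_v0 pV r0)) J0 (h1 r rr) (h2 r rr))).
  rewrite mulrACA -powR_add//.
  by rewrite (_ : - th + (n%:R - th * p) = n%:R - th * (p + 1))//; ring.
- exact: cvg_cst.
- rewrite -[X in _ --> X](mulr0 (C1 * C2)); apply: cvgM; first exact: cvg_cst.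
  exact: powR_cvg0.
Unshelve. all: by end_near. Qed.

(* The derivative of [V(1-J) - v(1-I)] is [v I' - V J']: the terms with [v'V'] cancel. *)
Lemma wronskian a b g k v V J I : gok g -> gok k -> profile n (sing n) a g v J ->
  profile n (sing n) b k V I -> halfint (fun r => v r * (wt n r * k (V r)) - V r * (wt n r * g (v r))) ->
  \int[leb]_r ((v r * (wt n r * k (V r)) - V r * (wt n r * g (v r))) * Ipos r) = a - b.
Proof.
move=> gg kk pv pV hi.
rewrite -[RHS]opprB -[RHS]sub0r.
(* This Wronskian tends to b - a at 0+ and to 0 at infinity. *)
apply: (half_ftc (F := fun r => V r * (1 - J r) - v r * (1 - I r)) _ _ hi).
- move=> r r0; apply: cvgB; apply: cvgM.
  + exact: (prof_cv pv).
  + exact: (prof_cJ' kk pV).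
  + exact: (prof_cv pV).
  + exact: (prof_cJ' gg pv).
- move=> r r0; have w0 : wt n r != 0 by rewrite gt_eqF// exprn_gt0.
  apply: dd_eq (ddB (ddM (prof_dv pV r0) (ddB (dd_cst 1 r) (prof_dJ pv r0)))
    (ddM (prof_dv pv r0) (ddB (dd_cst 1 r) (prof_dJ pV r0)))) _.
  by field.
- rewrite (_ : (fun r => _) = fun r => (V r - sing n r) - (v r - sing n r) - V r * J r + v r * I r); last first.
    by apply/funext => r; ring.
  rewrite -[b - a]addr0 -[b - a]subr0.
  apply: cvgD; last exact: (prof_mix0 kk gg pV pv).
  apply: cvgB; last exact: (prof_mix0 gg kk pv pV).
  by apply: cvgB; [exact: (prof_S pV)|exact: (prof_S pv)].
- rewrite -[X in _ --> X](subr0 (0 : R)).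
  have h u1 g1 J1 u2 g2 J2 c1 c2 : profile n (sing n) c1 g1 u1 J1 -> profile n (sing n) c2 g2 u2 J2 ->
      u1 r * (1 - J2 r) @[r --> +oo] --> (0 : R).
    move=> pu1 pu2; apply: (@squeeze_cvgr _ _ _ _ (fun=> 0) u1).
    - near=> r; have r0 : 0 < r by near: r; apply: nbhs_pinfty_gt; exact: num_real.
      have /andP[J0 J1'] := prof_J01 pu2 r0; have u0 := prof_v0 pu1 r0.
      by rewrite mulr_ge0 ?(ltW u0) ?subr_ge0 ?(ltW J1')//= ler_piMr ?(ltW u0)// gerBl.
    - exact: cvg_cst.
    - exact: (prof_oo pu1).
  by apply: cvgB; [exact: (h _ _ _ _ _ _ _ _ pV pv)|exact: (h _ _ _ _ _ _ _ _ pv pV)].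
Unshelve. all: by end_near. Qed.

(* If [v0] stayed nonnegative, [(v0 + b - a) / V] would be nonincreasing, although it is bounded
   below by [(b - a) / V], which tends to infinity. *)
Lemma no_nonneg_solution a b om v0 J0 u0 V I : 0 <= om ->
  profile n (sing n) b (fun x => om * x) V I -> a < b ->
  (forall r, 0 < r -> 0 <= v0 r) -> ddpos v0 (fun r => - (1 - J0 r) / wt n r) ->
  ddpos J0 (fun r => wt n r * (om * u0 r)) -> (forall r, 0 < r -> u0 r <= v0 r) ->
  J0 r @[r --> 0^'+] --> (0 : R) -> (v0 r - sing n r) @[r --> 0^'+] --> a -> False.
Proof.
move=> om0 pV ab v00 dv0 dJ0 u0v0 J00 v0S.
have kk := gok_lin om0.
have [/andP[th0 th1] _ _ hth [C00 _]] := gexp.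
(* The Wronskian of V and v0; the inequality u0 <= v0 makes it nondecreasing. *)
pose W r := V r * (1 - J0 r) - v0 r * (1 - I r).
have dW : ddpos W (fun r => wt n r * om * V r * (v0 r - u0 r)).
  move=> r r0; have w0 : wt n r != 0 by rewrite gt_eqF// exprn_gt0.
  apply: dd_eq (ddB (ddM (prof_dv pV r0) (ddB (dd_cst 1 r) (dJ0 r r0)))
    (ddM (dv0 r r0) (ddB (dd_cst 1 r) (prof_dJ pV r0)))) _.
  by field.
(* The sign of J0 is unknown. An upper bound of V J0 by a positive power of r, together with I >= 0,
   gives the lower bound of W near 0. *)
have W_ge r : 0 < r -> b - a <= W r.
  move=> r0.
  have [d /andP[d0 d1] hd] := sing_near v0S.
  have [Cv Cv0 hV] := prof_v pV.
  pose c := om * ((`|a| + 1) * C0).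
  have c0 : 0 <= c by rewrite !mulr_ge0// addr_ge0.
  have nth : 0 < n%:R - th by lra.
  have hJ : forall r, 0 < r <= d / 2 -> J0 r <= c / (n%:R - th) * r `^ (n%:R - th).
    apply: (rate0 dJ0 J00 nth c0) => x /andP[x0 xd].
    have -> : x `^ (n%:R - th - 1) = wt n x * x `^ (- th).
      rewrite (wt_powR n23_gt0 x0) -powR_add//.
      by congr (_ `^ _); ring.
    rewrite [leRHS]mulrCA; apply: ler_wpM2l; first by rewrite ltW// exprn_gt0.
    rewrite /c -mulrA ler_wpM2l// (le_trans (u0v0 _ x0))// hd// x0/=.
    lra.
  pose K := Cv * (c / (n%:R - th)).
  pose e0 := n%:R - 2 * th.
  have e00 : 0 < e0 by rewrite subr_gt0.
  have cvgK : (V r - sing n r) - (v0 r - sing n r) - K * r `^ e0 @[r --> 0^'+] --> b - a.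
    rewrite -[b - a]subr0 -{2}(mulr0 K); apply: cvgB.
      by apply: cvgB; [exact: (prof_S pV)|exact: v0S].
    by apply: cvgM; [exact: cvg_cst|exact: powR_cvg0].
  pose d' := Num.min r (d / 2).
  have d'0 : 0 < d' by rewrite lt_min r0 divr_gt0.
  apply: (cvg0_le d'0 cvgK) => t /andP[t0]; rewrite lt_min => /andP[tr td].
  apply: (@le_trans _ _ (W t)); last first.
    apply: (pos_ndecr t0 (ltW tr) dW) => x /andP[tx _].
    have x0 := lt_trans t0 tx.
    rewrite mulr_ge0 ?subr_ge0 ?u0v0// mulr_ge0 ?(ltW (prof_v0 pV x0))// mulr_ge0//.
    by rewrite ltW// exprn_gt0.
  have td2 : 0 < t <= d / 2 by rewrite t0 ltW.
  have t01 : 0 < t <= 1.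
    by rewrite t0 (le_trans (ltW td))// ler_pdivrMr//; move: d1; lra.
  have /andP[I0' _] := prof_J01 pV t0.
  have Vt := ltW (prof_v0 pV t0).
  have h1 : V t * J0 t <= K * t `^ e0.
    apply: (le_trans (ler_wpM2l Vt (hJ t td2))).
    have h2 := hV t t01.
    apply: (le_trans (ler_wpM2r _ h2)).
      pos.
    rewrite /K mulrACA -powR_add//.
    by rewrite (_ : - th + (n%:R - th) = e0)// /e0; ring.
  have h3 := mulr_ge0 (v00 t t0) I0'.
  by rewrite /W; move: h1 h3; lra.
(* The numerator of Q' is (b - a)(1 - I) - W, nonpositive by [W_ge]. *)
pose Q r := (v0 r + (b - a)) / V r.
have dQ : ddpos Q (fun r => (v0 r + (b - a)) * (- (- (1 - I r) / wt n r) / V r ^+ 2) +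
    (- (1 - J0 r) / wt n r + 0) * (V r)^-1).
  move=> r r0; apply: ddM; first by apply: ddD; [exact: dv0|exact: dd_cst].
  by apply: ddV; [rewrite gt_eqF// (prof_v0 pV)|exact: (prof_dv pV)].
have Qle r : 1 <= r -> Q r <= Q 1.
  move=> r1; apply: (pos_nincr ltr01 r1 dQ) => x /andP[x1 _].
  have x0 := lt_trans ltr01 x1.
  have w0 : 0 < wt n x by rewrite exprn_gt0.
  have V0 := prof_v0 pV x0.
  have /andP[hI _] := prof_J01 pV x0.
  have -> : (v0 x + (b - a)) * (- (- (1 - I x) / wt n x) / V x ^+ 2) +
    (- (1 - J0 x) / wt n x + 0) * (V x)^-1 = ((b - a) * (1 - I x) - W x) / (wt n x * V x ^+ 2).
    by rewrite /W; field; rewrite !gt_eqF.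
  rewrite pmulr_lle0 ?invr_gt0 ?mulr_gt0 ?exprn_gt0// subr_le0.
  by apply: le_trans (W_ge x x0); rewrite ler_piMr ?subr_ge0 ?(ltW ab)// gerBl.
have ba : 0 < b - a by rewrite subr_gt0.
have Q1 : 0 < Q 1.
  by rewrite divr_gt0 ?(prof_v0 pV)// ltr_wpDl// v00.
have : \forall r \near +oo, V r < (b - a) / Q 1.
  by apply: (cvgr_lt _ (prof_oo pV)); rewrite divr_gt0.
move=> hV; have [r [r1 Vr]] : exists r, 1 <= r /\ V r < (b - a) / Q 1.
  near (+oo : set_system R) => r; exists r; split; last by near: r.
  by near: r; apply: nbhs_pinfty_ge; exact: num_real.
have r0 := lt_le_trans ltr01 r1.
have := Qle r r1; rewrite leNgt => /negP; apply.
rewrite /Q ltr_pdivlMr ?(prof_v0 pV)//.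
move: Vr; rewrite ltr_pdivlMr// mulrC => h.
by apply: (lt_le_trans h); rewrite lerDr v00.
Unshelve. all: by end_near. Qed.

End profile_bounds.

(** * Weak derivatives of radial functions *)

Section weak_derivative_calculus.
Context (R : realType) (n : nat).
Local Notation leb := (@lebesgue_measure R).
Local Notation E := 'rV[R]_n.
Local Notation mu := (lebesgue_rV R n).
Implicit Types (i : 'I_n) (g h K : E -> R).

Lemma wder_eq i g g' h h' : (forall x, g x = g' x) -> (forall x, h x = h' x) -> wder i g h -> wder i g' h'.
Proof. by move=> /funext <- /funext <-. Qed.

Lemma bump1_dd (k k' : R -> R) : bump1 k -> (forall x, dd k x (k' x)) -> bump1 k'.
Proof.
move=> bk dk; have [k1 bk1 dk1] := bump1_der bk.
by rewrite (_ : k' = k1)//; apply/funext => x; exact: dd_unique (dk x) (dk1 x).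
Qed.

Lemma wderZ (c : R) i g h : wder i g h -> wder i (fun x => c * g x) (fun x => c * h x).
Proof.
move=> [lg lh H]; split; [exact: locintegZ|exact: locintegZ|].
move=> k k' bk dk.
have bu := upd_bump1 i bk (bump1_dd (bk i) dk).
rewrite (Int_ext mu _ (fun x => c * (g x * prodf (upd k i k') x))); last by move=> x; rewrite mulrA.
rewrite [in RHS](Int_ext mu _ (fun x => c * (h x * prodf k x))); last by move=> x; rewrite mulrA.
by rewrite !IntZ ?H ?mulrN//; exact: locinteg_prodf.
Qed.

Lemma wderD i g1 h1 g2 h2 : wder i g1 h1 -> wder i g2 h2 ->
  wder i (fun x => g1 x + g2 x) (fun x => h1 x + h2 x).
Proof.
move=> [lg1 lh1 H1] [lg2 lh2 H2]; split; [exact: locintegD|exact: locintegD|].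
move=> k k' bk dk.
have bu := upd_bump1 i bk (bump1_dd (bk i) dk).
rewrite (Int_ext mu _ (fun x => g1 x * prodf (upd k i k') x + g2 x * prodf (upd k i k') x)); last first.
  by move=> x; rewrite mulrDl.
rewrite [in RHS](Int_ext mu _ (fun x => h1 x * prodf k x + h2 x * prodf k x)); last first.
  by move=> x; rewrite mulrDl.
by rewrite !IntD ?H1 ?H2 ?opprD//; exact: locinteg_prodf.
Qed.

Lemma wderB i g1 h1 g2 h2 : wder i g1 h1 -> wder i g2 h2 ->
  wder i (fun x => g1 x - g2 x) (fun x => h1 x - h2 x).
Proof.
move=> H1 H2; apply: wder_eq (wderD H1 (wderZ (-1) H2)) => x; by rewrite mulN1r.
Qed.

Lemma locinteg_bounded (g : E -> R) C : mfun g -> (forall x, `|g x| <= C) -> locinteg g.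
Proof.
move=> mg gC; split=> // m.
have i1 := integ_cube R n m.
by apply: (integ_eq _ (integM_bounded i1 mg gC)) => x; rewrite mulrC.
Qed.

Lemma locinteg_le (g G : E -> R) : mfun g -> locinteg G -> (forall x, `|g x| <= G x) -> locinteg g.
Proof.
move=> mg [mG iG] gG; split=> // m.
apply: (integ_le _ (iG m)); first by apply: measurable_funM => //; exact: indic_cube_measurable.
by move=> x; rewrite normrM [X in _ * X]ger0_norm// ler_wpM2r.
Qed.

Lemma bump1_integ k : bump1 k -> integ leb k.
Proof.
move=> bk; have [_ [M kM]] := bk; apply: (cont_csupp_integ (a := - M) (b := M) (bump1_cont bk) _ _).1.
  by move=> r rM; apply: kM; rewrite -normrN (le_trans _ (ler_norm _))// lerNr ltW.
by move=> r rM; apply: kM; rewrite (le_trans (ltW rM))// ler_norm.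
Qed.

Lemma bump1_Int_der k k' : bump1 k -> (forall x, dd k x (k' x)) -> \int[leb]_x k' x = 0.
Proof.
move=> bk dk; have bk1 := bump1_dd bk dk.
have [_ [M kM]] := bk; have [_ [M' kM']] := bk1.
pose b := `|M| + `|M'| + 1.
have b0 : 0 < b by rewrite ltr_wpDl// addr_ge0.
have bM : M <= b /\ M' <= b.
  by have := ler_norm M; have := ler_norm M'; have := normr_ge0 M; have := normr_ge0 M'; rewrite /b; lra.
have out (f : R -> R) (N r : R) : (forall x : R, N <= `|x| -> f x = 0) -> N <= b -> b <= `|r| -> f r = 0.
  by move=> fN Nb br; apply: fN; exact: le_trans br.
rewrite ((cont_csupp_integ (k := k') (a := - b) (b := b) _ _ _).2 (- b) b)//.
- rewrite (ftc2 _ dk) ?gtrN//; last exact: bump1_cont.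
  by rewrite !(out k M)//= ?bM.1 ?normrN ?gtr0_norm ?subrr.
- exact: bump1_cont.
- move=> r rb; apply: (out _ M') => //; first exact: bM.2.
  by rewrite -normrN (le_trans _ (ler_norm _))// lerNr ltW.
- move=> r rb; apply: (out _ M') => //; first exact: bM.2.
  by rewrite (le_trans (ltW rb))// ler_norm.
Qed.

Lemma wder_cst i (c : R) : wder i (fun=> c) (fun=> 0).
Proof.
suff h1 : wder i ((fun=> 1) : E -> R) (fun=> 0).
  by apply: wder_eq (wderZ c h1) => x; rewrite ?mulr1 ?mulr0.
split; [by apply: (locinteg_bounded (C := 1)) => // x; rewrite normr1|
        by apply: (locinteg_bounded (C := 0)) => // x; rewrite normr0|].
move=> k k' bk dk.
have bu := upd_bump1 i bk (bump1_dd (bk i) dk).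
rewrite (Int_ext mu _ (prodf (upd k i k'))); last by move=> x; rewrite mul1r.
rewrite [in RHS](Int_ext mu _ (fun=> 0)); last by move=> x; rewrite mul0r.
rewrite Int0 oppr0 (Int_prodf (fun j => bump1_integ (bu j))).2 (bigD1 i)//=.
by rewrite {1}/upd eqxx (bump1_Int_der (bk i) dk) mul0r.
Qed.

(** The divergence theorem for compact support, obtained as integration by parts against the
    constant 1. *)
Lemma Int_deriv0 i (K K' : E -> R) m C : continuous K -> mfun K' ->
  (forall x, is_derive x (e_ i) K (K' x)) -> (forall x, ~ rV_cube m x -> K x = 0) ->
  (forall x, `|K x| <= C) -> (forall x, `|K' x| <= C) -> \int[mu]_x K' x = 0.
Proof.
move=> cK mK' dK K0 bK bK'.
have := wder_ibp (wder_cst i 1) cK mK' dK K0 bK bK'.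
rewrite (Int_ext mu _ K') => [->|x]; last by rewrite mul1r.
by rewrite (Int_ext mu _ (fun=> 0)) ?Int0 ?oppr0// => x; rewrite mul0r.
Qed.

Lemma wder_C1 i (g h : E -> R) C : continuous g -> mfun h ->
  (forall x, is_derive x (e_ i) g (h x)) -> (forall x, `|g x| <= C) -> (forall x, `|h x| <= C) ->
  wder i g h.
Proof.
move=> cg mh dg bg bh.
have C0 : 0 <= C by apply: le_trans (bg 0).
have mg := continuous_measurable_rV cg.
have lg := locinteg_bounded mg bg; have lh := locinteg_bounded mh bh.
split => // k k' bk dk.
have bu := upd_bump1 i bk (bump1_dd (bk i) dk).
have [C1 C10 b1] := prodf_bounded bk; have [C2 C20 b2] := prodf_bounded bu.
have [m [C3 C30 b3]] := prodf_cube bk.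
have : \int[mu]_x (g x * prodf (upd k i k') x + h x * prodf k x) = 0.
  apply: (@Int_deriv0 i (fun x => g x * prodf k x) _ m (C * C1 + C * C2 + C * C1)).
  - have ck : continuous (prodf k) by apply: prodf_continuous => j; exact: bump1_cont.
    by move=> x; apply: continuousM; [exact: cg|exact: ck].
  - by apply: measurable_funD; apply: measurable_funM => //; exact: prodf_measurable.
  - move=> x; have := is_deriveM (dg x) (prodf_is_derive (dk (x ord0 i))).
    by rewrite /GRing.scale/= [X in _ + X]mulrC.
  - move=> x xm; have := b3 x; rewrite indicE memNset// mulr0 normr_le0 => /eqP ->.
    by rewrite mulr0.
  - move=> x; rewrite normrM; apply: (@le_trans _ _ (C * C1)); first exact: ler_pM.
    nra.
  - move=> x; apply: (le_trans (ler_normD _ _)); apply: (@le_trans _ _ (C * C2 + C * C1)).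
      by rewrite !normrM; apply: lerD; exact: ler_pM.
    nra.
rewrite IntD; [|exact: locinteg_prodf|exact: locinteg_prodf].
by move/eqP; rewrite addr_eq0 => /eqP.
Qed.

Lemma wder_dct i (g_ h_ : nat -> E -> R) (g h G H : E -> R) : (forall m, wder i (g_ m) (h_ m)) ->
  locinteg g -> locinteg h -> locinteg G -> locinteg H ->
  (forall m x, `|g_ m x| <= G x) -> (forall m x, `|h_ m x| <= H x) ->
  (forall x, g_ ^~ x @ \oo --> g x) -> (forall x, h_ ^~ x @ \oo --> h x) -> wder i g h.
Proof.
move=> w lg lh lG lH bg bh cg ch; split=> // k k' bk dk.
have bu := upd_bump1 i bk (bump1_dd (bk i) dk).
have key (f_ : nat -> E -> R) (f F : E -> R) (kk : 'I_n -> R -> R) : (forall j, bump1 (kk j)) -> (forall m, mfun (f_ m)) ->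
    locinteg F -> (forall m x, `|f_ m x| <= F x) -> (forall x, f_ ^~ x @ \oo --> f x) ->
    \int[mu]_x (f_ m x * prodf kk x) @[m --> \oo] --> \int[mu]_x (f x * prodf kk x).
  move=> bkk mf lF bf cf.
  apply: (@dct_cvg _ _ _ mu _ _ (fun x => `|F x * prodf kk x|)).
  - by move=> m; apply: measurable_funM => //; exact: prodf_measurable.
  - exact/integ_norm/locinteg_prodf.
  - by move=> m x; rewrite !normrM ler_wpM2r//; exact: le_trans (bf m x) (ler_norm _).
  - by move=> x; apply: cvgM; [exact: cf|exact: cvg_cst].
have h1 := key g_ g G _ bu (fun m => let: And3 lg1 _ _ := w m in lg1.1) lG bg cg.
have h2 := key h_ h H _ bk (fun m => let: And3 _ lh1 _ := w m in lh1.1) lH bh ch.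
have h3 : \int[mu]_x (g_ m x * prodf (upd k i k') x) @[m --> \oo] --> - \int[mu]_x (h x * prodf k x).
  rewrite (_ : (fun m => _) = fun m => - \int[mu]_x (h_ m x * prodf k x)); first exact: cvgN.
  by apply/funext => m; have [_ _ ->] := w m.
exact: (@cvg_unique _ (@Rhausdorff R) _ _ _ _ h1 h3).
Qed.

Lemma wder_unique i g h h' : wder i g h -> wder i g h' -> \forall x \ae mu, h x = h' x.
Proof.
move=> [lg lh H] [_ lh' H'].
have : \forall x \ae mu, h x - h' x = 0.
  apply: (fundamental_lemma (locintegB lh lh')) => k bk.
  have [k' bk' dk] := bump1_der (bk i).
  have := H k k' bk dk; rewrite (H' k k' bk dk) => /oppr_inj e.
  rewrite (Int_ext mu _ (fun x => h x * prodf k x - h' x * prodf k x)); last first.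
    by move=> x; rewrite mulrBl.
  by rewrite IntB; [rewrite e subrr|exact: locinteg_prodf|exact: locinteg_prodf].
by apply: filterS => x /eqP; rewrite subr_eq0 => /eqP.
Qed.

Lemma wder_aeq i g g' h : mfun g' -> (\forall x \ae mu, g x = g' x) ->
  wder i g h -> wder i g' h.
Proof.
move=> mg' gg' [lg lh H].
have mM (kk : 'I_n -> R -> R) (f : E -> R) : mfun f -> (forall j, bump1 (kk j)) ->
    mfun (fun x => f x * prodf kk x).
  by move=> mf bkk; apply: measurable_funM => //; exact: prodf_measurable.
split=> //.
  split=> // m; apply: (integ_ae _ (lg.2 m)).
    by apply: measurable_funM => //; exact: indic_cube_measurable.
  by apply: filterS gg' => x ->.
move=> k k' bk dk.
have bu := upd_bump1 i bk (bump1_dd (bk i) dk).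
rewrite -(H k k' bk dk); apply: Int_ae; [exact: mM|exact: (mM _ _ lg.1)|].
by apply: filterS gg' => x ->.
Qed.

End weak_derivative_calculus.

(** * Gradients and divergences of radial functions *)

Section radial_calculus.
Context (R : realType) (n : nat).
Context (n_gt0 : (0 < n)%N).
Local Notation E := 'rV[R]_n.
Local Notation mu := (lebesgue_rV R n).

Lemma radE H (x : E) : x != 0 -> rad H x = H (enorm x).
Proof. by move=> x0; rewrite /rad IposE enorm_gt0 x0 mulr1. Qed.

Lemma rad0 H : rad H (0 : E) = 0.
Proof. by rewrite /rad IposE enorm_gt0 eqxx mulr0. Qed.

Lemma enorm0 : enorm (0 : E) = 0.
Proof. by apply/eqP; rewrite eq_le enorm_ge0 leNgt enorm_gt0 eqxx. Qed.

Lemma coord_measurable i : mfun (fun x : E => x ord0 i).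
Proof. exact: measurable_coord. Qed.

Lemma enorm_line i (x : E) h :
  enorm (h *: e_ i + x) = Num.sqrt ((h + x ord0 i) ^+ 2 + (enorm x ^+ 2 - x ord0 i ^+ 2)).
Proof.
rewrite enorm_sq /enorm (bigD1 i)//= [in RHS](bigD1 i)//= coord_line eqxx addrAC subrr add0r.
congr (Num.sqrt (_ + _)); apply: eq_bigr => j /negbTE ji.
by rewrite coord_line ji.
Qed.

(** The origin is harmless because H vanishes near 0. Gradients of radial functions are always
    written as x_i times the radial factor H'(r)/r. *)
Lemma radial_deriv (H H' : R -> R) a : (forall r, dd H r (H' r)) -> 0 < a ->
  (forall r, r <= a -> H r = 0) -> forall x i,
  is_derive x (e_ i) (fun x : E => H (enorm x)) (x ord0 i * rad (fun r => H' r / r) x).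
Proof.
move=> dH a0 Ha x i; pose q := enorm x ^+ 2 - x ord0 i ^+ 2.
apply: (is_derive_coord (g := fun s => H (Num.sqrt (s ^+ 2 + q)))).
  by move=> h; rewrite enorm_line.
have [x0|x0] := eqVneq x 0.
  rewrite x0 mxE mul0r; apply: (dd_near _ (dd_cst 0 _)).
  near=> s; rewrite Ha// -(gtr0_norm a0) -sqrtr_sqr ler_wsqrtr//.
  rewrite /q x0 enorm0 mxE subrr addr0.
  by rewrite -real_normK ?num_real// ler_sqr ?nnegrE ?(ltW a0).
have sq : x ord0 i ^+ 2 + q = enorm x ^+ 2 by rewrite /q addrC subrK.
have e0 := enorm_pos x0.
have es : Num.sqrt (x ord0 i ^+ 2 + q) = enorm x by rewrite sq sqrtr_sqr gtr0_norm.
have dq : dd (fun s => s ^+ 2 + q) (x ord0 i) (2 * x ord0 i).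
  by apply: dd_eq (ddD (ddX 2 _) (dd_cst q _)) _; rewrite addr0 expr1.
have ds : dd (fun s => Num.sqrt (s ^+ 2 + q)) (x ord0 i) ((2 * enorm x)^-1 * (2 * x ord0 i)).
  apply: (dd_comp (f := Num.sqrt)) dq.
  by rewrite -es; apply: is_derive1_sqrt; rewrite sq exprn_gt0.
apply: dd_eq (dd_comp (f := H) _ ds) _; first exact: dH.
by rewrite es radE//; field; rewrite gt_eqF.
Unshelve. all: by end_near. Qed.

(** The model majorant: it behaves like r^(-s) at the origin and like r^(-t) at infinity. *)
Lemma rad_pow_integ s t : s < n%:R -> n%:R < t -> 0 <= s ->
  integ mu (rad (fun r : R => r `^ (- s) * (1 + r) `^ (- (t - s))) : E -> R).
Proof.
move=> sn nt s0; pose H (r : R) := r `^ (- s) * (1 + r) `^ (- (t - s)).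
have H0 r : 0 < r -> 0 <= H r by move=> _; apply: mulr_ge0; exact: powR_ge0.
have C1H : isC1 H.
  apply: isC1M; first exact: isC1_powR.
  apply: isC1_comp_powR => [|r r0]; last by rewrite addr_gt0.
  by apply: isC1D; [exact: isC1_cst|exact: isC1_id].
have Hle a r : 0 < r -> H r <= r `^ a -> `|H r * r ^+ n.-1| <= 1 * `|r `^ (a + (n%:R - 1))|.
  move=> r0 h; have w0 : 0 <= r ^+ n.-1 by rewrite exprn_ge0// ltW.
  rewrite mul1r (ger0_norm (mulr_ge0 (H0 _ r0) w0)) (ger0_norm (powR_ge0 _ _)) powR_add// -(wt_powR n_gt0 r0).
  by rewrite ler_wpM2r.
have [H' cH'] := C1H.
suff h : halfint (fun r => H r * r ^+ n.-1) by have [] := (radial_ge0 n_gt0 cH' H0).1 h.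
have ts : 0 <= t - s by lra.
have pge1 (r a : R) : 0 <= a -> 0 < r -> r <= 1 + r -> r `^ a <= (1 + r) `^ a.
  by move=> a0 r0 rr; apply: ge0_ler_powR; rewrite ?nnegrE// ?addr_ge0 ?ltW.
apply: half_dom.
- by move=> r r0; apply: cvgM; [exact: (isC1_cpos C1H)|exact: exprn_continuous].
- have a1 : -1 < - s + (n%:R - 1) by lra.
  apply: (dom0_le ler01 (dom0_powR a1)) => r /andP[r0 r1]; apply: Hle => //.
  rewrite ler_piMr ?powR_ge0// powRN invf_le1 ?powR_gt0 ?addr_gt0//.
  by rewrite -[leLHS](powRr0 (1 + r)) ler_powR// lerDl ltW.
- have a1 : - t + (n%:R - 1) < -1 by lra.
  apply: (domoo_le ler01 (domoo_powR a1)) => r r1; have r0 := lt_le_trans ltr01 r1; apply: Hle => //.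
  rewrite (_ : - t = - s + - (t - s)); last by ring.
  rewrite powR_add// ler_wpM2l ?powR_ge0// !powRN lef_pV2 ?posrE ?powR_gt0 ?addr_gt0//.
  by apply: pge1; rewrite // lerDr.
Qed.

Lemma locinteg_rad H C s : cpos H -> 0 <= C -> 0 <= s < n%:R ->
  (forall r, 0 < r -> `|H r| <= C * (1 + r `^ (- s))) -> locinteg (rad H : E -> R).
Proof.
move=> cH C0 /andP[s0 sn] bH; split; first exact: rad_measurable.
(* On the cube (1 + |x|)^t is at most B^t, which compensates the decay of the model majorant. *)
move=> m; pose t : R := n%:R + 1; pose B : R := 2 + n%:R * m%:R ^+ 2.
have nt : n%:R < t by rewrite ltrDl.
have B0 : 0 < B by rewrite ltr_wpDr// mulr_ge0.
have i0 := rad_pow_integ (le_lt_trans s0 sn) nt (lexx 0).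
have i1 := rad_pow_integ sn (ltr_wpDr s0 nt) s0.
apply: (integ_le _ (integZ (C * B `^ t) (integD i0 i1))).
  by apply: measurable_funM; [exact: rad_measurable|exact: indic_cube_measurable].
move=> x; have [->|x0] := eqVneq x 0; first by rewrite !rad0 mul0r normr0 addr0 mulr0.
rewrite !radE// subr0 addrK oppr0 powRr0 -mulrDl -mulrA; have e0 := enorm_pos x0.
rewrite indicE; case: (boolP (x \in _)) => [/set_mem xm|_]; last first.
  by rewrite mulr0 normr0; pos.
rewrite mulr1 (le_trans (bH _ e0))// ler_wpM2l// mulrCA ler_peMr ?addr_ge0 ?powR_ge0//.
rewrite powRN ler_pdivlMr ?powR_gt0 ?addr_gt0// mul1r.
apply: ge0_ler_powR; rewrite ?nnegrE ?addr_ge0 ?(ltW B0) ?(ltW e0)//.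
suff : enorm x ^+ 2 <= n%:R * m%:R ^+ 2 by rewrite /B; nra.
rewrite enorm_sq mulr_natl -[X in _ *+ X]card_ord -sumr_const.
apply: ler_sum => i _; have := xm i; rewrite /= in_itv/= => /andP[h1 h2].
nra.
Qed.

Lemma seg_bounded (k : R -> R) a b : continuous k -> (forall r, r < a -> k r = 0) ->
  (forall r, b < r -> k r = 0) -> exists2 C, 0 <= C & forall r, `|k r| <= C.
Proof.
move=> ck ka kb; have [C C0 hC] := cont_bounded_seg a b ck; exists C => // r.
have [ra|ra] := ltP r a; first by rewrite ka ?normr0.
have [rb|rb] := ltP b r; first by rewrite kb ?normr0.
by apply: hC; rewrite ra.
Qed.

Lemma coord_rad_le (x : E) i H (C : R) : 0 <= C -> (forall r, 0 < r -> `|r * H r| <= C) ->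
  `|x ord0 i * rad H x| <= C.
Proof.
move=> C0 hH; have [->|x0] := eqVneq x 0; first by rewrite rad0 mulr0 normr0.
have e0 := enorm_pos x0.
apply: le_trans (hH _ e0); rewrite radE// !normrM ler_wpM2r// (le_trans (enorm_coord x i))//.
exact: ler_norm.
Qed.

(** With cutoffs near 0 and infinity the derivative is classical, and the cutoffs are then removed
    by dominated convergence. The error F c' is dominated by |F|/r, locally integrable because s + 1
    < n. *)
Lemma wder_rad i (F F' : R -> R) C s t : C1pos F F' -> 0 <= C -> 0 <= s -> s + 1 < n%:R ->
  0 <= t < n%:R -> (forall r, 0 < r -> `|F r| <= C * (1 + r `^ (- s))) ->
  (forall r, 0 < r -> `|F' r| <= C * (1 + r `^ (- t))) ->
  wder i (rad F : E -> R) (fun x => x ord0 i * rad (fun r => F' r / r) x).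
Proof.
move=> CF C0 s0 sn tn bF bF'.
have cF := ddpos_cpos CF.1; have cF' := CF.2.
have cinv : cpos (fun r : R => r^-1) by move=> r r0; apply: cvgV; [rewrite gt_eqF|exact: cvg_id].
have cFr : cpos (fun r => `|F r| / r).
  by move=> r r0; apply: cvgM; [apply: cvg_norm; exact: cF|exact: cinv].
have cF'r : cpos (fun r => F' r / r) by move=> r r0; apply: cvgM; [exact: cF'|exact: cinv].
have cnF : cpos (fun r => `|F r|) by move=> r r0; apply: cvg_norm; exact: cF.
have cnF' : cpos (fun r => `|F' r|) by move=> r r0; apply: cvg_norm; exact: cF'.
have ss : 0 <= s < n%:R by rewrite s0; move: sn; lra.
have s1 : 0 <= s + 1 < n%:R by rewrite sn addr_ge0.
have lF : locinteg (rad F : E -> R) := locinteg_rad cF C0 ss bF.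
have lnF : locinteg (rad (fun r => `|F r|) : E -> R).
  by apply: (locinteg_rad cnF C0 ss) => r r0; rewrite normr_id bF.
have lnF' : locinteg (rad (fun r => `|F' r|) : E -> R).
  by apply: (locinteg_rad cnF' C0 tn) => r r0; rewrite normr_id bF'.
have lFr : locinteg (rad (fun r => `|F r| / r) : E -> R).
  apply: (locinteg_rad (C := C * 2) cFr _ s1) => [|r r0]; first by rewrite mulr_ge0.
  rewrite normrM normr_id normfV (gtr0_norm r0) ler_pdivrMr//.
  apply: (le_trans (bF r r0)); rewrite -!mulrA ler_wpM2l//.
  have e1 : r `^ (- (s + 1)) * r = r `^ (- s).
    rewrite -{2}(powRr1 (ltW r0)) -powR_add//.
    by congr (_ `^ _); ring.
  rewrite [X in _ <= _ * X]mulrDl mul1r e1; have p0 := powR_ge0 r (- s).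
  have [r1|r1] := leP r 1; last by nra.
  have : 1 <= r `^ (- s) by apply: powN_ge1; rewrite ?r0.
  by nra.
have mcoord H : cpos H -> mfun (fun x : E => x ord0 i * rad H x).
  by move=> cH; apply: measurable_funM; [exact: coord_measurable|exact: rad_measurable].
have lh : locinteg (fun x : E => x ord0 i * rad (fun r => F' r / r) x).
  apply: (locinteg_le (mcoord _ cF'r) lnF') => x.
  have [->|x0] := eqVneq x 0; first by rewrite !rad0 mulr0 normr0.
  have e0 := enorm_pos x0.
  rewrite !radE// !normrM mulrCA ler_piMr// normfV (gtr0_norm e0) ler_pdivrMr// mul1r.
  exact: enorm_coord.
have [c [c' [D D0 [[dc cc' c01 clo chi] [rc' cvg1 cvg0]]]]] := cutoffs R.
have a0 m : 0 < (m.+1%:R^-1 : R) by pos.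
have cut m := C1pos_cut CF (a0 m) (dc m) (cc' m) (clo m).
pose G' m r := F r * c' m r + F' r * c m r.
apply: (wder_dct (g_ := fun m (x : E) => F (enorm x) * c m (enorm x))
  (h_ := fun m x => x ord0 i * rad (fun r => G' m r / r) x)
  (G := rad (fun r => `|F r|)) (H := fun x => rad (fun r => `|F' r|) x + D * rad (fun r => `|F r| / r) x)) => //.
- move=> m.
  have [dG cG] := cut m.
  have FC0 r : r <= m.+1%:R^-1 -> F r * c m r = 0 by move=> rm; rewrite clo ?mulr0.
  have FC1 r : 2 * m.+1%:R <= r -> F r * c m r = 0 by move=> rm; rewrite chi ?mulr0.
  have G0 := dd_cst_lt dG FC0; have G1 := dd_cst_gt dG FC1.
  have cFC : continuous (fun r => F r * c m r) by move=> r; exact: dd_cont (dG r).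
  have [B1 B10 hB1] := seg_bounded cFC (fun r h => FC0 r (ltW h)) (fun r h => FC1 r (ltW h)).
  have [B2 B20 hB2] := seg_bounded cG G0 G1.
  apply: (wder_C1 (C := B1 + B2)).
  + move=> x; apply: (@continuous_comp _ _ _ (@enorm R n) (fun r => F r * c m r)); first exact: enorm_cont.
    exact: cFC.
  + by apply: mcoord => r r0; apply: cvgM; [exact: cG|exact: cinv].
  + by move=> x; exact: (radial_deriv dG (a0 m) FC0 x i).
  + by move=> x; rewrite (le_trans (hB1 _))// lerDl.
  + move=> x; apply: (@le_trans _ _ B2); last by rewrite lerDr.
    by apply: coord_rad_le => // r r0; rewrite mulrC mulfVK ?gt_eqF//; exact: hB2.
- by apply: locintegD => //; exact: locintegZ.
- move=> m x; have /andP[h0 h1] := c01 m (enorm x).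
  have [->|x0] := eqVneq x 0; first by rewrite rad0 enorm0 clo ?mulr0 ?normr0// invr_ge0.
  by rewrite radE// normrM (ger0_norm h0) ler_piMr.
- move=> m x; have [->|x0] := eqVneq x 0; first by rewrite !rad0 mulr0 normr0 mulr0 addr0.
  have e0 := enorm_pos x0.
  have /andP[h0 h1] := c01 m (enorm x).
  have hr := rc' m (enorm x).
  rewrite !radE// mulrCA normrM mulrC.
  have h2 : `|x ord0 i / enorm x| <= 1.
    by rewrite normrM normfV (gtr0_norm e0) ler_pdivrMr// mul1r enorm_coord.
  apply: (@le_trans _ _ `|G' m (enorm x)|); first by rewrite ler_piMl.
  rewrite /G' addrC (le_trans (ler_normD _ _))// lerD//.
    by rewrite normrM (ger0_norm h0) ler_piMr.
  rewrite normrM mulrCA ler_wpM2l// ler_pdivlMr// mulrC -{1}(gtr0_norm e0) -normrM.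
  exact: hr.
- move=> x; have [->|x0] := eqVneq x 0.
    rewrite rad0; apply: cvg_near_cst; near=> m; apply/eqP.
    by rewrite enorm0 clo ?mulr0// invr_ge0.
  have e0 := enorm_pos x0.
  rewrite radE//; apply: cvg_near_cst; near=> m; apply/eqP.
  suff -> : c m (enorm x) = 1 by rewrite mulr1.
  by near: m; exact: cvg1.
- move=> x; have [->|x0] := eqVneq x 0.
    by rewrite rad0 mulr0; under eq_fun do rewrite rad0 mulr0; exact: cvg_cst.
  have e0 := enorm_pos x0.
  rewrite radE//; apply: cvg_near_cst; near=> m; apply/eqP.
  rewrite radE// /G'.
  have -> : c m (enorm x) = 1 by near: m; exact: cvg1.
  have -> : c' m (enorm x) = 0 by near: m; exact: cvg0.
  by rewrite mulr0 add0r mulr1.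
Unshelve. all: by end_near. Qed.

(* The divergence of [x * m0(|x|) / |x|^n] is [m0'(|x|) / |x|^(n-1)]. *)
Lemma radial_ibp (g : E -> R) (h : 'I_n -> E -> R) (m0 m1 : R -> R) :
  (forall i, wder i g (h i)) -> C1pos m0 m1 ->
  integ mu (fun x => g x * rad (fun r => m1 r / r ^+ n.-1) x) ->
  integ mu (fun x => g x * rad (fun r => m0 r / r ^+ n) x) ->
  (forall i, integ mu (fun x => h i x * (x ord0 i * rad (fun r => m0 r / r ^+ n) x))) ->
  \sum_i \int[mu]_x (h i x * (x ord0 i * rad (fun r => m0 r / r ^+ n) x)) =
  - \int[mu]_x (g x * rad (fun r => m1 r / r ^+ n.-1) x).
Proof.
move=> wg Cm i1 i0 ih.
have [c [c' [D D0 [[dc cc' c01 clo chi] [rc' cvg1 cvg0]]]]] := cutoffs R.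
have a0 m : 0 < (m.+1%:R^-1 : R) by pos.
pose P r := m0 r / r ^+ n; pose P' r := m0 r * (- (n%:R * r ^+ n.-1) / (r ^+ n) ^+ 2) + m1 r / r ^+ n.
have CP : C1pos P P'.
  have cV k : cpos (fun r : R => (r ^+ k)^-1).
    by move=> r r0; apply: cvgV; [rewrite gt_eqF// exprn_gt0|exact: exprn_continuous].
  split=> r r0.
    apply: ddM; first exact: Cm.1.
    by apply: ddV; [rewrite gt_eqF// exprn_gt0|exact: ddX].
  apply: cvgD; apply: cvgM.
  - exact: (ddpos_cpos Cm.1).
  - apply: cvgM; last first.
      apply: cvgV; first by rewrite gt_eqF// !exprn_gt0.
      apply: (@continuous_comp _ _ _ (fun r : R => r ^+ n) (fun r : R => r ^+ 2)); exact: exprn_continuous.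
    by apply: cvgN; apply: cvgM; [exact: cvg_cst|exact: exprn_continuous].
  - exact: Cm.2.
  - exact: cV.
have lgg : locinteg g by have [] := wg (Ordinal n_gt0).
pose Q m r := P r * c' m r + P' r * c m r.
(* The field x P(|x|) c(|x|) has compact support away from 0, so its classical divergence can be
   tested against g. *)
have step m : \sum_i \int[mu]_x (h i x * (x ord0 i * (P (enorm x) * c m (enorm x)))) =
    - \int[mu]_x (g x * (rad P x * (enorm x * c' m (enorm x)) +
       rad (fun r => m1 r / r ^+ n.-1) x * c m (enorm x))).
  have [dG cG] := C1pos_cut CP (a0 m) (dc m) (cc' m) (clo m).
  have FC0 r : r <= m.+1%:R^-1 -> P r * c m r = 0 by move=> rm; rewrite clo ?mulr0.
  have FC1 r : 2 * m.+1%:R <= r -> P r * c m r = 0 by move=> rm; rewrite chi ?mulr0.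
  have G0 : forall r, r < m.+1%:R^-1 -> Q m r = 0 := dd_cst_lt dG FC0.
  have G1 : forall r, 2 * m.+1%:R < r -> Q m r = 0 := dd_cst_gt dG FC1.
  have cFC : continuous (fun r => P r * c m r) by move=> r; exact: dd_cont (dG r).
  have crFC : continuous (fun r : R => r * (P r * c m r)) by move=> r; apply: cvgM; [exact: cvg_id|exact: cFC].
  have crG : continuous (fun r : R => r * Q m r) by move=> r; apply: cvgM; [exact: cvg_id|exact: cG].
  have [B1 B10 hB1] := seg_bounded cFC (fun r h => FC0 r (ltW h)) (fun r h => FC1 r (ltW h)).
  have [B2 B20 hB2] := seg_bounded crG (a := m.+1%:R^-1) (b := 2 * m.+1%:R)
    (fun r h => etrans (congr1 _ (G0 r h)) (mulr0 r)) (fun r h => etrans (congr1 _ (G1 r h)) (mulr0 r)).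
  have [B3 B30 hB3] := seg_bounded crFC (a := m.+1%:R^-1) (b := 2 * m.+1%:R)
    (fun r h => etrans (congr1 _ (FC0 r (ltW h))) (mulr0 r)) (fun r h => etrans (congr1 _ (FC1 r (ltW h))) (mulr0 r)).
  pose K i (x : E) := x ord0 i * (P (enorm x) * c m (enorm x)).
  pose K' i (x : E) := x ord0 i * (x ord0 i * rad (fun r => Q m r / r) x) + P (enorm x) * c m (enorm x).
  have cPe : continuous (fun x : E => P (enorm x) * c m (enorm x)).
    move=> x; apply: (@continuous_comp _ _ _ (@enorm R n) (fun r => P r * c m r)); first exact: enorm_cont.
    exact: cFC.
  have crad : cpos (fun r => Q m r / r).
    by move=> r r0; apply: cvgM; [exact: cG|apply: cvgV; [rewrite gt_eqF|exact: cvg_id]].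
  have mK' i : mfun (K' i).
    apply: measurable_funD; last exact: continuous_measurable_rV.
    by apply: measurable_funM; [exact: coord_measurable|apply: measurable_funM;
      [exact: coord_measurable|exact: rad_measurable]].
  pose k := (Num.truncn (2 * m.+1%:R : R)).+2.
  have kk (x : E) : ~ rV_cube k x -> 2 * m.+1%:R < enorm x.
    move=> xk; rewrite ltNge; apply/negP => xm; apply: xk; apply: enorm_cube.
    by rewrite (le_lt_trans xm)// (lt_trans (truncnS_gt _))// ltr_nat.
  have Qout (x : E) : ~ rV_cube k x -> rad (fun r => Q m r / r) x = 0.
    by move=> /kk xk; rewrite /rad G1 ?mul0r.
  have Kout i (x : E) : ~ rV_cube k x -> K i x = 0.
    by move=> /kk xk; rewrite /K FC1 ?mulr0// ltW.
  have K'out i (x : E) : ~ rV_cube k x -> K' i x = 0.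
    by move=> xk; rewrite /K' Qout// FC1 ?mulr0 ?addr0// ltW// kk.
  have bK i x : `|K i x| <= B1 + B2 + B3.
    apply: (@le_trans _ _ B3); last by rewrite lerDr addr_ge0.
    apply: le_trans (hB3 (enorm x)); rewrite /K !normrM ler_wpM2r// (le_trans (enorm_coord x i))//.
    exact: ler_norm.
  have bK' i x : `|K' i x| <= B1 + B2 + B3.
    apply: (@le_trans _ _ (B1 + B2)); last by rewrite lerDl.
    rewrite /K' (le_trans (ler_normD _ _))// [leRHS]addrC lerD//.
    have [->|x0] := eqVneq x 0; first by rewrite rad0 !mulr0 normr0.
    have e0 := enorm_pos x0.
    apply: le_trans (hB2 (enorm x)); rewrite radE// !normrM normfV (gtr0_norm e0).
    have := enorm_coord x i; have := normr_ge0 (x ord0 i); have := normr_ge0 (Q m (enorm x)) => q0 y0 ye.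
    rewrite mulrA mulrCA mulrC ler_wpM2r// ler_pdivrMr//.
    by nra.
  have dK i x : is_derive x (e_ i) (K i) (K' i x).
    have d1 : is_derive x (e_ i) (fun x : E => x ord0 i) 1.
      by apply: (is_derive_coord (g := id)); [move=> h1; rewrite coord_line eqxx|exact: dd_id].
    have := is_deriveM d1 (radial_deriv dG (a0 m) FC0 x i).
    by rewrite /GRing.scale/= mulr1.
  have ibp i := wder_ibp (wg i) (_ : continuous (K i)) (mK' i) (dK i) (Kout i) (bK i) (bK' i).
  have cK i : continuous (K i).
    move=> x; have h1 : {for x, continuous (fun x : E => x ord0 i)} by exact: coord_continuous.
    exact: (cvgM h1 (cPe x)).
  have iK' i : integ mu (fun x => g x * K' i x).
    apply: (locinteg_test (m := k) (C := B1 + B2 + B3) lgg (mK' i)); first by rewrite !addr_ge0.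
    move=> x; rewrite indicE; case: (boolP (x \in _)) => xk; first by rewrite mulr1.
    by rewrite mulr0 K'out ?normr0// => /mem_set; exact/negP.
  transitivity (\sum_i - \int[mu]_x (g x * K' i x)).
    by apply: eq_bigr => i _; rewrite (ibp cK i) opprK.
  rewrite sumrN; congr (- _); rewrite -Int_sum//; apply: Int_ext => x.
  rewrite -mulr_sumr; congr (_ * _).
  rewrite /K' big_split/= sumr_const card_ord.
  have [->|x0] := eqVneq x 0.
    rewrite !rad0 enorm0 clo// !mulr0 mul0rn mul0r addr0.
    by rewrite addr0 big1// => i _; rewrite !mulr0.
  have e0 := enorm_pos x0.
  rewrite (eq_bigr (fun i => x ord0 i ^+ 2 * rad (fun r => Q m r / r) x)); last first.
    by move=> i _; rewrite mulrA.
  rewrite -mulr_suml -enorm_sq !radE// -mulr_natl /Q /P /P'.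
  have en : enorm x ^+ n = enorm x * enorm x ^+ n.-1 by rewrite -exprS prednK.
  by rewrite en; field; rewrite expf_eq0 (gt_eqF e0) andbF.
have meas i : mfun (fun x => h i x * (x ord0 i * rad P x)) := integ_measurable (ih i).
have cme (f : R -> R) : continuous f -> mfun (fun x : E => f (enorm x)).
  move=> cf; apply: continuous_measurable_rV => x.
  by apply: (@continuous_comp _ _ _ (@enorm R n) f); [exact: enorm_cont|exact: cf].
have cc m : continuous (c m) by move=> r; exact: dd_cont (dc m r).
have lim1 : \sum_i \int[mu]_x (h i x * (x ord0 i * (P (enorm x) * c m (enorm x)))) @[m --> \oo] -->
    \sum_i \int[mu]_x (h i x * (x ord0 i * rad P x)).
  apply: cvg_sumr => i.
  rewrite (_ : (fun m => _) = fun m => \int[mu]_x (h i x * (x ord0 i * rad P x) * c m (enorm x))).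
    apply: (@dct_cvg _ _ _ mu _ _ (fun x => `|h i x * (x ord0 i * rad P x)|)).
    - by move=> m; apply: measurable_funM; [exact: meas|exact: cme].
    - exact: integ_norm.
    - by move=> m x; have /andP[h0 h1] := c01 m (enorm x); rewrite normrM (ger0_norm h0) ler_piMr.
    - move=> x; have [->|x0] := eqVneq x 0.
        by rewrite rad0 !mulr0; under eq_fun do rewrite mul0r; exact: cvg_cst.
      have e0 := enorm_pos x0.
      apply: cvg_near_cst; near=> m; apply/eqP.
      suff -> : c m (enorm x) = 1 by rewrite mulr1.
      by near: m; exact: cvg1.
  apply/funext => m; apply: Int_ext => x.
  have [->|x0] := eqVneq x 0; first by rewrite rad0 enorm0 clo// !mulr0.
  by rewrite radE// !mulrA.
(* The term with c' is dominated thanks to the uniform bound on r c', and it tends to 0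
   pointwise. *)
have lim2 : \int[mu]_x (g x * (rad P x * (enorm x * c' m (enorm x)) +
       rad (fun r => m1 r / r ^+ n.-1) x * c m (enorm x))) @[m --> \oo] -->
    \int[mu]_x (g x * rad (fun r => m1 r / r ^+ n.-1) x).
  have mg1 := integ_measurable i1; have mg0 := integ_measurable i0.
  rewrite (_ : (fun m => _) = fun m => \int[mu]_x (g x * rad P x * (enorm x * c' m (enorm x)) +
     g x * rad (fun r => m1 r / r ^+ n.-1) x * c m (enorm x))); last first.
    by apply/funext => m; apply: Int_ext => x; rewrite mulrDr !mulrA.
  apply: (@dct_cvg _ _ _ mu _ _ (fun x => D * `|g x * rad P x| +
     `|g x * rad (fun r => m1 r / r ^+ n.-1) x|)).
  - move=> m; apply: measurable_funD; apply: measurable_funM.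
    + exact: mg0.
    + by apply: measurable_funM; [exact: enorm_measurable|exact: cme].
    + exact: mg1.
    + exact: cme.
  - by apply: integD; [apply: integZ; exact: integ_norm|exact: integ_norm].
  - move=> m x; have /andP[h0 h1] := c01 m (enorm x).
    rewrite (le_trans (ler_normD _ _))// lerD//.
      by rewrite [leLHS]normrM mulrC ler_wpM2r.
    by rewrite [leLHS]normrM (ger0_norm h0) ler_piMr.
  - move=> x; have [->|x0] := eqVneq x 0.
      by rewrite !rad0 !mulr0; under eq_fun do rewrite !mul0r addr0; exact: cvg_cst.
    have e0 := enorm_pos x0.
    apply: cvg_near_cst; near=> m; apply/eqP.
    have -> : c m (enorm x) = 1 by near: m; exact: cvg1.
    have -> : c' m (enorm x) = 0 by near: m; exact: cvg0.
    by rewrite !mulr0 add0r mulr1.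
have lim2' : \sum_i \int[mu]_x (h i x * (x ord0 i * (P (enorm x) * c m (enorm x)))) @[m --> \oo] -->
    - \int[mu]_x (g x * rad (fun r => m1 r / r ^+ n.-1) x).
  rewrite (_ : (fun m => _) = fun m => - \int[mu]_x (g x * (rad P x * (enorm x * c' m (enorm x)) +
       rad (fun r => m1 r / r ^+ n.-1) x * c m (enorm x)))); last by apply/funext => m; exact: step.
  exact: cvgN.
exact: (@cvg_unique _ (@Rhausdorff R) _ _ _ _ lim1 lim2').
Unshelve. all: by end_near. Qed.

End radial_calculus.

(** * The Green function *)

Section free_profiles.
Context (R : realType).

Lemma cvg_scale0 (f : R -> R) (l k : R) : 0 < k -> f r @[r --> 0^'+] --> l ->
  f (k * r) @[r --> 0^'+] --> l.
Proof.
move=> k0 h; apply: (cvg_comp (fun r => k * r) f _ h) => A [e /= e0 he].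
exists (e / k); first exact: divr_gt0.
move=> r; rewrite /ball_/= add0r normrN => re r0; apply: he; rewrite /ball_/= ?mulr_gt0//.
by rewrite add0r normrN normrM (gtr0_norm k0) mulrC -ltr_pdivlMr.
Qed.

Lemma cvg_scaley (f : R -> R) (l k : R) : 0 < k -> f r @[r --> +oo] --> l ->
  f (k * r) @[r --> +oo] --> l.
Proof.
move=> k0 h; apply: (cvg_comp (fun r => k * r) f _ h) => A [M [Mr HM]].
exists (M / k); split; first exact: num_real.
by move=> r Mr'; apply: HM; rewrite mulrC -ltr_pdivrMr.
Qed.

Lemma ddpos_cst0 (f : R -> R) (l : R) : ddpos f (fun=> 0) -> f r @[r --> 0^'+] --> l ->
  forall r, 0 < r -> f r = l.
Proof.
move=> df fl r r0; apply/eqP; rewrite eq_le; apply/andP; split.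
  apply: (cvg0_ge r0 fl) => e /andP[e0 er].
  by apply: (pos_nincr e0 (ltW er) df).
apply: (cvg0_le r0 fl) => e /andP[e0 er].
by apply: (pos_ndecr e0 (ltW er) df).
Qed.

(** Without source J0 vanishes and the solution is S + a exactly: -ln r + a is negative at exp(a +
    1), and 1/r + a is negative at -2/a when a < 0. *)
Lemma no_nonneg_free n (a : R) (v0 J0 u0 : R -> R) : n = 2%N \/ (n = 3%N /\ a < 0) ->
  (forall r, 0 < r -> 0 <= v0 r) -> ddpos v0 (fun r => - (1 - J0 r) / wt n r) ->
  ddpos J0 (fun r => wt n r * (0 * u0 r)) ->
  J0 r @[r --> 0^'+] --> (0 : R) -> (v0 r - sing n r) @[r --> 0^'+] --> a -> False.
Proof.
move=> h v00 dv0 dJ0 J00 v0S.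
have n23 : (n == 2%N) || (n == 3%N) by case: h => [->|[-> _]].
have J0E : forall r, 0 < r -> J0 r = 0.
  by apply: ddpos_cst0 => // r r0; apply: dd_eq (dJ0 r r0) _; rewrite mul0r mulr0.
have vE : forall r, 0 < r -> v0 r - sing n r = a.
  apply: ddpos_cst0 => // r r0; apply: dd_eq (ddB (dv0 r r0) (sing_dd n23 r0)) _.
  by rewrite J0E// subr0 mulN1r opprK addNr.
case: h => [n2|[n3 a0]].
  have r0 := expR_gt0 (a + 1); have := v00 _ r0; have := vE _ r0.
  by rewrite /sing n2 eqxx expRK; lra.
have r0 : 0 < 2 / - a by rewrite divr_gt0// oppr_gt0.
have := v00 _ r0; have := vE _ r0.
by rewrite /sing n3/= invf_div; lra.
Qed.

Lemma profile_ext n a (g k v J : R -> R) : (forall x, 0 < x -> g x = k x) ->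
  profile n (sing n) a g v J -> profile n (sing n) a k v J.
Proof.
move=> gk [v0 dv dJ J01 lim]; split=> // r r0.
by apply: dd_eq (dJ r r0) _; rewrite gk// v0.
Qed.

Lemma ddpos_scale (f f' : R -> R) k : 0 < k -> ddpos f f' -> ddpos (fun r => f (k * r)) (fun r => f' (k * r) * k).
Proof.
move=> k0 df r r0; apply: dd_comp; first by apply: df; rewrite mulr_gt0.
by apply: dd_eq (ddZ k (dd_id r)) _; rewrite mulr1.
Qed.

Lemma profile2_scale a l k (V I : R -> R) : 0 < k -> profile 2 (sing 2) a (fun x => l * x) V I ->
  profile 2 (sing 2) (a - ln k) (fun x => k ^+ 2 * l * x) (fun r => V (k * r)) (fun r => I (k * r)).
Proof.
move=> k0 [v0 dv dJ J01 [J0 vS voo]].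
have kr r : 0 < r -> 0 < k * r by pos.
split.
- by move=> r /kr; exact: v0.
- move=> r r0; apply: dd_eq (ddpos_scale k0 dv r0) _; rewrite /wt/= !expr1.
  by field; rewrite !gt_eqF.
- move=> r r0; apply: dd_eq (ddpos_scale k0 dJ r0) _; rewrite /wt/= !expr1.
  by ring.
- by move=> r /kr; exact: J01.
- split; [exact: (cvg_scale0 k0 J0)| |exact: (cvg_scaley k0 voo)].
  have := cvg_scale0 k0 vS => h.
  apply: (cvg_trans (near_eq_cvg _) (cvgB h (cvg_cst (ln k)))).
  near=> r; have r0 : 0 < r by near: r; exact: nbhs_right_gt.
  rewrite /sing eqxx; transitivity (V (k * r) - - ln (k * r) - ln k); first by [].
  by rewrite lnM//; ring.
Unshelve. all: by end_near. Qed.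

(** In dimension 3 the profile is explicit, the Yukawa potential. *)
Lemma profile3_ex k : 0 < k -> profile 3 (sing 3) (- k) (fun x => k ^+ 2 * x)
  (fun r : R => expR (- k * r) / r) (fun r => 1 - (1 + k * r) * expR (- k * r)).
Proof.
move=> k0.
have de r : dd (fun r : R => expR (- k * r)) r (expR (- k * r) * - k).
  by apply: dd_expR; apply: dd_eq (ddZ (- k) (dd_id r)) _; rewrite mulr1.
have dJ (r : R) : dd (fun r => 1 - (1 + k * r) * expR (- k * r)) r (k ^+ 2 * r * expR (- k * r)).
  apply: dd_eq (ddB (dd_cst 1 r) (ddM (ddD (dd_cst 1 r) (ddZ k (dd_id r))) (de r))) _.
  by ring.
split.
- pos.
- move=> r r0; have rn : r != 0 by rewrite gt_eqF.
  apply: dd_eq (ddM (de r) (ddV rn (dd_id r))) _.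
  by rewrite /wt/=; field.
- move=> r r0; apply: dd_eq (dJ r) _; rewrite /wt/=.
  by field; rewrite gt_eqF.
- move=> r r0; have kr : 0 < k * r by rewrite mulr_gt0.
  rewrite gtrBl mulr_gt0 ?expR_gt0 ?addr_gt0// subr_ge0 mulNr expRN ler_pdivrMr ?expR_gt0//.
  by rewrite mul1r expR_ge1Dx.
- split.
  + have := dd_cont (dJ 0); rewrite /prop_for /continuous_at mulr0 mulr0 expR0 addr0 mulr1 subrr.
    by move=> h; exact: cvg_at_right_filter h.
  + have /dd_limP := de 0; rewrite mulr0 expR0 mul1r => h.
    apply: (cvg_trans (near_eq_cvg _) (cvg_dnbhs_at_right h)); near=> r.
    have r0 : 0 < r by near: r; exact: nbhs_right_gt.
    by rewrite /sing/= addr0; field; rewrite gt_eqF.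
  + apply: (@squeeze_cvgr _ _ _ _ (fun=> 0) (fun r : R => r^-1)).
    * near=> r; have r0 : 0 < r by near: r; apply: nbhs_pinfty_gt; exact: num_real.
      rewrite divr_ge0//= ler_piMl ?invr_ge0//.
      by rewrite -expR0 ler_expR mulNr oppr_le0 mulr_ge0// ltW.
    * exact: cvg_cst.
    * apply/cvgrPdist_lt => e e0; near=> r.
      rewrite sub0r normrN gtr0_norm ?invr_gt0// -[ltRHS]invrK ltf_pV2 ?posrE ?invr_gt0//.
      by near: r; apply: nbhs_pinfty_gt; exact: num_real.
Unshelve. all: by end_near. Qed.

(** The area of the unit sphere. *)
Definition sigma n : R := n%:R * evol R n.

Lemma sigma2 : sigma 2 = 2 * pi. Proof. exact: evol2. Qed.
Lemma sigma3 : sigma 3 = 4 * pi. Proof. exact: evol3. Qed.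

Lemma sigma_gt0 n : (n == 2%N) || (n == 3%N) -> 0 < sigma n.
Proof. by case/orP => /eqP ->; rewrite ?sigma2 ?sigma3 mulr_gt0// pi_gt0. Qed.

(* The shooting solution in dimension 2 gives the Bessel function [K_0] up to a dilation; the
   normalization of the logarithm at 0, which involves the Euler constant, only enters [b0]. *)
Lemma green_profile_ex n : (n == 2%N) || (n == 3%N) -> exists b0 : R, (n = 3%N -> b0 = 0) /\
  forall l, 0 < l -> exists V I,
    profile n (sing n) (sigma n * (b0 - beta_coef n l)) (fun x => l * x) V I.
Proof.
case/orP => /eqP ->.
  have n23 : (2%N == 2%N) || (2%N == 3%N) by [].
  have [|th [C ge]] := @good_exp_ex R 2 1; first by left.
  (* Shooting with omega = 0 and exponent 1 gives the linear equation with some coefficient M > 0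
     that is not controlled; a dilation then reaches every l. *)
  have [//|M [V [I [M0 pV]]]] := @shooting R 2 (sing 2) 0 0 1 (lexx 0) (lexx 1) (sing_dd n23) (sing_cvgy n23)
    (good_lint n23 (lexx 1) ge) isT.
    move=> v0 J0 u0 h1 h2 h3 _ h5 h6.
    exact: (@no_nonneg_free 2 0 v0 J0 u0 (or_introl erefl) h1 h2 h3 h5 h6).
  have {}pV : profile 2 (sing 2) 0 (fun x => M * x) V I.
    by apply: profile_ext pV => x x0; rewrite mul0r add0r powRr1// ltW.
  (* This is beta at M: then sigma (b0 - beta(l)) = -ln k for the dilation factor k = sqrt(l /
     M). *)
  exists ((2 * pi)^-1 * (euler_gamma R + ln (Num.sqrt M / 2))); split=> // l l0.
  pose k := Num.sqrt l / Num.sqrt M.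
  have sl : 0 < Num.sqrt l by rewrite sqrtr_gt0.
  have sM : 0 < Num.sqrt M by rewrite sqrtr_gt0.
  have k0 : 0 < k by rewrite divr_gt0.
  have := profile2_scale k0 pV; rewrite (_ : k ^+ 2 * M = l); last first.
    by rewrite /k exprMn exprVn !sqr_sqrtr ?(ltW l0) ?(ltW M0)// mulfVK// gt_eqF.
  rewrite (_ : 0 - ln k = sigma 2 * ((2 * pi)^-1 * (euler_gamma R + ln (Num.sqrt M / 2)) - beta_coef 2 l)).
    by move=> h; exists (fun r => V (k * r)), (fun r => I (k * r)).
  rewrite sigma2 /beta_coef eqxx /k !ln_div ?posrE// -mulrBr mulrA divff; last first.
    by rewrite mulf_neq0// gt_eqF// pi_gt0.
  by ring.
exists 0; split=> // l l0.
have sl : 0 < Num.sqrt l by rewrite sqrtr_gt0.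
have := profile3_ex sl; rewrite sqr_sqrtr ?(ltW l0)//.
rewrite (_ : - Num.sqrt l = sigma 3 * (0 - beta_coef 3 l)).
  by move=> h; eexists; eexists; exact: h.
rewrite sigma3 /beta_coef/= sub0r mulrN; congr (- _).
by rewrite [RHS]mulrC divfK// mulf_neq0// gt_eqF// pi_gt0.
Qed.

End free_profiles.

(** * Total mass of linear profiles *)

Section linear_profile.
Context (R : realType) (n : nat) (p th C0 b l : R) (V I : R -> R).
Context (n23 : (n == 2%N) || (n == 3%N)) (p1 : 1 <= p) (gexp : good_exp n p th C0).
Context (l0 : 0 < l) (pV : profile n (sing n) b (fun x => l * x) V I).

(** In dimension 2 the function is -V'. In dimension 3, V' = -(1 - I)/r^2 and I' = l r^2 V; so I/l -
    r V is bounded above and its derivative dominates (1 - I)/r for r >= 1. *)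
Lemma prof_domoo1 : domoo (fun r => (1 - I r) / r).
Proof.
have cinv : cpos (fun r : R => r^-1) by move=> r r0; apply: cvgV; [rewrite gt_eqF|exact: cvg_id].
case/orP: (n23) => /eqP n2.
  have := prof_domoov pV; rewrite /wt n2/=.
  pos.
exists (fun r => (1 - I r) / r - V r + r ^+ 2 * V r), (fun r => l^-1 * I r - r * V r), (l^-1 + V 1); last first.
  move=> r r1; have r0 := lt_le_trans ltr01 r1.
  have /andP[_ I1] := prof_J01 pV r0; have /andP[I0' _] := prof_J01 pV (@ltr01 R).
  have h1 : l^-1 * I r <= l^-1 by rewrite ler_piMr ?invr_ge0 ?ltW.
  have h2 : 0 <= l^-1 * I 1 by pos.
  have h3 : 0 <= r * V r by rewrite mulr_ge0 ?(ltW r0) ?(ltW (prof_v0 pV r0)).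
  lra.
split.
- move=> r r0; apply: cvgD; first apply: cvgB.
  + apply: cvgM; last exact: cinv.
    by apply: cvgB; [exact: cvg_cst|exact: (prof_cJ pV)].
  + exact: (prof_cv pV).
  + by apply: cvgM; [exact: exprn_continuous|exact: (prof_cv pV)].
- move=> r r0; apply: dd_eq (ddB (ddZ l^-1 (prof_dJ pV r0)) (ddM (dd_id r) (prof_dv pV r0))) _.
  by rewrite /wt n2/=; field; rewrite !gt_eqF.
- move=> r r1; have r0 := lt_le_trans ltr01 r1; have /andP[_ I1] := prof_J01 pV r0.
  rewrite ger0_norm ?divr_ge0 ?subr_ge0 ?(ltW I1) ?(ltW r0)// -addrA lerDl addrC subr_ge0.
  by rewrite ler_peMl ?(ltW (prof_v0 pV r0))// exprn_ege1.
Qed.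

Lemma domoo_inv_absurd (f : R -> R) c : 0 < c -> domoo f -> (forall r, 1 <= r -> c / r <= f r) -> False.
Proof.
move=> c0 [f1 [F1 [C [cf dF ff] FC]]] fc.
have d1 : ddpos (fun r => F1 r - c * ln r) (fun r => f1 r - c * r^-1).
  move=> r r0; apply: ddB; first exact: dF.
  by apply: ddZ; exact: is_derive1_ln.
pose r := expR ((`|C| + 1) / c).
have r1 : 1 <= r by rewrite -expR0 ler_expR divr_ge0 ?(ltW c0)// addr_ge0.
have := pos_ndecr ltr01 r1 d1; rewrite /r expRK ln1 mulr0 subr0 [c * _]mulrC divfK ?gt_eqF//.
have h : forall x, 1 < x < r -> 0 <= f1 x - c * x^-1.
  move=> x /andP[x1 _]; rewrite subr_ge0 (le_trans (fc x (ltW x1)))//; exact: le_trans (ler_norm _) (ff x (ltW x1)).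
by move=> /(_ h); have := FC _ r1; have := ler_norm C; rewrite /r; lra.
Qed.

(** If 1 - I stayed above some e > 0, then (1 - I)/r >= e/r would contradict the integrability in
    [prof_domoo1]. *)
Lemma prof_J1 : I r @[r --> +oo] --> (1 : R).
Proof.
apply/cvgrPdist_lt => e e0.
have [r0 [r01 hr]] : exists r0, 1 <= r0 /\ 1 - I r0 < e.
  apply: contrapT => /forallNP h; apply: (domoo_inv_absurd e0 prof_domoo1) => r r1.
  rewrite ler_wpM2r ?invr_ge0 ?(le_trans ler01 r1)// leNgt; apply/negP => hh.
  by apply: (h r); split.
have r00 := lt_le_trans ltr01 r01.
near=> r; have rr : r0 <= r by near: r; apply: nbhs_pinfty_ge; exact: num_real.
have rp := lt_le_trans r00 rr; have /andP[_ I1] := prof_J01 pV rp.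
rewrite ger0_norm ?subr_ge0 ?(ltW I1)//; apply: le_lt_trans hr; rewrite lerD2l lerN2.
apply: (pos_ndecr r00 rr (prof_dJ pV)) => x /andP[x0 _].
have xp := lt_trans r00 x0.
by rewrite !mulr_ge0 ?(ltW l0) ?(ltW (prof_v0 pV xp))// exprn_ge0// ltW.
Unshelve. all: by end_near. Qed.

Lemma lin_half (f : R -> R) (s C D : R) : cpos f -> s < n%:R -> 0 <= C -> 0 <= D ->
  (forall r, 0 < r <= 1 -> `|f r| <= C * r `^ (- s)) ->
  (forall r, 1 <= r -> `|f r| <= D * V r) -> halfint (fun r => f r * r ^+ n.-1).
Proof.
move=> cf sn C_0 D0 h0 hoo.
have kk : gok 1 (fun x => l * x) by apply: gok_lin; exact: ltW.
apply: (prof_half n23 kk pV (D := D / l) cf sn C_0 _ h0); first by rewrite divr_ge0// ltW.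
by move=> r r1; rewrite mulrA divfK ?gt_eqF// hoo.
Qed.

(** The source absorbs the whole flux: I increases from 0 to 1. *)
Lemma Int_lin_prof : \int[lebesgue_measure]_r (wt n r * (l * V r) * \1_(`]0, +oo[%classic) r) = 1.
Proof.
have kk : gok 1 (fun x => l * x) by apply: gok_lin; exact: ltW.
have [/andP[th0 th1] hp1 hp2 h2 _] := gexp.
have [C C_0 hC] := prof_v gexp pV.
rewrite -[RHS]subr0; apply: (half_ftc _ (prof_dJ pV)).
- exact: (prof_cJ' kk pV).
- have h : halfint (fun r => l * V r * r ^+ n.-1).
    apply: (lin_half (s := th) (C := l * C) (D := l)).
    + by move=> r r0; apply: cvgM; [exact: cvg_cst|exact: (prof_cv pV)].
    + lra.
    + pos.
    + exact: ltW.
    + move=> r rr; have /andP[r0 _] := rr.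
      by rewrite ger0_norm ?mulr_ge0 ?(ltW l0) ?(ltW (prof_v0 pV r0))// -mulrA ler_wpM2l ?(ltW l0)// hC.
    + move=> r r1; have r0 := lt_le_trans ltr01 r1.
      by rewrite ger0_norm// mulr_ge0 ?(ltW l0) ?(ltW (prof_v0 pV r0)).
  by apply: integ_eq h => r; rewrite [wt n r * _]mulrC.
- exact: (prof_J0 pV).
- exact: prof_J1.
Qed.

End linear_profile.

Lemma powR_sub1 (R : realType) (q x : R) : 0 < x -> x `^ q = x `^ (q - 1) * x.
Proof.
move=> x0; rewrite -[in RHS](powRr1 (ltW x0)) -powRrM mul1r -powR_add//.
by rewrite subrK.
Qed.

(** * General test functions *)

Section test_functions.
Context (R : realType) (n : nat).
Local Notation E := 'rV[R]_n.
Local Notation mu := (lebesgue_rV R n).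
Implicit Types psi : E -> R.

Lemma compact_fun_bound (f : E -> R) (A : set E) : continuous f -> compact A ->
  exists2 C : R, 0 <= C & forall x, A x -> `|f x| <= C.
Proof.
move=> cf cA.
have cfA : compact (f @` A).
  by apply: continuous_compact => //; exact: continuous_subspaceT.
have [M [Mr HM]] := compact_bounded cfA.
exists (`|M| + 1); first by rewrite addr_ge0.
move=> x Ax; apply: (HM (`|M| + 1)); last by exists x.
by rewrite (le_lt_trans (ler_norm _))// ltrDl.
Qed.

Lemma test_cont psi : test_function psi -> continuous psi.
Proof. by move=> [h _]; have [] := h 0%N. Qed.

Lemma test_is_derive psi i x : test_function psi -> is_derive x (e_ i) psi (pderiv i psi x).
Proof.
move=> [h _]; have [_ /(_ i) [dpsi _]] := h 1%N.
pos.
Qed.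

Lemma test_pderiv psi i : test_function psi -> test_function (pderiv i psi).
Proof.
move=> tpsi; have [h cpt] := tpsi; split=> [k|].
  by have [_ /(_ i) []] := h k.+1.
apply: (subclosed_compact _ cpt); first exact: closed_closure.
rewrite [X in X `<=` _]closureE => x; apply; split; first exact: closed_closure.
move=> y /= dy; apply: contrapT => ny; move/eqP: dy; apply.
have oc : open (~` closure [set x | psi x != 0]) by apply: closed_openC; exact: closed_closure.
have near0 : \forall z \near y, psi z = 0.
  have : nbhs y (~` closure [set x | psi x != 0]) by pos.
  apply: filterS => z nz; apply/eqP; apply: contrapT => /negP pz.
  by apply: nz; apply: subset_closure.
have := near_eq_derive (e_ i) near0.
by rewrite /pderiv => ->; rewrite derive_cst.
Qed.

Lemma test_cube psi : test_function psi -> exists m : nat, exists2 C : R, 0 <= C &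
  forall x, `|psi x| <= C * \1_(rV_cube m) x.
Proof.
move=> tpsi; have [_ cpt] := tpsi.
have [C C0 hC] := compact_fun_bound (test_cont tpsi) cpt.
have [M M0 hM] := compact_fun_bound (@enorm_cont R n) cpt.
exists (Num.truncn M).+1, C => // x; rewrite indicE.
have [->|px] := eqVneq (psi x) 0; first by rewrite normr0 mulr_ge0.
have cx : closure [set x | psi x != 0] x by exact: subset_closure.
rewrite mem_set ?mulr1 ?hC//; apply: enorm_cube.
apply: le_lt_trans (truncnS_gt M); apply: le_trans (hM _ cx); exact: ler_norm.
Qed.

Lemma test_bound psi : test_function psi -> exists2 C : R, 0 <= C & forall x, `|psi x| <= C.
Proof.
move=> /test_cube[m [C C0 hC]]; exists C => // x; apply: (le_trans (hC x)).
by rewrite indicE; case: (_ \in _); rewrite ?mulr1// mulr0.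
Qed.

Lemma test_measurable psi : test_function psi -> mfun psi.
Proof. by move=> /test_cont; exact: continuous_measurable_rV. Qed.

Lemma locinteg_test_fun (F : E -> R) psi : locinteg F -> test_function psi -> integ mu (fun x => F x * psi x).
Proof.
by move=> lF tpsi; have [m [C C0 hC]] := test_cube tpsi; apply: (locinteg_test lF (test_measurable tpsi) C0 hC).
Qed.

Lemma wder_test psi i : test_function psi -> wder i psi (pderiv i psi).
Proof.
move=> tpsi; have [C C0 hC] := test_bound tpsi.
have tp := test_pderiv i tpsi; have [D D0 hD] := test_bound tp.
apply: (wder_C1 (C := C + D)).
- exact: test_cont.
- exact: test_measurable.
- by move=> x; exact: test_is_derive.
- by move=> x; rewrite (le_trans (hC x))// lerDl.
- by move=> x; rewrite (le_trans (hD x))// lerDr.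
Qed.

Lemma wder_ibp_test i (g h : E -> R) psi : wder i g h -> test_function psi ->
  \int[mu]_x (g x * pderiv i psi x) = - \int[mu]_x (h x * psi x).
Proof.
move=> w tpsi; have [C C0 hC] := test_bound tpsi; have [m [C1 C10 hm]] := test_cube tpsi.
have tp := test_pderiv i tpsi; have [D D0 hD] := test_bound tp.
apply: (wder_ibp (m := m) (C := C + D) w (test_cont tpsi) (test_measurable tp)).
- by move=> x; exact: test_is_derive.
- move=> x xm; have := hm x; rewrite indicE memNset// mulr0 normr_le0 => /eqP ->//.
- by move=> x; rewrite (le_trans (hC x))// lerDl.
- by move=> x; rewrite (le_trans (hD x))// lerDr.
Qed.

Lemma test_line_mvt psi i (y : E) (t : R) : test_function psi ->
  exists2 c, `|c| <= `|t| & psi (t *: e_ i + y) - psi y = pderiv i psi (c *: e_ i + y) * t.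
Proof.
move=> tpsi; have d r : dd (fun r : R => psi (r *: e_ i + y)) r (pderiv i psi (r *: e_ i + y)).
  by apply: line_dd => x; exact: test_is_derive.
have cc a b : {within `[a, b], continuous (fun r : R => psi (r *: e_ i + y))}.
  by apply: continuous_subspaceT => r; exact: dd_cont (d r).
have [t0|t0] := leP 0 t.
  have [c] := MVT_segment t0 (fun x _ => d x) (cc 0 t).
  rewrite in_itv/= scale0r add0r subr0 => /andP[c0 ct] e.
  by exists c => //; rewrite !ger0_norm.
have [c] := MVT_segment (ltW t0) (fun x _ => d x) (cc t 0).
rewrite in_itv/= scale0r add0r sub0r => /andP[ct c0] e.
exists c; first by rewrite ler0_norm// ltr0_norm// lerN2.
by rewrite -opprB e mulrN opprK.
Qed.

Lemma test_lip_line psi i : test_function psi -> exists2 D : R, 0 <= D &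
  forall y t, `|psi (t *: e_ i + y) - psi y| <= D * `|t|.
Proof.
move=> tpsi; have [D D0 hD] := test_bound (test_pderiv i tpsi); exists D => // y t.
by have [c _ ->] := test_line_mvt i y t tpsi; rewrite normrM ler_wpM2r.
Qed.

Lemma test_taylor psi i : test_function psi -> exists2 D : R, 0 <= D &
  forall y t, `|psi (t *: e_ i + y) - psi y - t * pderiv i psi y| <= D * t ^+ 2.
Proof.
move=> tpsi; have [D D0 hD] := test_lip_line i (test_pderiv i tpsi); exists D => // y t.
have [c ct ->] := test_line_mvt i y t tpsi; rewrite mulrC -mulrBr normrM mulrC.
rewrite -[t ^+ 2]real_normK ?num_real// expr2 mulrA ler_wpM2r//.
by rewrite (le_trans (hD y c))// ler_wpM2l.
Qed.

Lemma test_lip psi : test_function psi -> exists2 C : R, 0 <= C &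
  forall x y, `|psi (x + y) - psi y| <= C * enorm x.
Proof.
move=> tpsi.
have /choice[D hD] : forall i, exists D : R, 0 <= D /\ forall y t, `|psi (t *: e_ i + y) - psi y| <= D * `|t|.
  by move=> i; have [D D0 h] := test_lip_line i tpsi; exists D.
have sums (s : seq 'I_n) (x y : E) : `|psi (\sum_(i <- s) x ord0 i *: e_ i + y) - psi y| <=
    \sum_(i <- s) D i * enorm x.
  elim: s => [|i s IH]; first by rewrite !big_nil add0r subrr normr0.
  rewrite !big_cons -addrA.
  apply: (le_trans (ler_distD (psi (\sum_(i <- s) x ord0 i *: e_ i + y)) _ _)).
  apply: lerD => //; apply: (le_trans ((hD i).2 _ _)); rewrite ler_wpM2l ?enorm_coord//.
  exact: (hD i).1.
exists (\sum_i D i); first by apply: sumr_ge0 => i _; exact: (hD i).1.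
move=> x y; have := sums (index_enum 'I_n) x y.
by rewrite -mulr_suml -row_sum_delta.
Qed.

Lemma pderiv_shift i (f : E -> R) (a : E) : pderiv i (fun y => f (y + a)) = fun y => pderiv i f (y + a).
Proof.
apply/funext => y; rewrite /pderiv /derive.
rewrite (_ : (fun h : R => _) = fun h : R => h^-1 *: ((f \o shift (y + a)) (h *: e_ i) - f (y + a)))//.
by apply/funext => h /=; rewrite addrA.
Qed.

Lemma laplacian_shift (f : E -> R) (a : E) y : laplacian (fun y => f (y + a)) y = laplacian f (y + a).
Proof. by apply: eq_bigr => i _; rewrite !pderiv_shift. Qed.

End test_functions.

(** * Existence of the Green function *)

Section green_exists.
Context (R : realType) (n : nat) (p th C0 b l : R) (V I : R -> R).
Context (n23 : (n == 2%N) || (n == 3%N)) (p1 : 1 <= p) (gexp : good_exp n p th C0).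
Context (l0 : 0 < l) (pV : profile n (sing n) b (fun x => l * x) V I).
Local Notation E := 'rV[R]_n.
Local Notation mu := (lebesgue_rV R n).

Let n0 : (0 < n)%N := n23_gt0 n23.
Let s0 : 0 < sigma R n := sigma_gt0 R n23.
Let si : 0 <= (sigma R n)^-1. Proof. pos. Qed.

Definition Grad : E -> R := rad (fun r => V r / sigma R n).

Lemma Grad_ge0 x : 0 <= Grad x.
Proof.
rewrite /Grad /rad IposE; case: ltP => e0; rewrite ?mulr0//.
by rewrite mulr1 divr_ge0// ltW// (prof_v0 pV).
Qed.

Lemma Grad_measurable : mfun Grad.
Proof.
apply: rad_measurable => r r0; apply: cvgM; [exact: (prof_cv pV)|exact: cvg_cst].
Qed.

(** At infinity V^q <= V(1)^(q-1) V, so the integrability of V is enough there; at the origin the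
    condition is th q < n. *)
Lemma Grad_integ (q : R) : 1 <= q -> th * q < n%:R -> integ mu (fun x => Grad x `^ q).
Proof.
move=> q1 hq; have q0 : 0 <= q := le_trans ler01 q1.
have [C C_0 hC] := prof_v gexp pV.
have V0 : forall r, 0 < r -> 0 < V r := prof_v0 pV.
pose H r := (V r / sigma R n) `^ q.
have C1H : isC1 H.
  apply: isC1_comp_powR.
    by apply: isC1M; [exact: (prof_C1v pV)|exact: isC1_cst].
  pos.
have [H' CH] := C1H.
have H0 r : 0 < r -> 0 <= H r by rewrite powR_ge0.
have hH : halfint (fun r => H r * r ^+ n.-1).
  apply: (lin_half n23 l0 pV (s := th * q) (C := (C / sigma R n) `^ q)
    (D := (V 1 / sigma R n) `^ (q - 1) / sigma R n)).
  - exact: isC1_cpos.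
  - exact: hq.
  - exact: powR_ge0.
  - pos.
  - move=> r rr; have /andP[r0 _] := rr; rewrite ger0_norm ?H0//.
    apply: (@le_trans _ _ ((C / sigma R n * r `^ (- th)) `^ q)).
      have v1 := V0 _ r0.
      apply: ge0_ler_powR => //.
      + by rewrite nnegrE; exact: (mulr_ge0 (ltW v1) si).
      + by rewrite nnegrE; exact: (mulr_ge0 (mulr_ge0 C_0 si) (powR_ge0 _ _)).
      + by rewrite [leRHS]mulrAC ler_wpM2r ?hC.
    by rewrite powRM ?powR_ge0 ?(mulr_ge0 C_0 si)// -powRrM mulNr.
  - move=> r r1; have r0 := lt_le_trans ltr01 r1; rewrite ger0_norm ?H0// /H.
    have y0 : 0 < V r / sigma R n by rewrite divr_gt0// V0.
    rewrite (powR_sub1 q y0) [leRHS]mulrAC -[leRHS]mulrA ler_wpM2r ?(ltW y0)//; apply: ge0_ler_powR.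
    + lra.
    + by rewrite nnegrE ltW.
    + by rewrite nnegrE divr_ge0// ltW// V0.
    + by rewrite ler_wpM2r//; exact: (prof_le pV ltr01).
have [iH _] := (radial_ge0 n0 CH H0).1 hH.
apply: (integ_eq _ iH) => x; rewrite /Grad /rad IposE; case: ltP => e0; rewrite ?mulr1// !mulr0.
by rewrite powR0// gt_eqF// (lt_le_trans ltr01).
Qed.

Lemma Grad_integ1 : integ mu Grad.
Proof.
have [/andP[th0 th1] _ _ h2 _] := gexp.
apply: (integ_eq _ (Grad_integ (q := 1) _ _)) => [x||].
- by rewrite powRr1// Grad_ge0.
- exact: lexx.
- lra.
Qed.

Let F' (r : R) := - (1 - I r) / wt n r / sigma R n.

Definition gradG (i : 'I_n) (x : E) : R := x ord0 i * rad (fun r => F' r / r) x.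

Lemma green_wder i : wder i Grad (gradG i).
Proof.
have [/andP[th0 th1] _ hp h2 _] := gexp.
have [C C_0 hC] := prof_v gexp pV.
have CF : C1pos (fun r => V r / sigma R n) F'.
  split=> r r0.
    apply: dd_eq (ddM (prof_dv pV r0) (dd_cst (sigma R n)^-1 r)) _.
    by rewrite mulr0 add0r.
  by apply: cvgM; [exact: (prof_cv' pV)|exact: cvg_cst].
have V1 := prof_v0 pV (@ltr01 R).
have K0 : 0 <= (C + V 1 + 1) / sigma R n by pos.
apply: (wder_rad n0 i CF K0 (ltW th0) (t := n%:R - 1)).
- by move: hp th0 p1; nra.
- by rewrite ltrBlDr ltrDl ltr01 andbT subr_ge0 ler1n.
- move=> r r0; have Vr := prof_v0 pV r0.
  rewrite ger0_norm ?divr_ge0 ?(ltW s0) ?(ltW Vr)// mulrAC ler_wpM2r ?(ltW s0)//.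
  have p0 := powR_ge0 r (- th).
  have [r1|r1] := leP r 1.
    have rr : 0 < r <= 1 by rewrite r0.
    by have := hC r rr; nra.
  have : V r <= V 1 by apply: (prof_le pV ltr01); exact: ltW.
  by nra.
- move=> r r0; have /andP[I0' I1] := prof_J01 pV r0.
  have w0 : 0 < wt n r by rewrite exprn_gt0.
  rewrite /F' !normrM normrN !normfV (gtr0_norm w0) (gtr0_norm s0) [leRHS]mulrAC.
  rewrite ler_wpM2r ?(ltW s0)// powRN -(wt_powR n0 r0).
  have wi : 0 < (wt n r)^-1 by pos.
  rewrite ger0_norm ?subr_ge0 ?(ltW I1)//.
  by nra.
Qed.

Let m0 (r : R) := - (1 - I r) / sigma R n.
Let m1 (r : R) := wt n r * (l * V r) / sigma R n.

Lemma rad_ext (H K : R -> R) (x : E) : (forall r, 0 < r -> H r = K r) -> rad H x = rad K x.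
Proof.
by move=> HK; rewrite /rad IposE; case: ltP => e0; rewrite ?mulr0// HK.
Qed.

Lemma gradGE i x : gradG i x = x ord0 i * rad (fun r => m0 r / r ^+ n) x.
Proof.
rewrite /gradG; congr (_ * _); apply: rad_ext => r r0.
have -> : r ^+ n = r * wt n r by rewrite -[in LHS](prednK n0) exprS.
rewrite /F' /m0; field; rewrite !gt_eqF//.
by rewrite exprn_gt0.
Qed.

Lemma Int_Grad : l * \int[mu]_x Grad x = 1.
Proof.
pose H r := V r / sigma R n.
have C1H : isC1 H by apply: isC1M; [exact: (prof_C1v pV)|exact: isC1_cst].
have [H' CH] := C1H.
have H0 r : 0 < r -> 0 <= H r by move=> r0; rewrite divr_ge0// ltW// (prof_v0 pV).
have ev : 0 < evol R n by move: s0; rewrite /sigma pmulr_rgt0// ltr0n.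
have hH : halfint (fun r => H r * r ^+ n.-1) := (radial_ge0 n0 CH H0).2 ev Grad_integ1.
have [_ ->] := (radial_ge0 n0 CH H0).1 hH.
rewrite -[RHS](Int_lin_prof n23 gexp l0 pV) -/(sigma R n) mulrA -IntZ//.
apply: Int_ext => r; rewrite mulrA; congr (_ * _); rewrite /H /wt.
by field; rewrite gt_eqF.
Qed.

(** Radial integration by parts is applied to psi - psi(0), because m0(r)/r^n is of order r^(-n) and
    needs a factor vanishing at the origin. The identity l int G = 1 then brings psi(0) back. *)
Lemma Grad_green psi : test_function psi ->
  \int[mu]_x (Grad x * (l * psi x - laplacian psi x)) = psi 0.
Proof.
move=> tpsi.
have [L L0 hL'] := test_lip tpsi; have [C C_0 hC] := test_bound tpsi.
have hL x : `|psi x - psi 0| <= L * enorm x by have := hL' x 0; rewrite addr0.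
have lG : locinteg Grad by have [] := green_wder (Ordinal n0).
have lgG i : locinteg (gradG i) by have [] := green_wder i.
have Cm : C1pos m0 m1.
  split=> r r0.
    apply: dd_eq (ddM (ddN (ddB (dd_cst 1 r) (prof_dJ pV r0))) (dd_cst (sigma R n)^-1 r)) _.
    by rewrite mulr0 add0r sub0r opprK.
  apply: cvgM; last exact: cvg_cst.
  by apply: (prof_cJ' (p := 1) _ pV) => //; apply: gok_lin; exact: ltW.
have E1 x : rad (fun r => m1 r / r ^+ n.-1) x = l * Grad x.
  have -> : l * Grad x = rad (fun r => l * (V r / sigma R n)) x by rewrite /Grad /rad mulrA.
  apply: rad_ext => r r0; rewrite /m1 /wt; field; rewrite !gt_eqF//.
  pos.
have tdpsi i := test_pderiv i tpsi.
have wpsi i : wder i (fun x => psi x - psi 0) (pderiv i psi).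
  by apply: wder_eq (wderB (wder_test i tpsi) (wder_cst i (psi 0))) => x; rewrite ?subr0.
have mpsi : mfun (fun x : E => psi x - psi 0).
  by apply: measurable_funB => //; exact: test_measurable.
have bpsi x : `|psi x - psi 0| <= C + C by rewrite (le_trans (ler_normB _ _))// lerD.
have i1 : integ mu (fun x => (psi x - psi 0) * rad (fun r => m1 r / r ^+ n.-1) x).
  apply: (integ_eq _ (integM_bounded (integZ l Grad_integ1) mpsi bpsi)) => x.
  by rewrite E1 mulrC.
have i2 : integ mu (fun x => (psi x - psi 0) * rad (fun r => m0 r / r ^+ n) x).
  (* The factor r/(1 + r) plays the part of min(r, 1), which controls psi - psi(0) up to a
     constant. *)
  pose H r := (1 - I r) / sigma R n / r ^+ n * (r / (1 + r)).
  have C1H : isC1 H.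
    apply: isC1M; last first.
      apply: isC1M; first exact: isC1_id.
      by apply: isC1V; [apply: isC1D; [exact: isC1_cst|exact: isC1_id]|move=> r r0; rewrite addr_gt0].
    apply: isC1M; last by apply: isC1V; [exact: isC1_exp|move=> r r0; rewrite exprn_gt0].
    apply: isC1M; last exact: isC1_cst.
    apply: isC1B; first exact: isC1_cst.
    by apply: (prof_C1J (p := 1) _ pV) => //; apply: gok_lin; exact: ltW.
  have [H' CH] := C1H.
  have Ir r : 0 < r -> 0 <= 1 - I r <= 1.
    by move=> r0; have /andP[a1 a2] := prof_J01 pV r0; rewrite subr_ge0 (ltW a2) gerBl a1.
  have H0 r : 0 < r -> 0 <= H r.
    move=> r0; have /andP[a1 _] := Ir r r0.
    have r1 : 0 <= 1 + r by pos.
    apply: mulr_ge0; apply: divr_ge0; rewrite ?exprn_ge0 ?(ltW r0)//.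
    pos.
  have HE r : 0 < r -> H r * r ^+ n.-1 = (1 - I r) / sigma R n * (1 + r)^-1.
    move=> r0; have en : r ^+ n = r * wt n r by rewrite -[in LHS](prednK n0) exprS.
    rewrite /H en /wt; field; rewrite !gt_eqF ?exprn_gt0//.
    pos.
  have hH : halfint (fun r => H r * r ^+ n.-1).
    apply: half_dom.
    - by move=> r r0; apply: cvgM; [exact: isC1_cpos|exact: exprn_continuous].
    - apply: (dom0_le (C := (sigma R n)^-1) _ (@dom0_powR R 0 _)).
      + pos.
      + pos.
      + move=> r /andP[r0 r1]; rewrite HE// powRr0 normr1 mulr1.
        have /andP[a1 a2] := Ir r r0.
        have q1 : (1 + r)^-1 <= 1 by rewrite invf_le1 ?addr_gt0// lerDl ltW.
        have q0 : 0 <= (1 + r)^-1 by pos.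
        rewrite ger0_norm; last exact: (mulr_ge0 (mulr_ge0 a1 si) q0).
        by rewrite mulrAC ler_piMl//; apply: mulr_ile1.
    - apply: (domoo_le (C := (sigma R n)^-1) _ (prof_domoo1 n23 l0 pV)); first by rewrite invr_ge0 ltW.
      move=> r r1; have r0 := lt_le_trans ltr01 r1; rewrite HE//.
      have /andP[a1 a2] := Ir r r0.
      have q0 : 0 <= (1 + r)^-1 by pos.
      have ri : 0 <= r^-1 by pos.
      rewrite ger0_norm; last exact: (mulr_ge0 (mulr_ge0 a1 si) q0).
      rewrite ger0_norm; last exact: (mulr_ge0 a1 ri).
      rewrite -mulrA [leRHS]mulrCA ler_wpM2l// ler_wpM2l//.
      by rewrite lef_pV2 ?posrE ?addr_gt0// lerDr.
  have [iH _] := (radial_ge0 n0 CH H0).1 hH.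
  (* For |x| <= 1 the Lipschitz bound of psi uses 2 L; beyond, boundedness uses 4 C. *)
  apply: (integ_le _ (integZ (2 * L + 4 * C) iH)).
    apply: measurable_funM => //; apply: rad_measurable => r r0; apply: cvgM.
      exact: (ddpos_cpos Cm.1).
    by apply: cvgV; [rewrite gt_eqF// exprn_gt0|exact: exprn_continuous].
  move=> x; have [->|x0] := eqVneq x 0; first by rewrite !rad0 !mulr0 normr0.
  have e0 := enorm_pos x0.
  rewrite !radE// /H /m0; have /andP[a1 a2] := Ir _ e0.
  rewrite !normrM normrN (ger0_norm a1) normfV (gtr0_norm s0) normfV (gtr0_norm (exprn_gt0 n e0)).
  rewrite mulrC [leRHS]mulrCA ler_wpM2l//.
    pos.
  have h1 := hL x; have h2 := bpsi x.
  rewrite mulrA ler_pdivlMr ?addr_gt0//.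
  have [e1|e1] := leP (enorm x) 1; by nra.
have i3 i : integ mu (fun x => pderiv i psi x * (x ord0 i * rad (fun r => m0 r / r ^+ n) x)).
  apply: (integ_eq _ (locinteg_test_fun (lgG i) (tdpsi i))) => x.
  by rewrite gradGE mulrC.
have := radial_ibp n0 wpsi Cm i1 i2 i3.
rewrite [in RHS](Int_ext mu _ (fun x => l * (Grad x * psi x) - psi 0 * (l * Grad x))); last first.
  by move=> x; rewrite E1; ring.
have iGp := locinteg_test_fun lG tpsi.
rewrite IntB; [|exact: integZ|apply: integZ; apply: integZ; exact: Grad_integ1].
rewrite !IntZ//; [|exact: Grad_integ1|apply: integZ; exact: Grad_integ1].
rewrite Int_Grad mulr1 => ibp.
have iGpp i : integ mu (fun x => Grad x * pderiv i (pderiv i psi) x).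
  by apply: locinteg_test_fun => //; exact: test_pderiv.
rewrite (Int_ext mu _ (fun x => l * (Grad x * psi x) - \sum_i Grad x * pderiv i (pderiv i psi) x)); last first.
  by move=> x; rewrite /laplacian mulrBr mulr_sumr; congr (_ - _); ring.
rewrite IntB; [|exact: integZ|exact: integ_sum].
rewrite IntZ// Int_sum//.
have -> : \sum_i \int[mu]_x (Grad x * pderiv i (pderiv i psi) x) =
    - \sum_i \int[mu]_x (pderiv i psi x * (x ord0 i * rad (fun r => m0 r / r ^+ n) x)).
  rewrite -sumrN; apply: eq_bigr => i _.
  rewrite (wder_ibp_test (green_wder i) (tdpsi i)); congr (- _).
  by apply: Int_ext => x; rewrite gradGE mulrC.
by rewrite ibp; ring.
Qed.

End green_exists.

(** * Uniqueness of the Green function *)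

Section second_derivative_test.
Context (R : realType).

Lemma mvt_all (f f' : R -> R) (a b : R) : a < b -> (forall x, dd f x (f' x)) ->
  exists2 c, a < c < b & f b - f a = f' c * (b - a).
Proof.
move=> ab df; have [|c cab e] := MVT ab (fun x _ => df x); last by exists c.
by apply: continuous_subspaceT => x; exact: dd_cont (df x).
Qed.

Lemma dd_sign_right (f : R -> R) (a d : R) : dd f a d -> f a = 0 -> 0 < d ->
  exists2 e, 0 < e & forall x, a < x < a + e -> 0 < f x.
Proof.
move=> /dd_limP h fa d0.
have : \forall t \near (0 : R)^', 0 < t^-1 * (f (t + a) - f a).
  by apply: (cvgr_gt _ h).
move=> [e /= e0 he]; exists e => // x /andP[ax xe].
have xa : 0 < x - a by lra.
have := he (x - a); rewrite /ball_/= add0r normrN gtr0_norm// subrK fa subr0.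
rewrite pmulr_rgt0 ?invr_gt0//; apply; last by rewrite gt_eqF.
lra.
Qed.

Lemma second_derivative_max (g g1 g2 : R -> R) : (forall x, dd g x (g1 x)) -> (forall x, dd g1 x (g2 x)) ->
  (forall x, g x <= g 0) -> g2 0 <= 0.
Proof.
move=> dg dg1 gmax.
have pos (h h1 : R -> R) : (forall x, dd h x (h1 x)) -> (forall x, h x <= h 0) -> h1 0 <= 0.
  move=> dh hm; rewrite leNgt; apply/negP => h10.
  have d0 : dd (fun x => h x - h 0) 0 (h1 0) by apply: dd_eq (ddB (dh 0) (dd_cst _ _)) _; rewrite subr0.
  have [e e0 he] := dd_sign_right d0 (subrr _) h10.
  have := he (e / 2); rewrite add0r divr_gt0//= ltr_pdivrMr// ltr_pMr// ltr1n => /(_ isT).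
  by rewrite subr_gt0 ltNge hm.
have g10 : g1 0 = 0.
  apply/eqP; rewrite eq_le (pos _ _ dg gmax)/=.
  have dn x : dd (fun x => g (-1 * x + 0)) x (g1 (-1 * x + 0) * -1).
    by apply: dd_comp; [exact: dg|exact: dd_affine].
  have := pos _ _ dn; rewrite mulr0 addr0 mulrN1 oppr_le0; apply.
  pos.
rewrite leNgt; apply/negP => g20.
have [e e0 he] := dd_sign_right (dg1 0) g10 g20.
have e2 : 0 < e / 2 by pos.
have [c /andP[c0 ce] hc] := mvt_all e2 dg.
have : 0 < g1 c.
  by apply: he; rewrite c0 add0r (lt_le_trans ce)// ler_pdivrMr// ler_pMr// ler1n.
have := gmax (e / 2); rewrite -subr_le0 hc subr0 => h h1.
by move: h; rewrite pmulr_lle0// leNgt h1.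
Qed.

End second_derivative_test.

Section green_unique.
Context (R : realType) (n : nat).
Local Notation E := 'rV[R]_n.
Local Notation mu := (lebesgue_rV R n).
Implicit Types (D psi : E -> R).

Lemma L2_locinteg D : mfun D -> integ mu (fun x => D x ^+ 2) -> locinteg D.
Proof.
move=> mD iD; split=> // m.
have i1 := integ_cube R n m.
apply: (integ_le _ (integD iD i1)).
  by apply: measurable_funM => //; exact: indic_cube_measurable.
move=> x; rewrite normrM [X in _ * X]ger0_norm//.
have := sqr_ge0 (D x); have := sqr_ge0 (`|D x| - 1); rewrite indicE -[D x ^+ 2]real_normK ?num_real//.
by case: (_ \in _) => /=; nra.
Qed.

Lemma coord_bound_cube (x y : E) m (r : R) : (forall i, `|y ord0 i| <= r) -> rV_cube m x ->
  rV_cube (m + (Num.truncn r).+1) (x + y).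
Proof.
move=> yr xm i; have := xm i; rewrite /= !in_itv/= mxE => /andP[h1 h2].
have h3 := yr i; have h4 := truncnS_gt r.
rewrite natrD; have := ler_norm (y ord0 i); have := ler_norm (- y ord0 i); rewrite normrN => h5 h6.
by apply/andP; split; lra.
Qed.

(** Correlation with psi: a smooth substitute for D whose value at 0 is D tested against psi. *)
Definition conv D psi (x : E) := \int[mu]_y (D y * psi (y - x)).

Lemma shift_cube psi m C (r : R) : (forall x, `|psi x| <= C * \1_(rV_cube m) x) -> 0 <= C ->
  forall x : E, (forall i, `|x ord0 i| <= r) -> forall y, `|psi (y - x)| <= C * \1_(rV_cube (m + (Num.truncn r).+1)) y.
Proof.
move=> h C0 x xr y; apply: (le_trans (h _)); rewrite ler_wpM2l//.
rewrite [leLHS]indicE; case: (boolP (_ \in _)) => [/set_mem yx|_]; last by rewrite indicE.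
by rewrite indicE mem_set//; have := coord_bound_cube xr yx; rewrite subrK.
Qed.

Lemma shift_measurable psi x : test_function psi -> mfun (fun y : E => psi (y - x)).
Proof. by move=> tpsi; apply: measurableT_comp (rV_shift_measurable (- x)); exact: test_measurable. Qed.

Lemma conv_integ D psi x : locinteg D -> test_function psi -> integ mu (fun y => D y * psi (y - x)).
Proof.
move=> lD tpsi; have [m [C C0 h]] := test_cube tpsi.
by apply: (locinteg_test lD (shift_measurable x tpsi) C0) => y; exact: (shift_cube h C0 (enorm_coord x)).
Qed.

Lemma conv_cont D psi : locinteg D -> test_function psi -> continuous (conv D psi).
Proof.
move=> lD tpsi x.
have [m [C C0 h]] := test_cube tpsi; have [L L0 hL] := test_lip tpsi.
pose M := (m + (Num.truncn (enorm x + 1)).+1)%N.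
have iM : integ mu (fun y => `|D y| * \1_(rV_cube M) y).
  apply: integ_eq (integ_norm (lD.2 M)) => y.
  by rewrite normrM; congr (_ * _); rewrite ger0_norm.
pose B := L * \int[mu]_y (`|D y| * \1_(rV_cube M) y).
have key (z : E) : enorm (z - x) <= 1 -> `|conv D psi x - conv D psi z| <= B * enorm (z - x).
  move=> zx.
  have ex i : `|x ord0 i| <= enorm x + 1 by rewrite (le_trans (enorm_coord x i))// lerDl.
  have ez i : `|z ord0 i| <= enorm x + 1.
    rewrite -[z](subrK x) mxE addrC (le_trans (ler_normD _ _))// lerD ?enorm_coord//.
    exact: le_trans (enorm_coord (z - x) i) zx.
  rewrite /conv -IntB; [|exact: conv_integ|exact: conv_integ].
  rewrite /B mulrAC -IntZ//; apply: Int_abs_leP.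
  - by apply: integB; exact: conv_integ.
  - exact: integZ.
  - move=> y; rewrite -mulrBr normrM mulrCA ler_wpM2l//.
    have hx := shift_cube h C0 ex y; have hz := shift_cube h C0 ez y.
    rewrite -/M in hx hz.
    case: (boolP (y \in rV_cube M)) => yM; last first.
      move: hx hz; rewrite !indicE (negbTE yM) !mulr0 !normr_le0 => /eqP -> /eqP ->.
      by rewrite subrr.
    rewrite indicE yM mulr1; have := hL (z - x) (y - z).
    by rewrite [z - x + _]addrC addrA subrK.
apply/(@cvgrPdist_lt _ _ _ _ (nbhs_filter x)) => e e0.
have B0 : 0 <= B by rewrite mulr_ge0//; apply: Int_ge0 => y; rewrite mulr_ge0.
have ce : continuous (fun z : E => enorm (z - x)).
  move=> z; apply: (@continuous_comp _ _ _ (fun z : E => z - x) (@enorm R n)); last exact: enorm_cont.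
  exact: (@cvgB _ _ _ _ (nbhs_filter z) _ _ _ _ cvg_id (cvg_cst x)).
have e0x : enorm (x - x) = 0 by rewrite subrr; apply/eqP; rewrite eq_le enorm_ge0 leNgt enorm_gt0 eqxx.
near=> z.
have z1 : enorm (z - x) < Num.min 1 (e / (B + 1)).
  near: z; apply: (cvgr_lt _ (ce x)); rewrite e0x lt_min ltr01 divr_gt0//.
  pos.
move: z1; rewrite lt_min => /andP[z1 z2].
apply: (le_lt_trans (key z (ltW z1))).
have := enorm_ge0 (z - x); move: z2; rewrite ltr_pdivlMr ?ltr_wpDl//.
by move=> z2 z0; nra.
Unshelve. all: by end_near. Qed.

(** The Taylor remainder of psi is quadratic uniformly in y, so [dd_bound0] applies once the affine
    part is subtracted. *)
Lemma conv_dd D psi i (x : E) : locinteg D -> test_function psi ->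
  forall t, dd (fun t => conv D psi (t *: e_ i + x)) t (- conv D (pderiv i psi) (t *: e_ i + x)).
Proof.
move=> lD tpsi t; pose z := t *: e_ i + x.
have tp := test_pderiv i tpsi.
have [m [C C0 h]] := test_cube tpsi; have [m1 [C1 C10 h1]] := test_cube tp.
have [L L0 hL] := test_taylor i tpsi.
pose r := enorm z + 1.
pose M := (m + (Num.truncn r).+1 + (m1 + (Num.truncn r).+1))%N.
have iM : integ mu (fun y => `|D y| * \1_(rV_cube M) y).
  apply: integ_eq (integ_norm (lD.2 M)) => y.
  by rewrite normrM; congr (_ * _); rewrite ger0_norm.
pose c := conv D (pderiv i psi) z.
pose F s := conv D psi (s *: e_ i + x) - conv D psi z + (s - t) * c.
have dF : dd F t 0.
  apply: (dd_bound0 (C := L * \int[mu]_y (`|D y| * \1_(rV_cube M) y))).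
    by rewrite /F -/z !subrr mul0r addr0.
  near=> s.
  have ez j : `|z ord0 j| <= r by rewrite /r (le_trans (enorm_coord z j))// lerDl.
  have zs : s *: e_ i + x = (s - t) *: e_ i + z.
    by rewrite /z addrA -scalerDl subrK.
  have es j : `|(s *: e_ i + x) ord0 j| <= r.
    rewrite zs coord_line /r; case: eqP => [->|_]; last exact: ez.
    by rewrite addrC (le_trans (ler_normD _ _))// lerD// enorm_coord.
  rewrite /F /c /conv -IntZ; last exact: conv_integ.
  rewrite -IntB; [|exact: conv_integ|exact: conv_integ].
  rewrite -IntD; [|by apply: integB; exact: conv_integ|by apply: integZ; exact: conv_integ].
  rewrite mulrAC -IntZ//; apply: Int_abs_leP.
  - by apply: integD; [apply: integB; exact: conv_integ|apply: integZ; exact: conv_integ].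
  - exact: integZ.
  - move=> y; rewrite -mulrBr mulrCA -mulrDr normrM mulrCA ler_wpM2l//.
    have hz := shift_cube h C0 ez y; have hs := shift_cube h C0 es y.
    have hd := shift_cube h1 C10 ez y.
    case: (boolP (y \in rV_cube M)) => yM; last first.
      have out k : (k <= M)%N -> \1_(rV_cube k) y = 0 :> R.
        move=> kM; rewrite indicE memNset// => yk; move/negP: yM; apply; apply/mem_set.
        exact: rV_cube_mono kM yk.
      move: hz hs hd; rewrite !out ?leq_addr ?leq_addl// !mulr0 !normr_le0 => /eqP -> /eqP -> /eqP ->.
      by rewrite mulr0 subrr addr0.
    rewrite indicE yM mulr1; have := hL (y - z) (t - s).
    rewrite (_ : (t - s) *: e_ i + (y - z) = y - (s *: e_ i + x)); last first.
      by rewrite zs -[t - s]opprB scaleNr [in RHS]opprD; exact: addrCA.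
    rewrite -mulNr opprB [leRHS](_ : _ = L * (s - t) ^+ 2)//.
    by rewrite -[t - s]opprB sqrrN.
have d2 : dd (fun s => F s + (conv D psi z + (- c * s + c * t))) t (- c).
  apply: dd_eq (ddD dF (ddD (dd_cst _ t) (dd_affine (- c) (c * t) t))) _.
  by rewrite !add0r.
have alg (A1 A2 c' s' : R) : A1 - A2 + (s' - t) * c' + (A2 + (- c' * s' + c' * t)) = A1 by ring.
by apply: dd_near d2; near=> s; rewrite /F alg.
Unshelve. all: by end_near. Qed.

(** Far away the translated psi only meets the L^2 tail of D. The product is split by Young's
    inequality with parameter d = e/(P + 1), which bounds the part in psi by e/2. *)
Lemma conv_infty D psi : mfun D -> integ mu (fun x => D x ^+ 2) -> test_function psi ->
  forall e, 0 < e -> exists B : nat, forall x, ~ rV_cube B x -> `|conv D psi x| <= e.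
Proof.
move=> mD iD tpsi e e0.
have lD := L2_locinteg mD iD.
have [m [C C0 h]] := test_cube tpsi.
have ip : integ mu (fun y => psi y ^+ 2).
  have i1 := integ_cube R n m.
  have mp := test_measurable tpsi.
  apply: (integ_le _ (integZ (C ^+ 2) i1)); first exact: measurable_funX.
  move=> x; rewrite ger0_norm// -real_normK ?num_real//.
  have := h x; rewrite indicE; case: (_ \in _) => /=; rewrite ?mulr1 ?mulr0 => h0.
    by rewrite ler_sqr.
  by rewrite (_ : `|psi x| = 0) ?expr0n//; apply/eqP; rewrite eq_le h0 normr_ge0.
pose P := \int[mu]_y psi y ^+ 2.
have P0 : 0 <= P by apply: Int_ge0 => y; exact: sqr_ge0.
pose d := e / (P + 1).
have d0 : 0 < d by rewrite divr_gt0// ltr_wpDl.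
pose tail k x := D x ^+ 2 * \1_(~` rV_cube k : set E) x.
have mtail k : mfun (tail k).
  apply: measurable_funM; first exact: integ_measurable iD.
  by apply: measurable_indic; apply: measurableC; exact: measurable_rV_cube.
have dtail k x : `|tail k x| <= D x ^+ 2.
  rewrite /tail normrM ger0_norm ?sqr_ge0// indicE.
  by case: (_ \in _); rewrite ?normr1 ?mulr1// normr0 mulr0 sqr_ge0.
have itail k : integ mu (tail k) := integ_le (mtail k) iD (dtail k).
have ctail x : tail ^~ x @ \oo --> (0 : R).
  apply: cvg_near_cst; have : (\bigcup_k rV_cube k) x by rewrite rV_cube_cover.
  move=> [k _ xk]; exists k => //= j kj; rewrite /tail indicE memNset ?mulr0// => nx; apply: nx.
  exact: rV_cube_mono kj xk.
have := @dct_cvg _ _ _ mu tail (fun=> 0) _ mtail iD dtail ctail.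
rewrite Int0 => /cvgrPdist_lt /(_ (d * e) (mulr_gt0 d0 e0)) [k _ /(_ k (leqnn k))].
rewrite /= sub0r normrN => hk.
exists (m + k)%N => x xB.
have D0 : 0 <= \int[mu]_y tail k y by apply: Int_ge0 => y; rewrite mulr_ge0 ?sqr_ge0.
rewrite ger0_norm// in hk.
have bnd : `|conv D psi x| <= (2 * d)^-1 * \int[mu]_y tail k y + d / 2 * P.
  have ips : integ mu (fun y => psi (y - x) ^+ 2) by exact: (integ_shift (- x) ip).
  rewrite /P -(Int_shift (- x) ip) -!IntZ// -IntD; [|exact: integZ|exact: integZ].
  apply: Int_abs_leP; first exact: conv_integ.
    by apply: integD; exact: integZ.
  move=> y; have hy := h (y - x).
  case: (boolP (y - x \in rV_cube m)) => ym; last first.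
    have -> : psi (y - x) = 0 by move: hy; rewrite indicE (negbTE ym) mulr0 normr_le0 => /eqP.
    rewrite mulr0 normr0 expr0n mulr0 addr0; apply: mulr_ge0; last exact: mulr_ge0 (sqr_ge0 _) _.
    pos.
  have yk : tail k y = D y ^+ 2.
    rewrite /tail indicE mem_set ?mulr1// => yk; apply: xB => i.
    have := yk i; have := set_mem ym i; rewrite /= !in_itv/= !mxE natrD => /andP[a1 a2] /andP[a3 a4].
    by apply/andP; split; lra.
  rewrite yk normrM -[D y ^+ 2]real_normK ?num_real// -[psi _ ^+ 2]real_normK ?num_real//.
  set a := `|D y|; set b := `|psi _|.
  have : 0 <= (a - d * b) ^+ 2 / (2 * d) by pos.
  rewrite (_ : (a - d * b) ^+ 2 / (2 * d) = (2 * d)^-1 * a ^+ 2 + d / 2 * b ^+ 2 - a * b); last first.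
    by field; rewrite gt_eqF.
  by rewrite subr_ge0.
apply: (le_trans bnd).
have h1 : (2 * d)^-1 * \int[mu]_y tail k y <= e / 2.
  have hk' : \int[mu]_y tail k y <= d * e by lra.
  have d2 : 0 <= (2 * d)^-1 by pos.
  rewrite (le_trans (ler_wpM2l d2 hk'))// le_eqVlt; apply/orP; left; apply/eqP.
  by field; rewrite gt_eqF.
have h2 : d / 2 * P <= e / 2.
  rewrite mulrAC ler_pM2r// /d mulrAC ler_pdivrMr ?ltr_wpDl//.
  lra.
lra.
Qed.

(** With psi a product of bumps, its translates are again products of bumps, hence admissible in the
    equation for D. *)
Lemma conv_laplacian D psi l (x : E) : locinteg D ->
  (forall psi, test_function psi -> \int[mu]_y (D y * (l * psi y - laplacian psi y)) = 0) ->
  (exists2 k, (forall j, bump1 (k j)) & psi = prodf k) ->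
  \sum_i conv D (pderiv i (pderiv i psi)) x = l * conv D psi x.
Proof.
move=> lD H [k bk pk].
have tpsi : test_function psi by rewrite pk; exact: prodf_test.
have ts : test_function (fun y => psi (y - x)).
  have -> : (fun y => psi (y - x)) = prodf (fun j s => k j (s + - x ord0 j)).
    by apply/funext => y; rewrite pk /prodf; apply: eq_bigr => j _; rewrite !mxE.
  by apply: prodf_test => j; exact: bump1_shift.
have := H _ ts.
have i2 i : integ mu (fun y => D y * pderiv i (pderiv i psi) (y - x)).
  by apply: conv_integ => //; apply: test_pderiv; exact: test_pderiv.
have i0 := conv_integ x lD tpsi.
rewrite (Int_ext mu _ (fun y => l * (D y * psi (y - x)) - \sum_i D y * pderiv i (pderiv i psi) (y - x))); last first.
  by move=> y; rewrite laplacian_shift /laplacian mulrBr mulr_sumr; congr (_ - _); ring.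
rewrite IntB; [|exact: integZ|exact: integ_sum].
by rewrite IntZ// Int_sum// => /eqP; rewrite subr_eq0 => /eqP.
Qed.

(** Maximum principle: a positive value gives a positive maximum, attained because the function
    vanishes at infinity. There the second derivatives are nonpositive while the Laplacian is l
    times a positive value. *)
Lemma conv_le0 D psi l : mfun D -> integ mu (fun x => D x ^+ 2) -> 0 < l ->
  (forall psi, test_function psi -> \int[mu]_y (D y * (l * psi y - laplacian psi y)) = 0) ->
  (exists2 k, (forall j, bump1 (k j)) & psi = prodf k) -> forall x, conv D psi x <= 0.
Proof.
move=> mD iD l0 H pk x1; rewrite leNgt; apply/negP => u1.
have lD := L2_locinteg mD iD.
have tpsi : test_function psi by have [k bk ->] := pk; exact: prodf_test.
have [B hB] := conv_infty mD iD tpsi (divr_gt0 u1 (ltr0Sn R 1)).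
have x1B : rV_cube B x1.
  apply: contrapT => /hB; rewrite (ger0_norm (ltW u1)) leNgt => /negP; apply.
  lra.
pose K : set E := [set x | forall i, `[- B%:R, B%:R]%classic (x ord0 i)].
have cK : compact K by exact: (@rV_compact R n (fun=> `[- B%:R, B%:R]%classic) (fun=> @segment_compact _ _ _)).
have cubeK x : rV_cube B x -> K x.
  by move=> h i; have := h i; rewrite /= !in_itv/= => /andP[/ltW -> /ltW ->].
have cu := conv_cont lD tpsi.
have [|c cK0 hc] := @EVT_max_rV R n (conv D psi) K _ cK (continuous_subspaceT cu).
  by exists x1; exact: cubeK.
have uc : conv D psi x1 <= conv D psi c by apply: hc; apply/mem_set; exact: cubeK.
have umax t : conv D psi t <= conv D psi c.
  have [tB|tB] := pselect (rV_cube B t); first by apply: hc; apply/mem_set; exact: cubeK.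
  apply: (le_trans (ler_norm _)); apply: (le_trans (hB t tB)); apply: le_trans uc.
  lra.
have : \sum_i conv D (pderiv i (pderiv i psi)) c <= 0.
  apply: sumr_le0 => i _.
  have d1 := conv_dd i c lD tpsi.
  have d2 t := ddN (conv_dd i c lD (test_pderiv i tpsi) t).
  have := second_derivative_max d1 d2; rewrite opprK scale0r add0r; apply.
  pos.
rewrite (conv_laplacian c lD H pk) pmulr_rle0// leNgt => /negP; apply.
exact: lt_le_trans uc.
Qed.

Lemma green_unique_real D l : mfun D -> integ mu (fun x => D x ^+ 2) -> 0 < l ->
  (forall psi, test_function psi -> \int[mu]_y (D y * (l * psi y - laplacian psi y)) = 0) ->
  \forall x \ae mu, D x = 0.
Proof.
move=> mD iD l0 H; have lD := L2_locinteg mD iD.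
apply: (fundamental_lemma lD) => k bk.
have pk : exists2 k', (forall j, bump1 (k' j)) & prodf k = prodf k' by exists k.
have mND : mfun (fun x => - D x) by exact: measurable_funN.
have iND : integ mu (fun x => (- D x) ^+ 2) by apply: integ_eq iD => x; rewrite sqrrN.
have HN psi : test_function psi -> \int[mu]_y (- D y * (l * psi y - laplacian psi y)) = 0.
  move=> tpsi; rewrite (Int_ext mu _ (fun y => -1 * (D y * (l * psi y - laplacian psi y)))); last first.
    by move=> y; rewrite mulN1r mulNr.
  rewrite IntZ ?H ?mulr0//.
  apply: (integ_eq (g := fun y => D y * (l * psi y) - \sum_i D y * pderiv i (pderiv i psi) y)).
    by move=> y; rewrite /laplacian mulrBr mulr_sumr.
  apply: integB.
    by apply: (integ_eq _ (integZ l (locinteg_test_fun lD tpsi))) => y; rewrite mulrCA.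
  apply: integ_sum => i; apply: locinteg_test_fun => //.
  by apply: test_pderiv; exact: test_pderiv.
have conv0 F : conv F (prodf k) 0 = \int[mu]_y (F y * prodf k y).
  by apply: Int_ext => y; rewrite subr0.
apply/eqP; rewrite eq_le -conv0 (conv_le0 mD iD l0 H pk)/=.
have := conv_le0 mND iND l0 HN pk 0; rewrite conv0.
rewrite (Int_ext mu _ (fun y => -1 * (D y * prodf k y))); last by move=> y; rewrite mulN1r mulNr.
rewrite IntZ; last exact: locinteg_prodf.
by rewrite mulN1r oppr_le0 conv0.
Qed.

End green_unique.

(** * Criticality and uniqueness in real form *)

Section young.
Context (R : realType).
Implicit Types (x y z s p q : R).

Lemma powRS s x : 0 <= x -> 0 < s -> x `^ s * x = x `^ (s + 1).
Proof.
move=> x0 s0; have [->|xn] := eqVneq x 0; first by rewrite mulr0 powR0// gt_eqF// addr_gt0.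
by rewrite (powR_sub1 (s + 1)) ?addrK// lt_neqAle eq_sym xn.
Qed.

Lemma powR_ge1 s x : 0 <= s -> 1 <= x -> 1 <= x `^ s.
Proof.
by move=> s0 x1; rewrite -[leLHS](congr1 (@^~ s) (powR1 R)); apply: ge0_ler_powR; rewrite ?nnegrE// (le_trans ler01).
Qed.

Lemma young_pow s x y : 0 < s -> 0 <= x -> 0 <= y -> x `^ s * y <= x `^ (s + 1) + y `^ (s + 1).
Proof.
move=> s0 x0 y0; have hx := powR_ge0 x (s + 1); have hy := powR_ge0 y (s + 1).
have [xy|yx] := leP x y.
  apply: (@le_trans _ _ (y `^ s * y)); last by rewrite powRS// lerDr.
  by rewrite ler_wpM2r//; apply: ge0_ler_powR; rewrite// ltW.
apply: (@le_trans _ _ (x `^ s * x)); last by rewrite powRS// lerDl.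
by rewrite ler_wpM2l ?powR_ge0// ltW.
Qed.

(** It makes |u|^(p-1) a b integrable for u, a, b in L^(p+1); the constants do not matter. *)
Lemma young_pow3 p x y z : 1 < p -> 0 <= x -> 0 <= y -> 0 <= z ->
  x `^ (p - 1) * y * z <= x `^ (p + 1) + y `^ (p + 1) + 2 * z `^ (p + 1).
Proof.
move=> p1 x0 y0 z0; have p0 : 0 < p := lt_trans ltr01 p1.
have p10 : 0 < p - 1 by lra.
have := young_pow p10 x0 y0; rewrite subrK => h1.
apply: (le_trans (ler_wpM2r z0 h1)); rewrite mulrDl.
have h2 := young_pow p0 x0 z0; have h3 := young_pow p0 y0 z0.
by lra.
Qed.

Lemma young_conj p x y : 0 < p -> 0 <= x -> 0 <= y -> x * y <= x `^ (p + 1) + y `^ ((p + 1) / p).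
Proof.
move=> p0 x0 y0; have h := young_pow p0 (powR_ge0 y p^-1) x0.
rewrite -!powRrM mulVf ?gt_eqF// powRr1// [p^-1 * _]mulrC in h.
lra.
Qed.

Lemma powR_normD q x y : 0 <= q -> `|x + y| `^ q <= 2 `^ q * (`|x| `^ q + `|y| `^ q).
Proof.
move=> q0.
have h : `|x + y| <= 2 * Num.max `|x| `|y|.
  apply: (le_trans (ler_normD _ _)).
  have h1 : `|x| <= Num.max `|x| `|y| by rewrite le_max lexx.
  have h2 : `|y| <= Num.max `|x| `|y| by rewrite le_max lexx orbT.
  lra.
apply: (@le_trans _ _ ((2 * Num.max `|x| `|y|) `^ q)).
  by apply: ge0_ler_powR => //; rewrite nnegrE// mulr_ge0.
rewrite powRM// ler_wpM2l//.
by case: (leP `|x| `|y|) => _; rewrite ?lerDl ?lerDr powR_ge0.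
Qed.

End young.

Section Lp_tools.
Context d (T : measurableType d) (R : realType) (mu : {measure set T -> \bar R}).
Implicit Types (f g : T -> R).

Lemma powR_measurable f (q : R) : mfun f -> mfun (fun x => f x `^ q).
Proof. by move=> mf; exact: (measurableT_comp (measurable_powR q) mf). Qed.

Lemma abs_powR_measurable f (q : R) : mfun f -> mfun (fun x => `|f x| `^ q).
Proof. by move=> mf; apply: powR_measurable; exact: measurableT_comp. Qed.

Lemma integ_powD f g (q : R) : 0 <= q -> mfun f -> mfun g ->
  integ mu (fun x => `|f x| `^ q) -> integ mu (fun x => `|g x| `^ q) ->
  integ mu (fun x => `|f x + g x| `^ q).
Proof.
move=> q0 mf mg fi gi; apply: (integ_le _ (integZ (2 `^ q) (integD fi gi))).
  by apply: abs_powR_measurable; exact: measurable_funD.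
by move=> x; rewrite ger0_norm// powR_normD.
Qed.

Lemma integ_powZ f (c q : R) : mfun f -> integ mu (fun x => `|f x| `^ q) ->
  integ mu (fun x => `|c * f x| `^ q).
Proof.
move=> mf fi; apply: (integ_eq _ (integZ (`|c| `^ q) fi)) => x.
by rewrite normrM powRM.
Qed.

Lemma integ_sqD f g : mfun f -> mfun g ->
  integ mu (fun x => f x ^+ 2) -> integ mu (fun x => g x ^+ 2) -> integ mu (fun x => (f x + g x) ^+ 2).
Proof.
move=> mf mg fi gi; apply: (integ_le _ (integD (integZ 2 fi) (integZ 2 gi))).
  by apply: measurable_funX; exact: measurable_funD.
by move=> x; rewrite ger0_norm ?sqr_ge0//; have := sqr_ge0 (f x - g x); nra.
Qed.

Lemma integ_sqZ f (c : R) : integ mu (fun x => f x ^+ 2) -> integ mu (fun x => (c * f x) ^+ 2).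
Proof. by move=> fi; apply: (integ_eq _ (integZ (c ^+ 2) fi)) => x; rewrite exprMn. Qed.

Lemma integ_sqM f g : mfun f -> mfun g ->
  integ mu (fun x => f x ^+ 2) -> integ mu (fun x => g x ^+ 2) -> integ mu (fun x => f x * g x).
Proof.
move=> mf mg fi gi; apply: (integ_le _ (integD fi gi)); first exact: measurable_funM.
move=> x; rewrite normrM -[f x ^+ 2]real_normK ?num_real// -[g x ^+ 2]real_normK ?num_real//.
nra.
Qed.

Lemma integ_conj f g (p : R) : 0 < p -> mfun f -> mfun g ->
  integ mu (fun x => `|f x| `^ (p + 1)) -> integ mu (fun x => `|g x| `^ ((p + 1) / p)) ->
  integ mu (fun x => f x * g x).
Proof.
move=> p0 mf mg fi gi; apply: (integ_le _ (integD fi gi)); first exact: measurable_funM.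
by move=> x; rewrite normrM young_conj.
Qed.

End Lp_tools.

(** * The quadratic form with frozen weight *)

Section variational.
Context (R : realType) (n : nat) (p om K l : R) (G : 'rV[R]_n -> R).
Local Notation E := 'rV[R]_n.
Local Notation mu := (lebesgue_rV R n).
Context (p1 : 1 < p) (om0 : 0 <= om) (mG : mfun G)
  (iG2 : integ mu (fun x => G x ^+ 2)) (iGp : integ mu (fun x => `|G x| `^ (p + 1)))
  (iGq : integ mu (fun x => `|G x| `^ ((p + 1) / p))).

Let p0 : 0 < p := lt_trans ltr01 p1.
Let pp0 : 0 <= p + 1 := ltW (addr_gt0 p0 ltr01).

(* ((u, c), grad f) for u = f + c G. *)
Definition charged : Type := ((E -> R) * R * ('I_n -> E -> R))%type.
Implicit Types (a b : charged) (i : 'I_n) (W : E -> R).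

Definition reg a (x : E) : R := a.1.1 x - a.1.2 * G x.

(** One real space for both cases: for omega = 0 the last condition is void and this is X_0; for
    omega > 0 it is H^1_alpha by the inclusion [H1_Lp]. *)
Definition XR a := [/\ gradL2 (reg a) a.2, integ mu (fun x => `|reg a x| `^ (p + 1)) &
  om != 0 -> integ mu (fun x => reg a x ^+ 2)].

Definition lin a t b : charged :=
  (fun x => a.1.1 x + t * b.1.1 x, a.1.2 + t * b.1.2, fun i x => a.2 i x + t * b.2 i x).

(** The weights |u|^(p-1) with u in L^(p+1); this makes W a b integrable on [XR]. *)
Definition weight W := exists u : E -> R, [/\ mfun u, forall x, 0 <= u x,
  integ mu (fun x => u x `^ (p + 1)) & forall x, W x = u x `^ (p - 1)].

(** The first variation with the factor |phi|^(p-1) frozen as W, hence bilinear and symmetric. K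
    will be alpha + beta(l) + l |G|^2, with the L^2 norm of G. *)
Definition LW W a b : R :=
  \sum_i \int[mu]_x (a.2 i x * b.2 i x) + K * a.1.2 * b.1.2
  - l * b.1.2 * \int[mu]_x (a.1.1 x * G x) - l * a.1.2 * \int[mu]_x (b.1.1 x * G x)
  + om * \int[mu]_x (a.1.1 x * b.1.1 x) + \int[mu]_x (W x * a.1.1 x * b.1.1 x).

Lemma XR_mreg a i : XR a -> mfun (reg a).
Proof. by move=> [g _ _]; have [[[m _] _ _] _] := g i. Qed.

Lemma XR_mgr a i : XR a -> mfun (a.2 i).
Proof. by move=> [g _ _]; have [[_ [m _] _] _] := g i. Qed.

Lemma XR_gr2 a i : XR a -> integ mu (fun x => a.2 i x ^+ 2).
Proof. by move=> [g _ _]; have [] := g i. Qed.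

Context (n_gt0 : (0 < n)%N).
Let i0 : 'I_n := Ordinal n_gt0.

Lemma regK a x : reg a x + a.1.2 * G x = a.1.1 x. Proof. exact: subrK. Qed.

Lemma XR_m a : XR a -> mfun a.1.1.
Proof.
move=> Xa; rewrite (_ : a.1.1 = fun x => reg a x + a.1.2 * G x); last first.
  by apply/funext => x; rewrite regK.
by apply: measurable_funD; [exact: (XR_mreg i0 Xa)|exact: measurable_funM].
Qed.

Lemma XR_Lp a : XR a -> integ mu (fun x => `|a.1.1 x| `^ (p + 1)).
Proof.
move=> Xa; have [_ ir _] := Xa.
apply: (integ_eq _ (integ_powD pp0 (XR_mreg i0 Xa) _ ir (integ_powZ a.1.2 mG iGp))).
  by move=> x; rewrite regK.
exact: measurable_funM.
Qed.

Lemma XR_L2 a : XR a -> om != 0 -> integ mu (fun x => a.1.1 x ^+ 2).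
Proof.
move=> Xa h; have [_ _ /(_ h) ir] := Xa.
apply: (integ_eq _ (integ_sqD (XR_mreg i0 Xa) _ ir (integ_sqZ a.1.2 iG2))).
  by move=> x; rewrite regK.
exact: measurable_funM.
Qed.

Lemma XR_G a : XR a -> integ mu (fun x => a.1.1 x * G x).
Proof.
move=> Xa; have [_ ir _] := Xa.
have i1 := integ_conj p0 (XR_mreg i0 Xa) mG ir iGq.
apply: (integ_eq _ (integD i1 (integZ a.1.2 iG2))) => x.
by rewrite expr2 mulrA -mulrDl regK.
Qed.

Lemma XR_om a b : XR a -> XR b -> om != 0 -> integ mu (fun x => a.1.1 x * b.1.1 x).
Proof. by move=> Xa Xb h; apply: integ_sqM; [exact: XR_m|exact: XR_m|exact: XR_L2|exact: XR_L2]. Qed.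

Lemma XR_gr a b i : XR a -> XR b -> integ mu (fun x => a.2 i x * b.2 i x).
Proof. by move=> Xa Xb; apply: integ_sqM; [exact: XR_mgr|exact: XR_mgr|exact: XR_gr2|exact: XR_gr2]. Qed.

Lemma weight_ge0 W x : weight W -> 0 <= W x.
Proof. by move=> [u [_ _ _ ->]]; exact: powR_ge0. Qed.

Lemma weight_m W : weight W -> mfun W.
Proof. by move=> [u [mu0 _ _ /funext ->]]; exact: powR_measurable. Qed.

Lemma XR_W W a b : weight W -> XR a -> XR b -> integ mu (fun x => W x * a.1.1 x * b.1.1 x).
Proof.
move=> wW Xa Xb; have [u [mu0 u0 iu Wu]] := wW.
apply: (integ_le _ (integD (integD iu (XR_Lp Xa)) (integZ 2 (XR_Lp Xb)))).
  by apply: measurable_funM; [apply: measurable_funM; [exact: weight_m|exact: XR_m]|exact: XR_m].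
by move=> x; rewrite !normrM Wu (ger0_norm (powR_ge0 _ _)) young_pow3.
Qed.

Lemma XR_lin a t b : XR a -> XR b -> XR (lin a t b).
Proof.
move=> Xa Xb; have [ga ia ia2] := Xa; have [gb ib ib2] := Xb.
have E1 x : reg (lin a t b) x = reg a x + t * reg b x by rewrite /reg /=; ring.
have ma := XR_mreg i0 Xa; have mb := XR_mreg i0 Xb.
have mtb : mfun (fun x => t * reg b x) by exact: measurable_funM.
split.
- move=> i; split.
    by apply: wder_eq (wderD (ga i).1 (wderZ t (gb i).1)) => x; rewrite ?E1.
  by apply: integ_sqD; [exact: XR_mgr|apply: measurable_funM => //; exact: XR_mgr|exact: XR_gr2|apply: integ_sqZ; exact: XR_gr2].
- by apply: (integ_eq _ (integ_powD pp0 ma mtb ia (integ_powZ t mb ib))) => x; rewrite E1.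
- by move=> h; apply: (integ_eq _ (integ_sqD ma mtb (ia2 h) (integ_sqZ t (ib2 h)))) => x; rewrite E1.
Qed.

Lemma LW_sym W a b : LW W a b = LW W b a.
Proof.
rewrite /LW.
rewrite (eq_bigr (fun i => \int[mu]_x (b.2 i x * a.2 i x))); last first.
  by move=> i _; apply: Int_ext => x; rewrite mulrC.
rewrite (Int_ext mu (fun x => a.1.1 x * b.1.1 x) (fun x => b.1.1 x * a.1.1 x)); last first.
  by move=> x; rewrite mulrC.
rewrite (Int_ext mu (fun x => W x * a.1.1 x * b.1.1 x) (fun x => W x * b.1.1 x * a.1.1 x)); last first.
  by move=> x; rewrite mulrAC.
by ring.
Qed.

Lemma LW_lin W a t b d : weight W -> XR a -> XR b -> XR d ->
  LW W (lin a t b) d = LW W a d + t * LW W b d.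
Proof.
move=> wW Xa Xb Xd; rewrite /LW /=.
have -> : \sum_i \int[mu]_x ((a.2 i x + t * b.2 i x) * d.2 i x) =
    \sum_i \int[mu]_x (a.2 i x * d.2 i x) + t * \sum_i \int[mu]_x (b.2 i x * d.2 i x).
  rewrite mulr_sumr -big_split/=; apply: eq_bigr => i _.
  rewrite (Int_ext mu _ (fun x => a.2 i x * d.2 i x + t * (b.2 i x * d.2 i x))); last first.
    by move=> x; rewrite mulrDl mulrA.
  by rewrite IntD ?IntZ//; [exact: XR_gr|exact: XR_gr|apply: integZ; exact: XR_gr].
have -> : \int[mu]_x ((a.1.1 x + t * b.1.1 x) * G x) =
    \int[mu]_x (a.1.1 x * G x) + t * \int[mu]_x (b.1.1 x * G x).
  rewrite (Int_ext mu _ (fun x => a.1.1 x * G x + t * (b.1.1 x * G x))); last first.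
    by move=> x; rewrite mulrDl mulrA.
  by rewrite IntD ?IntZ//; [exact: XR_G|exact: XR_G|apply: integZ; exact: XR_G].
have -> : om * \int[mu]_x ((a.1.1 x + t * b.1.1 x) * d.1.1 x) =
    om * \int[mu]_x (a.1.1 x * d.1.1 x) + t * (om * \int[mu]_x (b.1.1 x * d.1.1 x)).
  have [->|h] := eqVneq om 0; first by rewrite !mul0r mulr0 addr0.
  rewrite (Int_ext mu _ (fun x => a.1.1 x * d.1.1 x + t * (b.1.1 x * d.1.1 x))); last first.
    by move=> x; rewrite mulrDl mulrA.
  rewrite IntD ?IntZ//; [|exact: XR_om|exact: XR_om|apply: integZ; exact: XR_om].
  by rewrite mulrDr mulrCA.
have -> : \int[mu]_x (W x * (a.1.1 x + t * b.1.1 x) * d.1.1 x) =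
    \int[mu]_x (W x * a.1.1 x * d.1.1 x) + t * \int[mu]_x (W x * b.1.1 x * d.1.1 x).
  rewrite (Int_ext mu _ (fun x => W x * a.1.1 x * d.1.1 x + t * (W x * b.1.1 x * d.1.1 x))); last first.
    by move=> x; ring.
  by rewrite IntD ?IntZ//; [exact: XR_W|exact: XR_W|apply: integZ; exact: XR_W].
ring.
Qed.

Lemma LW_quad W a t b : weight W -> XR a -> XR b ->
  LW W (lin a t b) (lin a t b) = LW W a a + 2 * t * LW W a b + t ^+ 2 * LW W b b.
Proof.
move=> wW Xa Xb; have Xl := XR_lin t Xa Xb.
rewrite (LW_lin t wW Xa Xb Xl) (LW_sym W a) (LW_sym W b (lin a t b)) !(LW_lin t wW Xa Xb)//.
by rewrite (LW_sym W b a); ring.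
Qed.

Lemma LW_neutral W a : weight W -> XR a -> a.1.2 = 0 ->
  LW W a a = \sum_i \int[mu]_x (a.2 i x ^+ 2) + om * \int[mu]_x (a.1.1 x ^+ 2) +
    \int[mu]_x (W x * a.1.1 x ^+ 2).
Proof.
move=> wW Xa a0; rewrite /LW a0 !mulr0 !mul0r !subr0 addr0.
by congr (_ + _ * _ + _); apply: Int_ext => x; rewrite -mulrA -expr2.
Qed.

(** Without charge the form is a sum of nonnegative integrals, and the weighted one is singled out
    because its vanishing determines a function. *)
Lemma LW_neutral_ge W a : weight W -> XR a -> a.1.2 = 0 ->
  0 <= \int[mu]_x (W x * a.1.1 x ^+ 2) <= LW W a a.
Proof.
move=> wW Xa a0; rewrite LW_neutral//; apply/andP; split.
  by apply: Int_ge0 => x; rewrite mulr_ge0 ?weight_ge0// sqr_ge0.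
rewrite lerDr addr_ge0//.
  by apply: sumr_ge0 => i _; apply: Int_ge0 => x; exact: sqr_ge0.
by rewrite mulr_ge0//; apply: Int_ge0 => x; exact: sqr_ge0.
Qed.

(* A multiple of a critical point with nonzero charge can be added without changing the form. *)
Lemma LW_ge0 W a b : weight W -> XR a -> XR b -> b.1.2 != 0 -> (forall d, XR d -> LW W b d = 0) ->
  0 <= LW W a a.
Proof.
move=> wW Xa Xb b0 Hb.
pose t := - a.1.2 / b.1.2.
have Xl := XR_lin t Xa Xb.
have l0 : (lin a t b).1.2 = 0 by rewrite /lin/= /t divfK// subrr.
have /andP[h1 h2] := LW_neutral_ge wW Xl l0; have := le_trans h1 h2.
by rewrite LW_quad// (LW_sym W a b) !Hb// !mulr0 !addr0.
Qed.

Lemma LW_diff W W' a : weight W -> weight W' -> XR a ->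
  LW W a a - LW W' a a = \int[mu]_x ((W x - W' x) * a.1.1 x ^+ 2).
Proof.
move=> wW wW' Xa; rewrite /LW.
rewrite (Int_ext mu (fun x => (W x - W' x) * a.1.1 x ^+ 2)
  (fun x => W x * a.1.1 x * a.1.1 x - W' x * a.1.1 x * a.1.1 x)); last by move=> x; ring.
by rewrite IntB; [ring|exact: XR_W|exact: XR_W].
Qed.

Lemma LW_ae W W' a b : weight W -> weight W' -> XR a -> XR b -> (\forall x \ae mu, W x = W' x) ->
  LW W a b = LW W' a b.
Proof.
move=> wW wW' Xa Xb h; rewrite /LW; congr (_ + _); apply: Int_ae.
- exact: integ_measurable (XR_W wW Xa Xb).
- exact: integ_measurable (XR_W wW' Xa Xb).
- by apply: filterS h => x ->.
Qed.

Lemma modulus_Lp (u1 u2 : charged) : XR u1 -> XR u2 ->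
  mfun (fun x => Num.sqrt (u1.1.1 x ^+ 2 + u2.1.1 x ^+ 2)) /\
  integ mu (fun x => Num.sqrt (u1.1.1 x ^+ 2 + u2.1.1 x ^+ 2) `^ (p + 1)).
Proof.
move=> X1 X2.
pose r x := Num.sqrt (u1.1.1 x ^+ 2 + u2.1.1 x ^+ 2).
have r2 x : r x ^+ 2 = u1.1.1 x ^+ 2 + u2.1.1 x ^+ 2 by rewrite sqr_sqrtr// addr_ge0 ?sqr_ge0.
have mr : mfun r.
  apply: (measurableT_comp (continuous_measurable_fun (@sqrt_continuous R))).
  by apply: measurable_funD; apply: measurable_funX; exact: XR_m.
split=> //.
apply: (integ_le _ (integZ (2 `^ (p + 1)) (integD (XR_Lp X1) (XR_Lp X2)))); first exact: powR_measurable.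
move=> x; rewrite ger0_norm//.
apply: (@le_trans _ _ (`| `|u1.1.1 x| + `|u2.1.1 x| | `^ (p + 1))); last first.
  by apply: (le_trans (powR_normD _ _ pp0)); rewrite !normr_id.
apply: ge0_ler_powR => //; rewrite ?nnegrE// ger0_norm//.
rewrite -ler_sqr ?nnegrE// r2 sqrrD !real_normK ?num_real// -addrA lerD2l addrC lerDl.
pos.
Qed.

Lemma modulus_weight (u1 u2 : charged) (W : E -> R) :
  (forall x, W x = Num.sqrt (u1.1.1 x ^+ 2 + u2.1.1 x ^+ 2) `^ (p - 1)) ->
  XR u1 -> XR u2 -> weight W.
Proof.
move=> WE X1 X2; have [mr ir] := modulus_Lp X1 X2.
by eexists; split; [exact: mr|move=> x; exact: sqrtr_ge0|exact: ir|exact: WE].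
Qed.

(** u1 and u2 are the real and imaginary parts of a critical point u. Both satisfy the linear
    equation with weight W = |u|^(p-1), which is how the nonlinear problem enters. *)
Lemma critical_unique (phi u1 u2 : charged) (W Wp : E -> R) :
  (forall x, Wp x = phi.1.1 x `^ (p - 1)) ->
  (forall x, W x = Num.sqrt (u1.1.1 x ^+ 2 + u2.1.1 x ^+ 2) `^ (p - 1)) ->
  XR phi -> XR u1 -> XR u2 -> phi.1.2 != 0 -> (\forall x \ae mu, 0 < phi.1.1 x) ->
  (forall x, 0 <= phi.1.1 x) ->
  (forall b, XR b -> LW Wp phi b = 0) -> (forall b, XR b -> LW W u1 b = 0) ->
  (forall b, XR b -> LW W u2 b = 0) ->
  ~ (\forall x \ae mu, u1.1.1 x = 0 /\ u2.1.1 x = 0) ->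
  exists t1 t2 : R, t1 ^+ 2 + t2 ^+ 2 = 1 /\
    \forall x \ae mu, u1.1.1 x = t1 * phi.1.1 x /\ u2.1.1 x = t2 * phi.1.1 x.
Proof.
move=> WpE WE Xp X1 X2 c0 phi_pos phi_ge0 Hp H1 H2 nz.
pose r x := Num.sqrt (u1.1.1 x ^+ 2 + u2.1.1 x ^+ 2).
have r0 x : 0 <= r x by exact: sqrtr_ge0.
have r2 x : r x ^+ 2 = u1.1.1 x ^+ 2 + u2.1.1 x ^+ 2 by rewrite sqr_sqrtr// addr_ge0 ?sqr_ge0.
have [mr irp] : mfun r /\ integ mu (fun x => r x `^ (p + 1)) :=
  modulus_Lp X1 X2.
have wW : weight W := modulus_weight WE X1 X2.
have wWp : weight Wp.
  exists phi.1.1; split=> //; first exact: XR_m.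
  by apply: (integ_eq _ (XR_Lp Xp)) => x; rewrite ger0_norm.
have Wr2 x : W x * r x ^+ 2 = r x `^ (p + 1).
  rewrite WE -/(r x) expr2 mulrA powRS ?subr_gt0// subrK powRS//.
have sW a : XR a -> integ mu (fun x => W x * a.1.1 x ^+ 2).
  by move=> Xa; apply: (integ_eq _ (XR_W wW Xa Xa)) => x; rewrite -mulrA -expr2.
have sWp a : XR a -> integ mu (fun x => Wp x * a.1.1 x ^+ 2).
  by move=> Xa; apply: (integ_eq _ (XR_W wWp Xa Xa)) => x; rewrite -mulrA -expr2.
(* Without charge, adding LW(u1, u1) = 0 and LW(u2, u2) = 0 would force int |u|^(p+1) = 0. *)
have charged_u : u1.1.2 != 0 \/ u2.1.2 != 0.
  have [c1|c1] := eqVneq u1.1.2 0; last by left.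
  have [c2|c2] := eqVneq u2.1.2 0; last by right.
  exfalso; apply: nz.
  have := LW_neutral_ge wW X1 c1; have := LW_neutral_ge wW X2 c2.
  rewrite H1// H2// -!eq_le => /eqP e2 /eqP e1.
  have : \int[mu]_x (r x `^ (p + 1)) = 0.
    rewrite (Int_ext mu _ (fun x => W x * u1.1.1 x ^+ 2 + W x * u2.1.1 x ^+ 2)); last first.
      by move=> x; rewrite -Wr2 r2 mulrDr.
    by rewrite IntD; [rewrite -e1 -e2 addr0|exact: sW|exact: sW].
  move/(Int_eq0 irp) => /(_ (fun x => powR_ge0 _ _)); apply: filterS => x /eqP.
  rewrite powR_eq0 => /andP[/eqP rx _]; have := r2 x; rewrite rx expr0n/= => /esym/eqP.
  by rewrite paddr_eq0 ?sqr_ge0// !sqrf_eq0 => /andP[/eqP -> /eqP ->].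
have Lphi a : XR a -> 0 <= LW Wp a a by move=> Xa; exact: (LW_ge0 wWp Xa Xp c0 Hp).
have Lu : 0 <= LW W phi phi.
  by case: charged_u => h; [exact: (LW_ge0 wW Xp X1 h H1)|exact: (LW_ge0 wW Xp X2 h H2)].
have isW1 : integ mu (fun x => (Wp x - W x) * u1.1.1 x ^+ 2).
  by apply: (integ_eq _ (integB (sWp _ X1) (sW _ X1))) => x; rewrite mulrBl.
have isW2 : integ mu (fun x => (Wp x - W x) * u2.1.1 x ^+ 2).
  by apply: (integ_eq _ (integB (sWp _ X2) (sW _ X2))) => x; rewrite mulrBl.
have isWp : integ mu (fun x => (W x - Wp x) * phi.1.1 x ^+ 2).
  by apply: (integ_eq _ (integB (sW _ Xp) (sWp _ Xp))) => x; rewrite mulrBl.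
(* The three nonnegative forms minus the three that vanish by criticality: only the difference of
   the weights remains. *)
have sum_ge0 : 0 <= \int[mu]_x ((Wp x - W x) * u1.1.1 x ^+ 2 + (Wp x - W x) * u2.1.1 x ^+ 2 +
    (W x - Wp x) * phi.1.1 x ^+ 2).
  rewrite IntD; [|exact: integD|exact: isWp]; rewrite IntD; [|exact: isW1|exact: isW2].
  rewrite -(LW_diff wWp wW X1) -(LW_diff wWp wW X2) -(LW_diff wW wWp Xp).
  rewrite (H1 _ X1) (H2 _ X2) (Hp _ Xp) !subr0.
  pos.
pose F x := (W x - Wp x) * (r x ^+ 2 - phi.1.1 x ^+ 2).
have iF : integ mu F.
  apply: (integ_eq _ (integN (integD (integD isW1 isW2) isWp))) => x.
  by rewrite /F r2; ring.
have p10 : 0 < p - 1 by rewrite subr_gt0.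
(* t^(p-1) and t^2 are increasing in t >= 0, so the two factors have the same sign. *)
have F0 x : 0 <= F x.
  rewrite /F WE WpE -/(r x).
  have [h|h] := leP (phi.1.1 x) (r x).
    apply: mulr_ge0; rewrite subr_ge0; first by apply: ge0_ler_powR; rewrite ?nnegrE// ltW.
    by rewrite ler_sqr ?nnegrE.
  rewrite mulr_le0// subr_le0; first by apply: ge0_ler_powR; rewrite ?nnegrE// ltW.
  by rewrite ler_sqr ?nnegrE// ltW.
have IF : \int[mu]_x F x = 0.
  apply/eqP; rewrite eq_le Int_ge0// andbT -oppr_ge0 -IntN//.
  by rewrite (le_trans sum_ge0)// le_eqVlt; apply/orP; left; apply/eqP/Int_ext => x; rewrite /F r2; ring.
have rphi : \forall x \ae mu, r x = phi.1.1 x.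
  have := Int_eq0 iF F0 IF; apply: filterS => x /eqP.
  rewrite /F mulf_eq0 => /orP[|]; rewrite subr_eq0.
    rewrite WE WpE -/(r x) => /eqP e; have := congr1 (fun z => z `^ (p - 1)^-1) e.
    by rewrite -!powRrM mulfV ?gt_eqF// !powRr1.
  by rewrite eqrXn2// => /eqP.
have WWp : \forall x \ae mu, W x = Wp x.
  by apply: filterS rphi => x rx; rewrite WE WpE -/(r x) rx.
have key (u : charged) : XR u -> (forall b, XR b -> LW W u b = 0) ->
    \forall x \ae mu, u.1.1 x = u.1.2 / phi.1.2 * phi.1.1 x.
  move=> Xu Hu; pose t := - u.1.2 / phi.1.2.
  have Xl := XR_lin t Xu Xp.
  have l0 : (lin u t phi).1.2 = 0 by rewrite /lin/= /t divfK// subrr.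
  have := LW_neutral_ge wWp Xl l0.
  have -> : LW Wp (lin u t phi) (lin u t phi) = 0.
    rewrite LW_lin// (Hp _ Xl) mulr0 addr0 -(LW_ae wW wWp Xu Xl WWp).
    exact: Hu.
  rewrite -eq_le => /eqP/esym/(Int_eq0 (sWp _ Xl)) => /(_ (fun x => mulr_ge0 (weight_ge0 x wWp) (sqr_ge0 _))).
  apply: filterS2 phi_pos => x px /eqP; rewrite mulf_eq0 WpE gt_eqF ?powR_gt0//= sqrf_eq0.
  by rewrite /lin/= addr_eq0 => /eqP ->; rewrite /t !mulNr opprK.
have k1 := key _ X1 H1; have k2 := key _ X2 H2.
exists (u1.1.2 / phi.1.2), (u2.1.2 / phi.1.2); split; last by apply: filterS2 k1 k2 => x e1 e2; split.
(* |u|^2 = (t1^2 + t2^2) phi^2 and |u| = phi > 0 almost everywhere. If t1^2 + t2^2 were not 1,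
   almost every point would be contradictory and u null. *)
apply/eqP; apply: contrapT => /negP ne; apply: nz.
apply: filterS3 k1 k2 (filterI phi_pos rphi) => x e1 e2 [px rx]; exfalso.
have := r2 x; rewrite rx e1 e2; move: (u1.1.2 / phi.1.2) (u2.1.2 / phi.1.2) ne => t1 t2 ne.
rewrite !exprMn -mulrDl => /eqP.
rewrite -{1}[phi.1.1 x ^+ 2]mul1r -subr_eq0 -mulrBl mulf_eq0 subr_eq0 eq_sym (negbTE ne) sqrf_eq0.
by rewrite gt_eqF.
Qed.

End variational.

Lemma domooD (R : realType) (f g : R -> R) : domoo f -> domoo g -> domoo (fun r => f r + g r).
Proof.
move=> [f1 [F1 [C [cf dF fF] FC]]] [g1 [G1 [D [cg dG gG] GD]]].
exists (fun r => f1 r + g1 r), (fun r => F1 r + G1 r), (C + D); last first.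
  by move=> r r1; have := FC r r1; have := GD r r1; lra.
split.
- by move=> r r0; apply: cvgD; [exact: cf|exact: cg].
- by move=> r r0; apply: ddD; [exact: dF|exact: dG].
- by move=> r r1; apply: (le_trans (ler_normD _ _)); apply: lerD; [exact: fF|exact: gG].
Qed.

Section green_integrability.
Context (R : realType) (n : nat) (p th C0 b l : R) (V I : R -> R).
Context (n23 : (n == 2%N) || (n == 3%N)) (p1 : 1 < p) (gexp : good_exp n p th C0).
Context (l0 : 0 < l) (pV : profile n (sing n) b (fun x => l * x) V I).
Local Notation mu := (lebesgue_rV R n).
Local Notation G := (Grad V : 'rV[R]_n -> R).

Lemma Grad_Lp : integ mu (fun x => `|G x| `^ (p + 1)).
Proof.
have [_ hp1 _ _ _] := gexp.
apply: (integ_eq _ (Grad_integ n23 gexp l0 pV (q := p + 1) _ hp1)) => [x|].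
  by rewrite ger0_norm// (Grad_ge0 n23 pV).
by rewrite lerDr ltW// (lt_trans ltr01).
Qed.

Lemma Grad_conj : integ mu (fun x => `|G x| `^ ((p + 1) / p)).
Proof.
have p0 := lt_trans ltr01 p1.
have [/andP[th0 _] hp1 _ _ _] := gexp.
apply: (integ_eq _ (Grad_integ n23 gexp l0 pV (q := (p + 1) / p) _ _)) => [x||].
- by rewrite ger0_norm// (Grad_ge0 n23 pV).
- by rewrite ler_pdivlMr// mul1r lerDl.
- rewrite mulrA ltr_pdivrMr// (lt_le_trans hp1)// ler_peMr// ltW//.
Qed.

Lemma Grad_L2 : integ mu (fun x => G x ^+ 2).
Proof.
have [_ _ _ h2 _] := gexp.
apply: (integ_eq _ (Grad_integ n23 gexp l0 pV (q := 2) _ _)) => [x||].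
- by rewrite powR_mulrn// (Grad_ge0 n23 pV).
- lra.
- lra.
Qed.

End green_integrability.

(** * The ground state is critical *)

Section ground_state.
Context (R : realType) (n : nat) (p th C0 om M a0 l b AB : R) (v J V I : R -> R).
Context (n23 : (n == 2%N) || (n == 3%N)) (p1 : 1 < p) (gexp : good_exp n p th C0).
Context (om0 : 0 <= om) (M0 : 0 < M) (l0 : 0 < l).
Context (pv : profile n (sing n) a0 (fun x => om * x + M * x `^ p) v J).
Context (pV : profile n (sing n) b (fun x => l * x) V I).
Context (a0b : a0 - b = sigma R n * AB).
Local Notation E := 'rV[R]_n.
Local Notation mu := (lebesgue_rV R n).
Local Notation G := (Grad V : E -> R).
Local Notation g := (fun x : R => om * x + M * x `^ p).

Let n0 : (0 < n)%N := n23_gt0 n23.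
Let s0 : 0 < sigma R n := sigma_gt0 R n23.
Let si : 0 <= (sigma R n)^-1. Proof. pos. Qed.
Let p1' : 1 <= p := ltW p1.
Let p0 : 0 < p := lt_trans ltr01 p1.
Let gg : gok p g := gok_pow p om0 (ltW M0).
Let kk : gok p (fun x => l * x) := gok_lin p (ltW l0).
Let v0 : forall r, 0 < r -> 0 < v r := prof_v0 pv.
Let V0 : forall r, 0 < r -> 0 < V r := prof_v0 pV.

(** kap^(p-1) = M, so kap v solves the equation with coefficient 1 in front of the power. *)
Definition kap : R := M `^ (p - 1)^-1.

Lemma kap_gt0 : 0 < kap. Proof. exact: powR_gt0. Qed.

Lemma kapE : kap `^ (p - 1) = M.
Proof. by rewrite /kap -powRrM mulVf ?gt_eqF ?subr_gt0// powRr1// ltW. Qed.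

Definition phir : E -> R := rad (fun r => kap * v r).
Let F' (r : R) := kap * ((J r - I r) / wt n r).
Definition hphi (i : 'I_n) (x : E) : R := x ord0 i * rad (fun r => F' r / r) x.
(** The charge is kap sigma because v has the singular part S while G has S/sigma; the regular part
    is then kap (v - V). *)
Definition phi3 : charged R n := (phir, kap * sigma R n, hphi).

Lemma phir_ge0 x : 0 <= phir x.
Proof.
rewrite /phir /rad IposE; case: ltP => e0; rewrite ?mulr0// mulr1 mulr_ge0//; first exact: ltW kap_gt0.
exact: ltW (v0 e0).
Qed.

Lemma phir_gt0 (x : E) : x != 0 -> 0 < phir x.
Proof.
by move=> x0; rewrite /phir radE// mulr_gt0 ?kap_gt0// v0// enorm_gt0.
Qed.

Let v1 := v0 (@ltr01 R).
Let V1 := V0 (@ltr01 R).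

Lemma rad_int (H : R -> R) : isC1 H -> (forall r, 0 < r -> 0 <= H r) ->
  halfint (fun r => H r * r ^+ n.-1) ->
  integ mu (rad H) /\ \int[mu]_x rad H x = sigma R n * \int[leb]_r (H r * r ^+ n.-1 * Ipos r).
Proof. by move=> [H' CH] H0 hH; exact: (radial_ge0 n0 CH H0).1. Qed.

Lemma prof_pow q : 0 <= q -> exists2 C, 0 <= C &
  forall r, 0 < r <= 1 -> v r `^ q <= C * r `^ (- (th * q)).
Proof.
move=> q0; have [C C_0 hC] := prof_v gexp pv.
exists (C `^ q); first exact: powR_ge0.
move=> r rr; have /andP[r0 _] := rr.
rewrite -mulNr powRrM -powRM ?powR_ge0//.
by apply: ge0_ler_powR; rewrite ?nnegrE ?mulr_ge0 ?powR_ge0 ?(ltW (v0 r0))// hC.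
Qed.

Lemma C1v : isC1 v. Proof. exact: (prof_C1v pv). Qed.
Lemma C1V : isC1 V. Proof. exact: (prof_C1v pV). Qed.

Lemma vpow_half q k : 0 <= q -> th * q < n%:R -> 0 <= k ->
  (forall x, 0 < x <= v 1 -> x `^ q <= k * g x) -> halfint (fun r => v r `^ q * r ^+ n.-1).
Proof.
move=> q0 hq k0 hk; have [C C_0 hC] := prof_pow q0.
apply: (prof_half n23 gg pv (s := th * q) (C := C) (D := k)) => //.
- by apply: isC1_cpos; exact: (isC1_comp_powR q C1v v0).
- by move=> r rr; rewrite ger0_norm ?powR_ge0// hC.
- move=> r r1; have r0 := lt_le_trans ltr01 r1.
  by rewrite ger0_norm ?powR_ge0// hk// v0//= (prof_le pv ltr01 r1).
Qed.

Lemma vp1_half : halfint (fun r => v r `^ (p + 1) * r ^+ n.-1).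
Proof.
have [_ hp1 _ _ _] := gexp.
apply: (vpow_half (k := v 1 / M)) => //; [pos|pos|] => x /andP[x0 x1].
rewrite -(powRS (ltW x0) p0) mulrAC ler_pdivlMr// mulrDr -[leLHS]add0r lerD//; first pos.
rewrite [leLHS](_ : _ = x * (M * x `^ p)); last by ring.
by rewrite ler_wpM2r//; pos.
Qed.

(** At infinity v^2 <= v(1) v, and v is controlled by the term om v of the source, whence om !=
    0. *)
Lemma v2_half : om != 0 -> halfint (fun r => v r ^+ 2 * r ^+ n.-1).
Proof.
move=> omn; have om1 : 0 < om by rewrite lt_neqAle eq_sym omn.
have [_ _ _ h2 _] := gexp.
have h : halfint (fun r => v r `^ 2 * r ^+ n.-1).
  apply: (vpow_half (k := v 1 / om)) => //; [by rewrite mulrC|pos|] => x /andP[x0 x1].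
  rewrite powR_mulrn ?(ltW x0)// mulrAC ler_pdivlMr// mulrDr -[leLHS]addr0 lerD//; last pos.
  rewrite [leLHS](_ : _ = x * (om * x)); last by ring.
  by rewrite ler_wpM2r//; pos.
apply: integ_eq h => r; rewrite IposE; case: ltP => r0; rewrite ?mulr0// powR_mulrn//.
exact: ltW (v0 r0).
Qed.

Lemma vV_half q : 1 <= q -> th * (q + 1) < n%:R -> halfint (fun r => v r `^ q * V r * r ^+ n.-1).
Proof.
move=> q1 hq; have q0 := le_trans ler01 q1.
have [C C_0 hC] := prof_pow q0; have [D D0 hD] := prof_v gexp pV.
apply: (prof_half n23 kk pV (s := th * (q + 1)) (C := C * D) (D := v 1 `^ q / l)) => //.
- by apply: isC1_cpos; apply: isC1M; [exact: (isC1_comp_powR q C1v v0)|exact: C1V].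
- exact: mulr_ge0.
- pos.
- move=> r rr; have /andP[r0 _] := rr.
  rewrite ger0_norm ?mulr_ge0 ?powR_ge0 ?(ltW (V0 r0))//.
  rewrite mulrDr mulr1 opprD powR_add//.
  by rewrite mulrACA ler_pM; pos.
- move=> r r1; have r0 := lt_le_trans ltr01 r1; have Vr := V0 r0.
  rewrite ger0_norm ?mulr_ge0 ?powR_ge0 ?(ltW Vr)// mulrA divfK ?gt_eqF//.
  rewrite ler_wpM2r ?(ltW Vr)//; apply: ge0_ler_powR; rewrite ?nnegrE ?(ltW v1) ?(ltW (v0 r0))//.
  exact: (prof_le pv ltr01 r1).
Qed.

Lemma phir_m : mfun phir.
Proof. by apply: rad_measurable; apply: isC1_cpos; exact: isC1M (isC1_cst _) C1v. Qed.

Lemma rad_pow (H : R -> R) q (x : E) : q != 0 -> rad H x `^ q = rad (fun r => H r `^ q) x.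
Proof. by move=> q0; rewrite /rad IposE; case: ltP => _; rewrite ?mulr1// !mulr0 powR0. Qed.

Lemma phir_Lp : integ mu (fun x => phir x `^ (p + 1)).
Proof.
have pp : 0 < p + 1 by pos.
have kv r : 0 < r -> 0 < kap * v r by move=> r0; rewrite mulr_gt0 ?kap_gt0// v0.
have H0 r : 0 < r -> 0 <= (kap * v r) `^ (p + 1) by pos.
have [|i1 _] := rad_int (isC1_comp_powR (p + 1) (isC1M (isC1_cst kap) C1v) kv) H0.
  apply: integ_eq (integZ (kap `^ (p + 1)) vp1_half) => r.
  rewrite mulrA; case: (ltP 0 r) => r0; last by rewrite IposE ltNge r0/= !mulr0.
  by rewrite powRM ?(ltW kap_gt0) ?(ltW (v0 r0))// !mulrA.
by apply: integ_eq i1 => x; rewrite /phir rad_pow// gt_eqF.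
Qed.

Lemma phir_L2 : om != 0 -> integ mu (fun x => phir x ^+ 2).
Proof.
move=> omn; have H0 r : 0 < r -> 0 <= (kap * v r) ^+ 2 by rewrite sqr_ge0.
have [||i1 _] := rad_int (H := fun r => (kap * v r) ^+ 2) _ H0.
- by apply: isC1_eq (isC1M (isC1M (isC1_cst kap) C1v) (isC1M (isC1_cst kap) C1v)) => r _; rewrite expr2.
- by apply: integ_eq (integZ (kap ^+ 2) (v2_half omn)) => r; rewrite exprMn !mulrA.
by apply: integ_eq i1 => x; rewrite /phir /rad IposE; case: ltP => _; rewrite ?mulr1// !mulr0 expr0n.
Qed.

Lemma phirG q : 1 <= q -> th * (q + 1) < n%:R ->
  integ mu (fun x => phir x `^ q * G x) /\
  \int[mu]_x (phir x `^ q * G x) = kap `^ q * \int[leb]_r (v r `^ q * V r * r ^+ n.-1 * Ipos r).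
Proof.
move=> q1 hq; have q0 : 0 < q := lt_le_trans ltr01 q1.
have kv r : 0 < r -> 0 < kap * v r by move=> r0; rewrite mulr_gt0 ?kap_gt0// v0.
pose H r := (kap * v r) `^ q * (V r / sigma R n).
have H0 r : 0 < r -> 0 <= H r.
  by move=> r0; apply: mulr_ge0; [exact: powR_ge0|exact: mulr_ge0 (ltW (V0 r0)) si].
have C1H : isC1 H.
  apply: isC1M; first exact: (isC1_comp_powR q (isC1M (isC1_cst kap) C1v) kv).
  by apply: isC1M; [exact: C1V|exact: isC1_cst].
have HE r : H r * r ^+ n.-1 * Ipos r = kap `^ q / sigma R n * (v r `^ q * V r * r ^+ n.-1 * Ipos r).
  case: (ltP 0 r) => r0; last by rewrite IposE ltNge r0/= !mulr0.
  by rewrite /H powRM ?(ltW kap_gt0) ?(ltW (v0 r0))//; field; rewrite gt_eqF.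
have hv := vV_half q1 hq.
have [|i1 e1] := rad_int C1H H0.
  by apply: integ_eq (integZ _ hv) => r; exact: HE.
have E1 x : phir x `^ q * G x = rad H x.
  rewrite /phir /Grad rad_pow ?gt_eqF// /rad /H IposE; case: ltP => _; last by rewrite !mulr0.
  by rewrite !mulr1.
split; first by apply: integ_eq i1 => x; rewrite E1.
rewrite (Int_ext mu _ (rad H))// e1 (Int_ext leb _ _ HE) IntZ//.
by rewrite mulrA mulrCA divff ?mulr1// gt_eqF.
Qed.

Lemma phirG1 : integ mu (fun x => phir x * G x) /\
  \int[mu]_x (phir x * G x) = kap * \int[leb]_r (v r * V r * r ^+ n.-1 * Ipos r).
Proof.
have [_ _ _ h2 _] := gexp.
have [|i1 e1] := @phirG 1 (lexx 1); first by rewrite mulrC; move: h2; rewrite mulrC; lra.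
have E1 x : phir x * G x = phir x `^ 1 * G x by rewrite powRr1 ?phir_ge0.
split; first by apply: integ_eq i1 => x.
rewrite (Int_ext mu _ _ E1) e1 powRr1 ?(ltW kap_gt0)//; congr (_ * _).
apply: (Int_ext leb) => r.
case: (ltP 0 r) => r0; last by rewrite IposE ltNge r0/= !mulr0.
by rewrite powRr1// ltW// v0.
Qed.

(** The Wronskian of v and V multiplied by kap. It is the boundary condition (alpha + beta) c = f(0)
    in integrated form. *)
Lemma charge_identity : (l - om) * \int[mu]_x (phir x * G x) - \int[mu]_x (phir x `^ p * G x) =
  AB * (kap * sigma R n).
Proof.
have [_ hp1 _ h2 _] := gexp.
have [_ ->] := phirG1; have [_ ->] := phirG p1' hp1.
have h1 : halfint (fun r => v r * V r * r ^+ n.-1).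
  have := @vV_half 1 (lexx 1) _; rewrite -[1 + 1]/2 mulrC => /(_ h2).
  apply: integ_eq => r; case: (ltP 0 r) => r0; last by rewrite IposE ltNge r0/= !mulr0.
  by rewrite powRr1// ltW// v0.
have hp := vV_half p1' hp1.
have kp : kap `^ p = M * kap by rewrite (powR_sub1 p kap_gt0) kapE.
have E1 r : (v r * (wt n r * (l * V r)) - V r * (wt n r * g (v r))) * Ipos r =
    (l - om) * (v r * V r * r ^+ n.-1 * Ipos r) - M * (v r `^ p * V r * r ^+ n.-1 * Ipos r).
  by rewrite /wt; ring.
have hw : halfint (fun r => v r * (wt n r * (l * V r)) - V r * (wt n r * g (v r))).
  by apply: integ_eq (integB (integZ (l - om) h1) (integZ M hp)) => r; exact: E1.
have := wronskian n23 p1' gexp gg kk pv pV hw.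
rewrite (Int_ext leb _ _ E1) IntB; [|exact: integZ|exact: integZ].
rewrite IntZ// IntZ// a0b kp => e.
by rewrite [AB * _]mulrCA [AB * _]mulrC -e; ring.
Qed.

Let Gp := Grad_Lp n23 p1 gexp l0 pV.
Let Gq := Grad_conj n23 p1 gexp l0 pV.
Let G2 := Grad_L2 n23 gexp l0 pV.
Let mG : mfun G := Grad_measurable pV.

Lemma JI_bound : exists2 C, 0 <= C & forall r, 0 < r <= 1 -> `|J r - I r| <= C * r `^ (n%:R - th * p).
Proof.
have [C1 C10 h1] := prof_J n23 p1' gexp gg pv; have [C2 C20 h2] := prof_J n23 p1' gexp kk pV.
exists (C1 + C2); first exact: addr_ge0.
move=> r rr; have /andP[r0 _] := rr.
have /andP[J0 _] := prof_J01 pv r0; have /andP[I0' _] := prof_J01 pV r0.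
rewrite mulrDl (le_trans (ler_normB _ _))// !ger0_norm// lerD ?h1 ?h2//.
Qed.

Lemma JI_le1 r : 0 < r -> `|J r - I r| <= 1.
Proof.
move=> r0; have /andP[J0 J1] := prof_J01 pv r0; have /andP[I0' I1] := prof_J01 pV r0.
by rewrite ler_norml; apply/andP; split; lra.
Qed.

Lemma C1F' : isC1 F'.
Proof.
apply: isC1M; first exact: isC1_cst.
apply: isC1M; first by apply: isC1B; [exact: (prof_C1J gg pv)|exact: (prof_C1J kk pV)].
by apply: isC1V; [exact: isC1_exp|move=> r r0; rewrite exprn_gt0].
Qed.

(** Near 0 the square of J - I compensates 1/r^(n-1). At infinity (J - I)^2 <= (1 - J) + (1 - I),
    and these two terms divided by r^(n-1) are -v' and -V'. *)
Lemma F'_half : halfint (fun r => F' r ^+ 2 * r ^+ n.-1).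
Proof.
have [/andP[th0 th1] hp1 hp2 _ _] := gexp; have [C C_0 hC] := JI_bound.
have n3 : (n%:R : R) <= 3 by case/orP: n23 => /eqP ->; rewrite ler_nat.
have cF2 : cpos (fun r => F' r ^+ 2).
  by apply: isC1_cpos; apply: isC1_eq (isC1M C1F' C1F') => r _; rewrite expr2.
have E1 r : 0 < r -> F' r ^+ 2 * r ^+ n.-1 = kap ^+ 2 * ((J r - I r) ^+ 2 / wt n r).
  by move=> r0; rewrite /F' /wt; field; rewrite gt_eqF// exprn_gt0.
apply: half_dom.
- by move=> r r0; apply: cvgM; [exact: cF2|exact: exprn_continuous].
- have a1 : -1 < 2 * (n%:R - th * p) - (n%:R - 1) by lra.
  apply: (dom0_le (C := kap ^+ 2 * C ^+ 2) _ (dom0_powR a1)); first by rewrite mulr_ge0 ?sqr_ge0.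
  move=> r rr; have /andP[r0 r1] := rr; rewrite E1// ger0_norm; last first.
    by rewrite mulr_ge0 ?sqr_ge0// divr_ge0 ?sqr_ge0// exprn_ge0// ltW.
  rewrite [X in _ <= _ * X](ger0_norm (powR_ge0 _ _)) -[leRHS]mulrA ler_wpM2l ?sqr_ge0//.
  rewrite powR_add//.
  rewrite powRN -(wt_powR n0 r0) mulrA ler_wpM2r ?invr_ge0 ?exprn_ge0 ?(ltW r0)//.
  rewrite [2 * _]mulrC powRrM powR_mulrn ?powR_ge0// -exprMn -real_normK ?num_real//.
  by rewrite ler_sqr ?nnegrE ?mulr_ge0 ?powR_ge0 ?hC.
- apply: (domoo_le (C := kap ^+ 2) _ (domooD (prof_domoov pv) (prof_domoov pV))); first exact: sqr_ge0.
  move=> r r1; have r0 := lt_le_trans ltr01 r1; rewrite E1// ger0_norm; last first.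
    by rewrite mulr_ge0 ?sqr_ge0// divr_ge0 ?sqr_ge0// exprn_ge0// ltW.
  rewrite ler_wpM2l ?sqr_ge0// -mulrDl (le_trans _ (ler_norm _))// ler_wpM2r ?invr_ge0 ?exprn_ge0 ?(ltW r0)//.
  have /andP[J0 J1] := prof_J01 pv r0; have /andP[I0' I1] := prof_J01 pV r0.
  by nra.
Qed.

Lemma hphi_L2 i : integ mu (fun x => hphi i x ^+ 2).
Proof.
have C1F2 : isC1 (fun r => F' r ^+ 2) by apply: isC1_eq (isC1M C1F' C1F') => r _; rewrite expr2.
have [i1 _] := rad_int C1F2 (fun r _ => sqr_ge0 _) F'_half.
apply: (integ_le _ i1).
  apply: measurable_funX; apply: measurable_funM; first exact: coord_measurable.
  apply: rad_measurable => r r0; apply: cvgM; first exact: (isC1_cpos C1F').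
  by apply: cvgV; [rewrite gt_eqF|exact: cvg_id].
move=> x; rewrite ger0_norm ?sqr_ge0// /hphi.
have [->|x0] := eqVneq x 0; first by rewrite !rad0 mulr0 expr0n.
have e0 := enorm_pos x0.
rewrite !radE// mulrCA exprMn ler_piMr ?sqr_ge0// -real_normK ?num_real//.
rewrite normrM normfV (gtr0_norm e0) exprn_ile1 ?divr_ge0 ?(ltW e0)//.
by rewrite ler_pdivrMr// mul1r enorm_coord.
Qed.

Lemma phi3_regE x : reg G phi3 x = rad (fun r => kap * (v r - V r)) x.
Proof.
rewrite /reg /phi3/= /phir /Grad /rad; field.
pos.
Qed.

Lemma phi3_wder i : wder i (reg G phi3) (hphi i).
Proof.
have [/andP[th0 th1] _ hp2 _ _] := gexp.
have [C1 C10 h1] := prof_v gexp pv; have [C2 C20 h2] := prof_v gexp pV.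
have CF : C1pos (fun r => kap * (v r - V r)) F'.
  split; last exact: isC1_cpos C1F'.
  move=> r r0; apply: dd_eq (ddZ kap (ddB (prof_dv pv r0) (prof_dv pV r0))) _.
  by rewrite /F' -mulrBl; congr (_ * (_ * _)); ring.
have D0 : 0 <= kap * (C1 + C2 + v 1 + V 1 + 1).
  by rewrite mulr_ge0 ?(ltW kap_gt0)// !addr_ge0// ltW.
have k0 := ltW kap_gt0.
have := wder_rad n0 i CF D0 (ltW th0) (t := n%:R - 1).
have -> : reg G phi3 = rad (fun r => kap * (v r - V r)) by apply/funext; exact: phi3_regE.
apply.
- by move: hp2 th0 p1; nra.
- by rewrite ltrBlDr ltrDl ltr01 andbT subr_ge0 ler1n.
- move=> r r0; have vr := v0 r0; have Vr := V0 r0.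
  rewrite normrM (ger0_norm k0) -mulrA ler_wpM2l// (le_trans (ler_normB _ _))// !gtr0_norm//.
  have q0 := powR_ge0 r (- th).
  have e1 := mulr_ge0 (ltW v1) q0; have e2 := mulr_ge0 (ltW V1) q0.
  have e3 := mulr_ge0 C10 q0; have e4 := mulr_ge0 C20 q0.
  rewrite mulrDr mulr1 !mulrDl mul1r.
  have [r1|r1] := leP r 1.
    have rr : 0 < r <= 1 by rewrite r0.
    have := h1 r rr; have := h2 r rr; have := v1; have := V1.
    by move: e1 e2 q0 C10 C20; lra.
  have b1 : v r <= v 1 := prof_le pv ltr01 (ltW r1).
  have b2 : V r <= V 1 := prof_le pV ltr01 (ltW r1).
  lra.
- move=> r r0; have w0 : 0 < wt n r by rewrite exprn_gt0.
  rewrite /F' normrM (ger0_norm k0) -mulrA ler_wpM2l// normrM normfV (gtr0_norm w0).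
  rewrite powRN -(wt_powR n0 r0); have wi : 0 < (wt n r)^-1 by rewrite invr_gt0.
  have := JI_le1 r0; set x := `|_| => x1.
  have x2 : x * (wt n r)^-1 <= (wt n r)^-1 by nra.
  apply: (le_trans x2); rewrite mulrDr mulr1.
  have S1 : 1 <= C1 + C2 + v 1 + V 1 + 1 by move: v1 V1 C10 C20; lra.
  have S0 := le_trans ler01 S1.
  nra.
Qed.

Lemma phi3_XR : XR p om G phi3.
Proof.
have Lp := phir_Lp; have pp : 0 <= p + 1 by rewrite addr_ge0// ltW.
have mcG : mfun (fun x => - (kap * sigma R n) * G x) by exact: measurable_funM.
split.
- by move=> i; split; [exact: phi3_wder|exact: hphi_L2].
- have iphi : integ mu (fun x => `|phir x| `^ (p + 1)).
    by apply: integ_eq Lp => x; rewrite ger0_norm// phir_ge0.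
  apply: (integ_eq _ (integ_powD pp phir_m mcG iphi (integ_powZ (- (kap * sigma R n)) mG Gp))) => x.
  by rewrite /reg/= mulNr.
- move=> omn.
  apply: (integ_eq _ (integ_sqD phir_m mcG (phir_L2 omn) (integ_sqZ (- (kap * sigma R n)) G2))) => x.
  by rewrite /reg/= mulNr.
Qed.

Let m0 (r : R) := kap * (J r - I r).
Let m1 (r : R) := kap * (wt n r * g (v r) - wt n r * (l * V r)).

Lemma m1E x : rad (fun r => m1 r / r ^+ n.-1) x =
  om * phir x + phir x `^ p - l * (kap * sigma R n) * G x.
Proof.
have [->|x0] := eqVneq x 0.
  by rewrite /phir /Grad !rad0 !mulr0 subr0 add0r powR0// gt_eqF.
have e0 := enorm_pos x0.
rewrite /phir /Grad !radE// /m1 powRM ?(ltW kap_gt0) ?(ltW (v0 e0))//.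
rewrite (powR_sub1 p kap_gt0) kapE /wt; field; rewrite !gt_eqF//.
pos.
Qed.

Lemma m0E i (x : E) : x ord0 i * rad (fun r => m0 r / r ^+ n) x = hphi i x.
Proof.
rewrite /hphi; congr (_ * _); apply: rad_ext => r r0.
have -> : r ^+ n = r * wt n r by rewrite -[in LHS](prednK n0) exprS.
rewrite /F' /m0; field; rewrite !gt_eqF//.
by rewrite exprn_gt0.
Qed.

(** In [radial_ibp] this factor meets a regular part known only in L^(p+1), so the dual exponent is
    needed. It is O(r^(-th p)) at the origin and O(r^(-n)) at infinity. *)
Lemma m0_Lq : integ mu (fun x : E => `|rad (fun r => m0 r / r ^+ n) x| `^ ((p + 1) / p)).
Proof.
have [/andP[th0 th1] hp1 hp2 _ _] := gexp; have [C C_0 hC] := JI_bound.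
pose q := (p + 1) / p.
have q1 : 1 < q by rewrite ltr_pdivlMr// mul1r ltrDl.
have q0 : 0 < q := lt_trans ltr01 q1.
have thp0 : 0 < th * p by pos.
have np : 0 < n%:R - th * p by lra.
(* The power of 2 comes from min(r, 1) <= 2 r/(1 + r). *)
pose D := kap * (C + 1) * 2 `^ (n%:R - th * p).
have D0 : 0 <= D by rewrite !mulr_ge0 ?(ltW kap_gt0)// addr_ge0.
pose H r := D * (r `^ (- (th * p)) * (1 + r) `^ (- (n%:R - th * p))).
have thpq : th * p * q < n%:R by rewrite (_ : _ * q = th * (p + 1)) ?/q; [lra|field; rewrite gt_eqF].
have nq : n%:R < n%:R * q :> R by rewrite ltr_pMr// ltr0n.
have i1 := integZ (D `^ q) (rad_pow_integ n0 thpq nq (ltW (mulr_gt0 thp0 q0))).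
have mr : mfun (rad (fun r => m0 r / r ^+ n) : E -> R).
  apply: rad_measurable; apply: isC1_cpos; apply: isC1M.
    by apply: isC1M; [exact: isC1_cst|apply: isC1B; [exact: (prof_C1J gg pv)|exact: (prof_C1J kk pV)]].
  by apply: isC1V; [exact: isC1_exp|move=> r r0; rewrite exprn_gt0].
apply: (integ_le _ i1); first exact: abs_powR_measurable.
move=> x; rewrite (ger0_norm (powR_ge0 _ _)) -/q.
have [->|x0] := eqVneq x 0; first by rewrite !rad0 normr0 powR0// gt_eqF.
have r0 := enorm_pos x0.
rewrite !radE//; move: (enorm x) r0 => r r0.
rewrite [leRHS](_ : _ = H r `^ q); last by rewrite /H (powRM _ D0) ?mulr_ge0 ?powR_ge0// powRM ?powR_ge0// -!powRrM !mulNr mulrBl.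
apply: ge0_ler_powR; rewrite ?nnegrE ?(ltW q0) /H ?(mulr_ge0 D0) ?mulr_ge0 ?powR_ge0//.
rewrite /m0 /H normrM normfV (gtr0_norm (exprn_gt0 n r0)) normrM (gtr0_norm kap_gt0).
rewrite /D -!mulrA ler_wpM2l ?(ltW kap_gt0)// ler_pdivrMr ?exprn_gt0//.
rewrite -(powR_mulrn n (ltW r0)).
have -> : r `^ n%:R = r `^ (th * p) * r `^ (n%:R - th * p).
  by rewrite -powR_add//; congr (_ `^ _); ring.
have -> : (C + 1) * (2 `^ (n%:R - th * p) * (r `^ (- (th * p)) * (1 + r) `^ (- (n%:R - th * p)))) *
    (r `^ (th * p) * r `^ (n%:R - th * p)) =
    (C + 1) * (2 * r / (1 + r)) `^ (n%:R - th * p).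
  rewrite [(_ / _) `^ _]powRM ?powRM ?mulr_ge0 ?invr_ge0 ?addr_ge0 ?(ltW r0)// -powR_inv1 ?addr_ge0 ?(ltW r0)//.
  rewrite -powRrM mulN1r !powRN; field.
  by rewrite !gt_eqF ?powR_gt0// addr_gt0.
have z0 : 0 <= 2 * r / (1 + r) by pos.
have [r1|r1] := leP r 1.
  have rr : 0 < r <= 1 by rewrite r0.
  apply: (le_trans (hC r rr)); apply: ler_pM => //; first exact: powR_ge0.
    lra.
  apply: ge0_ler_powR; rewrite ?nnegrE ?(ltW np) ?(ltW r0)//.
  by rewrite ler_pdivlMr ?addr_gt0//; nra.
apply: (le_trans (JI_le1 r0)); rewrite -[leLHS]mulr1; apply: ler_pM => //.
  lra.
apply: powR_ge1; first exact: ltW.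
by rewrite ler_pdivlMr ?addr_gt0// mul1r; move: r1; lra.
Qed.

(** Radial integration by parts settles the regular part of d; the terms proportional to the charge
    of d cancel by [charge_identity]. *)
Lemma phi3_critical d : XR p om G d ->
  LW om (AB + l * \int[mu]_x (G x ^+ 2)) l G (fun x => phir x `^ (p - 1)) phi3 d = 0.
Proof.
move=> Xd; have [gd ir ir2] := Xd; pose i0 : 'I_n := Ordinal n0.
have mreg := XR_mreg i0 Xd.
have Lp := phir_Lp.
have iphip : integ mu (fun x => phir x `^ p * reg G d x).
  apply: (integ_le _ (integD Lp ir)).
    by apply: measurable_funM => //; apply: powR_measurable; exact: phir_m.
  by move=> x; rewrite normrM (ger0_norm (powR_ge0 _ _)) young_pow ?phir_ge0.
have iG : integ mu (fun x => reg G d x * G x) := integ_conj p0 mreg mG ir Gq.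
have iom : om != 0 -> integ mu (fun x => phir x * reg G d x).
  by move=> omn; apply: integ_sqM => //; [exact: phir_m|exact: phir_L2|exact: ir2].
have iom' : integ mu (fun x => om * (phir x * reg G d x)).
  have [->|omn] := eqVneq om 0; last by apply: integZ; exact: iom.
  by apply: (integ_eq _ (integ0 mu)) => x; rewrite mul0r.
have [iphiG _] := phirG1; have [iphipG _] := phirG p1' (let: And5 _ h _ _ _ := gexp in h).
have C1m0 : C1pos m0 m1.
  split=> r r0.
    by apply: ddZ; apply: ddB; [exact: (prof_dJ pv)|exact: (prof_dJ pV)].
  by apply: cvgM; [exact: cvg_cst|apply: cvgB; [exact: (prof_cJ' gg pv)|exact: (prof_cJ' kk pV)]].
have E1 x : reg G d x * rad (fun r => m1 r / r ^+ n.-1) x =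
    om * (phir x * reg G d x) + phir x `^ p * reg G d x - l * (kap * sigma R n) * (reg G d x * G x).
  by rewrite m1E; ring.
have i1 : integ mu (fun x => reg G d x * rad (fun r => m1 r / r ^+ n.-1) x).
  apply: (integ_eq E1); apply: integB; first exact: integD.
  exact: integZ.
have mr : mfun (rad (fun r => m0 r / r ^+ n) : E -> R).
  apply: rad_measurable; apply: isC1_cpos; apply: isC1M; first by exists m1.
  by apply: isC1V; [exact: isC1_exp|move=> r r0; rewrite exprn_gt0].
have i2 : integ mu (fun x => reg G d x * rad (fun r => m0 r / r ^+ n) x) :=
  integ_conj p0 mreg mr ir m0_Lq.
have i3 i : integ mu (fun x => d.2 i x * (x ord0 i * rad (fun r => m0 r / r ^+ n) x)).
  apply: (integ_eq _ (XR_gr i Xd phi3_XR)) => x; by rewrite m0E.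
have := radial_ibp n0 (fun i => (gd i).1) C1m0 i1 i2 i3.
have -> : \sum_i \int[mu]_x (d.2 i x * (x ord0 i * rad (fun r => m0 r / r ^+ n) x)) =
    \sum_i \int[mu]_x (phi3.2 i x * d.2 i x).
  by apply: eq_bigr => i _; apply: Int_ext => x; rewrite m0E mulrC.
rewrite (Int_ext mu _ _ E1) IntB; [|exact: integD|exact: integZ].
rewrite IntD// [X in - (_ - X)]IntZ// => grad_id.
have ci := charge_identity.
pose c := d.1.2.
have EG : \int[mu]_x (d.1.1 x * G x) = \int[mu]_x (reg G d x * G x) + c * \int[mu]_x (G x ^+ 2).
  rewrite -IntZ// -IntD//; last exact: integZ.
  by apply: Int_ext => x; rewrite /reg /c; ring.
(* For om = 0 the integrals on both sides need not converge, hence the case distinction. *)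
have Eom : om * \int[mu]_x (phir x * d.1.1 x) =
    \int[mu]_x (om * (phir x * reg G d x)) + c * (om * \int[mu]_x (phir x * G x)).
  have [->|omn] := eqVneq om 0.
    rewrite !mul0r mulr0 addr0; apply/esym; rewrite (Int_ext mu _ (fun=> 0)) ?Int0// => x.
    by rewrite mul0r.
  rewrite IntZ; last exact: iom.
  rewrite [c * _]mulrCA -mulrDr; congr (_ * _).
  rewrite -IntZ// -IntD; [|exact: iom|exact: integZ].
  by apply: Int_ext => x; rewrite /reg /c; ring.
have Ep : \int[mu]_x (phir x `^ (p - 1) * phir x * d.1.1 x) =
    \int[mu]_x (phir x `^ p * reg G d x) + c * \int[mu]_x (phir x `^ p * G x).
  rewrite -IntZ// -IntD//; last exact: integZ.
  apply: Int_ext => x; rewrite powRS ?phir_ge0 ?subr_gt0// subrK /reg /c; ring.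
rewrite /LW grad_id EG Eom Ep /= -/c; move: ci.
move: (\int[mu]_x (phir x * G x)) (\int[mu]_x (phir x `^ p * G x)) => X Y ci.
rewrite (_ : Y = (l - om) * X - AB * (kap * sigma R n)); last by rewrite -ci; ring.
ring.
Qed.

End ground_state.

(** * Complex-valued functions *)

Section complex_components.
Context (R : realType).
Implicit Types (z w : R[i]) (x : R).
Local Open Scope complex_scope.

Lemma cReD z w : Re (z + w) = Re z + Re w. Proof. by case: z w => a b [c d]. Qed.
Lemma cImD z w : Im (z + w) = Im z + Im w. Proof. by case: z w => a b [c d]. Qed.
Lemma cReN z : Re (- z) = - Re z. Proof. by case: z. Qed.
Lemma cImN z : Im (- z) = - Im z. Proof. by case: z. Qed.
Lemma cReM z w : Re (z * w) = Re z * Re w - Im z * Im w. Proof. by case: z w => a b [c d]. Qed.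
Lemma cImM z w : Im (z * w) = Re z * Im w + Im z * Re w. Proof. by case: z w => a b [c d]. Qed.
Lemma cReJ z : Re z^* = Re z. Proof. by case: z. Qed.
Lemma cImJ z : Im z^* = - Im z. Proof. by case: z. Qed.

Definition compE := (cReD, cImD, cReN, cImN, cReM, cImM, cReJ, cImJ).

Lemma Re_sum n (F : 'I_n -> R[i]) : Re (\sum_i F i) = \sum_i Re (F i).
Proof. by rewrite (big_morph Re cReD (erefl : Re 0 = 0)). Qed.
Lemma Im_sum n (F : 'I_n -> R[i]) : Im (\sum_i F i) = \sum_i Im (F i).
Proof. by rewrite (big_morph Im cImD (erefl : Im 0 = 0)). Qed.

Lemma complex_ext z w : Re z = Re w -> Im z = Im w -> z = w.
Proof. by case: z w => a b [c d] /= -> ->. Qed.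

Lemma normcE z : Normc.normc z = Num.sqrt (Re z ^+ 2 + Im z ^+ 2). Proof. by case: z. Qed.

Lemma normc_ge0' z : 0 <= Normc.normc z. Proof. by rewrite normcE sqrtr_ge0. Qed.

Lemma Re_le_normc z : `|Re z| <= Normc.normc z.
Proof. by rewrite normcE -sqrtr_sqr ler_wsqrtr// lerDl sqr_ge0. Qed.

Lemma Im_le_normc z : `|Im z| <= Normc.normc z.
Proof. by rewrite normcE -sqrtr_sqr ler_wsqrtr// lerDr sqr_ge0. Qed.

Lemma normc_le z : Normc.normc z <= `|Re z| + `|Im z|.
Proof.
rewrite normcE -[leRHS]ger0_norm// -sqrtr_sqr ler_wsqrtr// sqrrD.
rewrite !real_normK ?num_real// -addrA lerD2l addrC lerDl.
pos.
Qed.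

Lemma circle_angle (a b : R) : a ^+ 2 + b ^+ 2 = 1 -> exists th, cos th = a /\ sin th = b.
Proof.
move=> ab; have a1 : -1 <= a <= 1.
  by apply/andP; split; nra.
have [_ ca] := acos_def a1.
have s2 : sin (acos a) ^+ 2 = b ^+ 2.
  by have := cos2Dsin2 (acos a); rewrite ca -ab => /addrI.
move/eqP: s2; rewrite eqf_sqr => /orP[/eqP sb|/eqP sb].
  by exists (acos a).
by exists (- acos a); rewrite cosN sinN sb opprK.
Qed.

End complex_components.

Section real_spaces.
Context (R : realType) (n : nat).
Local Notation E := 'rV[R]_n.
Local Notation mu := (lebesgue_rV R n).
Implicit Types (f : E -> R[i]) (g h : E -> R) (q : R).

Definition rLp q g := mfun g /\ integ mu (fun x => `|g x| `^ q).
Definition rD1 q g := rLp q g /\ exists k : 'I_n -> E -> R, gradL2 g k.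

Lemma cLp_integ q f : 0 < q -> cLp q f <->
  cmeasurable f /\ integ mu (fun x => Normc.normc (f x) `^ q).
Proof.
move=> q0; have qn : q^-1 != 0 by rewrite invr_eq0 gt_eqF.
have nE : ('N[mu]_(q%:E)[EFin \o (@Normc.normc R \o f)] =
    (\int[mu]_x `|(Normc.normc (f x) `^ q)%:E|) `^ q^-1)%E.
  rewrite unlock /=; congr (_ `^ _)%E; apply: eq_integral => x _.
  by rewrite /= !ger0_norm ?powR_ge0// normc_ge0'.
have mN : cmeasurable f -> mfun (fun x => Normc.normc (f x) `^ q).
  move=> [mR mI]; apply: powR_measurable; under eq_fun do rewrite normcE.
  apply: (measurableT_comp (continuous_measurable_fun (@sqrt_continuous R))).
  by apply: measurable_funD; exact: measurable_funX.
split=> -[mf h]; split=> //.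
  apply/integrableP; split; first by apply/measurable_EFinP; exact: mN.
  by apply: (lty_poweRy qn); rewrite -nE.
rewrite nE; apply: poweR_lty; by have /integrableP[] := h.
Qed.

Lemma cLpE q f : 0 < q -> cLp q f <-> rLp q (Re \o f) /\ rLp q (Im \o f).
Proof.
move=> q0; rewrite cLp_integ//; split.
  move=> [[mR mI] h]; split; split => //.
    apply: (integ_le _ h); first exact: abs_powR_measurable.
    move=> x; rewrite ger0_norm//; apply: ge0_ler_powR; rewrite ?nnegrE ?normc_ge0' ?(ltW q0)//.
    exact: Re_le_normc.
  apply: (integ_le _ h); first exact: abs_powR_measurable.
  move=> x; rewrite ger0_norm//; apply: ge0_ler_powR; rewrite ?nnegrE ?normc_ge0' ?(ltW q0)//.
  exact: Im_le_normc.
move=> [[mR hR] [mI hI]]; split=> //.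
apply: (integ_le _ (integZ (2 `^ q) (integD hR hI))).
  apply: powR_measurable; under eq_fun do rewrite normcE.
  apply: (measurableT_comp (continuous_measurable_fun (@sqrt_continuous R))).
  by apply: measurable_funD; exact: measurable_funX.
move=> x; rewrite ger0_norm ?powR_ge0//.
have := powR_normD `|Re (f x)| `|Im (f x)| (ltW q0); rewrite !normr_id; apply: le_trans.
apply: ge0_ler_powR; rewrite ?nnegrE ?normc_ge0' ?(ltW q0)//.
rewrite [leRHS]ger0_norm//; exact: normc_le.
Qed.

Lemma rLp2E g : rLp 2 g <-> mfun g /\ integ mu (fun x => g x ^+ 2).
Proof.
by split=> -[mg ig]; split=> //; apply: (integ_eq _ ig) => x;
  rewrite powR_mulrn// real_normK// num_real.
Qed.

Lemma rLp_locinteg q g : 1 <= q -> rLp q g -> locinteg g.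
Proof.
move=> q1 [mg ig]; split=> // m.
have i1 := integ_cube R n m.
apply: (integ_le _ (integD ig i1)).
  by apply: measurable_funM => //; exact: indic_cube_measurable.
move=> x; rewrite normrM indicE; have h := powR_ge0 `|g x| q.
case: (_ \in _) => /=; rewrite ?normr1 ?mulr1 ?normr0 ?mulr0//.
have [g1|g1] := leP `|g x| 1; first by rewrite (le_trans g1)// lerDr.
rewrite ler_wpDr// -{1}[`|g x|]powRr1//; apply: ler_powR => //; exact: ltW.
Qed.

(** From general test functions to products of bumps; [wder_ibp_test] is the way back. *)
Lemma wder_of_test (i : 'I_n) g h : locinteg g -> locinteg h ->
  (forall psi, test_function psi -> \int[mu]_x (g x * pderiv i psi x) = - \int[mu]_x (h x * psi x)) ->
  wder i g h.
Proof.
move=> lg lh H; split=> // k k' bk dk.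
have tk := prodf_test bk; rewrite -(H _ tk); apply: Int_ext => x; congr (_ * _).
have := prodf_is_derive (dk (x ord0 i)); have := test_is_derive i x tk.
by move=> [_ <-] [_ <-].
Qed.

Lemma weak_gradient_parts q f F : 1 <= q -> rLp q (Re \o f) -> rLp q (Im \o f) ->
  weak_gradient_L2 f F <-> gradL2 (Re \o f) (fun i => Re \o F i) /\ gradL2 (Im \o f) (fun i => Im \o F i).
Proof.
move=> q1 lR lI; have locR := rLp_locinteg q1 lR; have locI := rLp_locinteg q1 lI.
have cE (u : E -> R[i]) (psi : E -> R) : cintegral (fun x => u x * ((psi x)%:C)%C) =
    Complex (\int[mu]_x (Re (u x) * psi x)) (\int[mu]_x (Im (u x) * psi x)).
  by congr Complex; apply: Int_ext => x; rewrite !compE/= mulr0 ?subr0 ?add0r.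
split.
  move=> [cF H].
  have FL i : (mfun (Re \o F i) /\ integ mu (fun x => (Re (F i x)) ^+ 2)) /\
      (mfun (Im \o F i) /\ integ mu (fun x => (Im (F i x)) ^+ 2)).
    by have [/rLp2E h1 /rLp2E h2] := (cLpE (F i) (ltr0Sn R 1)).1 (cF i).
  split=> i; have [[mR iR] [mI iI]] := FL i; split=> //.
    apply: wder_of_test => //; first exact: L2_locinteg.
    by move=> psi tpsi; have := H i psi tpsi; rewrite !cE => -[].
  apply: wder_of_test => //; first exact: L2_locinteg.
  by move=> psi tpsi; have := H i psi tpsi; rewrite !cE => -[].
move=> [gR gI]; split.
  move=> i; apply/(cLpE (F i) (ltr0Sn R 1)); split; apply/rLp2E.
    by split; [have [[_ [m _] _] _] := gR i|have [] := gR i].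
  by split; [have [[_ [m _] _] _] := gI i|have [] := gI i].
move=> i psi tpsi; rewrite !cE (wder_ibp_test (gR i).1 tpsi) (wder_ibp_test (gI i).1 tpsi).
by [].
Qed.

Lemma weak_gradient_ex q f : 1 <= q -> rLp q (Re \o f) -> rLp q (Im \o f) ->
  weak_gradient_L2 f !=set0 <->
  (exists k : 'I_n -> E -> R, gradL2 (Re \o f) k) /\ (exists k : 'I_n -> E -> R, gradL2 (Im \o f) k).
Proof.
move=> q1 lR lI; split.
  move=> [F /(weak_gradient_parts F q1 lR lI)[gR gI]].
  by split; [exists (fun i => Re \o F i)|exists (fun i => Im \o F i)].
move=> [[h1 g1] [h2 g2]]; exists (fun i x => Complex (h1 i x) (h2 i x)).
by apply/(weak_gradient_parts _ q1 lR lI).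
Qed.

Lemma D1E q f : 1 <= q -> D1 q f <-> rD1 q (Re \o f) /\ rD1 q (Im \o f).
Proof.
move=> q1; have q0 := lt_le_trans ltr01 q1; split.
  move=> [/(cLpE f q0)[lR lI] /(weak_gradient_ex q1 lR lI)[gR gI]].
  pos.
move=> [[lR gR] [lI gI]]; split; first exact/(cLpE f q0).
exact/(weak_gradient_ex q1 lR lI).
Qed.

(** [gradient] is a choice among the weak gradients, so its parts are identified almost everywhere
    only. *)
Lemma gradient_parts q f (h1 h2 : 'I_n -> E -> R) i : 1 <= q -> rLp q (Re \o f) -> rLp q (Im \o f) ->
  gradL2 (Re \o f) h1 -> gradL2 (Im \o f) h2 ->
  cmeasurable (gradient f i) /\
  \forall x \ae mu, Re (gradient f i x) = h1 i x /\ Im (gradient f i x) = h2 i x.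
Proof.
move=> q1 lR lI g1 g2.
have : weak_gradient_L2 f (gradient f).
  apply: xgetPex; apply/(weak_gradient_ex q1 lR lI).
  by split; [exists h1|exists h2].
move=> /(weak_gradient_parts _ q1 lR lI)[gR gI]; split.
  by split; [have [[_ [m _] _] _] := gR i|have [[_ [m _] _] _] := gI i].
by apply: filterS2 (wder_unique (gR i).1 (g1 i).1) (wder_unique (gI i).1 (g2 i).1) => x.
Qed.

End real_spaces.

(** * The chosen Green function and uniqueness of the charge *)

Section charge.
Context (R : realType) (n : nat) (p th C0 b l : R) (V I : R -> R).
Context (n23 : (n == 2%N) || (n == 3%N)) (p1 : 1 < p) (gexp : good_exp n p th C0).
Context (l0 : 0 < l) (pV : profile n (sing n) b (fun x => l * x) V I).
Local Notation E := 'rV[R]_n.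
Local Notation mu := (lebesgue_rV R n).
Local Notation G := (Grad V : E -> R).
Local Notation gG := (gradG I : 'I_n -> E -> R).

Let n0 : (0 < n)%N := n23_gt0 n23.
Let s0 : 0 < sigma R n := sigma_gt0 R n23.
Let G2 := Grad_L2 n23 gexp l0 pV.

Lemma halfint_inv_absurd (f : R -> R) c d : 0 < c -> 0 < d -> halfint f ->
  (forall r, 0 < r -> 0 <= f r) -> (forall r, 0 < r <= d -> c / r <= f r) -> False.
Proof.
move=> c0 d0 hf f0 fc.
pose B := \int[leb]_r (f r * Ipos r).
have B0 : 0 <= B.
  by apply: Int_ge0 => r; rewrite IposE; case: ltP => r0; rewrite ?mulr0// mulr1 f0.
(* With this a the integral of c/r over [a, d] is B + 1, more than the whole integral B of f. *)
pose a := d * expR (- ((B + 1) / c)).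
have a0 : 0 < a by rewrite mulr_gt0// expR_gt0.
have ad : a < d.
  by rewrite -[ltRHS]mulr1 ltr_pM2l// -expR0 ltr_expR oppr_lt0 divr_gt0// ltr_wpDl.
have cc : cpos (fun r : R => c / r).
  by move=> r r0; apply: cvgM; [exact: cvg_cst|apply: cvgV; [rewrite gt_eqF|exact: cvg_id]].
have dl : ddpos (fun r => c * ln r) (fun r => c / r).
  by move=> r r0; apply: ddZ; exact: is_derive1_ln.
have [i1 e1] := ftc_seg a0 ad cc dl.
have := Int_le i1 hf; rewrite e1.
have -> : c * ln d - c * ln a = B + 1.
  by rewrite /a lnM ?posrE ?expR_gt0// expRK; field; rewrite gt_eqF.
have h r : c / r * \1_(`[a, d]%classic) r <= f r * Ipos r.
  rewrite indic_segE IposE; case: (boolP (a <= r <= d)) => [/andP[ar rd]|_].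
    have r0 := lt_le_trans a0 ar; rewrite r0 !mulr1; apply: fc; by rewrite r0.
  rewrite mulr0; case: ltP => r0; rewrite ?mulr0// mulr1; exact: f0.
by move=> /(_ h); rewrite -/B; lra.
Qed.

(** In polar coordinates the squared gradient contributes a multiple of 1/r^(n-1) near 0, which is
    at least of order 1/r. *)
Lemma gradG_not_L2 : ~ (forall i, integ mu (fun x => gG i x ^+ 2)).
Proof.
move=> H.
pose F r := - (1 - I r) / wt n r / sigma R n.
have C1J := prof_C1J (gok_lin p (ltW l0)) pV.
have [H' CH] : isC1 (fun r => F r ^+ 2).
  have C1F : isC1 F.
    apply: isC1M; last exact: isC1_cst.
    apply: isC1M; first by apply: isC1N; apply: isC1B => //; exact: isC1_cst.
    by apply: isC1V; [exact: isC1_exp|move=> r; exact: wt_gt0].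
  by apply: isC1_eq (isC1M C1F C1F) => r _; rewrite expr2.
have iS : integ mu (rad (fun r => F r ^+ 2)).
  apply: (integ_ae _ (integ_sum (index_enum 'I_n) H)).
    by apply: rad_measurable; apply: isC1_cpos; exists H'.
  apply: filterS (ae_neq0 R n0) => x x0.
  have e0 := enorm_pos x0.
  under eq_bigr do rewrite /gradG radE// exprMn.
  rewrite -mulr_suml -enorm_sq radE// -exprMn; congr (_ ^+ 2).
  by rewrite mulrC divfK// gt_eqF.
have ev : 0 < evol R n by move: s0; rewrite /sigma pmulr_rgt0// ltr0n.
have [_ /(_ ev iS) hF] := radial_ge0 n0 CH (fun r _ => sqr_ge0 _).
have half0 : 0 < 2^-1 :> R by pos.
have [d /andP[d0 d1] Id] := cvg0_near_le (prof_J0 pV) half0 ltr01.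
apply: (@halfint_inv_absurd _ (((2 * sigma R n) ^+ 2)^-1) d _ d0 hF).
- pos.
- pos.
move=> r /andP[r0 rd].
have Ir : I r <= 2^-1.
  apply: le_trans Id; apply: (pos_ndecr r0 rd (prof_dJ pV)) => x /andP[rx _].
  have x0 := lt_trans r0 rx.
  by rewrite mulr_ge0 ?(ltW (wt_gt0 n x0))// mulr_ge0// ltW// (prof_v0 pV).
have w0 := wt_gt0 n r0; set w := wt n r in w0.
have -> : F r ^+ 2 * r ^+ n.-1 = (1 - I r) ^+ 2 / w / sigma R n ^+ 2.
  by rewrite /F -/(wt n r) -/w; field; rewrite ?gt_eqF.
have -> : ((2 * sigma R n) ^+ 2)^-1 / r = 4^-1 / r / sigma R n ^+ 2.
  by field; rewrite ?gt_eqF.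
rewrite ler_wpM2r ?invr_ge0 ?exprn_ge0 ?(ltW s0)// ler_pM ?invr_ge0 ?(ltW r0)//; first by nra.
rewrite lef_pV2// /w /wt -[leRHS]expr1 ler_wiXn2l ?(ltW r0) ?(le_trans rd (ltW d1))//.
by case/orP: n23 => /eqP ->.
Qed.

(** Two different charges would express G through functions with square integrable weak
    gradients. *)
Lemma charge_unique (g : E -> R) (c c' : R) (h h' : 'I_n -> E -> R) :
  gradL2 (fun x => g x - c * G x) h -> gradL2 (fun x => g x - c' * G x) h' -> c = c'.
Proof.
move=> H H'; apply: contrapT => /eqP cc; have d0 : c' - c != 0 by rewrite subr_eq0 eq_sym.
apply: gradG_not_L2 => i.
have w1 : wder i G (fun x => (c' - c)^-1 * (h i x - h' i x)).
  apply: wder_eq (wderZ (c' - c)^-1 (wderB (H i).1 (H' i).1)) => x //.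
  by field.
have := wder_unique (green_wder n23 (ltW p1) gexp pV i) w1.
have [_ [mh _] _] := (H i).1; have [_ [mh' _] _] := (H' i).1.
have [_ [mG _] _] := green_wder n23 (ltW p1) gexp pV i.
move=> e; apply: (integ_ae (g := fun x => ((c' - c)^-1 * (h i x - h' i x)) ^+ 2)).
- exact: measurable_funX.
- apply: integ_sqZ; apply: (integ_eq (g := fun x => (h i x + -1 * h' i x) ^+ 2)).
    by move=> x; rewrite mulN1r.
  apply: integ_sqD => //; [exact: measurable_funM|exact: (H i).2|apply: integ_sqZ; exact: (H' i).2].
- by apply: filterS e => x ->.
Qed.

Local Open Scope complex_scope.
Local Notation gr := (green l : E -> R[i]).

Lemma green_is : is_green l (fun x : E => (G x)%:C).
Proof.
have mG : mfun G := Grad_measurable pV.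
split.
  apply/(cLpE _ (ltr0Sn R 1)); split; apply/rLp2E.
    by split=> //=; exact: G2.
  split; first exact: measurable_cst.
  by apply: (integ_eq (g := fun=> 0)); [move=> x; rewrite /= expr0n|exact: integ0].
move=> psi tpsi; apply: complex_ext => /=.
  rewrite -(Grad_green n23 (ltW p1) gexp l0 pV tpsi); apply: Int_ext => x.
  by rewrite /= mulr0 subr0.
by rewrite -[RHS](Int0 mu); apply: Int_ext => x; rewrite /= mulr0 mul0r addr0.
Qed.

(** [green] is some solution in L^2. Its real part minus G, and its imaginary part, solve the
    homogeneous equation and vanish almost everywhere. *)
Lemma green_parts : cmeasurable gr /\ \forall x \ae mu, Re (gr x) = G x /\ Im (gr x) = 0.
Proof.
have mG : mfun G := Grad_measurable pV.
have /xgetPex : [set g : E -> R[i] | is_green l g] !=set0 by exists (fun x : E => (G x)%:C); exact: green_is.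
move=> /(_ (fun=> 0)) [/(cLpE _ (ltr0Sn R 1))[/rLp2E[mR iR] /rLp2E[mI iI]] H].
have HRe psi : test_function psi -> \int[mu]_x (Re (gr x) * (l * psi x - laplacian psi x)) = psi 0.
  move=> tpsi; have := congr1 Re (H psi tpsi) => /= <-; apply: Int_ext => x.
  by rewrite cReM /= mulr0 subr0.
have HIm psi : test_function psi -> \int[mu]_x (Im (gr x) * (l * psi x - laplacian psi x)) = 0.
  move=> tpsi; have := congr1 Im (H psi tpsi) => /= <-; apply: Int_ext => x.
  by rewrite cImM /= mulr0 add0r.
have tI psi (F : E -> R) : test_function psi -> mfun F -> integ mu (fun x => F x ^+ 2) ->
    integ mu (fun x => F x * (l * psi x - laplacian psi x)).
  move=> tpsi mF iF; have lF := L2_locinteg mF iF.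
  apply: (integ_eq (g := fun x => l * (F x * psi x) - \sum_i (F x * pderiv i (pderiv i psi) x))).
    by move=> x; rewrite mulrBr mulrCA /laplacian mulr_sumr.
  apply: integB; first by apply: integZ; exact: locinteg_test_fun.
  by apply: integ_sum => i; apply: locinteg_test_fun => //; do 2 apply: test_pderiv.
have eR := @green_unique_real R n (fun x => Re (gr x) - G x) l _ _ l0 _.
have eI := green_unique_real mI iI l0 HIm.
split=> //; apply: filterS2 eI (eR _ _ _) => [x|||].
- by move=> eI' /eqP; rewrite subr_eq0 => /eqP.
- exact: measurable_funB.
- apply: (integ_eq (g := fun x => (Re (gr x) + -1 * G x) ^+ 2)) => [x|]; first by rewrite mulN1r.
  apply: integ_sqD => //; [exact: measurable_funM|by apply: integ_sqZ; exact: G2].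
- move=> psi tpsi; under Int_ext do rewrite mulrBl.
  rewrite IntB ?HRe ?(Grad_green n23 (ltW p1) gexp l0 pV tpsi) ?subrr//; exact: tI.
Qed.

Lemma regular_part_parts (u : E -> R[i]) (c : R[i]) : \forall x \ae mu,
  Re (regular_part l u c x) = Re (u x) - Re c * G x /\
  Im (regular_part l u c x) = Im (u x) - Im c * G x.
Proof.
have [_ e] := green_parts; apply: filterS e => x [eR eI].
by rewrite /regular_part !compE eR eI !mulr0 subr0 add0r.
Qed.

Lemma regular_part_measurable (u : E -> R[i]) (c : R[i]) :
  cmeasurable (regular_part l u c) <-> cmeasurable u.
Proof.
have [[mR mI] _] := green_parts.
have mc : mfun (fun x : E => Re (c * gr x)) /\ mfun (fun x : E => Im (c * gr x)).
  by split; under eq_fun do rewrite compE; [apply: measurable_funB|apply: measurable_funD];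
    apply: measurable_funM.
split=> -[m1 m2]; split.
- rewrite (_ : (fun x => _) = (fun x => Re (regular_part l u c x) + Re (c * gr x))).
    by apply: measurable_funD => //; exact: mc.1.
  by apply/funext => x; rewrite /regular_part [in RHS]cReD cReN subrK.
- rewrite (_ : (fun x => _) = (fun x => Im (regular_part l u c x) + Im (c * gr x))).
    by apply: measurable_funD => //; exact: mc.2.
  by apply/funext => x; rewrite /regular_part [in RHS]cImD cImN subrK.
- rewrite (_ : (fun x => _) = (fun x => Re (u x) - Re (c * gr x))).
    by apply: measurable_funB => //; exact: mc.1.
  by apply/funext => x; rewrite /regular_part cReD cReN.
- rewrite (_ : (fun x => _) = (fun x => Im (u x) - Im (c * gr x))).
    by apply: measurable_funB => //; exact: mc.2.
  by apply/funext => x; rewrite /regular_part cImD cImN.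
Qed.

End charge.

Section ae_classes.
Context (R : realType) (n : nat).
Local Notation E := 'rV[R]_n.
Local Notation mu := (lebesgue_rV R n).
Implicit Types (g : E -> R) (h : 'I_n -> E -> R) (q : R).

Lemma gradL2_ae g g' h : mfun g' -> (\forall x \ae mu, g x = g' x) ->
  gradL2 g h -> gradL2 g' h.
Proof. by move=> mg e H i; split; [exact: (wder_aeq mg e (H i).1)|exact: (H i).2]. Qed.

Lemma integ_pow_ae q g g' : mfun g' -> (\forall x \ae mu, g x = g' x) ->
  integ mu (fun x => `|g x| `^ q) -> integ mu (fun x => `|g' x| `^ q).
Proof.
move=> mg e ig; apply: (integ_ae _ ig); first exact: abs_powR_measurable.
by apply: filterS e => x ->.
Qed.

Lemma rD1_ae q g g' : mfun g' -> (\forall x \ae mu, g x = g' x) ->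
  rD1 q g -> rD1 q g'.
Proof.
move=> mg e [[_ ig] [h H]]; split; first by split=> //; exact: integ_pow_ae ig.
by exists h; exact: gradL2_ae H.
Qed.

(** Each Sobolev step raises the exponent by one: a single step from 2 to 3 in dimension 3, where p
    + 1 < 3, and as many as necessary in dimension 2. The exponent p + 1 then lies between 2 and the
    one reached. *)
Lemma H1_Lp (p : R) g : (n = 2%N) \/ (n = 3%N /\ p < 2) -> 1 < p ->
  rD1 2 g -> integ mu (fun x => `|g x| `^ (p + 1)).
Proof.
move=> hn p1 [/rLp2E[mg ig] [h H]].
have n0 : (0 < n)%N by case: hn => [->|[->]].
have i2 : integ mu (fun x => `|g x| ^+ 2) by apply: (integ_eq _ ig) => x; rewrite real_normK ?num_real.
have [m pm im] : exists2 m : nat, p + 1 <= m%:R & integ mu (fun x => `|g x| ^+ m).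
  case: hn => [n2|[n3 p2]]; last first.
    exists 3%N; first by move: p2; lra.
    by apply: (sobolev_step H n0 _ _ i2); rewrite ?n3.
  exists (Num.truncn (p + 1)).+2.
    by rewrite ltW// (lt_trans (truncnS_gt _))// ltr_nat.
  elim: (Num.truncn (p + 1)) => // k IH.
  apply: (sobolev_step H n0 _ _ IH) => //.
  by rewrite n2 ltn_pmul2l.
apply: (integ_le _ (integD i2 im)); first exact: abs_powR_measurable.
move=> x; rewrite ger0_norm//; have a0 := normr_ge0 (g x).
have [g1|g1] := leP `|g x| 1.
  rewrite ler_wpDr// -powR_mulrn//.
  have [->|gn] := eqVneq `|g x| 0; first by rewrite !powR0// gt_eqF// ltr_wpDl// (le_trans ler01)// ltW.
  have -> : p + 1 = 2 + (p - 1) by ring.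
  rewrite powRD ?gn ?implybT// ler_piMr//.
  have := @ge0_ler_powR R (p - 1) _ `|g x| 1; rewrite powR1; apply; rewrite ?nnegrE//.
  lra.
by rewrite ler_wpDl// -powR_mulrn// ler_powR// ltW.
Qed.

End ae_classes.

(** * From complex functions to pairs of real triples *)

Section bridge.
Context (R : realType) (n : nat) (p th C0 om alpha l b : R) (V I : R -> R).
Context (n23 : (n == 2%N) || (n == 3%N)) (p1 : 1 < p) (gexp : good_exp n p th C0).
Context (hn : (n = 2%N) \/ (n = 3%N /\ p < 2)).
Context (om0 : 0 <= om) (l0 : 0 < l) (pV : profile n (sing n) b (fun x => l * x) V I).
Local Notation E := 'rV[R]_n.
Local Notation mu := (lebesgue_rV R n).
Local Notation G := (Grad V : E -> R).
Implicit Types (u w : E -> R[i]) (c : R[i]).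

Let n0 : (0 < n)%N := n23_gt0 n23.
Let p0 : 0 < p := lt_trans ltr01 p1.
Let pp1 : 1 <= p + 1. Proof. by rewrite lerDr ltW. Qed.
Let mG : mfun G := Grad_measurable pV.
Let G2 := Grad_L2 n23 gexp l0 pV.
Let Gp := Grad_Lp n23 p1 gexp l0 pV.
Let Gq := Grad_conj n23 p1 gexp l0 pV.

Lemma D1_regular q u c : 1 <= q -> D1 q (regular_part l u c) <->
  [/\ cmeasurable u, rD1 q (fun x => Re (u x) - Re c * G x) & rD1 q (fun x => Im (u x) - Im c * G x)].
Proof.
move=> q1; rewrite D1E//; have e := regular_part_parts n23 p1 gexp l0 pV u c.
have mE := regular_part_measurable n23 p1 gexp l0 pV u c.
split.
  move=> [H1 H2]; have mu' : cmeasurable u by apply/mE; split; [exact: H1.1.1|exact: H2.1.1].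
  split=> //.
    apply: rD1_ae H1; first by apply: measurable_funB; [exact: mu'.1|exact: measurable_funM].
    by apply: filterS e => x [].
  apply: rD1_ae H2; first by apply: measurable_funB; [exact: mu'.2|exact: measurable_funM].
  by apply: filterS e => x [].
move=> [/mE[m1 m2] H1 H2]; split.
  by apply: rD1_ae H1 => //; apply: filterS e => x [].
by apply: rD1_ae H2 => //; apply: filterS e => x [].
Qed.

Let qe : R := if om == 0 then p + 1 else 2.

Lemma XR_rD1 (g : E -> R) t : mfun g ->
  rD1 qe (fun x => g x - t * G x) <-> exists h, XR p om G (g, t, h).
Proof.
move=> mg; rewrite /qe; have [z0|z1] := eqVneq om 0; split.
- by move=> [[_ ig] [h H]]; exists h; split=> //; rewrite z0 eqxx.
- move=> [h [H ig _]]; split; last by exists h.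
  by split=> //; apply: measurable_funB => //; exact: measurable_funM.
- move=> H; have [[m2 ig] [h Hh]] := H; exists h; split=> //; first exact: H1_Lp.
  by move=> _; have [_] := (rLp2E (fun x => g x - t * G x)).1 (conj m2 ig).
- move=> [h [H _ /(_ z1) ig]]; split; last by exists h.
  by apply/rLp2E; split=> //; apply: measurable_funB => //; exact: measurable_funM.
Qed.

(** Charge and gradients are explicit, so the computations avoid the chosen values [charge_coef] and
    [gradient] until these are identified. *)
Definition rep u c (h1 h2 : 'I_n -> E -> R) :=
  XR p om G (Re \o u, Re c, h1) /\ XR p om G (Im \o u, Im c, h2).

Lemma rep_measurable u c h1 h2 : rep u c h1 h2 -> cmeasurable u.
Proof. by move=> [X1 X2]; split; [exact: (XR_m mG n0 X1)|exact: (XR_m mG n0 X2)]. Qed.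

Lemma energy_spaceP u : energy_space p l om u <-> exists c h1 h2, rep u c h1 h2.
Proof.
have q1 : 1 <= qe by rewrite /qe; case: ifP => // _; rewrite ler1n.
have -> : energy_space p l om u = exists c, D1 qe (regular_part l u c).
  by rewrite /energy_space /qe; case: ifP.
split.
  move=> [c /(D1_regular u c q1)[[m1 m2] /(XR_rD1 _ m1)[h1 H1] /(XR_rD1 _ m2)[h2 H2]]].
  by exists c, h1, h2.
move=> [c [h1 [h2 H]]]; have [m1 m2] := rep_measurable H.
exists c; apply/(D1_regular u c q1); split=> //.
  by apply/(XR_rD1 _ m1); exists h1; exact: H.1.
by apply/(XR_rD1 _ m2); exists h2; exact: H.2.
Qed.

Lemma rep_D1 u c h1 h2 : rep u c h1 h2 -> D1 (p + 1) (regular_part l u c).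
Proof.
move=> H; have [m1 m2] := rep_measurable H; have [[g1 i1 _] [g2 i2 _]] := H.
apply/(D1_regular u c pp1); split=> //; split.
- by split=> //; apply: measurable_funB => //; exact: measurable_funM.
- by exists h1.
- by split=> //; apply: measurable_funB => //; exact: measurable_funM.
- by exists h2.
Qed.

(** [charge_coef] refers to X_0 even when omega > 0; the L^(p+1) bound contained in [XR] places u
    there, where the charge is unique. *)
Lemma rep_charge u c h1 h2 : rep u c h1 h2 -> charge_coef p l u = c.
Proof.
move=> H; have D := rep_D1 H; have [[g1 i1 _] [g2 i2 _]] := H.
have : D1 (p + 1) (regular_part l u (charge_coef p l u)).
  by apply: (@xgetPex _ 0 [set c | D1 (p + 1) (regular_part l u c)]); exists c.
move=> /(D1_regular u _ pp1)[_ [_ [k1 K1]] [_ [k2 K2]]].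
apply: complex_ext.
  exact: (charge_unique n23 p1 gexp l0 pV K1 g1).
exact: (charge_unique n23 p1 gexp l0 pV K2 g2).
Qed.

Lemma rep_gradient u c h1 h2 i : rep u c h1 h2 ->
  cmeasurable (gradient (regular_part l u c) i) /\
  \forall x \ae mu, Re (gradient (regular_part l u c) i x) = h1 i x /\
    Im (gradient (regular_part l u c) i x) = h2 i x.
Proof.
move=> H; have e := regular_part_parts n23 p1 gexp l0 pV u c.
have /(D1E _ pp1) [[lR _] [lI _]] := rep_D1 H; have [[g1 _ _] [g2 _ _]] := H.
apply: (gradient_parts i pp1 lR lI).
  by apply: gradL2_ae g1; [exact: lR.1|apply: filterS e => x [/= e1 _]].
by apply: gradL2_ae g2; [exact: lI.1|apply: filterS e => x [_ /= e2]].
Qed.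

Lemma inner_parts u w (a1 a2 b1 b2 : E -> R) : cmeasurable u -> cmeasurable w ->
  (\forall x \ae mu, Re (u x) = a1 x /\ Im (u x) = a2 x) ->
  (\forall x \ae mu, Re (w x) = b1 x /\ Im (w x) = b2 x) ->
  integ mu (fun x => a1 x * b1 x) -> integ mu (fun x => a2 x * b2 x) ->
  integ mu (fun x => a2 x * b1 x) -> integ mu (fun x => a1 x * b2 x) ->
  Re (inner u w) = \int[mu]_x (a1 x * b1 x) + \int[mu]_x (a2 x * b2 x) /\
  Im (inner u w) = \int[mu]_x (a2 x * b1 x) - \int[mu]_x (a1 x * b2 x).
Proof.
move=> [mu1 mu2] [mw1 mw2] eu ew i11 i22 i21 i12; split.
  rewrite -IntD//; apply: Int_ae.
  - under eq_fun do rewrite !compE mulrN opprK.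
    by apply: measurable_funD; apply: measurable_funM.
  - exact: integ_measurable (integD i11 i22).
  - by apply: filterS2 eu ew => x [e1 e2] [e3 e4]; rewrite !compE e1 e2 e3 e4 mulrN opprK.
rewrite -IntB//; apply: Int_ae.
- under eq_fun do rewrite !compE mulrN.
  by apply: measurable_funD; [apply/measurable_funN|]; apply: measurable_funM.
- exact: integ_measurable (integB i21 i12).
- by apply: filterS2 eu ew => x [e1 e2] [e3 e4]; rewrite !compE e1 e2 e3 e4 mulrN addrC.
Qed.

Let Kc : R := alpha + beta_coef n l + l * \int[mu]_x (G x ^+ 2).
Let WE u : E -> R := fun x => Num.sqrt (Re (u x) ^+ 2 + Im (u x) ^+ 2) `^ (p - 1).
Local Notation LWu u := (LW om Kc l G (WE u)).

Lemma rep_weight u c h1 h2 : rep u c h1 h2 -> weight p (WE u).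
Proof. by move=> [X1 X2]; apply: (modulus_weight p1 mG Gp n0 _ X1 X2). Qed.

(** The real part of the first variation pairs like parts of u and w, the imaginary part pairs
    unlike ones; the weight |u|^(p-1) is common to all four terms. *)
Lemma action_parts u w c d h1 h2 k1 k2 : rep u c h1 h2 -> rep w d k1 k2 ->
  let a1 := (Re \o u, Re c, h1) in let a2 := (Im \o u, Im c, h2) in
  let b1 := (Re \o w, Re d, k1) in let b2 := (Im \o w, Im d, k2) in
  Re (action_deriv alpha p l om u w) = LWu u a1 b1 + LWu u a2 b2 /\
  Im (action_deriv alpha p l om u w) = LWu u a2 b1 - LWu u a1 b2.
Proof.
move=> H K a1 a2 b1 b2; have [X1 X2] := H; have [Y1 Y2] := K.
have wu := rep_weight H.
have mu' := rep_measurable H; have mw := rep_measurable K.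
have [mg eg] := green_parts n23 p1 gexp l0 pV.
have tr (v : E -> R[i]) : \forall x \ae mu, Re (v x) = (Re \o v) x /\ Im (v x) = (Im \o v) x.
  by apply: nearW.
have cR (t : R) : Re (t%:C)%C = t by [].
have cI (t : R) : Im (t%:C)%C = 0 by [].
have iG0 (g : E -> R) : integ mu (fun x => g x * 0).
  by apply: (integ_eq _ (integ0 mu)) => x; rewrite mulr0.
have I0 (g : E -> R) : \int[mu]_x (g x * 0) = 0.
  by rewrite -[RHS](Int0 mu); apply: Int_ext => x; rewrite mulr0.
have gi i := inner_parts (rep_gradient i H).1 (rep_gradient i K).1 (rep_gradient i H).2 (rep_gradient i K).2
  (XR_gr i X1 Y1) (XR_gr i X2 Y2) (XR_gr i X2 Y1) (XR_gr i X1 Y2).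
have ug v e k k' : rep v e k k' -> Re (inner v (green l)) = \int[mu]_x (Re (v x) * G x) /\
    Im (inner v (green l)) = \int[mu]_x (Im (v x) * G x).
  move=> V1; have [Z1 Z2] := V1.
  have [-> ->] := inner_parts (rep_measurable V1) mg (tr v) eg
    (XR_G p1 mG G2 Gq n0 Z1) (iG0 _) (XR_G p1 mG G2 Gq n0 Z2) (iG0 _).
  by rewrite !I0 addr0 subr0.
have [rgg igg] : Re (inner (green l : E -> R[i]) (green l)) = \int[mu]_x (G x ^+ 2) /\
    Im (inner (green l : E -> R[i]) (green l)) = 0.
  have iGG : integ mu (fun x => G x * G x) by pos.
  have i0G : integ mu (fun x => 0 * G x) by apply: (integ_eq _ (integ0 mu)) => x; rewrite mul0r.
  have [-> ->] := inner_parts mg mg eg eg iGG (iG0 _) i0G (iG0 _).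
  rewrite !I0 addr0 subr0; split; first by apply: Int_ext => x; rewrite expr2.
  by rewrite -[RHS](Int0 mu); apply: Int_ext => x; rewrite mul0r.
have [rug iug] := ug _ _ _ _ H; have [rwg iwg] := ug _ _ _ _ K.
have [rO iO] : Re (om%:C%C * inner u w) = om * \int[mu]_x (Re (u x) * Re (w x)) + om * \int[mu]_x (Im (u x) * Im (w x)) /\
    Im (om%:C%C * inner u w) = om * \int[mu]_x (Im (u x) * Re (w x)) - om * \int[mu]_x (Re (u x) * Im (w x)).
  rewrite !compE !(cR om) !(cI om) !mul0r subr0 addr0.
  have [->|z1] := eqVneq om 0; first by rewrite !mul0r addr0 subr0.
  have [-> ->] := inner_parts mu' mw (tr u) (tr w) (XR_om mG G2 n0 X1 Y1 z1) (XR_om mG G2 n0 X2 Y2 z1)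
    (XR_om mG G2 n0 X2 Y1 z1) (XR_om mG G2 n0 X1 Y2 z1).
  by rewrite mulrDr mulrBr.
have WI a b' (Xa : XR p om G a) Xb := XR_W p1 mG Gp n0 wu (a := a) (b := b') Xa Xb.
have rN : Re (cintegral (fun x : E => (Normc.normc (u x) `^ (p - 1))%:C%C * u x * ((w x)^*)%C)) =
    \int[mu]_x (WE u x * Re (u x) * Re (w x)) + \int[mu]_x (WE u x * Im (u x) * Im (w x)).
  rewrite -IntD; [|exact: (WI _ _ X1 Y1)|exact: (WI _ _ X2 Y2)]; apply: Int_ext => x.
  by rewrite !compE !(cR (_ `^ _)) !(cI (_ `^ _)) normcE -/(WE u x); ring.
have iN : Im (cintegral (fun x : E => (Normc.normc (u x) `^ (p - 1))%:C%C * u x * ((w x)^*)%C)) =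
    \int[mu]_x (WE u x * Im (u x) * Re (w x)) - \int[mu]_x (WE u x * Re (u x) * Im (w x)).
  rewrite -IntB; [|exact: (WI _ _ X2 Y1)|exact: (WI _ _ X1 Y2)]; apply: Int_ext => x.
  by rewrite !compE !(cR (_ `^ _)) !(cI (_ `^ _)) normcE -/(WE u x); ring.
have -> : action_deriv alpha p l om u w = Defs.form alpha p l u w + om%:C%C * inner u w +
    cintegral (fun x : E => (Normc.normc (u x) `^ (p - 1))%:C%C * u x * ((w x)^*)%C) by [].
rewrite 2!cReD 2!cImD rO iO rN iN /Defs.form (rep_charge H) (rep_charge K).
rewrite /LW /a1 /a2 /b1 /b2; split.
  rewrite !compE Re_sum (eq_bigr _ (fun i _ => (gi i).1)) big_split !(cR l) !(cI l) rgg igg rug iug rwg iwg /Kc /=.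
  ring.
rewrite !compE Im_sum (eq_bigr _ (fun i _ => (gi i).2)) big_split !(cR l) !(cI l) sumrN rgg igg rug iug rwg iwg /Kc /=.
ring.
Qed.

End bridge.

(** * The set of critical points *)

Section critical.
Context (R : realType) (n : nat) (p th C0 om alpha M a0 l b : R) (v J V I : R -> R).
Context (n23 : (n == 2%N) || (n == 3%N)) (p1 : 1 < p) (gexp : good_exp n p th C0).
Context (hn : (n = 2%N) \/ (n = 3%N /\ p < 2)).
Context (om0 : 0 <= om) (M0 : 0 < M) (l0 : 0 < l).
Context (pv : profile n (sing n) a0 (fun x => om * x + M * x `^ p) v J).
Context (pV : profile n (sing n) b (fun x => l * x) V I).
Context (a0b : a0 - b = sigma R n * (alpha + beta_coef n l)).
Local Notation E := 'rV[R]_n.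
Local Notation mu := (lebesgue_rV R n).
Local Notation G := (Grad V : E -> R).
Local Notation phi := (phir p M v : E -> R).
Local Notation Phi3 := (phi3 n p M v J I).

Let n0 : (0 < n)%N := n23_gt0 n23.
Let mG : mfun G := Grad_measurable pV.
Let G2 := Grad_L2 n23 gexp l0 pV.
Let Gp := Grad_Lp n23 p1 gexp l0 pV.
Let Gq := Grad_conj n23 p1 gexp l0 pV.
Let Xphi : XR p om G Phi3 := phi3_XR n23 p1 gexp om0 M0 l0 pv pV.
Let K : R := alpha + beta_coef n l + l * \int[mu]_x (G x ^+ 2).
Let Wp (x : E) : R := phi x `^ (p - 1).
Let Hphi d (Xd : XR p om G d) : LW om K l G Wp Phi3 d = 0 :=
  phi3_critical n23 p1 gexp om0 M0 l0 pv pV a0b Xd.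

Lemma phir_ae_gt0 : \forall x \ae mu, 0 < phi x.
Proof. by apply: filterS (ae_neq0 R n0) => x; exact: (phir_gt0 M0 pv). Qed.

(** The measure is not zero, since l times the integral of G is 1. *)
Lemma rV_ae_nonempty : ~ (\forall x \ae mu, False).
Proof.
move=> h; have := Int_Grad n23 gexp l0 pV.
rewrite (@Int_ae _ _ _ mu _ (fun=> 0)) ?Int0 ?mulr0; first by move/esym/eqP; rewrite oner_eq0.
- exact: mG.
- exact: measurable_cst.
- by apply: filterS h.
Qed.

Let zero3 : charged R n := (fun=> 0, 0, fun _ _ => 0).

(** In this form, membership in [XR] and the vanishing of the form follow from linearity. *)
Lemma zero3E (a : charged R n) : zero3 = lin a (-1) a.
Proof.
by congr (_, _, _); rewrite /=; first (by apply/funext => x; rewrite mulN1r subrr);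
  [rewrite mulN1r subrr|apply/funext => i; apply/funext => x; rewrite mulN1r subrr].
Qed.

Lemma zero3_XR : XR p om G zero3.
Proof. by rewrite (zero3E Phi3); exact: XR_lin. Qed.

Lemma LW_zero3 W a : weight p W -> XR p om G a -> LW om K l G W a zero3 = 0.
Proof. by move=> wW Xa; rewrite LW_sym (zero3E Phi3) (LW_lin K l p1 mG G2 Gp Gq n0 (-1) wW Xphi Xphi Xa) mulN1r subrr. Qed.

Lemma XR_ae (g g' : E -> R) t h : mfun g' -> (\forall x \ae mu, g x = g' x) ->
  XR p om G (g, t, h) -> XR p om G (g', t, h).
Proof.
move=> mg e [H1 H2 H3].
have mr : mfun (reg G (g', t, h)).
  by apply: measurable_funB => //; exact: measurable_funM.
have er : \forall x \ae mu, reg G (g, t, h) x = reg G (g', t, h) x.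
  by apply: filterS e => x; rewrite /reg/= => ->.
split; [exact: gradL2_ae H1|exact: integ_pow_ae H2|move=> /H3 i2].
apply: (integ_ae _ i2); first exact: measurable_funX.
by apply: filterS er => x ->.
Qed.

Lemma LW_null W a d : (\forall x \ae mu, a.1.1 x = 0) -> a.1.2 = 0 -> (forall i x, a.2 i x = 0) ->
  weight p W -> XR p om G a -> XR p om G d -> LW om K l G W a d = 0.
Proof.
move=> e c0 h0 wW Xa Xd; rewrite /LW c0 !(mulr0, mul0r) subr0.
have z (f : E -> R) : mfun f -> (\forall x \ae mu, f x = 0) -> \int[mu]_x f x = 0.
  by move=> mf ef; rewrite (@Int_ae _ _ _ mu _ (fun=> 0)) ?Int0.
have ma := XR_m mG n0 Xa; have md := XR_m mG n0 Xd; have mW := weight_m wW.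
rewrite big1 => [|i _]; last first.
  by rewrite -(Int0 mu); apply: Int_ext => x; rewrite h0 mul0r.
rewrite (z (fun x => a.1.1 x * G x)); last 2 first.
- exact: measurable_funM.
- by apply: filterS e => x ->; rewrite mul0r.
rewrite (z (fun x => a.1.1 x * d.1.1 x)); last 2 first.
- exact: measurable_funM.
- by apply: filterS e => x ->; rewrite mul0r.
rewrite (z (fun x => W x * a.1.1 x * d.1.1 x)); last 2 first.
- by apply: measurable_funM => //; exact: measurable_funM.
- by apply: filterS e => x ->; rewrite mulr0 mul0r.
by rewrite !mulr0 subr0 !addr0.
Qed.

Lemma phir_weight : weight p Wp.
Proof.
exists phi; split=> //; [exact: (phir_m pv)|exact: (phir_ge0 M0 pv)|].
apply: (integ_eq _ (XR_Lp p1 mG Gp n0 Xphi)) => x.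
by rewrite ger0_norm ?(phir_ge0 M0 pv).
Qed.

(** t times [phi3], but with room for another representative g of the function, because orbits are
    defined up to null sets. *)
Definition scaled3 (t : R) (g : E -> R) : charged R n :=
  (g, t * Phi3.1.2, fun i x => t * Phi3.2 i x).

Lemma scaled3_XR t g : mfun g -> (\forall x \ae mu, g x = t * phi x) ->
  XR p om G (scaled3 t g).
Proof.
move=> mg e; apply: (@XR_ae (fun x => t * phi x)) => //.
  by apply: filterS e => x ->.
rewrite [X in XR _ _ _ X](_ : _ = lin zero3 t Phi3); first exact: XR_lin zero3_XR Xphi.
by rewrite /lin /scaled3/=; congr (_, _, _); [apply/funext => x|
  |apply/funext => i; apply/funext => x]; rewrite add0r.
Qed.

Lemma scaled3_critical W t g d : weight p W -> (\forall x \ae mu, W x = Wp x) ->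
  mfun g -> (\forall x \ae mu, g x = t * phi x) ->
  XR p om G d -> LW om K l G W (scaled3 t g) d = 0.
Proof.
move=> wW eW mg e Xd; have Xs := scaled3_XR mg e; have wp := phir_weight.
rewrite (LW_ae K l p1 mG Gp n0 wW wp Xs Xd eW).
have := LW_lin K l p1 mG G2 Gp Gq n0 (- t) wp Xs Xphi Xd.
rewrite (Hphi Xd) mulr0 addr0 => <-; apply: LW_null => //.
- by apply: filterS e => x ex; rewrite /= ex mulNr subrr.
- by rewrite /= mulNr subrr.
- by move=> i x; rewrite /= mulNr subrr.
- exact: XR_lin.
Qed.

Lemma critical_pointsE : critical_points alpha p l om = phase_orbit phi.
Proof.
apply/seteqP; split=> u.
  move=> [/(energy_spaceP om n23 p1 gexp hn l0 pV)[c [h1 [h2 H]]] nz crit].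
  have [X1 X2] := H.
  have mu' := rep_measurable n23 pV H.
  have wu := rep_weight n23 p1 gexp l0 pV H.
  have X0' := zero3_XR.
  (* Real test functions separate the equation into one for the real part and one for the imaginary
     part. *)
  have key d : XR p om G d ->
      LW om K l G (fun x => Num.sqrt (Re (u x) ^+ 2 + Im (u x) ^+ 2) `^ (p - 1)) (Re \o u, Re c, h1) d = 0 /\
      LW om K l G (fun x => Num.sqrt (Re (u x) ^+ 2 + Im (u x) ^+ 2) `^ (p - 1)) (Im \o u, Im c, h2) d = 0.
    case: d => [[g t] k] Xd.
    have Kd : rep p om V (fun x => (g x)%:C%C) t%:C%C k (fun _ _ => 0) by split.
    have := crit _ ((energy_spaceP om n23 p1 gexp hn l0 pV _).2 (ex_intro _ _ (ex_intro _ _ (ex_intro _ _ Kd)))).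
    have [eR eI] := action_parts alpha n23 p1 gexp l0 pV H Kd.
    move=> e; move: eR eI; rewrite e.
    rewrite -/K -/zero3 => eR eI.
    have z1 := LW_zero3 wu X1; have z2 := LW_zero3 wu X2.
    split; first by move: eR; rewrite [X in _ + X]z2 addr0 => <-.
    by move: eI; rewrite [X in _ - X]z1 subr0 => <-.
  have kap0 : Phi3.1.2 != 0.
    by rewrite /= mulf_neq0// gt_eqF ?(sigma_gt0 R n23)//; exact: kap_gt0.
  have [|t1 [t2 [t12 e]]] := critical_unique p1 om0 mG G2 Gp Gq n0 (phi := Phi3)
      (fun x => erefl) (fun x => erefl) Xphi X1 X2 kap0 phir_ae_gt0 (phir_ge0 M0 pv)
      Hphi (fun d Xd => (key d Xd).1) (fun d Xd => (key d Xd).2).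
    by move=> h; apply: nz; apply: filterS h => x [e1 e2]; apply: complex_ext.
  have [th' [ct st]] := circle_angle t12.
  split=> //; exists th'; apply: filterS e => x [e1 e2].
  by apply: complex_ext; rewrite !compE /= ct st; [rewrite mulr0 subr0|rewrite mulr0 add0r].
move=> [mu' [th' e]].
have e1 : \forall x \ae mu, (Re \o u) x = cos th' * phi x.
  by apply: filterS e => x /= ->; rewrite !compE /= mulr0 subr0.
have e2 : \forall x \ae mu, (Im \o u) x = sin th' * phi x.
  by apply: filterS e => x /= ->; rewrite !compE /= mulr0 add0r.
have H : rep p om V u ((cos th' * Phi3.1.2) +i* (sin th' * Phi3.1.2))%C
    (fun i x => cos th' * Phi3.2 i x) (fun i x => sin th' * Phi3.2 i x).
  by split; [exact: (scaled3_XR mu'.1 e1)|exact: (scaled3_XR mu'.2 e2)].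
have wu := rep_weight n23 p1 gexp l0 pV H.
(* The modulus of u is phi because cos^2 + sin^2 = 1. *)
have eW : \forall x \ae mu, Num.sqrt (Re (u x) ^+ 2 + Im (u x) ^+ 2) `^ (p - 1) = Wp x.
  apply: filterS2 e1 e2 => x /= -> ->.
  by rewrite (exprMn _ (cos th')) (exprMn _ (sin th')) -mulrDl cos2Dsin2 mul1r sqrtr_sqr ger0_norm ?(phir_ge0 M0 pv).
split.
- by apply/(energy_spaceP om n23 p1 gexp hn l0 pV); do 3 eexists; exact: H.
(* A null u would give cos = sin = 0 at a point where phi > 0. *)
- move=> h; apply: rV_ae_nonempty; apply: filterS3 h e1 (filterI e2 phir_ae_gt0) => x.
  move=> /= -> /esym/eqP + [/esym/eqP]; rewrite (mulf_eq0 (cos th')) (mulf_eq0 (sin th')) => + + px.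
  rewrite (gt_eqF px) !orbF => /eqP ct /eqP st.
  by have := cos2Dsin2 th'; rewrite ct st expr0n/= addr0 => /esym/eqP; rewrite oner_eq0.
move=> w /(energy_spaceP om n23 p1 gexp hn l0 pV)[d [k1 [k2 Kw]]].
have [eR eI] := action_parts alpha n23 p1 gexp l0 pV H Kw.
have c1 := fun b' Xb => scaled3_critical (d := b') wu eW mu'.1 e1 Xb.
have c2 := fun b' Xb => scaled3_critical (d := b') wu eW mu'.2 e2 Xb.
apply: complex_ext.
  by rewrite eR (c1 _ Kw.1) (c2 _ Kw.2) addr0.
by rewrite eI (c1 _ Kw.2) (c2 _ Kw.1) subr0.
Qed.

End critical.

(** * Existence of the profile and uniqueness of the positive function *)

Section ground_state_profile.
Context (R : realType).

Lemma rad_continuous n (H : R -> R) (x : 'rV[R]_n) : cpos H -> x != 0 ->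
  {for x, continuous (rad H : 'rV[R]_n -> R)}.
Proof.
move=> cH; rewrite -enorm_gt0 => x0.
apply: (@continuous_comp _ _ _ (@enorm R n) (fun r => H r * \1_(`]0, +oo[%classic) r)).
  exact: enorm_cont.
apply: (cvg_trans (near_eq_cvg _)); last first.
  by rewrite IposE x0 mulr1; exact: (cH _ x0).
near=> r; have r0 : 0 < r by near: r; exact: lt_nbhsr.
by rewrite IposE r0 mulr1.
Unshelve. all: by end_near. Qed.

Lemma phir_positive_radial_decreasing n (p om M a0 : R) v J : 0 < M ->
  profile n (sing n) a0 (fun x => om * x + M * x `^ p) v J ->
  positive_radial_decreasing (phir p M v : 'rV[R]_n -> R).
Proof.
move=> M0 pv; split=> [x|x y _ e|x y x0 xy].
- exact: (phir_gt0 M0 pv).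
- by rewrite /phir /rad e.
- have ex : 0 < enorm x by rewrite enorm_gt0.
  have y0 : y != 0 by rewrite -enorm_gt0 (lt_trans ex).
  by rewrite /phir !radE// ltr_pM2l ?kap_gt0//; exact: (profile_decr pv).
Qed.

(** phi lies in the orbit of psi, so phi is a phase times psi almost everywhere; both are positive,
    and equal moduli give equality. *)
Lemma phase_orbit_inj n (phi psi : 'rV[R]_n -> R) : (0 < n)%N -> mfun phi ->
  (forall x, x != 0 -> 0 < phi x) -> (forall x, x != 0 -> 0 < psi x) ->
  phase_orbit phi = phase_orbit psi -> \forall x \ae lebesgue_rV R n, psi x = phi x.
Proof.
move=> n0 mphi phi0 psi0 e.
have : phase_orbit phi (fun x => (phi x)%:C%C).
  split; first by split; [exact: mphi|exact: measurable_cst].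
  by exists 0; apply: nearW => x; rewrite cos0 sin0 mul1r.
rewrite e => -[_ [th h]]; apply: filterS2 h (ae_neq0 R n0) => x hx x0.
have := phi0 x x0; have := psi0 x x0; move: hx.
move: (phi x) (psi x) => a b /eqP; rewrite eq_complex /= !mulr0 subr0 add0r.
move=> /andP[/eqP ea /eqP eb] b0 a0.
have : a ^+ 2 = b ^+ 2.
  by rewrite -[RHS]mul1r -(cos2Dsin2 th) mulrDl -!exprMn -ea -eb expr0n addr0.
by move=> /eqP; rewrite eqrXn2 ?ltW// => /eqP.
Qed.

(** alpha + beta is increasing and vanishes at omega_alpha; concretely, sqrt(om) is compared with
    sqrt(omega_alpha) in the explicit formulas. *)
Lemma beta_coef_lt n (alpha om : R) : (n = 2%N) \/ (n = 3%N /\ alpha < 0) ->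
  0 < om < omega_alpha n alpha -> alpha + beta_coef n om < 0.
Proof.
move=> h /andP[om0]; have so : 0 < Num.sqrt om by rewrite sqrtr_gt0.
have pi0 : 0 < pi :> R by exact: pi_gt0.
rewrite /omega_alpha /eigenvalue_alpha /beta_coef; case: h => [->|[-> a0]] /=.
  set g := euler_gamma R; rewrite normrN ger0_norm// => lt.
  have e2 : expR (- (2 * pi * alpha) - g) ^+ 2 = expR (- (4 * pi * alpha) - 2 * g).
    by rewrite expr2 -expRD; congr expR; ring.
  have : Num.sqrt om / 2 < expR (- (2 * pi * alpha) - g).
    rewrite -ltr_sqr ?nnegrE// e2 exprMn sqr_sqrtr ?ltW// exprVn.
    lra.
  rewrite -ltr_ln ?posrE ?expR_gt0 ?divr_gt0// expRK => lt'.
  rewrite addrC -ltrBrDr sub0r mulrC ltr_pdivrMr ?mulr_gt0//.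
  lra.
rewrite normrN ger0_norm ?sqr_ge0// => lt.
have m0 : 0 <= - (4 * pi * alpha) by nra.
have : Num.sqrt om < - (4 * pi * alpha).
  by rewrite -ltr_sqr ?nnegrE// sqr_sqrtr ?(ltW om0)// sqrrN.
move=> lt'; rewrite addrC -ltrBrDr sub0r ltr_pdivrMr ?mulr_gt0//.
lra.
Qed.

(** The constant a0 = sigma (alpha + b0) is the one for which a0 - b = sigma (alpha + beta(l)) for
    every l. When omega > 0, comparison with the Green profile for l = omega asks for a0 < b, that
    is alpha + beta(omega) < 0. When omega = 0 in dimension 3, b0 = 0 and a0 = sigma alpha is
    negative. *)
Lemma ground_state_profile_ex n (alpha p om b0 : R) :
  (n = 2%N /\ 1 < p) \/ (n = 3%N /\ alpha < 0 /\ 1 < p < 2) -> 0 <= om < omega_alpha n alpha ->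
  (n = 3%N -> b0 = 0) ->
  (forall l, 0 < l -> exists V I,
    profile n (sing n) (sigma R n * (b0 - beta_coef n l)) (fun x => l * x) V I) ->
  exists M v J, 0 < M /\
    profile n (sing n) (sigma R n * (alpha + b0)) (fun x => om * x + M * x `^ p) v J.
Proof.
move=> h /andP[om0 omlt] b03 green_ex.
have hn : (n = 2%N) \/ (n = 3%N /\ alpha < 0) by case: h => [[]|[? []]]; [left|right].
have n23 : (n == 2%N) || (n == 3%N) by case: hn => [->|[-> _]].
have p1 : 1 <= p by lra.
have [|th [C ge]] := @good_exp_ex R n p.
  by case: h => [[? ?]|[? [_ /andP[? ?]]]]; [left|right; split=> //; apply/andP; split=> //; exact: ltW].
have s0 := sigma_gt0 R n23.
apply: (@shooting R n (sing n) _ om p om0 p1 (sing_dd n23) (sing_cvgy n23) (good_lint n23 p1 ge)).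
  exact: n23_gt0.
move=> v0 J0 u0 v00 dv dJ uv J00 vS.
have [omz|omn] := eqVneq om 0.
  rewrite omz in dJ; apply: (no_nonneg_free _ v00 dv dJ J00 vS).
  case: hn => [|[n3 a0]]; [by left|right; split=> //].
  by rewrite b03// addr0 pmulr_rlt0.
have om0' : 0 < om by lra.
have [V [I pV]] := green_ex _ om0'.
apply: (no_nonneg_solution n23 ge om0 pV _ v00 dv dJ uv J00 vS).
rewrite ltr_pM2l// addrC ltrD2l -subr_lt0 opprK.
by apply: beta_coef_lt; rewrite ?om0'.
Qed.

End ground_state_profile.

(** The ground state is built before lambda is fixed, so one phi serves every decomposition f + c
    G_lambda. Uniqueness is almost everywhere, since an orbit determines its function only up to
    null sets. *)
Theorem theorem1p4 (R : realType) (N : nat) (alpha p omega : R)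
  (hNp : (N = 2%N /\ 1 < p) \/ (N = 3%N /\ alpha < 0 /\ 1 < p < 2))
  (homega : 0 <= omega < omega_alpha N alpha) :
  exists phi : 'rV[R]_N -> R,
    [/\ positive_radial_decreasing phi,
        (forall x : 'rV[R]_N, x != 0 -> {for x, continuous phi}),
        (forall lambda : R, 0 < lambda ->
           critical_points alpha p lambda omega = phase_orbit phi) &
        (forall (psi : 'rV[R]_N -> R) (lambda : R),
           positive_radial_decreasing psi -> 0 < lambda ->
           critical_points alpha p lambda omega = phase_orbit psi ->
           \forall x \ae lebesgue_rV R N, psi x = phi x)].
Proof.
have n23 : (N == 2%N) || (N == 3%N) by case: hNp => [[->]|[->]].
have hn : (N = 2%N) \/ (N = 3%N /\ p < 2) by case: hNp => [[]|[? [_ /andP[]]]]; [left|right].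
have p1 : 1 < p by lra.
have [|th [C ge]] := @good_exp_ex R N p.
  by case: hn => [?|[? ?]]; [left|right]; split=> //; rewrite ltW.
have [b0 [b03 green_ex]] := green_profile_ex R n23.
have [M [v [J [M0 pv]]]] := ground_state_profile_ex hNp homega b03 green_ex.
have om0 : 0 <= omega by lra.
have critE l : 0 < l -> critical_points alpha p l omega = phase_orbit (phir p M v : 'rV[R]_N -> R).
  move=> l0; have [V [I pV]] := green_ex l l0.
  apply: (critical_pointsE n23 p1 ge hn om0 M0 l0 pv pV).
  by rewrite -mulrBr; congr (_ * _); ring.
exists (phir p M v); split=> //.
- exact: (phir_positive_radial_decreasing M0 pv).
- move=> x; apply: rad_continuous => r r0.
  by apply: cvgM; [exact: cvg_cst|exact: (prof_cv pv)].
- move=> psi l [psi0 _ _] l0; rewrite critE// => e.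
  apply: (phase_orbit_inj _ _ _ psi0 e); [exact: n23_gt0|exact: (phir_m pv)|].
  by move=> x; exact: (phir_gt0 M0 pv).
Qed.
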